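(* Fix $m\ge 2$. Let $D$ and $E$ be thickened ribbons each of which is either of the form $\alpha\boxdot\beta$ or the transpose of a diagram of the form $\alpha\boxdot\beta$ (i.e. each contains exactly one $2\times m$ or $m\times 2$ block, for this fixed $m$). Then $D\sim E$ if and only if $D=E_1\circ_{W}E_2$ and $E=E_1'\circ_{W}E_2'$, where (a) if $D$ admits a nontrivial factorization, then $D=E_1\circ_W E_2$ is a nontrivial factorization, so that $E_1,E_2$ are ribbons and $W=(m-1)$ or $W=(1^{m-1})$; otherwise $D$ has only the trivial factorization and $(E_1,W,E_2)=(1,\varnothing,D)$; (b) for $i=1,2$, $E_i'=E_i$ or $E_i'=E_i^*$. Moreover, the equivalence class of $D$ (the set of skew diagrams $E$ with $E\sim D$) has exactly $2^{\kappa}$ elements, where $\kappa$ is the number of $i\in\{1,2\}$ with $E_i\neq E_i^*$; this number $\kappa$ does not depend on the choice of the nontrivial factorization of $D$.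
   Context: For a skew diagram $X$, $s_X$ is its skew Schur function; two skew diagrams $X,Y$ are equivalent, $X\sim Y$, if $s_X=s_Y$. $X^*$ denotes the rotation of $X$ by 180 degrees and $X^t$ its transpose (reflection in the main diagonal). A composition $\gamma=\gamma_1\cdots\gamma_k$ is identified with the ribbon (edgewise connected skew diagram with no $2\times2$ block of boxes) whose $i$-th row from the bottom has $\gamma_i$ boxes, consecutive rows overlapping in exactly one column. A thickened ribbon is an edgewise connected skew diagram containing no $3\times 3$ block of boxes. For compositions $\alpha=\alpha_1\cdots\alpha_k$ and $\beta=\beta_1\cdots\beta_l$ with $\alpha_k\ge m$ and $\beta_1\ge m$, $\alpha\boxdot\beta$ is the skew diagram whose rows from bottom to top have $\alpha_1,\dots,\alpha_k,\beta_1,\dots,\beta_l$ boxes, where for any two consecutive rows the leftmost $j$ boxes of the upper row lie directly above the rightmost $j$ boxes of the lower row, with $j=m$ for the pair of rows $(\alpha_k,\beta_1)$ and $j=1$ otherwise; these are exactly the thickened ribbons with exactly one $2\times m$ block and no $3\times 2$ block. A single box is denoted $1$. Composition $\circ_W$ for $W=(m-1)$ (a row of $m-1$ boxes). Let $T$ be a ribbon. Its lower copy of $W$ is the leftmost $m-1$ boxes of its bottom row and its upper copy is the rightmost $m-1$ boxes of its top row; let $O$ be $T$ with these two copies removed (required to be a skew diagram). The lower copy is horizontally attached ($W\to O$) if the bottom row of $T$ has at least $m$ boxes and vertically attached ($W\uparrow O$) if it has exactly $m-1$ boxes; the upper copy is horizontally attached ($O\to W$) if the top row has at least $m$ boxes,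 vertically attached ($O\uparrow W$) if exactly $m-1$. For ribbons $S,T$, $S\circ_W T$ is built by taking for each box $d$ of $S$ a translate $T_d$ of $T$ and positioning them as follows. If $d'$ is immediately east of $d$ in $S$, $T_{d'}$ is placed so that its lower copy of $W$ coincides with the upper copy of $W$ in $T_d$. If $d'$ is immediately north of $d$: if $T$ is of type $W\to O\to W$ (resp. $W\uparrow O\uparrow W$), $T_{d'}$ is placed so that its lower copy of $W$ is one position northwest (resp. southeast), i.e. one row up and one column left (resp. one row down and one column right), of the upper copy of $W$ in $T_d$; if $T$ is of type $W\to O\uparrow W$ (resp. $W\uparrow O\to W$), $T_{d'}$ is placed so that its lower copy of $W$ coincides with the upper copy of $W$ of $T_d$, and an extra copy of $W$ is added one position southeast (resp. northwest) of this common copy. $S\circ_W T$ is the union of all these boxes. For $W=(1^{m-1})$ (a column of $m-1$ boxes) the composition is the transposed version: $S\circ_{(1^{m-1})}T=(S^*\circ_{(m-1)}T^t)^t$. A nontrivial factorization of $D$ is an expression $D=S\circ_W T$ with $S,T$ ribbons, $S\ne 1$, $T\ne 1$, $W\in\{(m-1),(1^{m-1})\}$. The trivial factorization is $D=1\circ_{\varnothing} D$ (with $1\circ D=D$). *)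

(* Defs.v *)
From mathcomp Require Import all_boot all_order all_algebra finmap.
From mathcomp.multinomials Require Import mpoly.

Set Implicit Arguments.
Unset Strict Implicit.
Unset Printing Implicit Defensive.

Import Order.TTheory GRing.Theory Num.Theory.
Local Open Scope fset_scope.
Local Open Scope ring_scope.

(* Boxes carry matrix coordinates (row, column): rows are numbered downwards,
   columns to the right, so that north is row - 1 and east is column + 1. *)
Definition box : Type := (int * int)%type.
Definition diagram : Type := {fset box}.

Definition east (b : box) : box := b + (0, 1).
Definition north (b : box) : box := b + (-1, 0).
Definition southeast1 : box := (1, 1).

Definition translate (v : box) (D : diagram) : diagram := [fset b + v | b in D].
Definition rotate (D : diagram) : diagram := [fset - b | b in D].
Definition transpose (D : diagram) : diagram := [fset (b.2, b.1) | b in D].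

(* Equality of diagrams, which are considered up to translation; the only
   candidate translations are those moving some box of D to some box of E. *)
Definition same_diagram (D E : diagram) : bool :=
  (D == E) || [exists a : D, exists b : E, translate (val b - val a) D == E].

Lemma same_diagramP (D E : diagram) :
  reflect (exists v, E = translate v D) (same_diagram D E).
Proof.
apply: (iffP orP) => [[/eqP <-|/existsP[a /existsP[b /eqP <-]]]|[v ->]].
- exists 0; apply/fsetP => x; apply/idP/imfsetP => [xD|[y yD ->]] /=.
    by exists x; rewrite ?addr0.
  by rewrite addr0.
- by exists (val b - val a).
have [D0|[a aD]] := fset_0Vmem D.
  left; apply/eqP/fsetP => x; rewrite D0 in_fset0.
  by symmetry; apply/negP => /imfsetP[y]; rewrite in_fset0.
right; apply/existsP; exists [` aD].
have avD : a + v \in translate v D by apply/imfsetP; exists a.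
by apply/existsP; exists [` avD]; rewrite /= addrC addKr.
Qed.

Definition row_of (p : box) (n : nat) : diagram :=
  [fset p + (0, k%:Z) | k in iota 0 n].

Definition block (p : box) (h w : nat) : diagram :=
  [fset p + (i%:Z, j%:Z) | i in iota 0 h, j in iota 0 w].

Definition unit_box : diagram := [fset 0].

Definition is_partition (la : seq nat) : bool :=
  sorted geq la && (0%N \notin la).

Definition skew_shape (la mu : seq nat) : diagram :=
  \bigcup_(i <- iota 0 (size la))
     row_of (i%:Z, (nth 0%N mu i)%:Z) (nth 0%N la i - nth 0%N mu i).

Definition skew_diagram (D : diagram) : Prop :=
  exists la mu : seq nat,
    [/\ is_partition la, is_partition mu,
        forall i, (nth 0%N mu i <= nth 0%N la i)%N
      & same_diagram D (skew_shape la mu)].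

Definition adjacent (a b : box) : bool := `|a.1 - b.1| + `|a.2 - b.2| == 1.

Definition edgewise_connected (D : diagram) : Prop :=
  D != fset0 /\ forall a b : D, connect (fun x y : D => adjacent (val x) (val y)) a b.

Definition has_block (h w : nat) (D : diagram) : Prop :=
  exists p, block p h w `<=` D.

Definition ribbon (D : diagram) : Prop :=
  [/\ skew_diagram D, edgewise_connected D & ~ has_block 2 2 D].

Definition thickened_ribbon (D : diagram) : Prop :=
  [/\ skew_diagram D, edgewise_connected D & ~ has_block 3 3 D].

Definition semistandard n (X : diagram) (t : {ffun X -> 'I_n}) : bool :=
  [forall a : X, forall b : X,
     (((val a).1 == (val b).1) && ((val a).2 <= (val b).2) ==> (t a <= t b)%N)
  && (((val a).2 == (val b).2) && ((val a).1 < (val b).1) ==> (t a < t b)%N)].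

Definition skew_schur (X : diagram) (n : nat) : {mpoly int[n]} :=
  \sum_(t : {ffun X -> 'I_n} | semistandard t) \prod_(b : X) 'X_(t b).

(* A symmetric function in infinitely many variables is the compatible family
   of its specializations to n variables. *)
Definition equivalent (X Y : diagram) : Prop :=
  forall n, skew_schur X n = skew_schur Y n.

Definition is_composition (g : seq nat) : bool := (g != [::]) && all (leq 1) g.

(* Rows are listed from bottom to top as pairs (length, overlap with the next
   row up); p is the leftmost box of the lowest row. *)
Fixpoint stack (p : box) (rows : seq (nat * nat)) : diagram :=
  if rows is (a, j) :: rows' then
    row_of p a `|` stack (p + (-1, a%:Z - j%:Z)) rows'
  else fset0.

(* The overlap attached to the top row is a dummy. *)
Definition boxdot (m : nat) (al be : seq nat) : diagram :=
  stack 0 (zip (al ++ be) (nseq (size al).-1 1%N ++ m :: nseq (size be) 1%N)).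

Definition is_boxdot (m : nat) (D : diagram) : Prop :=
  exists al be : seq nat,
    [/\ is_composition al, is_composition be,
        (m <= last 0%N al)%N, (m <= head 0%N be)%N
      & same_diagram D (boxdot m al be)].

Definition maxz (s : seq int) : int := foldr Num.max (head 0 s) s.
Definition minz (s : seq int) : int := foldr Num.min (head 0 s) s.

Definition bottom_index (T : diagram) : int := maxz [seq b.1 | b : box <- T].
Definition top_index (T : diagram) : int := minz [seq b.1 | b : box <- T].
Definition row_columns (T : diagram) (i : int) : seq int :=
  [seq b.2 | b : box <- T & b.1 == i].

Definition bottom_length (T : diagram) : nat :=
  size (row_columns T (bottom_index T)).
Definition top_length (T : diagram) : nat :=
  size (row_columns T (top_index T)).

(* Leftmost boxes of the lower and of the upper copy of W = (m - 1) in T. *)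
Definition lower_corner (T : diagram) : box :=
  (bottom_index T, minz (row_columns T (bottom_index T))).
Definition upper_corner (m : nat) (T : diagram) : box :=
  (top_index T, maxz (row_columns T (top_index T)) - (m%:Z - 2)).

Definition lower_copy (m : nat) (T : diagram) : diagram :=
  row_of (lower_corner T) m.-1.
Definition upper_copy (m : nat) (T : diagram) : diagram :=
  row_of (upper_corner m T) m.-1.

Definition row_composable (m : nat) (T : diagram) : Prop :=
  [/\ (m.-1 <= bottom_length T)%N, (m.-1 <= top_length T)%N
    & skew_diagram (T `\` lower_copy m T `\` upper_copy m T)].

(* When row_composable m T holds, a copy that is not horizontally attached is
   vertically attached: its row has exactly m - 1 boxes. *)
Definition lower_horizontal (m : nat) (T : diagram) : bool :=
  (m <= bottom_length T)%N.
Definition upper_horizontal (m : nat) (T : diagram) : bool :=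
  (m <= top_length T)%N.

Definition east_step (m : nat) (T : diagram) : box :=
  upper_corner m T - lower_corner T.
Definition north_step (m : nat) (T : diagram) : box :=
  east_step m T +
  match lower_horizontal m T, upper_horizontal m T with
  | true, true => - southeast1
  | false, false => southeast1
  | _, _ => 0
  end.

(* The translate T_d of T is positioned at offset m T d: by offset_east and
   offset_north below, moving one box east (north) in S translates T by
   east_step (north_step). *)
Definition offset (m : nat) (T : diagram) (d : box) : box :=
  east_step m T *~ d.2 - north_step m T *~ d.1.

Lemma offset_east m T d : offset m T (east d) = offset m T d + east_step m T.
Proof. by rewrite /offset /= addr0 mulrzDr mulr1z addrAC. Qed.

Lemma offset_north m T d : offset m T (north d) = offset m T d + north_step m T.
Proof. by rewrite /offset /= addr0 mulrzDr mulrN1z opprD opprK addrA. Qed.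

(* The copy of W added when d and north d both lie in S; in the mixed types the
   upper copy in T_d coincides with the lower copy in T_(north d). *)
Definition extra_copy (m : nat) (T : diagram) (d : box) : diagram :=
  match lower_horizontal m T, upper_horizontal m T with
  | true, false => translate (offset m T (north d) + southeast1) (lower_copy m T)
  | false, true => translate (offset m T (north d) - southeast1) (lower_copy m T)
  | _, _ => fset0
  end.

Definition row_compose (m : nat) (S T : diagram) : diagram :=
  (\bigcup_(d <- S) translate (offset m T d) T)
  `|` (\bigcup_(d <- S | north d \in S) extra_copy m T d).

Inductive overlap_shape : Type := WEmpty | WRow | WCol.

(* factors m D S W T means D = S o_W T, the composition being defined. *)
Definition factors (m : nat) (D S : diagram) (W : overlap_shape) (T : diagram) : Prop :=
  match W with
  | WEmpty => same_diagram S unit_box /\ same_diagram D T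
  | WRow => [/\ ribbon S, ribbon T, row_composable m T
              & same_diagram D (row_compose m S T)]
  | WCol => [/\ ribbon S, ribbon T, row_composable m (transpose T)
              & same_diagram D (transpose (row_compose m (rotate S) (transpose T)))]
  end.

Definition nontrivial_factorization (m : nat) (D S : diagram) (W : overlap_shape)
    (T : diagram) : Prop :=
  [/\ W <> WEmpty, ~~ same_diagram S unit_box, ~~ same_diagram T unit_box
    & factors m D S W T].

Definition has_nontrivial_factorization (m : nat) (D : diagram) : Prop :=
  exists S W T, nontrivial_factorization m D S W T.

Definition chosen_factorization (m : nat) (D S : diagram) (W : overlap_shape)
    (T : diagram) : Prop :=
  (has_nontrivial_factorization m D -> nontrivial_factorization m D S W T) /\
  (~ has_nontrivial_factorization m D ->
     [/\ same_diagram S unit_box, W = WEmpty & same_diagram T D]).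

Definition same_or_rotated (E' E : diagram) : Prop :=
  same_diagram E' E \/ same_diagram E' (rotate E).

Definition kappa (E1 E2 : diagram) : nat :=
  ((~~ same_diagram E1 (rotate E1)) + (~~ same_diagram E2 (rotate E2)))%N.

(* The skew diagrams equivalent to D form exactly N translation classes. *)
Definition equivalence_class_size (D : diagram) (N : nat) : Prop :=
  exists f : 'I_N -> diagram,
    [/\ forall i, skew_diagram (f i) /\ equivalent (f i) D,
        forall i j, same_diagram (f i) (f j) -> i = j
      & forall X, skew_diagram X -> equivalent X D ->
          exists i, same_diagram X (f i)].

(* Main.v *)
Require Import Defs.
From mathcomp Require Import all_boot all_order all_algebra finmap.
From mathcomp.multinomials Require Import mpoly.
From mathcomp Require Import zify ring.
From Stdlib Require Import Classical.

Set Implicit Arguments.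
Unset Strict Implicit.
Unset Printing Implicit Defensive.

Import Order.TTheory GRing.Theory Num.Theory.
Local Open Scope ring_scope.

(** With [w = m - 1], a boxdot is encoded by two positive integers [u], [s] and a word of
    marks [S] on the positions [0 < x < u + w + s]: a mark at [x] means that the ribbon step
    from position [x - 1] to position [x] goes up, and there are no marks in the window
    [u <= x <= u + w] of the doubled row.

    Swapping the tails of two words at the first violated column condition shows that the
    skew Schur function is [r1 * r2 - e_w * r], where [r1], [r2], [r] are polynomials in the
    elementary symmetric functions attached to the marks of the left part, of the right part
    and of the whole word.  The [e_k] being algebraically independent, equivalence is a formal
    identity, and its components of degrees two to four determine [u] and [s] up to order and
    give linear and quadratic relations between the mark words of two equivalent diagrams.
    Their solutions are: equal or reversed words, or words that are periodic with period
    [c = gcd(u, s)] apart from the window, one being the reversal of the other on each period.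
    Periodic words are exactly the compositions [S o_W T], whence the description of the
    equivalence classes.

    Finally, a skew diagram equivalent to a boxdot is a boxdot: counting chains of horizontal
    and vertical strips shows that equivalence is preserved by transposition and by deleting
    the top box of every column, so that the numbers of nonempty rows and columns of all
    iterated deletions are invariants. *)

(** * Odd periodic solutions of the relations between mark words *)

(** Each cut adds one factor [e_k]. After grading by the number of factors, degree two knows only
    the sizes (and fixes a global sign), degree three is linear and degree four quadratic in the
    marks. For two equivalent words [S], [S'] put [f = S - S'] and [g = S + S']. Degree three makes
    [f] odd under reversal of the whole word and of either part; two reflections compose to a
    translation, hence the period [gcd(u, s)]. Degree four makes the defect [k x = g (L - x) - g x]
    additive wherever [f] is not; the combinatorial core is that [k] then vanishes if [f] does not.
    The obstacle: monomials containing [e_(u+w)] or [e_(s+w)] receive contributions of several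
    products, so relations are missing at a few positions tied to the ends of the window. The
    remedy: a mark put at [u] or [u + w] only changes the sign of [r1 * r2 - e_w * r], so these two
    marks are free and can be chosen to restore the symmetry. For [u = s] the two parts cannot be
    told apart, and the quadratic relations first have to decide which part of [S'] corresponds to
    the left part of [S]. *)

Section PeriodicOddPair.

(** In the applications [f] is the difference of two mark words and [k] measures the asymmetry of
    their sum. The set [e] lists the multiples of the period at which relations are missing: [u] and
    [s] for the whole word, none for a single part. The hypothesis [window] holds because the sum is
    nonnegative and vanishes inside the window. *)
Variables (n c w : nat) (f k : nat -> int) (e : pred nat).
Local Notation L := (n * c + w)%N.

Hypothesis n2 : (2 <= n)%N.
Hypothesis c0 : (0 < c)%N.
Hypothesis w0 : (0 < w)%N.
Hypothesis fval : forall x, f x = 0 \/ f x = 1 \/ f x = -1.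
Hypothesis fodd : forall x y, (0 < x)%N -> (0 < y)%N -> (x + y = L)%N -> f y = - f x.
Hypothesis kodd : forall x y, (0 < x)%N -> (0 < y)%N -> (x + y = L)%N -> k y = - k x.
Hypothesis fper : forall x, (0 < x)%N -> (x + c < L)%N -> f (x + c)%N = f x.
Hypothesis fw0 : forall x, (0 < x < w)%N -> f x = 0.
Hypothesis fk : forall x, (0 < x < L)%N -> f x <> 0 -> k x = 0.
Hypothesis e_range : forall j, e j -> (0 < j < n)%N.
Hypothesis rel : forall x y, (0 < x)%N -> (0 < y)%N -> (x + y < L)%N ->
  (forall j, e j -> [/\ x + y <> j * c, x <> j * c + w & y <> j * c + w]%N) ->
  f x + f y <> f (x + y)%N -> k (x + y)%N = k x + k y.
Hypothesis ke : forall j, e j -> k (j * c)%N = 0.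
Hypothesis window : exists j, (j < n)%N /\
  ((forall t, (0 < t < w)%N -> 0 <= k (j * c + t)%N) \/
   (forall t, (0 < t < w)%N -> k (j * c + t)%N <= 0)).
Hypothesis fnz : exists x, (0 < x < L)%N && (f x != 0).

Let nm z := forall j, e j -> z <> (j * c)%N.
Let nw z := forall j, e j -> z <> (j * c + w)%N.

Let relE x y z : z = (x + y)%N -> (0 < x)%N -> (0 < y)%N -> (z < L)%N ->
  nm z -> nw x -> nw y -> f x + f y <> f z -> k z = k x + k y.
Proof.
move=> -> x_gt0 y_gt0 zL mz wx wy; apply: rel => // j ej.
by split; [exact: mz | exact: wx | exact: wy].
Qed.

Let mulc_lt j : (j < n)%N -> (j * c + c <= n * c)%N.
Proof. by move=> jn; rewrite -mulSnr leq_mul2r jn orbT. Qed.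

Let fperj j x z : z = (j * c + x)%N -> (0 < x)%N -> (z < L)%N -> f z = f x.
Proof.
elim: j z => [|j IH] z ->; first by rewrite mul0n.
move=> x_gt0 zL; have -> : (j.+1 * c + x = (j * c + x) + c)%N by lia.
rewrite fper; [|lia|lia]; apply: IH => //; lia.
Qed.

Let nm_res z i r : z = (i * c + r)%N -> (0 < r < c)%N -> nm z.
Proof.
move=> -> rc j _ E; have := congr1 (modn^~ c) E.
by rewrite modnMDl modnMl modn_small; lia.
Qed.

Let nm_n z : z = (n * c)%N -> nm z.
Proof.
move=> -> j /e_range jn /eqP; rewrite eqn_mul2r; lia.
Qed.

Let nw_small z : (z < c + w)%N -> nw z.
Proof.
move=> zc j /e_range jn E; have : (1 * c <= j * c)%N by rewrite leq_mul2r; lia.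
lia.
Qed.

Let nw_res z i r : z = (i * c + r)%N -> (r < c)%N -> (w < c)%N -> r <> w -> nw z.
Proof.
move=> -> rc wc rw j _ E; have := congr1 (modn^~ c) E.
by rewrite !modnMDl !modn_small.
Qed.

Let nm_k z : k z <> 0 -> nm z.
Proof. by move=> kz j ej E; apply: kz; rewrite E ke. Qed.

Let fnzP : exists x, (0 < x)%N && (f x != 0).
Proof. by case: fnz => x; rewrite -andbA => /and3P[x_gt0 _ fx]; exists x; rewrite x_gt0. Qed.

Let x0 := ex_minn fnzP.

Let x0_gt0 : (0 < x0)%N. Proof. by rewrite /x0; case: ex_minnP => x /andP[]. Qed.
Let fx0 : f x0 <> 0. Proof. by rewrite /x0; case: ex_minnP => x /andP[_ /eqP]. Qed.
Let fltx0 y : (0 < y < x0)%N -> f y = 0.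
Proof.
rewrite /x0; case: ex_minnP => x _ xmin /andP[y0 yx]; apply/eqP/negP => /negP fy.
have := xmin y; rewrite y0 fy => /(_ isT); lia.
Qed.
Let x0L : (x0 < L)%N.
Proof.
case: fnz => x /andP[xL fx]; rewrite /x0; case: ex_minnP => y _ /(_ x).
rewrite fx; lia.
Qed.
Let c_n : (2 * c <= n * c)%N. Proof. by rewrite leq_mul2r n2 orbT. Qed.

Let x0c : (x0 <= c)%N.
Proof.
rewrite leqNgt; apply/negP => cx; apply: fx0.
have -> : x0 = (x0 - c + c)%N by lia.
rewrite fper; [|lia|lia]; apply: fltx0; lia.
Qed.

(** Oddness about the whole length, brought back by [n - 1] periods, becomes oddness about
    [c + w]. *)
Let refl x y : (0 < x)%N -> (0 < y)%N -> (x + y = c + w)%N -> f y = - f x.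
Proof.
move=> x_gt0 y_gt0 xy; have n1 := @mulc_lt n.-1.
have n1' : (n.-1 * c + c = n * c)%N by case: (n) n2 => // n' _ /=; lia.
have <- : f (n.-1 * c + y)%N = f y by apply: (@fperj n.-1 y) => //; lia.
apply: fodd; lia.
Qed.

Let wx0 : (w <= x0)%N.
Proof. by rewrite leqNgt; apply/negP => h; apply: fx0; apply: fw0; rewrite x0_gt0. Qed.

Let x0half : (2 * x0 < c + w)%N.
Proof.
have E := @refl x0 (c + w - x0)%N x0_gt0.
have [h|h|h] := ltngtP (2 * x0)%N (c + w)%N; first by [].
- have E2 : f (c + w - x0)%N = 0 by apply: fltx0; lia.
  by lia.
- have E2 : (c + w - x0 = x0)%N by lia.
  by rewrite E2 in E; lia.
Qed.

Let x0_lt_c : (x0 < c)%N. Proof. lia. Qed.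
Let w_lt_c : (w < c)%N. Proof. lia. Qed.

Let x1 := (c + w - x0)%N.
Let fx1 : f x1 = - f x0. Proof. by apply: refl; rewrite /x1; lia. Qed.

(** The zeros of [f] below [x0] reappear here, reflected in [c + w] or shifted by a period. *)
Let gap z : (x1 < z < c + x0)%N -> f z = 0.
Proof.
rewrite /x1 => zz; have [zcw|cwz] := ltnP z (c + w)%N.
- rewrite (@refl (c + w - z)%N z); [|lia|lia|lia].
  by rewrite fltx0 ?oppr0 //; lia.
- have -> : z = (z - c + c)%N by lia.
  rewrite fper; [|lia|lia]; apply: fltx0; lia.
Qed.

Let kx0 : k x0 = 0. Proof. by apply: fk => //; rewrite x0_gt0. Qed.
Let kx1 : k x1 = 0. Proof. by apply: fk; rewrite ?fx1 /x1; lia. Qed.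

Let kjx0 j z : (j < n)%N -> z = (j * c + x0)%N -> k z = 0.
Proof.
move=> jn ->; have := mulc_lt jn => ?.
by apply: fk; [lia | rewrite (@fperj j x0) //; lia].
Qed.

(** Every splitting of [x0] violates additivity of [f], which is zero below [x0] but not at [x0]; so
    [k] is additive on it, and [k x0 = 0]. *)
Let I0 y y' : (0 < y)%N -> (0 < y')%N -> (y + y' = x0)%N -> k y' = - k y.
Proof.
move=> y0 y'0 E; suff : k x0 = k y + k y' by rewrite kx0; lia.
apply: relE => //; [apply: (@nm_res x0 0 x0); lia | | |].
- by apply: nw_small; lia.
- by apply: nw_small; lia.
- by rewrite (@fltx0 y) ?(@fltx0 y'); lia.
Qed.

(** The splitting used is [c + w - t = x1 + (x0 - t)]: only the term at [x1] has a nonzero [f]. *)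
Let I1 t z : (0 < t < x0)%N -> t <> w -> (z + t = c + w)%N -> k z = - k t.
Proof.
move=> tx0 tw zt.
have -> : k z = k x1 + k (x0 - t)%N.
  apply: relE; rewrite /x1; try lia.
  - have [tltw|?] := ltnP t w.
      apply: (@nm_res z 1 (w - t)); lia.
    apply: (@nm_res z 0 z); lia.
  - by apply: nw_small; lia.
  - by apply: nw_small; lia.
  - rewrite -/x1 fx1 (@fltx0 (x0 - t)%N) ?(@gap z) /x1; lia.
by rewrite kx1 (@I0 t (x0 - t)%N); lia.
Qed.

(** Split [j * c + x0], where [k] vanishes, into [x0 - t] and [j * c + t]. *)
Let Jt j t z : (j < n)%N -> (0 < t < x0)%N -> t <> w -> z = (j * c + t)%N ->
  k z = k t.
Proof.
move=> jn tx0 tw zE; have jc := mulc_lt jn.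
have E : k (j * c + x0)%N = k (x0 - t)%N + k z.
  apply: relE; try lia.
  - apply: (@nm_res _ j x0); lia.
  - by apply: nw_small; lia.
  - apply: (@nw_res z j t); lia.
  - rewrite (@fltx0 (x0 - t)%N); last lia.
    rewrite (@fperj j t z) //; try lia.
    rewrite (@fperj j x0 (j * c + x0)%N) //; try lia.
    by rewrite (@fltx0 t); lia.
move: E; rewrite (@kjx0 j) // (@I0 t (x0 - t)%N); lia.
Qed.

(** The values at [t] and [w - t] are opposite, and by [Jt] they can be read in the period where [k]
    has one sign. *)
Let kltw t : (0 < t < w)%N -> k t = 0.
Proof.
have flip t1 t2 : (0 < t1)%N -> (0 < t2)%N -> (t1 + t2 = w)%N -> k t2 = - k t1.
  move=> t1_gt0 t2_gt0 tw.
  rewrite -(@I1 t1 (c + t2)%N); [|lia|lia|lia].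
  rewrite (@Jt 1 t2 (c + t2)%N) //; lia.
move=> tw; case: window => j [jn H].
have E1 : k (j * c + t)%N = k t by apply: (@Jt j t) => //; lia.
have E2 : k (j * c + (w - t))%N = k (w - t)%N by apply: (@Jt j (w - t)%N) => //; lia.
have E3 : k (w - t)%N = - k t by apply: flip; lia.
have tw' : (0 < w - t < w)%N by lia.
by case: H => H; have := H _ tw; have := H _ tw'; lia.
Qed.

(** With [t' = t - w], expanding [k (c + x0) = 0] through [c + x0 - t' = x0 + (c + w - t)] gives
    [k t' - k t = 0]. *)
Let I4 t : (w < t < x0)%N -> k t = k (t - w)%N.
Proof.
move=> tt; have E1 := @I1 t (c + w - t)%N; have {E1} E1 : k (c + w - t)%N = - k t by apply: E1; lia.
set t' := (t - w)%N; have fz : f (c + w - t)%N = 0 by apply: gap; rewrite /x1; lia.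
have E2 : k (c + x0 - t')%N = k x0 + k (c + w - t)%N.
  apply: relE; rewrite /t'; try lia.
  - apply: (@nm_res _ 1 (x0 - (t - w))); lia.
  - by apply: nw_small; lia.
  - by apply: nw_small; lia.
  - have -> : f (c + x0 - (t - w))%N = 0.
      by rewrite (@fperj 1 (x0 - (t - w))%N) ?fltx0 //; lia.
    lia.
have E3 : k (c + x0)%N = k t' + k (c + x0 - t')%N.
  apply: relE; rewrite /t'; try lia.
  - apply: (@nm_res _ 1 x0); lia.
  - by apply: nw_small; lia.
  - apply: (@nw_res _ 1 (x0 - (t - w))%N); lia.
  - rewrite (@fperj 1 (x0 - (t - w))%N (c + x0 - (t - w))%N) ?(@fperj 1 x0 (c + x0)%N); try lia.
    rewrite (@fltx0 (t - w)%N) ?(@fltx0 (x0 - (t - w))%N); lia.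
have E4 : k (c + x0)%N = 0 by apply: (@kjx0 1); lia.
lia.
Qed.

(** By [I4] all values below [x0] are [0] or [k w]; the values at [y] and [x0 - y] are opposite,
    which leaves only [0]. *)
Let kI y : (0 < y < x0)%N -> k y = 0.
Proof.
have Q z : (0 < z < x0)%N -> k z = 0 \/ k z = k w.
  elim/ltn_ind: z => z IH zx0; have [zw|wz|->] := ltngtP z w; last by right.
  - by left; apply: kltw; lia.
  - by rewrite I4; [apply: IH; lia | lia].
move=> yx0; have E := @I0 y (x0 - y)%N.
have {E} E : k (x0 - y)%N = - k y by apply: E; lia.
have yx0' : (0 < x0 - y < x0)%N by lia.
have := Q _ yx0; have := Q _ yx0'; lia.
Qed.

Let fc : f c = - f w. Proof. by apply: refl; lia. Qed.

(** When [f c = 0] and [j] is not exceptional, [j * c] is the sum of [(j - 1) * c + x1] and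
    [x0 - w], where [k] is already known to vanish. *)
Let kjc j : (0 < j <= n)%N -> k (j * c)%N = 0.
Proof.
case: j => [//|i] jn; have [ej|nej] := boolP (e i.+1); first exact: ke.
have j1 : (i.+1 * c = i * c + c)%N by rewrite mulSnr.
have jcn : (i.+1 * c <= n * c)%N by rewrite leq_mul2r; lia.
have fjc : f (i.+1 * c)%N = f c by apply: (@fperj i); lia.
have [fc0|/eqP fcn0] := eqVneq (f c) 0; last by apply: fk; [lia | rewrite fjc].
have x0w : (w < x0)%N.
  by rewrite ltn_neqAle wx0 andbT; apply/eqP => wE; apply: fx0; rewrite -wE; lia.
have fix1 : f (i * c + x1)%N = - f x0.
  by rewrite (@fperj i x1) // /x1; lia.
have -> : k (i.+1 * c)%N = k (i * c + x1)%N + k (x0 - w)%N.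
  apply: relE; rewrite /x1; try lia.
  - by move=> l el /eqP; rewrite eqn_mul2r => /orP[|/eqP il]; [lia | rewrite il el in nej].
  - apply: (@nw_res _ i x1); rewrite /x1; lia.
  - by apply: nw_small; lia.
  - by rewrite -/x1 fjc fix1 (@fltx0 (x0 - w)%N); lia.
rewrite (@kI (x0 - w)%N); last lia.
rewrite addr0; apply: fk; first by rewrite /x1; lia.
by rewrite fix1; lia.
Qed.

Let kjcw j : (j < n)%N -> k (j * c + w)%N = 0.
Proof.
move=> jn; have E : (j * c + (n - j) * c = n * c)%N by rewrite -mulnDl subnKC // ltnW.
have := @kodd ((n - j) * c)%N (j * c + w)%N.
rewrite kjc; last lia.
move=> ->; rewrite ?oppr0 //; have := mulc_lt jn; lia.
Qed.

Let gapk j t z : (j < n)%N -> (0 < t < x0)%N -> z = (j * c + t)%N -> k z = 0.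
Proof.
move=> jn tx0 zE; have [tw|/eqP tw] := eqVneq t w; first by rewrite zE tw kjcw.
by rewrite (@Jt j t) // kI.
Qed.

Let gapk' j t z : (0 < j <= n)%N -> (0 < t < x0)%N -> (z + t = j * c + w)%N -> k z = 0.
Proof.
move=> jn tx0 zE; have E : (j * c + (n - j) * c = n * c)%N by rewrite -mulnDl subnKC //; lia.
have jc : (1 * c <= j * c)%N by rewrite leq_mul2r; lia.
have kq : k ((n - j) * c + t)%N = 0 by apply: (@gapk (n - j)%N t) => //; lia.
move: kq E; generalize ((n - j) * c)%N => q kq E.
by rewrite (@kodd (q + t)%N z) ?kq ?oppr0 //; lia.
Qed.

(** Residues up to [x0] and from [x1] on have been dealt with, as have the multiples of [c] and the
    last [w] positions. *)
Let Kform z : (0 < z < L)%N -> k z <> 0 ->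
  exists j rho, [/\ z = (j * c + rho)%N, (j < n)%N & (x0 < rho < x1)%N].
Proof.
move=> zL kz; set j := (z %/ c)%N; set r := (z %% c)%N.
have zE : z = (j * c + r)%N by rewrite /j /r -divn_eq.
have rc : (r < c)%N by rewrite /r ltn_mod.
clearbody j r.
have [jn|nj] := ltnP j n; last first.
  have E : (n * c <= j * c)%N by rewrite leq_mul2r nj orbT.
  have [r0|r_gt0] := posnP r.
    case: kz; rewrite zE r0 addn0; suff -> : (j * c = n * c)%N by apply: kjc; lia.
    have [jE|] := eqVneq j n; first by rewrite jE.
    rewrite neq_ltn ltnNge nj /= => nltj.
    have : (n.+1 * c <= j * c)%N by rewrite leq_mul2r nltj orbT.
    lia.
  case: kz; rewrite (@kodd (L - z)%N z); try lia.
  by rewrite kI ?oppr0 //; lia.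
have [r0|r_gt0] := posnP r.
  case: kz; rewrite zE r0 addn0; apply: kjc; rewrite (ltnW jn) andbT.
  by move: zL; rewrite zE r0 addn0; case: (j).
have jcn := mulc_lt jn.
exists j, r; split => //; apply/andP; split.
- rewrite ltnNge; apply/negP => rx0; case: kz.
  have [rE|rn] := eqVneq r x0; first by apply: (@kjx0 j); rewrite -?rE.
  by apply: (@gapk j r) => //; lia.
- rewrite ltnNge; apply/negP => x1r; case: kz.
  have [rE|rn] := eqVneq r x1.
    by apply: fk => //; rewrite (@fperj j x1) ?fx1; lia.
  by apply: (@gapk' j.+1 (c + w - r)%N); rewrite /x1 in x1r rn *; lia.
Qed.

Section Contradiction.

(** A minimal counterexample: [rho] is the least residue, over all periods at once, at which [k]
    does not vanish. *)
Variables (j rho : nat).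
Hypothesis jn : (j < n)%N.
Hypothesis rho_in : (x0 < rho < x1)%N.
Local Notation y := (j * c + rho)%N.
Hypothesis ky : k y <> 0.
Hypothesis kmin : forall i r, (i < n)%N -> (0 < r < rho)%N -> k (i * c + r)%N = 0.

Let rho_c : (rho < c)%N. Proof. by move: rho_in; rewrite /x1; lia. Qed.
Let jcn : (j * c + c <= n * c)%N. Proof. exact: mulc_lt. Qed.

Let frho : f rho = 0.
Proof.
have <- : f y = f rho by apply: (@fperj j); lia.
by apply/eqP/negP => /negP/eqP fy; apply: ky; apply: fk => //; lia.
Qed.

Let fy : f y = 0.
Proof. by rewrite (@fperj j rho) ?frho; lia. Qed.

Let kmin0 r : (0 < r < rho)%N -> k r = 0.
Proof. by move=> rr; have := @kmin 0 r; rewrite mul0n add0n => ->//; lia. Qed.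

(** Otherwise additivity would express [k y] by two values of residue below [rho], which vanish by
    minimality. The summand [j * c + w] may be exceptional; the two summands are then exchanged,
    which is no help only for [t = t' = w], the case covered by the first hypothesis. *)
Let odd_rho t t' : f w = 0 \/ j = 0%N -> (0 < t)%N -> (0 < t')%N -> (t + t' = rho)%N ->
  f t' = - f t.
Proof.
move=> fwj.
have aux s s' : (0 < s)%N -> (0 < s')%N -> (s + s' = rho)%N -> s' <> w \/ j = 0%N ->
    f s' = - f s.
  move=> s0 s'0 ss' wj; apply/eqP; rewrite -addr_eq0; apply/negP => /negP/eqP h.
  apply: ky; have -> : k y = k s + k (j * c + s')%N.
    apply: relE; try lia.
    - apply: (@nm_res _ j rho); lia.
    - by apply: nw_small; lia.
    - case: wj => [sw|j0]; first by apply: (@nw_res _ j s'); lia.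
      by rewrite j0; apply: nw_small; lia.
    - by rewrite fy (@fperj j s' (j * c + s')%N); lia.
  by rewrite kmin0 ?kmin //; lia.
move=> t0 t'0 tt'; have [t'w|/eqP] := eqVneq t' w; last by move=> ?; apply: aux; lia.
have [tw|/eqP tw] := eqVneq t w.
  by case: fwj => [fw|j0]; [rewrite t'w tw fw oppr0 | apply: aux; lia].
have := @aux t' t; rewrite addnC => E; have -> := E t'0 t0 tt'; first by rewrite opprK.
by left.
Qed.

(** Subtracting [x0] repeatedly, the value [- f x0] is carried either to a position below [x0],
    where [f] is zero, or to [x0] itself. *)
Let descend g : (g < rho)%N -> f g = - f x0 -> (0 < g)%N ->
  (forall z, (x0 < z <= g)%N -> f z = f (z - x0)%N) -> False.
Proof.
elim/ltn_ind: g => g IH grho fg g0 H; have [gx|xg|gE] := ltngtP g x0.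
- by move: fg; rewrite fltx0; lia.
- apply: (IH (g - x0)%N); try lia.
    by rewrite -H //; lia.
  by move=> z zz; apply: H; lia.
- by move: fg; rewrite gE; lia.
Qed.

(** If [f w = 0], then [d = x0 - w] is a zero of [f]. The point [z = c + x0 - rho] is the mirror
    image of the smaller residue [rho - d], and [y + z] has residue [x0]; this kills [k y] unless
    [y] lies in the last period. *)
Let f_w_neq0 : f w <> 0.
Proof.
move=> fw; have x0w : (w < x0)%N.
  by rewrite ltn_neqAle wx0 andbT; apply/eqP => wE; apply: fx0; rewrite -wE.
set d := (x0 - w)%N.
have fd : f d = 0 by apply: fltx0; rewrite /d; lia.
have [jn1|jn1] := ltnP j.+1 n.
  have jn1c := mulc_lt jn1; apply: ky; set z := (c + x0 - rho)%N.
  have fz : f z = 0.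
    rewrite (@refl (rho - d)%N z); rewrite /z /d; try lia.
    by rewrite -/d (@odd_rho d (rho - d)%N) ?fd ?oppr0 //; rewrite /d; try lia; left.
  have kz : k z = 0.
    have n1 : (n.-1 < n)%N by lia.
    have n1' : (n.-1 * c + c = n * c)%N by case: (n) n2 => // n' _ /=; lia.
    rewrite (@kodd (n.-1 * c + (rho - d))%N z); rewrite /z /d; try lia.
    by rewrite kmin ?oppr0 //; lia.
  have E : k (j.+1 * c + x0)%N = k y + k z.
    apply: relE; rewrite /z; try lia.
    - apply: (@nm_res _ j.+1 x0); lia.
    - apply: (@nw_res _ j rho); lia.
    - by apply: nw_small; lia.
    - rewrite -/z fz (@fperj j.+1 x0 (j.+1 * c + x0)%N) // ?fy; lia.
  by move: E; rewrite (@kjx0 j.+1) // kz; lia.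
(* In the last period [y + z] falls outside the word. The reflection of [y] is now [c + w - rho],
   and the points [rho + d], [rho + x0] and [c + x0] take over. *)
have jE : n = j.+1 by lia.
have nE : (n * c = j * c + c)%N by rewrite jE mulSnr.
have nmt t : (0 < t < c + w - rho)%N -> nm (y + t)%N.
  move=> tt; have [h|h|h] := ltngtP (rho + t)%N c.
  - apply: (@nm_res _ j (rho + t)); lia.
  - apply: (@nm_res _ j.+1 (rho + t - c)); lia.
  - by apply: nm_n; lia.
have frd : f (rho + d)%N = 0.
  apply/eqP/negP => /negP/eqP h.
  have E : k (y + d)%N = k y + k d.
    apply: relE; rewrite /d; try lia.
    - by apply: nmt; move: rho_in; rewrite /x1; lia.
    - apply: (@nw_res _ j rho); lia.
    - by apply: nw_small; lia.
    - rewrite -/d fd fy (@fperj j (rho + d)%N (y + d)%N) ?addr0; try (rewrite /d; move: rho_in; rewrite /x1; lia).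
      by move=> h'; apply: h; rewrite -h'.
  have : k (y + d)%N = 0.
    apply: fk; first by move: rho_in; rewrite /x1 /d; lia.
    rewrite (@fperj j (rho + d)%N) //; move: rho_in; rewrite /x1 /d; lia.
  have kd : k d = 0 by apply: kI; rewrite /d; lia.
  by rewrite E kd addr0.
have frx : f (rho + x0)%N = f x0.
  apply/eqP/negP => /negP/eqP h.
  have fyx : f (y + x0)%N = f (rho + x0)%N.
    by apply: (@fperj j); move: rho_in; rewrite /x1; lia.
  have E : k (y + x0)%N = k y + k x0.
    apply: relE; try (move: rho_in; rewrite /x1; lia).
    - by apply: nmt; move: rho_in; rewrite /x1; lia.
    - apply: (@nw_res _ j rho); lia.
    - by apply: nw_small; lia.
  have kn : k (y + x0)%N <> 0 by rewrite E kx0 addr0.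
  have f0 : f (y + x0)%N = 0.
    apply/eqP/negP => /negP/eqP h'; apply: kn; apply: fk => //.
    by move: rho_in; rewrite /x1; lia.
  apply: (@descend (rho - x0)%N); try lia.
    by apply: odd_rho; [left | lia | lia | lia].
  move=> z zz; set t := (rho + x0 - z)%N.
  have -> : f (z - x0)%N = - f t.
    by apply: odd_rho; [left | rewrite /t; lia | lia | rewrite /t; lia].
  apply/eqP; rewrite -addr_eq0; apply/negP => /negP/eqP h'; apply: kn.
  have -> : k (y + x0)%N = k t + k (j * c + z)%N.
    apply: relE; rewrite /t; try (move: rho_in; rewrite /x1; lia).
    - by apply: nmt; move: rho_in; rewrite /x1; lia.
    - by apply: nw_small; lia.
    - apply: (@nw_res _ j z); lia.
    - have fz : f (j * c + z)%N = f z by apply: (@fperj j); lia.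
      by rewrite f0 fz -/t; lia.
  by rewrite kmin0 ?kmin //; rewrite /t; lia.
have krho1 : k (c + w - rho)%N = - k y by apply: kodd; lia.
(* [E1] and [E2] share the summand [k (rho + d)]. Both left sides vanish, and so does [k w]; hence
   [k (c + w - rho) = - k y] vanishes too. *)
have E1 : k (c + x0)%N = k (c + w - rho)%N + k (rho + d)%N.
  apply: relE; rewrite /d; try lia.
  - apply: (@nm_res _ 1 x0); lia.
  - by apply: nw_small; lia.
  - by apply: nw_small; move: rho_in; rewrite /x1; lia.
  - rewrite -/d frd (@refl rho (c + w - rho)%N) ?frho ?(@fperj 1 x0 (c + x0)%N); lia.
have E2 : k (rho + x0)%N = k w + k (rho + d)%N.
  apply: relE; rewrite /d; try (move: rho_in; rewrite /x1; lia).
  - have [h|h|h] := ltngtP (rho + x0)%N c.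
    + apply: (@nm_res _ 0 (rho + x0)); lia.
    + apply: (@nm_res _ 1 (rho + x0 - c)); move: rho_in; rewrite /x1; lia.
    + by exfalso; move: frx; rewrite h fc fw oppr0; lia.
  - by apply: nw_small; lia.
  - by apply: nw_small; move: rho_in; rewrite /x1; lia.
  - rewrite -/d frd fw frx; lia.
have E3 : k (c + x0)%N = 0 by apply: (@kjx0 1); lia.
have E4 : k (rho + x0)%N = 0.
  by apply: fk; [move: rho_in; rewrite /x1; lia | rewrite frx].
have E5 : k w = 0 by apply: kI; lia.
lia.
Qed.

Lemma no_minimal_residue : False.
Proof.
have fwn := f_w_neq0; have x0E : x0 = w.
  apply/eqP; rewrite eqn_leq wx0 andbT leqNgt; apply/negP => wx.
  by apply: fwn; apply: fltx0; lia.
have fcn : f c <> 0 by rewrite fc; lia.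
(* Now [f c = - f w] is nonzero, so adding [c] always violates additivity of the periodic [f] and
   [k] inherits the period. *)
have kper z : (0 < z)%N -> (z + c < L)%N -> k (z + c)%N = k z.
  move=> z0 zL; have fzc := fper z0 zL.
  have [fz|/eqP fz] := eqVneq (f z) 0; last first.
    by rewrite !fk ?fzc //; lia.
  rewrite addnC (@relE c z (c + z)%N); try lia.
  - by rewrite fk ?add0r //; lia.
  - have zE := divn_eq z c; have rc : (z %% c < c)%N by rewrite ltn_mod.
    move: zE rc; generalize (z %/ c)%N (z %% c)%N => i r zE rc.
    case: r zE rc => [|r] zE rc; last by apply: (@nm_res _ i.+1 r.+1); lia.
    case: i zE => [|i] zE; first by lia.
    case: fcn; rewrite -fz; apply/esym; apply: (@fperj i); lia.
  - by apply: nw_small; lia.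
  - move=> i ei zE; case: fwn; rewrite -fz; apply/esym; apply: (@fperj i); lia.
  - by rewrite fz addnC fzc fz; lia.
have kperj i z : (0 < z)%N -> (i * c + z < L)%N -> k (i * c + z)%N = k z.
  elim: i => [|i IH] z0 zL; first by rewrite mul0n.
  have -> : (i.+1 * c + z = (i * c + z) + c)%N by lia.
  by rewrite kper ?IH //; lia.
have krho : k rho <> 0 by rewrite -(@kperj j rho) //; lia.
have n1 : (n.-1 * c + c = n * c)%N by case: (n) n2 => // n' _ /=; lia.
have odd0 t t' : (0 < t)%N -> (0 < t')%N -> (t + t' = rho)%N -> f t' = - f t.
  move=> t0 t'0 tt'; apply/eqP; rewrite -addr_eq0; apply/negP => /negP/eqP h.
  apply: krho; have -> : k rho = k t + k t'.
    apply: relE; try lia.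
    - by apply: (@nm_res _ 0 rho); lia.
    - by apply: nw_small; lia.
    - by apply: nw_small; lia.
  by rewrite (@kmin0 t) ?(@kmin0 t'); lia.
set rho1 := (c + w - rho)%N.
have krho1 : k rho1 = - k rho.
  have <- : k (n.-1 * c + rho1)%N = k rho1 by apply: kperj; rewrite /rho1; lia.
  by apply: kodd; rewrite /rho1; lia.
have rho_le : (rho <= rho1)%N.
  rewrite leqNgt; apply/negP => h; have : k rho1 = 0 by apply: kmin0; rewrite /rho1; lia.
  by rewrite krho1; lia.
have frho1 : f rho1 = 0.
  apply/eqP/negP => /negP/eqP h; have : k rho1 = 0 by apply: fk => //; rewrite /rho1; lia.
  by rewrite krho1; lia.
have pair_rho t : (0 < t < rho)%N -> f (rho + t)%N <> f t -> k (rho + t)%N = k rho.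
  move=> tr h; have kt : k t = 0 by apply: kmin0; lia.
  have rtc : (rho + t < c + w)%N by rewrite /rho1 in rho_le; lia.
  (* The multiple [c] may be exceptional. The relation is therefore used at [n * c], which never is,
     and moved back by the period of [k]. *)
  have [E|E] := eqVneq (rho + t)%N c.
    have kc : k (n.-1 * c + (rho + t))%N = k (n.-1 * c + rho)%N + k t.
      apply: relE; try lia.
      - by apply: nm_n; lia.
      - by apply: (@nw_res _ n.-1 rho); lia.
      - by apply: nw_small; lia.
      - rewrite (@fperj n.-1 rho (n.-1 * c + rho)%N) //; try lia.
        rewrite (@fperj n.-1 (rho + t)%N (n.-1 * c + (rho + t))%N) ?frho; lia.
    by move: kc; rewrite !kperj ?kt ?addr0 //; lia.
  rewrite (@relE rho t (rho + t)%N) ?kt ?addr0 //; try lia.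
  - have [h'|h'] := ltnP (rho + t)%N c.
      by apply: (@nm_res _ 0 (rho + t)); lia.
    by apply: (@nm_res _ 1 (rho + t - c)); lia.
  - by apply: nw_small; lia.
  - by apply: nw_small; lia.
have sum_rho x z t : (0 < x)%N -> (0 < z)%N -> (x + z = rho + t)%N -> (0 < t < rho)%N ->
    k (rho + t)%N = k rho -> k x + k z <> k rho -> f z = - f x.
  move=> x_gt0 z_gt0 xz tr kt kxz; apply/eqP; rewrite -addr_eq0; apply/negP => /negP/eqP h.
  have rtc : (rho + t < c + w)%N by rewrite /rho1 in rho_le; lia.
  apply: kxz; rewrite -kt; apply/esym; apply: relE; try lia.
  - by apply: nm_k; rewrite kt.
  - by apply: nw_small; lia.
  - by apply: nw_small; lia.
  - have -> : f (rho + t)%N = 0; last by lia.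
    apply/eqP/negP => /negP/eqP h'; apply: krho; rewrite -kt; apply: fk => //; lia.
(* The sum [rho1 + (rho + t)] equals [c + (w + t)], where [k] vanishes by periodicity and
   minimality; additivity would give [k (rho + t) = - k rho1 = k rho]. *)
have stepw t : (0 < t)%N -> (w + t < rho)%N -> k (rho + t)%N <> k rho -> f (w + t)%N = f t.
  move=> t0 tr kt; have frt : f (rho + t)%N = f t.
    by apply/eqP/negP => /negP/eqP h; apply: kt; apply: pair_rho; lia.
  rewrite -frt; apply/eqP/negP => /negP/eqP h; apply: kt.
  have kwt : k (w + t)%N = 0 by apply: kmin0; lia.
  have E : k (c + (w + t))%N = k rho1 + k (rho + t)%N.
    apply: relE; rewrite /rho1; try lia.
    - by apply: (@nm_res _ 1 (w + t)); lia.
    - by apply: nw_small; lia.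
    - by apply: nw_small; rewrite /rho1 in rho_le; lia.
    - rewrite -/rho1 frho1 (@fperj 1 (w + t)%N (c + (w + t))%N); lia.
  have E' : k (c + (w + t))%N = k (w + t)%N.
    by rewrite -(@kperj 1 (w + t)%N) ?mul1n //; lia.
  lia.
have fw' : f (rho - w)%N = - f x0 by rewrite x0E; apply: odd0; lia.
(* If the value [k rho] never recurs, [stepw] makes [f] periodic with period [w = x0] up to
   [rho - w], and the descent starts at [rho - w]. If it recurs, the least such shift [t1] is a
   period of [f] below [rho]; the descent then starts at [t1 - w], or at [rho - w] when [t1 = w]. *)
have [/existsP[t0 /andP[t0w kt0]]|none] := boolP [exists t : 'I_rho, ((0 < t) && (w + t < rho))%N && (k (rho + t)%N == k rho)]; last first.
  apply: (@descend (rho - w)%N) => //; try lia.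
  move=> z zz; have -> : z = (w + (z - x0))%N by lia.
  rewrite (@stepw (z - x0)%N); [congr f; lia | lia | lia |] => h.
  move: none; rewrite negb_exists => /forallP.
  have zr : (z - x0 < rho)%N by lia.
  move=> /(_ (Ordinal zr)); rewrite /= h eqxx; lia.
have ext : exists t, [&& (0 < t)%N, (w + t < rho)%N & k (rho + t)%N == k rho].
  by exists t0; rewrite andbA t0w.
case: (ex_minnP ext) => t1 /and3P[t1_gt0 t1r /eqP kt1] t1min.
have per1 z : (0 < z)%N -> (z + t1 < rho)%N -> f (z + t1)%N = f z.
  move=> z0 zr; have -> : f z = - f (rho - z)%N by apply: odd0; lia.
  apply: (@sum_rho _ _ t1) => //; try lia.
  by rewrite (@kmin0 (rho - z)%N) ?(@kmin0 (z + t1)%N); lia.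
have t1w : (w <= t1)%N.
  rewrite leqNgt; apply/negP => tw; apply: fwn.
  have -> : w = (w - t1 + t1)%N by lia.
  rewrite per1; try lia.
  by apply: fw0; lia.
have [t1E|t1n] := eqVneq t1 w.
  apply: (@descend (rho - w)%N) => //; try lia.
  move=> z zz; have -> : z = (z - x0 + t1)%N by lia.
  by rewrite per1; [congr f; lia | lia | lia].
have kt1' t : (0 < t < t1)%N -> k (rho + t)%N <> k rho.
  move=> tt h; have := t1min t; rewrite h eqxx; lia.
apply: (@descend (t1 - w)%N); try lia.
- have <- : f (rho + (t1 - w))%N = f (t1 - w)%N.
    apply/eqP/negP => /negP/eqP h; apply: (@kt1' (t1 - w)%N); first lia.
    by apply: pair_rho; lia.
  rewrite x0E; apply: (@sum_rho _ _ t1) => //; try lia.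
  have -> : k w = 0 by apply: kmin0; lia.
  by rewrite add0r; apply: kt1'; lia.
- move=> z zz; have -> : z = (w + (z - x0))%N by lia.
  rewrite (@stepw (z - x0)%N); [congr f; lia | lia | lia |].
  by apply: kt1'; lia.
Qed.

End Contradiction.

Lemma periodic_odd_pair_vanish x : (0 < x < L)%N -> k x = 0.
Proof.
move=> xL; apply/eqP/negP => /negP/eqP kx.
have [j [rho [xE jn rr]]] := Kform xL kx.
pose P r := [&& (x0 < r)%N, (r < x1)%N & [exists i : 'I_n, k (i * c + r)%N != 0]].
have exP : exists r, P r.
  exists rho; rewrite /P; case/andP: rr => -> -> /=; apply/existsP; exists (Ordinal jn) => /=.
  by rewrite -xE; apply/eqP.
case: (ex_minnP exP) => r0 /and3P[r0x r0x1 /existsP[i /eqP kir]] rmin.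
apply: (@no_minimal_residue i r0) => //; first by rewrite r0x.
move=> i' r i'n rr0; have i'c := mulc_lt i'n.
have rc : (r < c)%N by move: r0x1; rewrite /x1; lia.
have [rx|xr|rE] := ltngtP r x0.
- by apply: (@gapk i' r) => //; lia.
- apply/eqP/negP => /negP kn; have := rmin r.
  have -> : P r; last by lia.
  rewrite /P xr /=; apply/andP; split; first by lia.
  by apply/existsP; exists (Ordinal i'n).
- by apply: (@kjx0 i'); rewrite ?rE.
Qed.

End PeriodicOddPair.

(** * Extracting coefficients from sums over cuts *)

Ltac perm_tac := let a := fresh in apply/permP => a /=; lia.

Lemma sum_rev n (F : nat -> int) :
  \sum_(1 <= x < n) F x = \sum_(1 <= x < n) F (n - x)%N.
Proof.
by rewrite big_nat_rev /= !big_nat; apply: eq_bigr => x xn; congr F; lia.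
Qed.

Lemma sum_antisym n (F : nat -> int) :
  (forall x, (0 < x < n)%N -> F (n - x)%N = - F x) -> \sum_(1 <= x < n) F x = 0.
Proof.
move=> H; have E : \sum_(1 <= x < n) F x = - \sum_(1 <= x < n) F x.
  rewrite {1}sum_rev -sumrN !big_nat; apply: eq_bigr => x xn; exact: H.
lia.
Qed.

Lemma sum_delta n (F : nat -> int) x : (0 < x < n)%N ->
  \sum_(1 <= i < n) F i * (i == x)%:R = F x.
Proof.
move=> xn; rewrite (bigD1_seq x) ?iota_uniq ?mem_index_iota //= eqxx mulr1 big1 ?addr0 //.
by move=> i /negbTE ->; rewrite mulr0.
Qed.

Lemma perm_eq2 (k l y z : nat) :
  perm_eq [:: k; l] [:: y; z] = ((k == y) && (l == z)) || ((k == z) && (l == y)).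
Proof.
apply/idP/idP => [H|/orP[/andP[/eqP-> /eqP->]|/andP[/eqP-> /eqP->]]] //.
- have : k \in [:: y; z] by rewrite -(perm_mem H) inE eqxx.
  rewrite !inE => /orP[/eqP kE|/eqP kE]; move: H; rewrite kE.
    rewrite perm_cons => /perm_small_eq /= E; have [->] := E isT.
    by rewrite !eqxx.
  rewrite (perm_sym _ [:: y; z]) (perm_catC [:: y] [:: z]) /= perm_cons.
  move=> /perm_small_eq /= E; have [->] := E isT.
  by rewrite !eqxx orbT.
- by rewrite (perm_catC [:: z] [:: y]).
Qed.

Lemma perm_eq3 (i k l x y z : nat) :
  perm_eq [:: i; k; l] [:: x; y; z] =
  [|| (i == x) && perm_eq [:: k; l] [:: y; z], (i == y) && perm_eq [:: k; l] [:: x; z]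
    | (i == z) && perm_eq [:: k; l] [:: x; y]].
Proof.
have Py : perm_eq [:: x; y; z] [:: y; x; z] by perm_tac.
have Pz : perm_eq [:: x; y; z] [:: z; x; y] by perm_tac.
apply/idP/idP => [H|].
- have : i \in [:: x; y; z] by rewrite -(perm_mem H) inE eqxx.
  rewrite !inE => /or3P[] /eqP iE; move: H; rewrite iE eqxx ?orbT /=.
  + by rewrite perm_cons => ->.
  + by rewrite (permPr Py) perm_cons => ->; rewrite orbT.
  + by rewrite (permPr Pz) perm_cons => ->; rewrite !orbT.
- case/or3P => /andP[/eqP-> H].
  + by rewrite perm_cons.
  + by rewrite (permPr Py) perm_cons.
  + by rewrite (permPr Pz) perm_cons.
Qed.

(** For [x = y] a single term survives and gives [F x = 0], which still implies the stated form. *)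
Lemma pair_coef0 n (F : nat -> int) x y : (0 < x)%N -> (0 < y)%N -> (x + y = n)%N ->
  \sum_(1 <= i < n) F i * (perm_eq [:: i; n - i] [:: x; y])%N%:R = 0 -> F x + F y = 0.
Proof.
move=> x0 y0 xy; have [xE|xy'] := eqVneq x y.
  have -> : \sum_(1 <= i < n) F i * (perm_eq [:: i; n - i] [:: x; y])%N%:R =
            \sum_(1 <= i < n) F i * (i == x)%:R.
    rewrite !big_nat; apply: eq_bigr => i iN; congr (_ * _%:R); rewrite perm_eq2; lia.
  by rewrite sum_delta -?xE; [lia | lia].
have -> : \sum_(1 <= i < n) F i * (perm_eq [:: i; n - i] [:: x; y])%N%:R =
          \sum_(1 <= i < n) (F i * (i == x)%:R + F i * (i == y)%:R).
  rewrite !big_nat; apply: eq_bigr => i iN; rewrite -mulrDr -natrD; congr (_ * _%:R).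
  rewrite perm_eq2; lia.
by rewrite big_split /= !sum_delta //; lia.
Qed.

Lemma sum2_delta n (G : nat -> nat -> int) x y : (0 < x < n)%N -> (0 < y < n)%N ->
  \sum_(1 <= i < n) \sum_(1 <= j < n) G i j * ((i == x) && (j == y))%:R = G x y.
Proof.
move=> xn yn; rewrite -(sum_delta (fun i => G i y) xn); apply: eq_bigr => i _.
rewrite -(sum_delta (G i) yn) mulr_suml; apply: eq_bigr => j _.
by case: eqP => _; case: eqP => _; rewrite /= ?mulr0 ?mulr1 ?mul0r.
Qed.

Lemma triple_coef0 n (G : nat -> nat -> int) x y z :
  (0 < x)%N -> (0 < y)%N -> (0 < z)%N -> (x + y + z = n)%N ->
  \sum_(1 <= i < n) \sum_(1 <= j < n)
     G i j * ((i < j) && perm_eq [:: i; j - i; n - j] [:: x; y; z])%N%:R = 0 ->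
  G x (x + y)%N + G x (x + z)%N + G y (y + x)%N + G y (y + z)%N
    + G z (z + x)%N + G z (z + y)%N = 0.
Proof.
move=> x0 y0 z0 xyz.
(* [M] is the number of permutations of the triple that fix it; after multiplication by [M] the sum
   over distinct arrangements becomes the sum over all six orders. *)
pose M : nat := (if (x == y) && (y == z) then 6 else 1 + (x == y) + (y == z) + (x == z))%N.
have [xL yL zL] : [/\ 0 < x < n, 0 < y < n & 0 < z < n]%N by split; lia.
have [xyL xzL yzL] : [/\ 0 < x + y < n, 0 < x + z < n & 0 < y + z < n]%N by split; lia.
move=> H; have {H} := congr1 (fun t => M%:R * t) H; rewrite mulr0 => H.
rewrite -H -(sum2_delta G xL xyL) -(sum2_delta G xL xzL) (addnC y x) -(sum2_delta G yL xyL).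
rewrite -(sum2_delta G yL yzL) (addnC z x) -(sum2_delta G zL xzL) (addnC z y) -(sum2_delta G zL yzL).
rewrite -!big_split /= mulr_sumr !big_nat; apply: eq_bigr => i iN.
rewrite -!big_split /= mulr_sumr !big_nat; apply: eq_bigr => j jN.
rewrite -!mulrDr -!natrD mulrCA -natrM; congr (_ * _%:R).
have [ij|ij] := ltnP i j; last first.
  have D p q : (0 < p)%N -> (0 < q)%N -> (i == p) && (j == p + q)%N = false by lia.
  by rewrite (addnC x y) (D y x) // (addnC y x) (D x y) // (D x z) // (D y z) //
     (addnC x z) (D z x) // (addnC y z) (D z y) // muln0.
set d := fun p q : nat => (i == p) && (j - i == q)%N.
have D p q : (i == p) && (j == p + q)%N = d p q by rewrite /d; lia.
have P p q r : (p + q + r = n)%N -> (i == p) && perm_eq [:: j - i; n - j]%N [:: q; r] = d p q || d p r.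
  by move=> pqr; rewrite perm_eq2 /d; have [ip|//] := eqVneq i p; rewrite /=; lia.
rewrite perm_eq3 (P x y z) // (P y x z) ?(P z x y) //; try lia.
rewrite (D x y) (D x z) (addnC x y) (D y x) (D y z) (addnC x z) (D z x) (addnC y z) (D z y) /d /M.
by repeat (match goal with |- context [(?a == ?p :> nat)] => case: (a =P p) => ? end; rewrite /=); lia.
Qed.

(* With [f] odd under [x -> n - x] and [k x = g (n - x) - g x], the coefficient
   identity of degree three factors. *)
Lemma odd_triple n (f g : nat -> int) x y z :
  (forall i j, (0 < i)%N -> (0 < j)%N -> (i + j = n)%N -> f j = - f i) ->
  (0 < x)%N -> (0 < y)%N -> (0 < z)%N -> (x + y + z = n)%N ->
  \sum_(1 <= i < n) \sum_(1 <= j < n) (f i * g j + g i * f j)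
     * ((i < j) && perm_eq [:: i; j - i; n - j] [:: x; y; z])%N%:R = 0 ->
  let k i := g (n - i)%N - g i in
  (f x + f y + f z) * (k x + k y + k z) = f x * k x + f y * k y + f z * k z.
Proof.
move=> fodd x0 y0 z0 xyz /(triple_coef0 x0 y0 z0 xyz) H k.
have [Ez Ey Ex] : [/\ f (x + y)%N = - f z, f (x + z)%N = - f y & f (y + z)%N = - f x].
  by split; apply: fodd; lia.
have [Gz Gy Gx] : [/\ g (n - z) = g (x + y), g (n - y) = g (x + z) & g (n - x) = g (y + z)]%N.
  by split; congr g; lia.
rewrite /k Gx Gy Gz; move: H.
rewrite (addnC y x) (addnC z x) (addnC z y) Ez Ey Ex => H.
apply/eqP; rewrite -subr_eq0; apply/eqP; rewrite -[RHS]H; ring.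
Qed.

(** The theorem of Fine and Wilf by Euclid's algorithm: [p - q] is again a period, since the step by
    [q] can be taken on whichever side stays inside the word. *)
Lemma gcd_period (T : Type) (F : nat -> T) L p q : (0 < p)%N -> (0 < q)%N -> (p + q < L)%N ->
  (forall x, 0 < x -> x + p < L -> F (x + p) = F x)%N ->
  (forall x, 0 < x -> x + q < L -> F (x + q) = F x)%N ->
  forall x, (0 < x -> x + gcdn p q < L -> F (x + gcdn p q) = F x)%N.
Proof.
have [N] := ubnP (p + q)%N; elim: N p q => // N IH p q pqN p0 q0 pqL Hp Hq.
have main p' q' : (0 < q')%N -> (q' < p')%N -> (p' + q' = p + q)%N ->
  (forall x, 0 < x -> x + p' < L -> F (x + p') = F x)%N ->
  (forall x, 0 < x -> x + q' < L -> F (x + q') = F x)%N ->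
  forall x, (0 < x -> x + gcdn p' q' < L -> F (x + gcdn p' q') = F x)%N.
  move=> q'0 qp' E Hp' Hq'; have -> : gcdn p' q' = gcdn (p' - q') q'.
    by rewrite gcdnC -{1}(subnK (ltnW qp')) gcdnDr gcdnC.
  apply: IH => //; try lia.
  move=> x x0 xL; have [xp|xp] := ltnP (x + p')%N L.
    rewrite -Hq' ?Hp'; try lia.
    by rewrite -[RHS]Hp' //; congr F; lia.
  rewrite -[in RHS](@subnK q' x); last lia.
  rewrite [RHS]Hq'; try lia.
  by rewrite -[RHS]Hp'; [congr F; lia | lia | lia].
have [pq|pq|->] := ltngtP p q; last by rewrite gcdnn.
- by rewrite gcdnC; apply: main => //; lia.
- by apply: main.
Qed.

Lemma natr_false : (nat_of_bool false)%:R = 0 :> int.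
Proof. by []. Qed.

(** * Linear and quadratic relations between two mark words *)

Section FatAnalysis.

Variables (w u s : nat).
Hypothesis w0 : (0 < w)%N.
Hypothesis u0 : (0 < u)%N.
Hypothesis s0 : (0 < s)%N.
Local Notation v := (u + w)%N.
Local Notation b := (s + w)%N.
Local Notation L := (u + w + s)%N.

(* The coefficients at the monomial [e_l] of the part of [r1 * r2 - e_w * r] in which one
   (resp. two) marks are used as cuts. *)
Definition cut1 (x : nat) (l : seq nat) : int :=
  ((x < v) && perm_eq [:: b; x; v - x] l)%N%:R
  + ((u < x) && perm_eq [:: v; x - u; L - x] l)%N%:R
  - (perm_eq [:: w; x; L - x]%N l)%:R.

Definition cut2 (x z : nat) (l : seq nat) : int :=
  ((x < z) && (z < v) && perm_eq [:: b; x; z - x; v - z] l)%N%:R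
  + ((x < z) && (x < v) && (u < z) && perm_eq [:: x; v - x; z - u; L - z] l)%N%:R
  + ((x < z) && (u < x) && perm_eq [:: v; x - u; z - x; L - z] l)%N%:R
  - ((x < z) && perm_eq [:: w; x; z - x; L - z] l)%N%:R.

Definition coef3 (F : nat -> int) l := \sum_(1 <= x < L) F x * cut1 x l.
Definition coef4 (G : nat -> nat -> int) l :=
  \sum_(1 <= x < L) \sum_(1 <= z < L) G x z * cut2 x z l.

Definition end_point x := (x == u) || (x == v).
Definition in_window x := (u < x < v)%N.

(** A cut at an end of the window splits off a segment of length [w], so that the term from
    [r1 * r2] equals the term from [e_w * r]. Marks at [u] and [u + w] are thus invisible. *)
Lemma cut1_end x l : end_point x -> cut1 x l = 0.
Proof.
rewrite /cut1 => /orP[]/eqP->.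
- have -> : (u < u)%N = false by lia.
  have -> : (u < v)%N by lia.
  have -> : (L - u = b)%N by lia. have -> : (v - u = w)%N by lia.
  have /permPl -> : perm_eq [:: b; u; w] [:: w; u; b].
    by perm_tac.
  by rewrite addr0 subrr.
- have -> : (v < v)%N = false by lia.
  have -> : (u < v)%N by lia.
  have -> : (v - u = w)%N by lia.
  have /permPl -> : perm_eq [:: v; w; L - v]%N [:: w; v; L - v]%N by perm_tac.
  by rewrite add0r subrr.
Qed.

Lemma cut2_end x z l : ~~ in_window x -> ~~ in_window z -> end_point x || end_point z ->
  cut2 x z l = 0.
Proof.
rewrite /cut2 /in_window => wx wz; have [xz|] := ltnP x z; last by rewrite subr0.
have PCA (p q : nat) (t : seq nat) : perm_eq [:: p, q & t] [:: q, p & t].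
  by perm_tac.
have swap4 (p q r t : nat) : perm_eq [:: p; q; r; t] [:: t; q; r; p].
  by perm_tac.
case/orP => /orP[]/eqP E.
- have -> : (u < x)%N = false by lia.
  have -> : (z < v)%N = false by lia.
  have [-> ->] : (x < v)%N /\ (u < z)%N by lia.
  have -> : (v - x = w)%N by lia.
  by rewrite -E (permPl (PCA x w _)) /=; case: perm_eq.
- have -> : (x < v)%N = false by lia.
  have -> : (z < v)%N = false by lia.
  have -> : (u < x)%N by lia.
  have -> : (x - u = w)%N by lia.
  by rewrite -E (permPl (PCA x w _)) /=; case: perm_eq.
- have -> : (u < z)%N = false by lia.
  have -> : (u < x)%N = false by lia.
  have -> : (z < v)%N by lia.
  have [-> ->] : (v - z = w)%N /\ (L - z = b)%N by lia.
  by rewrite (permPl (swap4 b x _ w)) /= ?andbF ?natr_false; case: perm_eq.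
- have -> : (z < v)%N = false by lia.
  have [xu|xu] := leqP x u; last first.
    have xv : x = v by lia.
    lia.
  have [-> ->] : (x < v)%N /\ (u < z)%N by lia.
  have -> : (z - u = w)%N by lia.
  have -> : (v - x = z - x)%N by lia.
  have /permPl -> : perm_eq [:: x; z - x; w; L - z]%N [:: w; x; z - x; L - z]%N.
    by perm_tac.
  by rewrite /=; case: perm_eq.
Qed.

Lemma coef3_ext F F' l : (forall x, (0 < x < L)%N -> ~~ end_point x -> F x = F' x) ->
  coef3 F l = coef3 F' l.
Proof.
move=> H; rewrite /coef3 !big_nat; apply: eq_bigr => x xL.
have [ex|nex] := boolP (end_point x); first by rewrite cut1_end // !mulr0.
by rewrite H.
Qed.

Lemma coef4_ext G G' l :
  (forall x z, (0 < x < L)%N -> (0 < z < L)%N -> in_window x || in_window z ->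
     G x z = 0 /\ G' x z = 0) ->
  (forall x z, (0 < x < L)%N -> (0 < z < L)%N -> ~~ end_point x -> ~~ end_point z ->
     G x z = G' x z) ->
  coef4 G l = coef4 G' l.
Proof.
move=> H0 H; rewrite /coef4 !big_nat; apply: eq_bigr => x xL.
rewrite !big_nat; apply: eq_bigr => z zL.
have [wxz|] := boolP (in_window x || in_window z).
  by have [-> ->] := H0 _ _ xL zL wxz.
rewrite negb_or => /andP[wx wz].
have [exz|] := boolP (end_point x || end_point z); first by rewrite cut2_end // !mulr0.
by rewrite negb_or => /andP[ex ez]; rewrite H.
Qed.

Lemma sum_head (F : nat -> int) :
  \sum_(1 <= x < L) F x * (x < v)%N%:R = \sum_(1 <= x < v) F x.
Proof.
rewrite (big_cat_nat (n := v)) /=; [|lia|lia].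
have -> : \sum_(v <= x < L) F x * (x < v)%N%:R = 0.
  rewrite big_nat; apply: big1 => x xv.
  by have -> : (x < v)%N = false; first lia; rewrite mulr0.
rewrite addr0 !big_nat; apply: eq_bigr => x xv.
by have -> : (x < v)%N; first lia; rewrite mulr1.
Qed.

Lemma sum_tail (F : nat -> int) :
  \sum_(1 <= x < L) F x * (u < x)%N%:R = \sum_(1 <= x < b) F (u + x)%N.
Proof.
rewrite (big_cat_nat (n := u.+1)) /=; [|lia|lia].
have -> : \sum_(1 <= x < u.+1) F x * (u < x)%N%:R = 0.
  rewrite big_nat; apply: big1 => x xv.
  by have -> : (u < x)%N = false; first lia; rewrite mulr0.
rewrite add0r -{1}(add1n u) big_addn; have -> : (L - u = b)%N by lia.
rewrite !big_nat; apply: eq_bigr => x xv.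
by have -> : (u < x + u)%N; first lia; rewrite mulr1 addnC.
Qed.

Lemma perm_notin (T : eqType) (x : T) l1 l2 : x \in l1 -> x \notin l2 -> perm_eq l1 l2 = false.
Proof. by move=> x1 x2; apply/negP => /perm_mem E; rewrite -E x1 in x2. Qed.

Section OddPair.

Variables (S S' : nat -> bool).
Hypothesis S_window : forall x, in_window x -> S x = false.
Hypothesis S'_window : forall x, in_window x -> S' x = false.

Let f x : int := (S x)%:Z - (S' x)%:Z.
Let g x : int := (S x)%:Z + (S' x)%:Z.

Hypothesis coef3_0 : forall l, coef3 f l = 0.

Let f_window x : in_window x -> f x = 0.
Proof. by move=> xw; rewrite /f S_window // S'_window. Qed.
Let g_window x : in_window x -> g x = 0.
Proof. by move=> xw; rewrite /g S_window // S'_window. Qed.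

(** At [e_w * e_x * e_y] with [x + y = L] only [e_w * r] contributes, unless [x] or [y] is [u + w]
    or [s + w]. Those positions and their complements are what the two hypotheses cover. *)
Lemma odd_full : f u + f b = 0 -> f v + f s = 0 ->
  forall x y, (0 < x)%N -> (0 < y)%N -> (x + y = L)%N -> f y = - f x.
Proof.
move=> fu fv x y x0 y0 xy.
have [xE|xu] := eqVneq x u; first by have -> : y = b; first lia; rewrite xE; lia.
have [xE|xv] := eqVneq x v; first by have -> : y = s; first lia; rewrite xE; lia.
have [xE|xb] := eqVneq x b; first by have -> : y = u; first lia; rewrite xE; lia.
have [xE|xs] := eqVneq x s; first by have -> : y = v; first lia; rewrite xE; lia.
apply/eqP; rewrite -addr_eq0 addrC; apply/eqP; apply: (pair_coef0 x0 y0 xy).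
have := coef3_0 [:: w; x; y]; rewrite /coef3 => H; apply/eqP; rewrite -oppr_eq0 -sumrN; apply/eqP; rewrite -[RHS]H.
rewrite !big_nat; apply: eq_bigr => i iL; rewrite /cut1 perm_cons.
rewrite (@perm_notin _ b [:: b; _; _]) ?inE ?eqxx //; last by rewrite !negb_or; lia.
rewrite (@perm_notin _ v [:: v; _; _]) ?inE ?eqxx //; last by rewrite !negb_or; lia.
by rewrite !andbF ?natr_false ?add0r ?sub0r ?mulrN.
Qed.

Hypothesis f_odd : forall x y, (0 < x)%N -> (0 < y)%N -> (x + y = L)%N -> f y = - f x.

Let row_part0 l : \sum_(1 <= x < L) f x * (perm_eq [:: w; x; L - x]%N l)%:R = 0.
Proof.
apply: sum_antisym => x xL; rewrite (f_odd (x := x)) ?mulNr; [|lia|lia|lia].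
have -> : (L - (L - x) = x)%N by lia.
congr (- (_ * (nat_of_bool _)%:R)); apply: permPl; rewrite perm_cons.
by perm_tac.
Qed.

(** At [e_b * e_x * e_y] with [x + y = v] the part from [e_w * r] cancels by the oddness already
    known, and [u != s] keeps the cuts of the right part out. *)
Lemma odd_left : u != s -> forall x y, (0 < x)%N -> (0 < y)%N -> (x + y = v)%N -> f y = - f x.
Proof.
move=> us x y x0 y0 xy; apply/eqP; rewrite -addr_eq0 addrC; apply/eqP.
apply: (pair_coef0 x0 y0 xy).
have := coef3_0 [:: b; x; y]; rewrite /coef3 => H; rewrite -[RHS]H.
rewrite -sum_head -[LHS]subr0 -[X in _ - X](row_part0 [:: b; x; y]) -sumrB !big_nat.
apply: eq_bigr => i iL; rewrite /cut1 (@perm_notin _ v [:: v; _; _]) ?inE ?eqxx //; last first.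
  by rewrite !negb_or; lia.
rewrite perm_cons andbF ?natr_false ?addr0 mulrBr -mulrA -natrM mulnb andbC.
by [].
Qed.

Lemma odd_right : u != s -> forall x y, (0 < x)%N -> (0 < y)%N -> (x + y = b)%N ->
  f (u + y)%N = - f (u + x)%N.
Proof.
move=> us x y x0 y0 xy; apply/eqP; rewrite -addr_eq0 addrC; apply/eqP.
apply: (pair_coef0 (F := fun i => f (u + i)%N) x0 y0 xy).
have := coef3_0 [:: v; x; y]; rewrite /coef3 => H; rewrite -[RHS]H.
transitivity (\sum_(1 <= i < L)
   (f i * (perm_eq [:: i - u; L - i] [:: x; y])%N%:R) * (u < i)%N%:R).
  rewrite sum_tail !big_nat; apply: eq_bigr => i ib; congr (_ * (nat_of_bool _)%:R).
  by congr perm_eq; congr [:: _; _]; lia.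
rewrite -[LHS]subr0 -[X in _ - X](row_part0 [:: v; x; y]) -sumrB !big_nat.
apply: eq_bigr => i iL; rewrite /cut1 (@perm_notin _ b [:: b; _; _]) ?inE ?eqxx //; last first.
  by rewrite !negb_or; lia.
by rewrite perm_cons andbF ?natr_false ?add0r mulrBr -mulrA -natrM mulnb andbC.
Qed.

Hypothesis coef4_0 : forall l, coef4 (fun x z => f x * g z + g x * f z) l = 0.
Hypothesis f_oddl : forall x y, (0 < x)%N -> (0 < y)%N -> (x + y = v)%N -> f y = - f x.
Hypothesis f_oddr : forall x y, (0 < x)%N -> (0 < y)%N -> (x + y = b)%N ->
  f (u + y)%N = - f (u + x)%N.

Let G x z := f x * g z + g x * f z.

(** Reflecting the cut in either part changes the sign of [f] there but permutes the four lengths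
    only. *)
Let cross0 l : \sum_(1 <= x < L) \sum_(1 <= z < L) G x z *
  ((x < z) && (x < v) && (u < z) && perm_eq [:: x; v - x; z - u; L - z] l)%N%:R = 0.
Proof.
pose P x z := (perm_eq [:: x; v - x; z; b - z]%N l)%:R : int.
transitivity (\sum_(1 <= x < v) \sum_(1 <= z < b) G x (u + z)%N * P x z).
  rewrite -(sum_head (fun x => \sum_(1 <= z < b) G x (u + z)%N * P x z)) !big_nat.
  apply: eq_bigr => x xL; have [xv|] := ltnP x v; last first.
    by rewrite mulr0 => _; apply: big1 => z _; rewrite andbF ?natr_false mulr0.
  rewrite mulr1; transitivity (\sum_(1 <= z < L) (G x z * P x (z - u)%N) * (u < z)%N%:R).
    rewrite !big_nat; apply: eq_bigr => z zL; rewrite -mulrA -natrM mulnb andbT [_ && (u < z)%N]andbC.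
    have [uz|] := ltnP u z; last by rewrite /= andbF !mulr0.
    have -> : (b - (z - u) = L - z)%N by lia.
    have [xz|zx] := ltnP x z; first by rewrite !andbT /=.
    by rewrite /G f_window ?(g_window (x := x)) /in_window ?mul0r ?addr0 ?mul0r //; lia.
  by rewrite sum_tail; apply: eq_bigr => z _; rewrite addKn.
have Pl x z : (0 < x < v)%N -> P (v - x)%N z = P x z.
  move=> xv; rewrite /P; have -> : (v - (v - x) = x)%N by lia.
  by congr (nat_of_bool _)%:R; apply: permPl; perm_tac.
have Pr x z : (0 < z < b)%N -> P x (b - z)%N = P x z.
  move=> zb; rewrite /P; have -> : (b - (b - z) = z)%N by lia.
  congr (nat_of_bool _)%:R; apply: permPl.
  by perm_tac.
rewrite (eq_bigr (fun x => \sum_(1 <= z < b) f x * g (u + z)%N * P x z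
                        + \sum_(1 <= z < b) g x * f (u + z)%N * P x z)); last first.
  by move=> x _; rewrite -big_split /=; apply: eq_bigr => z _; rewrite /G mulrDl.
rewrite big_split /= sum_antisym ?add0r.
  apply: big1 => x _; apply: sum_antisym => z zb.
  by rewrite (f_oddr (x := z)) ?Pr //; [ring | lia | lia | lia].
move=> x xv; rewrite -sumrN; apply: eq_bigr => z _.
by rewrite (f_oddl (x := x)) ?Pl //; [ring | lia | lia | lia].
Qed.

Let coef4_split l :
  \sum_(1 <= x < L) \sum_(1 <= z < L) G x z *
     (((x < z) && (z < v) && perm_eq [:: b; x; z - x; v - z] l)%N%:R
      + ((x < z) && (u < x) && perm_eq [:: v; x - u; z - x; L - z] l)%N%:R
      - ((x < z) && perm_eq [:: w; x; z - x; L - z] l)%N%:R) = 0.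
Proof.
rewrite -[RHS](coef4_0 l) /coef4 -[LHS]addr0 -[X in _ + X](cross0 l) -big_split !big_nat; apply: eq_bigr => x _ /=.
rewrite -big_split !big_nat; apply: eq_bigr => z _ /=; rewrite /cut2 -/(G x z); ring.
Qed.

Let k x := g (L - x)%N - g x.

(** This is [odd_triple] at [e_w * e_x * e_y * e_z], where [z] completes the length; the exclusions
    keep the other products out. Its right side vanishes: if [f t] is nonzero, exactly one word is
    marked at [t] and exactly one at [L - t], so [k t = 0]. *)
Lemma rel_full x y : (0 < x)%N -> (0 < y)%N -> (x + y < L)%N ->
  (forall t, t \in [:: x; y; L - (x + y)]%N -> (t != v) && (t != b)) ->
  f x + f y <> f (x + y)%N -> k (x + y)%N = k x + k y.
Proof.
move=> x0 y0 xyL ex fxy; set z := (L - (x + y))%N.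
have z0 : (0 < z)%N by rewrite /z; lia.
have xyz : (x + y + z = L)%N by rewrite /z; lia.
have := ex x; have := ex y; have := ex z; rewrite !inE !eqxx !orbT => /(_ isT) ez /(_ isT) ey /(_ isT) ex'.
have H : \sum_(1 <= i < L) \sum_(1 <= j < L) (f i * g j + g i * f j)
     * ((i < j) && perm_eq [:: i; j - i; L - j] [:: x; y; z])%N%:R = 0.
  apply/eqP; rewrite -oppr_eq0 -sumrN; apply/eqP; rewrite -[RHS](coef4_split [:: w; x; y; z]); apply: eq_bigr => i _.
  rewrite -sumrN; apply: eq_bigr => j _.
  rewrite (@perm_notin _ b [:: b; _; _; _]) ?inE ?eqxx //; last by rewrite !negb_or; lia.
  rewrite (@perm_notin _ v [:: v; _; _; _]) ?inE ?eqxx //; last by rewrite !negb_or; lia.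
  by rewrite perm_cons !andbF ?natr_false ?add0r ?sub0r ?mulrN.
have := odd_triple f_odd x0 y0 z0 xyz H; rewrite /= -!/(k _).
have fk t : (0 < t < L)%N -> f t * k t = 0.
  move=> tL; have := @f_odd t (L - t)%N; have [/eqP ft|ft] := eqVneq (f t) 0.
    by move/eqP: ft => ->; rewrite mul0r.
  move=> H'; have {H'} H' : f (L - t)%N = - f t by apply: H'; lia.
  have -> : k t = 0; last by rewrite mulr0.
  move: ft H'; rewrite /k /f /g; case: (S t); case: (S' t); case: (S (L - t)%N); case: (S' (L - t)%N); lia.
rewrite !fk; [|lia|lia|lia].
have -> : f z = - f (x + y)%N by apply: f_odd; lia.
have -> : k z = - k (x + y)%N.
  by rewrite /k; have -> : (L - z = x + y)%N; first lia; have -> : (L - (x + y) = z)%N; first done; lia.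
by rewrite !addr0 => /eqP; rewrite mulf_eq0 => /orP[]/eqP; lia.
Qed.

Let fk x : (0 < x < L)%N -> f x <> 0 -> k x = 0.
Proof.
move=> xL fx; have : f (L - x)%N = - f x by apply: f_odd; lia.
move: fx; rewrite /k /f /g.
by case: (S x); case: (S' x); case: (S (L - x)%N); case: (S' (L - x)%N); lia.
Qed.

Let c := gcdn u s.
Let c0 : (0 < c)%N. Proof. by rewrite gcdn_gt0 u0. Qed.

(** The reflection of the whole word followed by that of the right part is the translation by [u];
    with the left part it is the translation by [s]. *)
Lemma f_period x : (0 < x)%N -> (x + c < L)%N -> f (x + c)%N = f x.
Proof.
apply: gcd_period => //; first by lia.
- move=> {}x x0 xL; rewrite addnC (f_oddr (x := (b - x)%N)); [|lia|lia|lia].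
  by rewrite (f_odd (x := x)) ?opprK //; lia.
- move=> {}x x0 xL; rewrite (f_odd (x := (v - x)%N)); [|lia|lia|lia].
  by rewrite (f_oddl (x := x)) ?opprK //; lia.
Qed.

Let f_w x : (0 < x < w)%N -> f x = 0.
Proof.
by move=> xw; rewrite (f_oddl (x := (v - x)%N)) ?f_window ?oppr0 // /in_window; lia.
Qed.

Lemma k_vanish : g b = g u -> g v = g s -> (exists x, (0 < x < L)%N && (f x != 0)) ->
  forall x, (0 < x < L)%N -> k x = 0.
Proof.
move=> gu gs fnz; pose p := (u %/ c)%N; pose q := (s %/ c)%N.
have pE : (p * c = u)%N by rewrite divnK // dvdn_gcdl.
have qE : (q * c = s)%N by rewrite divnK // dvdn_gcdr.
have p0 : (0 < p)%N by case: (p) pE => // /esym; lia.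
have q0 : (0 < q)%N by case: (q) qE => // /esym; lia.
have LE : ((p + q) * c + w = L)%N by rewrite mulnDl; lia.
have ku : k u = 0 by rewrite /k; have -> : (L - u = b)%N; first lia; rewrite gu subrr.
have ks : k s = 0 by rewrite /k; have -> : (L - s = v)%N; first lia; rewrite gs subrr.
rewrite -LE; apply: (@periodic_odd_pair_vanish _ _ _ f k [pred j | (j == p) || (j == q)]) => //.
- by rewrite -[2%N]/(1 + 1)%N leq_add.
- by rewrite LE.
- move=> x y x0 y0; rewrite LE => xy; rewrite /k.
  have -> : (L - x = y)%N by lia. have -> : (L - y = x)%N by lia. lia.
- by rewrite LE; exact: f_period.
- by rewrite LE; exact: fk.
- by move=> j /orP[]/eqP->; lia.
- move=> x y x0 y0; rewrite LE => xyL H; apply: rel_full => //.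
  have [H1 H2 H3] := H p ltac:(by rewrite /= eqxx); have [H4 H5 H6] := H q ltac:(by rewrite /= eqxx orbT).
  rewrite !pE in H1 H2 H3; rewrite !qE in H4 H5 H6.
  by move=> t; rewrite !inE => /or3P[]/eqP->; clear -H1 H2 H3 H4 H5 H6 xyL; lia.
- by move=> j /orP[]/eqP->; rewrite ?pE ?qE.
- exists p; split; first lia.
  left=> t tw; rewrite pE /k (g_window (x := (u + t)%N)); last by rewrite /in_window; lia.
  by rewrite /g; lia.
- by rewrite LE.
Qed.

Section Left.

Hypothesis k0 : forall x, (0 < x < L)%N -> k x = 0.
Hypothesis fnz : exists x, (0 < x < L)%N && (f x != 0).
Hypothesis us : u != s.

Let g_even x y : (0 < x)%N -> (0 < y)%N -> (x + y = L)%N -> g y = g x.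
Proof.
move=> x0 y0 xy; have := @k0 x; rewrite /k; have -> : (L - x = y)%N by lia.
by move=> H; have {}H := H ltac:(lia); lia.
Qed.

Let fnz_small : exists x, (0 < x <= c)%N && (f x != 0).
Proof.
have ex : exists x, (0 < x)%N && (f x != 0).
  by case: fnz => x /andP[/andP[x0 _] fx]; exists x; rewrite x0.
case: (ex_minnP ex) => x /andP[x0 fx] xmin; exists x; rewrite x0 fx andbT leqNgt.
apply/negP => cx; have xL : (x < L)%N.
  by case: fnz => y /andP[/andP[y0 yL] fy]; apply: leq_ltn_trans yL; apply: xmin; rewrite y0.
have := @f_period (x - c)%N; have -> : (x - c + c = x)%N by lia.
move=> H; have {}H := H ltac:(lia) ltac:(lia).
by have := xmin (x - c)%N; rewrite -H fx; lia.
Qed.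

(** Now that [g] is even, reversing the word maps the cuts [x], [z] to [L - z], [L - x] and changes
    the sign, which removes the part from [e_w * r] as well. *)
Let coef4_lr l :
  \sum_(1 <= x < L) \sum_(1 <= z < L) G x z *
     (((x < z) && (z < v) && perm_eq [:: b; x; z - x; v - z] l)%N%:R
      + ((x < z) && (u < x) && perm_eq [:: v; x - u; z - x; L - z] l)%N%:R) = 0.
Proof.
pose H := \sum_(1 <= x < L) \sum_(1 <= z < L) G x z *
  ((x < z) && perm_eq [:: w; x; z - x; L - z] l)%N%:R.
have H0 : H = 0.
  suff : H = - H by lia.
  rewrite {1}/H exchange_big /= sum_rev -sumrN !big_nat; apply: eq_bigr => z zL.
  rewrite sum_rev -sumrN !big_nat; apply: eq_bigr => x xL.
  have Gxz : G (L - x)%N (L - z)%N = - G z x.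
    have E1 : f (L - x)%N = - f x by apply: f_odd; lia.
    have E2 : f (L - z)%N = - f z by apply: f_odd; lia.
    have E3 : g (L - x)%N = g x by apply: g_even; lia.
    have E4 : g (L - z)%N = g z by apply: g_even; lia.
    by rewrite /G E1 E2 E3 E4; ring.
  rewrite Gxz mulNr; congr (- (_ * (nat_of_bool _)%:R)).
  have -> : (L - x < L - z)%N = (z < x)%N by lia.
  have [zx|//] := ltnP z x; rewrite /=; apply: permPl; rewrite perm_cons.
  have -> : (L - (L - z) = z)%N by lia. have -> : (L - z - (L - x) = x - z)%N by lia.
  by perm_tac.
rewrite -[RHS](coef4_split l) -[LHS]subr0 -[X in _ - X]H0 /H -sumrB; apply: eq_bigr => x _.
by rewrite -sumrB; apply: eq_bigr => z _; ring.
Qed.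

(** The vanishing result for the left part alone, free of exceptions because [u != s]; it requires
    two periods, that is [c < u]. Evenness of [g] on the part and on the whole word compose to the
    translation by [s]. *)
Lemma g_period_s : (c < u)%N -> forall x, (0 < x)%N -> (x + s < L)%N -> g (x + s)%N = g x.
Proof.
move=> cu; pose p := (u %/ c)%N; have pE : (p * c = u)%N by rewrite divnK // dvdn_gcdl.
have p2 : (2 <= p)%N by case: (p) pE => [|[|]] // /esym; lia.
pose ka x := g (v - x)%N - g x.
have ka0 : forall x, (0 < x < v)%N -> ka x = 0.
  have vE : (p * c + w = v)%N by rewrite pE.
  rewrite -vE; apply: (@periodic_odd_pair_vanish _ _ _ f ka pred0) => //.
  - by rewrite vE.
  - move=> x y x0 y0; rewrite vE => xy; rewrite /ka.
    have -> : (v - x = y)%N by lia. have -> : (v - y = x)%N by lia. lia.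
  - by rewrite vE => x x0 xv; apply: f_period; lia.
  - rewrite vE => x xv fx; have : f (v - x)%N = - f x by apply: f_oddl; lia.
    move: fx; rewrite /ka /f /g.
    by case: (S x); case: (S' x); case: (S (v - x)%N); case: (S' (v - x)%N); lia.
  - move=> x y x0 y0; rewrite vE => xyv _ fxy; set z := (v - (x + y))%N.
    have z0 : (0 < z)%N by rewrite /z; lia.
    have xyz : (x + y + z = v)%N by rewrite /z; lia.
    have H : \sum_(1 <= i < v) \sum_(1 <= j < v) (f i * g j + g i * f j)
         * ((i < j) && perm_eq [:: i; j - i; v - j] [:: x; y; z])%N%:R = 0.
      rewrite -[RHS](coef4_lr [:: b; x; y; z]) -sum_head !big_nat; apply: eq_bigr => i iL.
      rewrite -(sum_head (fun j => (f i * g j + g i * f j) *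
        ((i < j) && perm_eq [:: i; j - i; v - j] [:: x; y; z])%N%:R)) mulr_suml.
      rewrite !big_nat; apply: eq_bigr => j jL.
      rewrite (@perm_notin _ v [:: v; _; _; _]) ?inE ?eqxx //; last by rewrite !negb_or; lia.
      rewrite perm_cons andbF ?natr_false ?addr0 -/(G i j) -!mulrA -!natrM !mulnb; congr (_ * (nat_of_bool _)%:R).
      have [ij|//] := ltnP i j; have [jv|] := ltnP j v; last by rewrite /= andbF.
      by have -> : (i < v)%N; first lia; rewrite /= !andbT.
    have := odd_triple f_oddl x0 y0 z0 xyz H; rewrite /= -!/(ka _).
    have fka t : (0 < t < v)%N -> f t * ka t = 0.
      move=> tv; have : f (v - t)%N = - f t by apply: f_oddl; lia.
      rewrite /ka /f /g.
      by case: (S t); case: (S' t); case: (S (v - t)%N); case: (S' (v - t)%N); lia.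
    rewrite !fka; [|lia|lia|lia].
    have -> : f z = - f (x + y)%N by apply: f_oddl; lia.
    have -> : ka z = - ka (x + y)%N.
      by rewrite /ka; have -> : (v - z = x + y)%N; first lia; have -> : (v - (x + y) = z)%N; first done; lia.
    by rewrite !addr0 => /eqP; rewrite mulf_eq0 => /orP[]/eqP; lia.
  - exists 0%N; split; first lia.
    right=> t tw; rewrite mul0n add0n /ka (g_window (x := (v - t)%N)); last by rewrite /in_window; lia.
    by rewrite /g; lia.
  - by rewrite vE; case: fnz_small => x /andP[xc fx]; exists x; rewrite fx andbT; lia.
move=> x x0 xL; have := @ka0 x; rewrite /ka => H; have {}H := H ltac:(lia).
have := @g_even (v - x)%N (x + s)%N; move=> H2; have {}H2 := H2 ltac:(lia) ltac:(lia) ltac:(lia).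
lia.
Qed.

Lemma g_period_u : (c < s)%N -> forall x, (0 < x)%N -> (x + u < L)%N -> g (x + u)%N = g x.
Proof.
move=> cs; pose q := (s %/ c)%N; have qE : (q * c = s)%N by rewrite divnK // dvdn_gcdr.
have q2 : (2 <= q)%N by case: (q) qE => [|[|]] // /esym; lia.
pose f' x := f (u + x)%N; pose g' x := g (u + x)%N.
pose kb x := g' (b - x)%N - g' x.
have f'E x : (0 < x < b)%N -> f' x = f x.
  move=> xb; rewrite /f' (f_oddr (x := (b - x)%N)); [|lia|lia|lia].
  by rewrite (f_odd (x := x)) ?opprK //; lia.
have kb0 : forall x, (0 < x < b)%N -> kb x = 0.
  have bE : (q * c + w = b)%N by rewrite qE.
  rewrite -bE; apply: (@periodic_odd_pair_vanish _ _ _ f' kb pred0) => //.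
  - by rewrite bE.
  - move=> x y x0 y0; rewrite bE => xy; rewrite /kb.
    have -> : (b - x = y)%N by lia. have -> : (b - y = x)%N by lia. lia.
  - by rewrite bE => x x0 xb; rewrite /f' addnA; apply: f_period; lia.
  - by move=> x xw; rewrite /f' f_window // /in_window; lia.
  - rewrite bE => x xv fx; have : f' (b - x)%N = - f' x by apply: f_oddr; lia.
    move: fx; rewrite /kb /f' /f /g' /g.
    by case: (S _); case: (S' _); case: (S (u + (b - x))%N); case: (S' (u + (b - x))%N); lia.
  - move=> x y x0 y0; rewrite bE => xyv _ fxy; set z := (b - (x + y))%N.
    have z0 : (0 < z)%N by rewrite /z; lia.
    have xyz : (x + y + z = b)%N by rewrite /z; lia.
    have H : \sum_(1 <= i < b) \sum_(1 <= j < b) (f' i * g' j + g' i * f' j)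
         * ((i < j) && perm_eq [:: i; j - i; b - j] [:: x; y; z])%N%:R = 0.
      rewrite -[RHS](coef4_lr [:: v; x; y; z]).
      transitivity (\sum_(1 <= i < L) (\sum_(1 <= j < L) G i j *
        ((i < j) && perm_eq [:: i - u; j - i; L - j] [:: x; y; z])%N%:R * (u < j)%N%:R) * (u < i)%N%:R).
        rewrite sum_tail !big_nat; apply: eq_bigr => i iL.
        rewrite sum_tail !big_nat; apply: eq_bigr => j jL.
        have -> : (u + i < u + j)%N = (i < j)%N by lia.
        have -> : [:: u + i - u; u + j - (u + i); L - (u + j)]%N = [:: i; j - i; b - j]%N.
          by congr [:: _; _; _]; lia.
        by [].
      rewrite !big_nat; apply: eq_bigr => i iL; rewrite mulr_suml !big_nat; apply: eq_bigr => j jL.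
      rewrite (@perm_notin _ b [:: b; _; _; _]) ?inE ?eqxx //; last by rewrite !negb_or; lia.
      rewrite perm_cons andbF ?natr_false ?add0r -!mulrA -!natrM !mulnb; congr (_ * (nat_of_bool _)%:R).
      have [ij|//] := ltnP i j; have [ui|] := ltnP u i; last by rewrite /= !andbF.
      by have -> : (u < j)%N; first lia; rewrite /= !andbT.
    have := odd_triple (n := b) (f := f') (g := g') f_oddr x0 y0 z0 xyz H; rewrite /= -!/(kb _).
    have fkb t : (0 < t < b)%N -> f' t * kb t = 0.
      move=> tv; have : f' (b - t)%N = - f' t by apply: f_oddr; lia.
      rewrite /kb /f' /f /g' /g.
      by case: (S _); case: (S' _); case: (S (u + (b - t))%N); case: (S' (u + (b - t))%N); lia.
    rewrite !fkb; [|lia|lia|lia].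
    have -> : f' z = - f' (x + y)%N by apply: f_oddr; lia.
    have -> : kb z = - kb (x + y)%N.
      by rewrite /kb; have -> : (b - z = x + y)%N; first lia; have -> : (b - (x + y) = z)%N; first done; lia.
    by rewrite !addr0 => /eqP; rewrite mulf_eq0 => /orP[]/eqP; lia.
  - exists 0%N; split; first lia.
    left=> t tw; rewrite mul0n add0n /kb /g' (g_window (x := (u + t)%N)); last by rewrite /in_window; lia.
    by rewrite /g; lia.
  - rewrite bE; case: fnz_small => x /andP[xc fx]; exists x.
    by rewrite f'E ?fx ?andbT; lia.
move=> x x0 xL; have := @kb0 x; rewrite /kb /g' => H; have {}H := H ltac:(lia).
have := @g_even x (u + (b - x))%N; move=> H2; have {}H2 := H2 ltac:(lia) ltac:(lia) ltac:(lia).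
rewrite (addnC x u); lia.
Qed.

(** If one part is a single period, its length is already [c], and the other part, longer since
    [u != s], yields this period alone. *)
Lemma g_period x : (0 < x)%N -> (x + c < L)%N -> g (x + c)%N = g x.
Proof.
have cu : (c <= u)%N by apply: dvdn_leq => //; exact: dvdn_gcdl.
have cs : (c <= s)%N by apply: dvdn_leq => //; exact: dvdn_gcdr.
have [cuE|cun] := eqVneq c u.
  by rewrite cuE; apply: g_period_u; rewrite ltn_neqAle cs cuE us.
have [csE|csn] := eqVneq c s.
  by rewrite csE; apply: g_period_s; rewrite ltn_neqAle cu cun.
apply: gcd_period => //; first lia.
- by apply: g_period_u; rewrite ltn_neqAle cs csn.
- by apply: g_period_s; rewrite ltn_neqAle cu cun.
Qed.

End Left.

End OddPair.

Definition closed_window x := (u <= x <= v)%N.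

Definition ind (S : nat -> bool) x : int := (S x)%:Z.

(** Polarization of the difference of two squares; it brings in the sum and the difference of the
    two words. *)
Lemma coef4_double (S S' : nat -> bool) l :
  coef4 (fun x z => (ind S x - ind S' x) * (ind S z + ind S' z)
                  + (ind S x + ind S' x) * (ind S z - ind S' z)) l
  = 2%:R * coef4 (fun x z => ind S x * ind S z - ind S' x * ind S' z) l.
Proof.
rewrite /coef4 mulr_sumr; apply: eq_bigr => x _; rewrite mulr_sumr; apply: eq_bigr => z _.
rewrite mulrA; congr (_ * _); ring.
Qed.

Lemma ind_swap (T T' : nat -> bool) x y :
  ind T y - ind T' y = - (ind T x - ind T' x) -> ind T y + ind T' y - (ind T x + ind T' x) = 0 ->
  T' y = T x.
Proof. by rewrite /ind; case: (T x); case: (T' x); case: (T y); case: (T' y). Qed.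

Lemma ind_same (T T' : nat -> bool) x y :
  ind T y - ind T' y = ind T x - ind T' x -> ind T y + ind T' y = ind T x + ind T' x ->
  T y = T x.
Proof. by rewrite /ind; case: (T x); case: (T' x); case: (T y); case: (T' y). Qed.

Section Marks.

Variables (S S' : nat -> bool).
Hypothesis S_window : forall x, closed_window x -> S x = false.
Hypothesis S'_window : forall x, closed_window x -> S' x = false.
Hypothesis coef3_0 : forall l, coef3 (fun x => ind S x - ind S' x) l = 0.
Hypothesis coef4_0 : forall l, coef4 (fun x z => ind S x * ind S z - ind S' x * ind S' z) l = 0.

Let window_closed x : in_window x -> closed_window x.
Proof. by rewrite /in_window /closed_window; lia. Qed.

Section Toggle.

(** Altering the marks at the two ends of the window preserves all relations, because cuts there
    contribute nothing. *)
Variables (T T' : nat -> bool).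
Hypothesis TE : forall x, (0 < x < L)%N -> ~~ end_point x -> T x = S x.
Hypothesis T'E : forall x, (0 < x < L)%N -> ~~ end_point x -> T' x = S' x.

Let window_notend x : in_window x -> ~~ end_point x.
Proof. by rewrite /in_window /end_point; lia. Qed.

Lemma toggle_window x : in_window x -> T x = false.
Proof.
by move=> xw; rewrite TE ?S_window ?window_closed ?window_notend //; move: xw; rewrite /in_window; lia.
Qed.

Lemma toggle_window' x : in_window x -> T' x = false.
Proof.
by move=> xw; rewrite T'E ?S'_window ?window_closed ?window_notend //; move: xw; rewrite /in_window; lia.
Qed.

Lemma toggle_coef3 l : coef3 (fun x => ind T x - ind T' x) l = 0.
Proof. by rewrite -[RHS](coef3_0 l); apply: coef3_ext => x xL ex; rewrite /ind TE ?T'E. Qed.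

Lemma toggle_coef4 l :
  coef4 (fun x z => (ind T x - ind T' x) * (ind T z + ind T' z)
                  + (ind T x + ind T' x) * (ind T z - ind T' z)) l = 0.
Proof.
rewrite coef4_double; apply/eqP; rewrite mulf_eq0; apply/orP; right; apply/eqP.
rewrite -[RHS](coef4_0 l); apply: coef4_ext.
- move=> x z xL zL /orP[] h; rewrite /ind ?(toggle_window h) ?(toggle_window' h).
    by rewrite (S_window (window_closed h)) (S'_window (window_closed h)) !mul0r subrr.
  by rewrite (S_window (window_closed h)) (S'_window (window_closed h)) !mulr0 subrr.
- by move=> x z xL zL ex ez; rewrite /ind !TE ?T'E.
Qed.

End Toggle.

Lemma marks_cmp : (forall x, (0 < x < L)%N -> S x = S' x) \/
  exists x, [&& (0 < x < L)%N, S x != S' x & ~~ end_point x].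
Proof.
have [/existsP[[x xL] /= /andP[x0 Sx]]|/existsPn none] :=
    boolP [exists x : 'I_L, (0 < x)%N && (S x != S' x)].
  right; exists x; rewrite x0 xL Sx /=; apply: contra Sx => ex.
  by rewrite S_window ?S'_window // /closed_window; move: ex; rewrite /end_point; lia.
left=> x /andP[x0 xL]; have := none (Ordinal xL); rewrite /= x0 /= negbK.
by move/eqP.
Qed.

Lemma unequal_sides : u != s ->
  (forall x, (0 < x < L)%N -> S x = S' x) \/
  exists T : nat -> bool,
   [/\ forall x, (0 < x < L)%N -> ~~ end_point x -> T x = S x,
       forall x y, (0 < x)%N -> (0 < y)%N -> (x + y = L)%N -> ~~ end_point y -> S' y = T x,
       forall x, in_window x -> T x = false,
       forall x, (0 < x)%N -> (x + gcdn u s < L)%N -> T (x + gcdn u s)%N = T x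
     & exists x, [&& (0 < x < L)%N & T x != T (L - x)%N]].
Proof.
move=> us; have [SS|[x0 /and3P[x0L Sx0 ex0]]] := marks_cmp; first by left.
right; have vu : (v == u) = false by lia.
(* The free marks at [u] and [v] are copied from the other word at the mirror positions [b = L - u]
   and [s = L - v]. This makes the difference odd and the sum even there, as [odd_full] and
   [k_vanish] demand. *)
pose T x := if x == u then S' b else if x == v then S' s else S x.
pose T' x := if x == u then S b else if x == v then S s else S' x.
have TE x : (0 < x < L)%N -> ~~ end_point x -> T x = S x.
  by rewrite /end_point negb_or /T => _ /andP[/negbTE-> /negbTE->].
have T'E x : (0 < x < L)%N -> ~~ end_point x -> T' x = S' x.
  by rewrite /end_point negb_or /T' => _ /andP[/negbTE-> /negbTE->].
have Tw := toggle_window TE; have T'w := toggle_window' T'E.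
have C3 := toggle_coef3 TE T'E; have C4 := toggle_coef4 TE T'E.
have Su : S u = false by apply: S_window; rewrite /closed_window; lia.
have S'u : S' u = false by apply: S'_window; rewrite /closed_window; lia.
have Sv : S v = false by apply: S_window; rewrite /closed_window; lia.
have S'v : S' v = false by apply: S'_window; rewrite /closed_window; lia.
have Tu : T u = T' b /\ T' u = T b.
  rewrite /T /T' eqxx; have -> : (b == v) = false by rewrite eqn_add2r eq_sym (negbTE us).
  by have [->|//] := eqVneq b u; rewrite Su S'u.
have Tv : T v = T' s /\ T' v = T s.
  rewrite /T /T' vu eqxx; have -> : (s == u) = false by rewrite eq_sym (negbTE us).
  by have [->|//] := eqVneq s v; rewrite Sv S'v.
clearbody T T'; clear Su S'u Sv S'v vu.
have odd := @odd_full T T' C3.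
have {}odd : forall x y, (0 < x)%N -> (0 < y)%N -> (x + y = L)%N ->
    ind T y - ind T' y = - (ind T x - ind T' x).
  by apply: odd; rewrite ?Tu.1 ?Tu.2 ?Tv.1 ?Tv.2; ring.
have oddl := odd_left C3 odd us; have oddr := odd_right C3 odd us.
have fnz : exists x, (0 < x < L)%N && (ind T x - ind T' x != 0).
  exists x0; rewrite x0L /ind TE ?T'E //; move: Sx0; case: (S x0); case: (S' x0) => //.
have kv := k_vanish Tw T'w odd C4 oddl oddr.
have {}kv : forall x, (0 < x < L)%N ->
    (ind T (L - x) + ind T' (L - x)) - (ind T x + ind T' x) = 0.
  by apply: kv => //; rewrite ?Tu.1 ?Tu.2 ?Tv.1 ?Tv.2; ring.
have fp := f_period odd oddl oddr.
have gp := g_period Tw T'w odd C4 oddl oddr kv fnz us.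
have TT' x y : (0 < x)%N -> (0 < y)%N -> (x + y = L)%N -> T' y = T x.
  move=> xgt0 ygt0 xy; apply: ind_swap; first exact: odd.
  have xL : (0 < x < L)%N by clear -xgt0 ygt0 xy; lia.
  have yE : (L - x = y)%N by clear -xy; lia.
  by have := kv x xL; rewrite yE.
exists T; split => //.
- move=> x y xgt0 ygt0 xy ey; rewrite -T'E ?(TT' x) //.
  by clear -xgt0 ygt0 xy; lia.
- by move=> x xgt0 xL; apply: (ind_same (fp x xgt0 xL) (gp x xgt0 xL)).
- exists x0; rewrite x0L /= -(TT' (L - x0)%N x0) ?T'E ?TE //.
  + by clear -x0L; lia.
  + by clear -x0L; lia.
  + by clear -x0L; lia.
Qed.

Section EqualSides.

Hypothesis us : u = s.

Let odd0 x y : (0 < x)%N -> (0 < y)%N -> (x + y = L)%N ->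
  ind S y - ind S' y = - (ind S x - ind S' x).
Proof.
move=> x0 y0 xy; apply: (@odd_full S S' coef3_0) => //.
- by rewrite !S_window ?S'_window // /closed_window; lia.
- by rewrite !S_window ?S'_window // /closed_window; lia.
Qed.

Lemma equal_sides_odd :
  (forall x, (0 < x < v)%N -> x != w -> x != u ->
     ind S x - ind S' x + (ind S (v - x) - ind S' (v - x)) = 0) ->
  (forall x, (0 < x < L)%N -> S x = S' x) \/
  (forall x y, (0 < x)%N -> (0 < y)%N -> (x + y = L)%N -> S' y = S x).
Proof.
move=> oddv; have [SS|[x0 /and3P[x0L Sx0 ex0]]] := marks_cmp; first by left.
(* Reflection in the left part exchanges [u] and [w], so the difference at [u] has to be opposite to
   that at [w]; likewise [v] and [L - w]. Positive and negative parts of the difference keep the new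
   marks boolean and give equal sums at [u] and [v]. *)
right; pose T x := if x == u then S' w && ~~ S w
  else if x == v then S' (L - w)%N && ~~ S (L - w)%N else S x.
pose T' x := if x == u then S w && ~~ S' w
  else if x == v then S (L - w)%N && ~~ S' (L - w)%N else S' x.
have TE x : (0 < x < L)%N -> ~~ end_point x -> T x = S x.
  by rewrite /end_point negb_or /T => _ /andP[/negbTE-> /negbTE->].
have T'E x : (0 < x < L)%N -> ~~ end_point x -> T' x = S' x.
  by rewrite /end_point negb_or /T' => _ /andP[/negbTE-> /negbTE->].
have Tw := toggle_window TE; have T'w := toggle_window' T'E.
have C3 := toggle_coef3 TE T'E; have C4 := toggle_coef4 TE T'E.
have vu : (v == u) = false by lia.
have oddw := @odd0 w (L - w)%N; have {}oddw := oddw ltac:(lia) ltac:(lia) ltac:(lia).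
have Tu : ind T u - ind T' u = - (ind S w - ind S' w).
  by rewrite /ind /T /T' eqxx; case: (S w); case: (S' w).
have Tv : ind T v - ind T' v = ind S w - ind S' w.
  rewrite /ind /T /T' vu eqxx; move: oddw; rewrite /ind.
  by case: (S w); case: (S' w); case: (S (L - w)%N); case: (S' (L - w)%N); lia.
have gT : ind T u + ind T' u = ind T v + ind T' v.
  rewrite /ind /T /T' vu !eqxx; move: oddw; rewrite /ind.
  by case: (S w); case: (S' w); case: (S (L - w)%N); case: (S' (L - w)%N); lia.
have bv : b = v by lia.
have odd : forall x y, (0 < x)%N -> (0 < y)%N -> (x + y = L)%N ->
    ind T y - ind T' y = - (ind T x - ind T' x).
  by apply: (@odd_full T T' C3); rewrite ?bv -?us ?Tu ?Tv; lia.
have oddl : forall x y, (0 < x)%N -> (0 < y)%N -> (x + y = v)%N ->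
    ind T y - ind T' y = - (ind T x - ind T' x).
  move=> x y xgt0 y0 xy.
  have main z z' : (0 < z)%N -> (0 < z')%N -> (z + z' = v)%N -> z = u ->
      ind T z' - ind T' z' = - (ind T z - ind T' z).
    move=> z0 z'0 zz' zu; have z'w : z' = w by lia.
    rewrite zu Tu z'w opprK; have [wu|wu] := eqVneq w u.
      by rewrite wu Tu -?wu; move: Tu; rewrite /ind !S_window ?S'_window // /closed_window; lia.
    by rewrite /ind TE ?T'E // /end_point; lia.
  have [xu|xu] := eqVneq x u; first exact: main.
  have [yu|yu] := eqVneq y u.
    have := main y x y0 xgt0; rewrite addnC => H; rewrite (H xy yu) opprK //.
  have := oddv x; have -> : (v - x = y)%N by lia.
  move=> H; have {}H := H ltac:(lia) ltac:(lia) ltac:(lia).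
  by rewrite /ind !TE ?T'E; move: H; rewrite /ind /end_point; lia.
have oddr : forall x y, (0 < x)%N -> (0 < y)%N -> (x + y = b)%N ->
    ind T (u + y) - ind T' (u + y) = - (ind T (u + x) - ind T' (u + x)).
  move=> x y xgt0 y0 xy; have E1 := odd x (u + y)%N; have E2 := odd y (u + x)%N.
  have {}E1 := E1 ltac:(lia) ltac:(lia) ltac:(lia); have {}E2 := E2 ltac:(lia) ltac:(lia) ltac:(lia).
  have := oddl x y xgt0 y0; lia.
have fnz : exists x, (0 < x < L)%N && (ind T x - ind T' x != 0).
  exists x0; rewrite x0L /ind TE ?T'E //; move: Sx0; case: (S x0); case: (S' x0) => //.
have kv := k_vanish Tw T'w odd C4 oddl oddr.
have {}kv : forall x, (0 < x < L)%N ->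
    (ind T (L - x) + ind T' (L - x)) - (ind T x + ind T' x) = 0.
  by apply: kv => //; rewrite -?us; exact/esym/gT.
move=> x y xgt0 ygt0 xy; have [ex|ex] := boolP (end_point x).
  rewrite S_window ?S'_window //; move: ex; rewrite /closed_window /end_point; clear -xy us; lia.
have ey : ~~ end_point y by move: ex; rewrite /end_point; clear -xy us; lia.
have xL : (0 < x < L)%N by clear -xgt0 ygt0 xy; lia.
have yL : (0 < y < L)%N by clear -xgt0 ygt0 xy; lia.
have yE : (L - x = y)%N by clear -xy; lia.
rewrite -TE // -T'E //; apply: ind_swap; first exact: odd.
by have := kv x xL; rewrite yE.
Qed.

Let near x i := perm_eq [:: i; v - i]%N [:: x; v - x]%N.

Let perm_pairs i j x z : (0 < i < v)%N -> (0 < j < v)%N -> (0 < x < v)%N -> (0 < z < v)%N ->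
  perm_eq [:: i; v - i; j; v - j]%N [:: x; v - x; z; v - z]%N =
  (near x i && near z j) || (near z i && near x j).
Proof.
move=> iv jv xv zv; apply/idP/idP => [H|].
  have : i \in [:: x; v - x; z; v - z]%N by rewrite -(perm_mem H) inE eqxx.
  rewrite !inE => H'; have {H'} /orP[ix|iz] : near x i || near z i.
  - rewrite /near !perm_eq2; lia.
  - apply/orP; left; rewrite ix /=; move: H.
    by rewrite -[X in perm_eq X _]/([:: i; v - i]%N ++ _) (permPl (perm_cat ix (perm_refl _))) /= !perm_cons.
  - apply/orP; right; rewrite iz /=; move: H.
    rewrite -[X in perm_eq X _]/([:: i; v - i]%N ++ _) (permPl (perm_cat iz (perm_refl _))) /=.
    have P : perm_eq [:: x; v - x; z; v - z]%N [:: z; v - z; x; v - x]%N by perm_tac.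
    by rewrite (permPr P) /= !perm_cons.
case/orP => /andP[H1 H2]; first exact: (perm_cat H1 H2).
have := perm_cat H1 H2; rewrite /= => H3; apply: (perm_trans H3).
by perm_tac.
Qed.

(** Cuts at [x] and at [v - x] produce the same monomial, so only their joint contribution is
    visible. *)
Let A (R : nat -> bool) x := \sum_(1 <= i < v) ind R i * (near x i)%:R.
Let right_part (R : nat -> bool) i := R (u + i)%N.

Let near_rev x i : (0 < i < v)%N -> near x (v - i)%N = near x i.
Proof. by move=> iv; rewrite /near !perm_eq2; lia. Qed.

(** At [e_x * e_(v-x) * e_z * e_(v-z)], with all four indices different from [w] and [v], only one
    cut in each part contributes; as both parts have length [v], the two assignments are added. *)
Let cross x z : (0 < x < v)%N -> (0 < z < v)%N -> x != w -> x != u -> z != w -> z != u ->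
  A S x * A (right_part S) z + A S z * A (right_part S) x
  = A S' x * A (right_part S') z + A S' z * A (right_part S') x.
Proof.
move=> xv zv xw xu zw zu; pose l := [:: x; v - x; z; v - z]%N.
pose H i j : int := ind S i * ind S j - ind S' i * ind S' j.
pose N i j : int := ((near x i && near z j) || (near z i && near x j))%:R.
have E0 : \sum_(1 <= i < v) \sum_(1 <= j < v) H i (u + j)%N * N i j = 0.
  rewrite -[RHS](coef4_0 l) /coef4.
  rewrite -(sum_head (fun i => \sum_(1 <= j < v) H i (u + j)%N * N i j)) !big_nat.
  apply: eq_bigr => i iL.
  have vb : v = b by lia.
  transitivity (\sum_(1 <= j < L) H i j * N i (j - u)%N * (u < j)%N%:R * (i < v)%N%:R).
    rewrite -mulr_suml sum_tail -vb; congr (_ * _); apply: eq_bigr => j _; by rewrite addKn.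
  rewrite !big_nat; apply: eq_bigr => j jL; rewrite /cut2.
  rewrite (@perm_notin _ b [:: b; _; _; _] l) ?inE ?eqxx //; last by rewrite /l ?inE ?negb_or; lia.
  rewrite (@perm_notin _ v [:: v; _; _; _] l) ?inE ?eqxx //; last by rewrite /l ?inE ?negb_or; lia.
  rewrite (@perm_notin _ w [:: w; _; _; _] l) ?inE ?eqxx //; last by rewrite /l ?inE ?negb_or; lia.
  rewrite !andbF ?natr_false ?add0r ?addr0 ?subr0 -!mulrA -/(H i j).
  have [uj|] := ltnP u j; last by rewrite /= !andbF !mulr0 ?mul0r ?mulr0.
  have [iv|] := ltnP i v; last by rewrite /= !andbF !mulr0.
  rewrite !mulr1 !andbT.
  have [ij|ji] := ltnP i j; last first.
    by rewrite /H /ind !S_window ?S'_window ?mul0r // /closed_window; lia.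
  have -> : (L - j = v - (j - u))%N by lia.
  by rewrite perm_pairs //; lia.
have AA (R R' : nat -> bool) y y' : \sum_(1 <= i < v) \sum_(1 <= j < v)
    (ind R i * ind (right_part R') j) * ((near y i)%:R * (near y' j)%:R) = A R y * A (right_part R') y'.
  rewrite /A mulr_suml; apply: eq_bigr => i _; rewrite mulr_sumr; apply: eq_bigr => j _; ring.
have [nxz|nxz] := boolP (near x z).
  have nE i : near z i = near x i.
    by move: nxz; rewrite /near !perm_eq2; lia.
  have AE R : A R z = A R x by apply: eq_bigr => i _; rewrite nE.
  rewrite !AE; suff -> : A S x * A (right_part S) x = A S' x * A (right_part S') x by [].
  apply/eqP; rewrite -subr_eq0; apply/eqP; rewrite -[RHS]E0 -!AA -sumrB; apply: eq_bigr => i _.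
  rewrite -sumrB; apply: eq_bigr => j _.
  rewrite /N !nE orbb -!natrM mulnb -mulrBl; congr (_ * _).
apply/eqP; rewrite -subr_eq0; apply/eqP; rewrite -[RHS]E0 -!AA -!big_split -sumrB; apply: eq_bigr => i _.
rewrite -!big_split -sumrB; apply: eq_bigr => j _ /=.
have -> : N i j = (near x i)%:R * (near z j)%:R + (near z i)%:R * (near x j)%:R.
  rewrite /N -!natrM !mulnb -natrD; congr (_%:R).
  have : ~~ (near x i && near z i) by move: nxz; rewrite /near !perm_eq2; lia.
  by case: (near x i); case: (near z i); case: (near x j); case: (near z j).
rewrite /H /right_part; rewrite /ind; ring.
Qed.

Let sumA x : (0 < x < v)%N -> A S x + A (right_part S) x = A S' x + A (right_part S') x.
Proof.
move=> xv; have E (R : nat -> bool) : A (right_part R) x = \sum_(1 <= i < v) ind R (L - i) * (near x i)%:R.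
  rewrite /A sum_rev !big_nat; apply: eq_bigr => i iv; rewrite near_rev //.
  by congr (ind R _ * _); lia.
rewrite !E /A -!big_split !big_nat; apply: eq_bigr => i iv /=; rewrite -!mulrDl; congr (_ * _).
by have := @odd0 i (L - i)%N; move=> H; have {}H := H ltac:(lia) ltac:(lia) ltac:(lia); lia.
Qed.

(** At each [x] the left and right sums of the two words have equal sum and equal product, so they
    agree either directly or after exchanging the parts; the mixed products at [x] and [z] force the
    same choice everywhere. *)
Lemma equal_sides_split :
  (forall x, (0 < x < v)%N -> x != w -> x != u ->
     ind S x - ind S' x + (ind S (v - x) - ind S' (v - x)) = 0) \/
  (forall x, (0 < x < v)%N -> x != w -> x != u ->
     ind S x - ind S' (L - x) + (ind S (v - x) - ind S' (L - (v - x))) = 0).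
Proof.
have [/existsP[[x xv] /= /and4P[x0 xw xu Ax]]|/existsPn none] := boolP
   [exists x : 'I_v, [&& (0 < x)%N, (x != w :> nat), (x != u :> nat) & A S x != A S' x]]; last first.
  left=> x /andP[x0 xv] xw xu.
  apply: (@pair_coef0 v (fun i => ind S i - ind S' i) x (v - x)%N) => //; try lia.
  have := none (Ordinal xv); rewrite /= x0 xw xu negbK => /eqP E.
  move/eqP: E; rewrite -subr_eq0 /A -sumrB => /eqP E; rewrite -[RHS]E.
  by apply: eq_bigr => i _; rewrite mulrBl.
right=> z /andP[z0 zv] zw zu.
have x0v : (0 < x < v)%N by rewrite x0. have z0v : (0 < z < v)%N by rewrite z0.
(* At [x] the left sums differ, so the parts are exchanged there; the quadratic relation between [x]
   and [z] carries this over to [z]. *)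
have AB : A S z = A (right_part S') z.
  have := cross x0v z0v xw xu zw zu; have := cross x0v x0v xw xu xw xu.
  have := cross z0v z0v zw zu zw zu; have := sumA x0v; have := sumA z0v.
  move: Ax; move: (A S x) (A (right_part S) x) (A S' x) (A (right_part S') x).
  move: (A S z) (A (right_part S) z) (A S' z) (A (right_part S') z).
  move=> az bz az' bz' ax bx ax' bx' axn sz sx pz px pxz.
  have ebx : bx' = ax + bx - ax' by lia. have ebz : bz' = az + bz - az' by lia.
  subst bx' bz'.
  have /eqP : (ax - ax') * (ax' - bx) = 0 by move: px; rewrite -!mulr2n => /eqP; nia.
  rewrite mulf_eq0 subr_eq0 (negbTE axn) /= => /eqP h.
  have eax' : ax' = bx by lia.
  subst ax'.
  have /eqP : (az - az') * (az' - bz) = 0 by nia.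
  rewrite mulf_eq0 => /orP[]/eqP h'; last lia.
  have eaz : az' = az by lia.
  subst az'.
  have /eqP : (ax - bx) * (bz - az) = 0 by nia.
  by rewrite mulf_eq0 subr_eq0 (negbTE axn) /= => /eqP; lia.
apply: (@pair_coef0 v (fun i => ind S i - ind S' (L - i)) z (v - z)%N) => //; try lia.
move/eqP: AB; rewrite -subr_eq0 /A => /eqP AB; rewrite -[RHS]AB.
rewrite [X in _ - X]sum_rev -sumrB !big_nat; apply: eq_bigr => i iv; rewrite near_rev // -mulrBl.
by congr ((_ - ind S' _) * _); lia.
Qed.

End EqualSides.

End Marks.

End FatAnalysis.

(** * Ribbon polynomials and their low degree parts *)

Section RibbonPolynomial.

Variable R : comNzRingType.
Implicit Types (y : nat -> R) (a : nat) (bs : seq bool).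

(* [a] is the length of the segment read so far; at a mark one either cuts or, with a sign,
   goes on. *)
Fixpoint tacc y a bs : R :=
  if bs is b :: bs' then
    if b then y a * tacc y 1 bs' - tacc y a.+1 bs' else tacc y a.+1 bs'
  else y a.

Definition rpoly y bs := tacc y 1 bs.

(** [A] and [B] are the marks outside the closed window. It has [w + 1] positions, of which each
    part contains [w] as steps; hence the two lengths of padding. *)
Definition fatpoly y w (A B : seq bool) :=
  rpoly y (A ++ nseq w false) * rpoly y (nseq w false ++ B)
  - y w * rpoly y (A ++ nseq w.+1 false ++ B).

Lemma tacc_ext y y' a bs : (0 < a)%N ->
  (forall k, (0 < k <= a + size bs)%N -> y k = y' k) -> tacc y a bs = tacc y' a bs.
Proof.
elim: bs a => [|b bs IH] a a0 H /=; first by apply: H; rewrite a0 addn0 leqnn.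
have E1 : tacc y a.+1 bs = tacc y' a.+1 bs by apply: IH => // k kk; apply: H; rewrite /=; lia.
have E2 : tacc y 1 bs = tacc y' 1 bs by apply: IH => // k kk; apply: H; rewrite /=; lia.
by rewrite E1 E2 H //; rewrite /=; lia.
Qed.

Lemma tacc_false y a k bs : tacc y a (nseq k false ++ bs) = tacc y (a + k) bs.
Proof. by elim: k a => [|k IH] a; rewrite ?addn0 //= IH addSnnS. Qed.

(** The product rule for ribbon Schur functions: a product is the sum over the two ways of joining
    the ribbons. *)
Lemma tacc_split y a bs1 bs2 :
  tacc y a (bs1 ++ true :: bs2) + tacc y a (bs1 ++ false :: bs2) = tacc y a bs1 * rpoly y bs2.
Proof.
elim: bs1 a => [|b bs1 IH] a /=; first by rewrite /rpoly subrK.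
case: b; last exact: IH.
by rewrite mulrBl -mulrA -!IH; ring.
Qed.

(** The terms of [tacc] with exactly one cut, and below with exactly two, without their signs. *)
Fixpoint cuts1 y a bs : R :=
  if bs is b :: bs' then
    (if b then y a * y (size bs').+1 else 0) + cuts1 y a.+1 bs'
  else 0.

Fixpoint cuts2 y a bs : R :=
  if bs is b :: bs' then
    (if b then y a * cuts1 y 1 bs' else 0) + cuts2 y a.+1 bs'
  else 0.

Lemma cuts1_sum y (S : nat -> bool) a p l :
  cuts1 y a [seq S x | x <- iota p l] =
  \sum_(p <= x < p + l) (S x)%:R * (y (a + x - p)%N * y (p + l - x)%N).
Proof.
elim: l a p => [|l IH] a p /=; first by rewrite addn0 big_geq.
rewrite IH size_map size_iota big_ltn; last lia.
congr (_ + _).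
  by case: (S p); rewrite ?mul1r ?mul0r //; congr (y _ * y _); lia.
rewrite addSnnS !big_nat; apply: eq_bigr => x xx.
by congr (_ * (y _ * y _)); lia.
Qed.

Lemma cuts2_sum y (S : nat -> bool) a p l :
  cuts2 y a [seq S x | x <- iota p l] =
  \sum_(p <= x < p + l) \sum_(x.+1 <= z < p + l)
     ((S x)%:R * (S z)%:R) * (y (a + x - p)%N * y (z - x)%N * y (p + l - z)%N).
Proof.
elim: l a p => [|l IH] a p /=; first by rewrite addn0 big_geq.
rewrite IH [RHS]big_ltn; last lia.
congr (_ + _).
  have -> : (a + p - p = a)%N by lia.
  case: (S p); last by rewrite big1 // => z _; rewrite !mul0r.
  rewrite cuts1_sum mulr_sumr addSnnS !big_nat; apply: eq_bigr => z zz.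
  have -> : (1 + z - p.+1 = z - p)%N by lia.
  by rewrite mul1r; ring.
rewrite addSnnS !big_nat; apply: eq_bigr => x xx; apply: eq_bigr => z zz.
by congr (_ * (y _ * _ * _)); lia.
Qed.

End RibbonPolynomial.

Lemma tacc_morph (R R' : comNzRingType) (phi : {rmorphism R -> R'}) y a bs :
  phi (tacc y a bs) = tacc (phi \o y) a bs.
Proof.
elim: bs a => [|b bs IH] a //=; case: b => //.
by rewrite rmorphB rmorphM !IH.
Qed.

Lemma fatpoly_morph (R R' : comNzRingType) (phi : {rmorphism R -> R'}) y w A B :
  phi (fatpoly y w A B) = fatpoly (phi \o y) w A B.
Proof. by rewrite /fatpoly rmorphB !rmorphM /rpoly !tacc_morph. Qed.

Lemma fatpoly_ext (R : comNzRingType) (y y' : nat -> R) w A B : (0 < w)%N ->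
  (forall k, (0 < k <= size A + w + size B + 2)%N -> y k = y' k) ->
  fatpoly y w A B = fatpoly y' w A B.
Proof.
move=> w0 H; rewrite /fatpoly /rpoly (H w); last lia.
congr (_ * _ - _ * _); apply: tacc_ext => // k kk; apply: H; move: kk;
  rewrite !(size_cat, size_nseq, size_map, size_iota) ?size_cat ?size_nseq; lia.
Qed.

Section LowDegree.

Variable R : comNzRingType.
Variable y : nat -> R.
Let y' k : {poly R} := (y k)%:P * 'X.

(** Every variable carries a factor ['X], so the exponent is one more than the number of cuts; each
    mark that is not cut contributes a sign, which makes the signs alternate with the exponent. *)
Lemma tacc_low a bs : exists q : {poly R},
  tacc y' a bs = (-1) ^+ count id bs *
    ((y (a + size bs))%:P * 'X - (cuts1 y a bs)%:P * 'X^2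
     + (cuts2 y a bs)%:P * 'X^3 + q * 'X^4).
Proof.
elim: bs a => [|b bs IH] a /=.
  by exists 0; rewrite addn0 expr0 !polyC0 !mul0r subr0 !addr0 mul1r.
have [q1 E1] := IH a.+1; have [q2 E2] := IH 1%N.
case: b; last first.
  by exists q1; rewrite E1 !add0r addSnnS.
exists (q1 - (y a)%:P * (cuts2 y 1 bs)%:P - (y a)%:P * 'X * q2).
rewrite E1 E2 /y' add1n addnS addSn !polyCD !polyCM exprD expr1 !exprS expr0.
by ring.
Qed.

Variables (w : nat) (A B : seq bool).
Let al := A ++ nseq w false.
Let be := nseq w false ++ B.
Let X := A ++ nseq w.+1 false ++ B.

Definition deg2 := y (size al).+1 * y (size be).+1 - y w * y (size X).+1.
Definition deg3 := y (size be).+1 * cuts1 y 1 al + y (size al).+1 * cuts1 y 1 be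
  - y w * cuts1 y 1 X.
Definition deg4 := y (size be).+1 * cuts2 y 1 al + cuts1 y 1 al * cuts1 y 1 be
  + y (size al).+1 * cuts2 y 1 be - y w * cuts2 y 1 X.

Lemma fatpoly_low : exists q : {poly R},
  fatpoly y' w A B = (-1) ^+ count id (A ++ B) *
    (deg2%:P * 'X^2 - deg3%:P * 'X^3 + deg4%:P * 'X^4 + q * 'X^5).
Proof.
have [qa Ea] := tacc_low 1 al; have [qb Eb] := tacc_low 1 be; have [qx Ex] := tacc_low 1 X.
have cnt0 k : count id (nseq k false) = 0%N by rewrite count_nseq.
have Na : count id al = count id A by rewrite count_cat cnt0 addn0.
have Nb : count id be = count id B by rewrite count_cat cnt0.
have Nx : count id X = (count id A + count id B)%N by rewrite /X !count_cat cnt0.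
pose p s c1 c2 q : {poly R} := (y s)%:P * 'X - c1%:P * 'X^2 + c2%:P * 'X^3 + q * 'X^4.
exists ((y (size al).+1)%:P * qb - (cuts1 y 1 al)%:P * ((cuts2 y 1 be)%:P + qb * 'X)
     + (cuts2 y 1 al)%:P * (- (cuts1 y 1 be)%:P + (cuts2 y 1 be)%:P * 'X + qb * 'X^2)
     + qa * ((y (size be).+1)%:P - (cuts1 y 1 be)%:P * 'X + (cuts2 y 1 be)%:P * 'X^2 + qb * 'X^3)
     - (y w)%:P * qx).
rewrite /fatpoly /rpoly -/al -/be -/X Ea Eb Ex Na Nb Nx count_cat exprD /y'.
rewrite /deg2 /deg3 /deg4 !add1n !polyCB !polyCD !polyCM !exprS expr0.
by ring.
Qed.

End LowDegree.

(** * The coefficients of degrees two, three and four *)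

Section Monomials.

Variable N : nat.
Let yv k : {mpoly int[N.+1]} := 'X_(inord k).

(** The exponent vector of the product of the variables indexed by [t]. Since [inord] is faithful
    only up to [N], all indices below are bounded by [N]. *)
Definition mono (t : seq nat) : 'X_{1..N.+1} := [multinom count_mem (i : nat) t | i < N.+1].

Lemma mono_prod t : all (leq^~ N) t -> \prod_(k <- t) yv k = 'X_[mono t].
Proof.
elim: t => [|k t IH] /=.
  by move=> _; rewrite big_nil -mpolyX0; congr 'X_[_]; apply/mnmP => i; rewrite mnmE mnm0E.
case/andP => kN tN; rewrite big_cons IH // -mpolyXD; congr 'X_[_].
apply/mnmP => i; rewrite mnmDE !mnmE /=; congr (_ + _)%N.
by rewrite -val_eqE /= inordK.
Qed.

Lemma mono_inj t t' : all (leq^~ N) t -> all (leq^~ N) t' ->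
  (mono t == mono t') = perm_eq t t'.
Proof.
move=> tN t'N; apply/eqP/idP => [/mnmP E|/permP E]; last first.
  by apply/mnmP => i; rewrite !mnmE; exact: E.
rewrite /perm_eq; apply/allP => k; rewrite mem_cat => kt.
have kN : (k < N.+1)%N.
  by case/orP: kt => /(allP _) H; [have := H _ tN | have := H _ t'N]; rewrite /= ltnS.
by have := E (Ordinal kN); rewrite !mnmE /= => ->.
Qed.

Lemma mcoeff_prod t t' : all (leq^~ N) t -> all (leq^~ N) t' ->
  (\prod_(k <- t) yv k)@_(mono t') = (perm_eq t t')%:R.
Proof. by move=> tN t'N; rewrite mono_prod // mcoeffX mono_inj. Qed.

Variables (w u s : nat).
Hypothesis u0 : (0 < u)%N.
Hypothesis s0 : (0 < s)%N.
Hypothesis w0 : (0 < w)%N.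
Local Notation v := (u + w)%N.
Local Notation b := (s + w)%N.
Local Notation L := (u + w + s)%N.
Hypothesis LN : (L <= N)%N.
Variable S : nat -> bool.
Hypothesis S_window : forall x, closed_window w u x -> S x = false.
Definition lmarks := [seq S x | x <- iota 1 u.-1].
Definition rmarks := [seq S x | x <- iota v.+1 s.-1].

Lemma left_marks : lmarks ++ nseq w false = [seq S x | x <- iota 1 v.-1].
Proof.
have -> : v.-1 = (u.-1 + w)%N by lia.
rewrite iotaD map_cat; congr (_ ++ _); rewrite add1n prednK //.
apply: (@eq_from_nth _ false); rewrite size_nseq ?size_map ?size_iota // => i iw.
by rewrite nth_nseq if_same (nth_map 0%N) ?size_iota // nth_iota // S_window // /closed_window; lia.
Qed.

Lemma right_marks : nseq w false ++ rmarks = [seq S x | x <- iota u.+1 b.-1].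
Proof.
have -> : b.-1 = (w + s.-1)%N by lia.
rewrite iotaD map_cat; congr (_ ++ _).
apply: (@eq_from_nth _ false); rewrite size_nseq ?size_map ?size_iota // => i iw.
by rewrite nth_nseq if_same (nth_map 0%N) ?size_iota // nth_iota // S_window // /closed_window; lia.
Qed.

Lemma all_marks : lmarks ++ nseq w.+1 false ++ rmarks = [seq S x | x <- iota 1 L.-1].
Proof.
have -> : L.-1 = (u.-1 + (w.+1 + s.-1))%N by lia.
rewrite !iotaD !map_cat; congr (_ ++ (_ ++ _)); last by rewrite /rmarks; congr map; congr iota; lia.
apply: (@eq_from_nth _ false); rewrite size_nseq ?size_map ?size_iota // => i iw.
rewrite nth_nseq if_same (nth_map 0%N) ?size_iota // nth_iota // S_window // /closed_window.
by clear -iw u0; lia.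
Qed.

Let dE := (left_marks, right_marks, all_marks).

Lemma deg2_marks : deg2 yv w lmarks rmarks = yv v * yv b - yv w * yv L.
Proof.
rewrite /deg2 !dE !size_map !size_iota !prednK //; lia.
Qed.

Lemma deg3_coef l : all (leq^~ N) l ->
  (deg3 yv w lmarks rmarks)@_(mono l) = coef3 w u s (ind S) l.
Proof.
move=> lN; rewrite /deg3 !dE !size_map !size_iota !prednK ?addn_gt0 ?u0 ?s0 // !cuts1_sum.
have sz (p q : nat) : (0 < q)%N -> (p.+1 + q.-1 = p + q)%N by lia.
rewrite !sz ?addn_gt0 ?u0 ?s0 ?w0 ?orbT // !add0n mcoeffB mcoeffD.
have natS (c : bool) (P : {mpoly int[N.+1]}) m : (c%:R * P)@_m = c%:Z * P@_m.
  by case: c; rewrite ?mul1r ?mul0r ?mcoeff0.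
rewrite !mulr_sumr !raddf_sum /=.
transitivity (\sum_(1 <= x < v) ind S x * (perm_eq [:: b; x; v - x]%N l)%:R
  + \sum_(u.+1 <= x < L) ind S x * (perm_eq [:: v; x - u; L - x]%N l)%:R
  - \sum_(1 <= x < L) ind S x * (perm_eq [:: w; x; L - x]%N l)%:R).
  have M t1 t2 t3 x : (t1 <= N)%N -> (t2 <= N)%N -> (t3 <= N)%N ->
     (yv t1 * ((S x)%:R * (yv t2 * yv t3)))@_(mono l) = ind S x * (perm_eq [:: t1; t2; t3] l)%:R.
    move=> h1 h2 h3; rewrite mulrCA natS -mcoeff_prod //=; last by rewrite h1 h2 h3.
    by rewrite !big_cons big_nil mulr1.
  have uL : (u + b = L)%N by lia.
  rewrite uL -sumrN; congr (_ + _ + _); rewrite !big_nat; apply: eq_bigr => x xx; rewrite M; try lia.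
  - by have -> : (1 + x - 1 = x)%N by lia.
  - by have -> : (1 + x - u.+1 = x - u)%N by lia.
  - by have -> : (1 + x - 1 = x)%N by lia.
rewrite /coef3 /cut1.
rewrite -(sum_head w0 u0 s0 (fun x => ind S x * (perm_eq [:: b; x; v - x]%N l)%:R)).
have -> : \sum_(u.+1 <= x < L) ind S x * (perm_eq [:: v; x - u; L - x]%N l)%:R
  = \sum_(1 <= x < L) ind S x * (perm_eq [:: v; x - u; L - x]%N l)%:R * (u < x)%N%:R.
  rewrite (sum_tail w0 u0 s0); have uE : u.+1 = (1 + u)%N by [].
  rewrite uE big_addn; have -> : (L - u = b)%N by lia.
  by apply: eq_bigr => x _; rewrite addnC.
rewrite -big_split -sumrB; apply: eq_bigr => x _ /=.
rewrite -!mulrA -!natrM !mulnb [_ && (x < v)%N]andbC [_ && (u < x)%N]andbC.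
by rewrite -mulrDr -mulrBr.
Qed.

Lemma sum_sub (F : nat -> int) p q n : (0 < p)%N -> (q <= n)%N ->
  \sum_(p <= x < q) F x = \sum_(1 <= x < n) F x * ((p <= x) && (x < q))%N%:R.
Proof.
move=> p0 qn; rewrite (big_nat_widenl p 1) // (big_nat_widen _ _ n) // big_mkcond /=.
by apply: eq_bigr => x _; case: ifP; rewrite ?mulr1 ?mulr0.
Qed.

Lemma deg4_coef l : all (leq^~ N) l ->
  (deg4 yv w lmarks rmarks)@_(mono l) = coef4 w u s (fun x z => ind S x * ind S z) l.
Proof.
move=> lN; rewrite /deg4 !dE !size_map !size_iota !prednK ?addn_gt0 ?u0 ?s0 // !cuts1_sum !cuts2_sum.
have sz (p q : nat) : (0 < q)%N -> (p.+1 + q.-1 = p + q)%N by lia.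
rewrite !sz ?addn_gt0 ?u0 ?s0 ?w0 ?orbT // !add0n.
have uL : (u + b = L)%N by lia.
rewrite !uL mcoeffB !mcoeffD.
pose SS x z : int := ind S x * ind S z.
have natS (c d : bool) (P : {mpoly int[N.+1]}) m : (c%:R * d%:R * P)@_m = c%:Z * d%:Z * P@_m.
  by case: c; case: d; rewrite ?mulr1 ?mulr0 ?mul1r ?mul0r ?mcoeff0.
have M t1 t2 t3 t4 x z : (t1 <= N)%N -> (t2 <= N)%N -> (t3 <= N)%N -> (t4 <= N)%N ->
    ((S x)%:R * (S z)%:R * (yv t1 * yv t2 * yv t3 * yv t4))@_(mono l)
    = SS x z * (perm_eq [:: t1; t2; t3; t4] l)%:R.
  move=> h1 h2 h3 h4; rewrite natS -mcoeff_prod //=; last by rewrite h1 h2 h3 h4.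
  by rewrite !big_cons big_nil mulr1 !mulrA.
have T p q t (F : nat -> nat -> seq nat) (Q : nat -> nat -> {mpoly int[N.+1]}) :
    (0 < p)%N -> (q <= L)%N -> (t <= N)%N ->
    (forall x z, (p <= x < q)%N -> (x < z < q)%N -> exists t2 t3 t4,
       [/\ Q x z = yv t2 * yv t3 * yv t4, F x z = [:: t; t2; t3; t4], (t2 <= N)%N, (t3 <= N)%N & (t4 <= N)%N]) ->
    (yv t * \sum_(p <= x < q) \sum_(x.+1 <= z < q) ((S x)%:R * (S z)%:R) * Q x z)@_(mono l)
    = \sum_(1 <= x < L) \sum_(1 <= z < L) SS x z * ((p <= x) && (x < z) && (z < q) && perm_eq (F x z) l)%N%:R.
  move=> p0 qL tN H; rewrite mulr_sumr raddf_sum /= (@sum_sub _ p q L) //.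
  apply: eq_bigr => x _; rewrite mulr_sumr raddf_sum /= (@sum_sub _ x.+1 q L) // mulr_suml.
  apply: eq_bigr => z _; have [pxq|] := boolP ((p <= x) && (x < q))%N; last first.
    move=> h; rewrite mulr0; have -> : ((p <= x) && (x < z) && (z < q) && perm_eq (F x z) l)%N = false by lia.
    by rewrite natr_false mulr0.
  rewrite mulr1; have [xzq|] := boolP ((x < z) && (z < q))%N; last first.
    move=> h; rewrite mulr0; have -> : ((p <= x) && (x < z) && (z < q) && perm_eq (F x z) l)%N = false by lia.
    by rewrite natr_false mulr0.
  rewrite mulr1; have [t2 [t3 [t4 [-> -> h2 h3 h4]]]] := H _ _ pxq xzq.
  have -> : yv t * ((S x)%:R * (S z)%:R * (yv t2 * yv t3 * yv t4))
     = (S x)%:R * (S z)%:R * (yv t * yv t2 * yv t3 * yv t4) by ring.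
  rewrite M //; have -> : (p <= x)%N by lia. have -> : (x < z)%N by lia. by have -> : (z < q)%N by lia.
rewrite (@T 1%N v b (fun x z => [:: b; x; z - x; v - z]%N)); try lia; last first.
  by move=> x z xv xzv; exists x, (z - x)%N, (v - z)%N; split => //; try lia; congr (yv _ * _ * _); lia.
rewrite (@T u.+1 L v (fun x z => [:: v; x - u; z - x; L - z]%N)); try lia; last first.
  by move=> x z xv xzv; exists (x - u)%N, (z - x)%N, (L - z)%N; split => //; try lia; congr (yv _ * _ * _); lia.
rewrite (@T 1%N L w (fun x z => [:: w; x; z - x; L - z]%N)); try lia; last first.
  by move=> x z xv xzv; exists x, (z - x)%N, (L - z)%N; split => //; try lia; congr (yv _ * _ * _); lia.
have -> : ((\sum_(1 <= x < v) (S x)%:R * (yv (1 + x - 1)%N * yv (v - x)%N))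
   * (\sum_(u.+1 <= x < L) (S x)%:R * (yv (1 + x - u.+1)%N * yv (L - x)%N)))@_(mono l)
  = \sum_(1 <= x < L) \sum_(1 <= z < L) SS x z *
     ((x < z) && (x < v) && (u < z) && perm_eq [:: x; v - x; z - u; L - z] l)%N%:R.
  rewrite mulr_suml raddf_sum /= (@sum_sub _ 1 v L) //; last lia.
  rewrite [LHS]big_nat [RHS]big_nat; apply: eq_bigr => x xL; rewrite mulr_sumr raddf_sum /= (@sum_sub _ u.+1 L L) // mulr_suml.
  rewrite !big_nat; apply: eq_bigr => z zL; have [xv|xv] := boolP ((0 < x) && (x < v))%N; last first.
    rewrite mulr0; have -> : (x < v)%N = false by lia.
    by rewrite andbF natr_false mulr0.
  rewrite mulr1; have [uz|uz] := boolP ((u < z) && (z < L))%N; last first.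
    rewrite mulr0; have -> : (u < z)%N = false by lia.
    by rewrite andbF natr_false mulr0.
  have -> : (1 + x - 1 = x)%N by lia. have -> : (1 + z - u.+1 = z - u)%N by lia.
  have -> : (S x)%:R * (yv x * yv (v - x)%N) * ((S z)%:R * (yv (z - u)%N * yv (L - z)%N))
     = (S x)%:R * (S z)%:R * (yv x * yv (v - x)%N * yv (z - u)%N * yv (L - z)%N) by ring.
  rewrite mulr1 M; try lia.
  have -> : (x < v)%N by lia. have -> : (u < z)%N by lia.
  (* Cuts [z <= x] with [x < v] and [u < z] would lie inside the window, where there is no mark; so
     [cut2] may ask for [x < z]. *)
  have [//|zx] := ltnP x z.
  by rewrite /SS /ind S_window ?mul0r // /closed_window; clear -zx xv uz; lia.
rewrite /coef4 -!big_split -sumrB !big_nat; apply: eq_bigr => x xL /=.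
rewrite -!big_split -sumrB !big_nat; apply: eq_bigr => z zL /=.
have -> : (0 < x)%N by lia. have -> : (z < L)%N by lia.
rewrite /cut2 -!mulrDr -mulrBr /SS andbT; congr (_ * (_ + _ + _ - _)).
  by rewrite (andbC (u < x)%N).
by rewrite !andbT.
Qed.

End Monomials.

Lemma low_coefs (R : comNzRingType) n1 n2 (d2 d3 d4 d2' d3' d4' : R) (q q' : {poly R}) :
  (-1) ^+ n1 * (d2%:P * 'X^2 - d3%:P * 'X^3 + d4%:P * 'X^4 + q * 'X^5)
  = (-1) ^+ n2 * (d2'%:P * 'X^2 - d3'%:P * 'X^3 + d4'%:P * 'X^4 + q' * 'X^5) ->
  [/\ (-1) ^+ n1 * d2 = (-1) ^+ n2 * d2', (-1) ^+ n1 * d3 = (-1) ^+ n2 * d3'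
    & (-1) ^+ n1 * d4 = (-1) ^+ n2 * d4'].
Proof.
have sgn n : (-1) ^+ n = ((-1) ^+ n)%:P :> {poly R} by rewrite rmorphXn rmorphN1.
rewrite !sgn => E.
have C i := congr1 (fun p : {poly R} => p`_i) E.
split.
- by have := C 2%N; rewrite !coefCM !coefD !coefN !coefCM !coefXn !coefMXn /= !mulr0 !mulr1 !subr0 !addr0.
- have := C 3%N; rewrite !coefCM !coefD !coefN !coefCM !coefXn !coefMXn /= !mulr0 !mulr1 !addr0 !add0r !mulrN.
  exact: oppr_inj.
- by have := C 4%N; rewrite !coefCM !coefD !coefN !coefCM !coefXn !coefMXn /= !mulr0 !mulr1 !subr0 !addr0 !add0r.
Qed.

(** * Consequences of an identity between two boxdot polynomials *)

Section FormalIdentity.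

Variables (w u s u' s' : nat) (S S' : nat -> bool).
Hypothesis w0 : (0 < w)%N.
Hypothesis u0 : (0 < u)%N.
Hypothesis s0 : (0 < s)%N.
Hypothesis u'0 : (0 < u')%N.
Hypothesis s'0 : (0 < s')%N.
Hypothesis S_window : forall x, closed_window w u x -> S x = false.
Hypothesis S'_window : forall x, closed_window w u' x -> S' x = false.
Hypothesis same : forall (R : comNzRingType) (y : nat -> R),
  fatpoly y w (lmarks u S) (rmarks w u s S) = fatpoly y w (lmarks u' S') (rmarks w u' s' S').

Let low N : exists n1 n2, let yv k : {mpoly int[N.+1]} := 'X_(inord k) in
  [/\ (-1) ^+ n1 * deg2 yv w (lmarks u S) (rmarks w u s S)
       = (-1) ^+ n2 * deg2 yv w (lmarks u' S') (rmarks w u' s' S'),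
      (-1) ^+ n1 * deg3 yv w (lmarks u S) (rmarks w u s S)
       = (-1) ^+ n2 * deg3 yv w (lmarks u' S') (rmarks w u' s' S')
    & (-1) ^+ n1 * deg4 yv w (lmarks u S) (rmarks w u s S)
       = (-1) ^+ n2 * deg4 yv w (lmarks u' S') (rmarks w u' s' S')].
Proof.
pose yv k : {mpoly int[N.+1]} := 'X_(inord k).
have := same (fun k => (yv k)%:P * 'X).
have [q ->] := fatpoly_low yv w (lmarks u S) (rmarks w u s S).
have [q' ->] := fatpoly_low yv w (lmarks u' S') (rmarks w u' s' S').
by move/low_coefs => H; exists (count id (lmarks u S ++ rmarks w u s S)),
  (count id (lmarks u' S' ++ rmarks w u' s' S')).
Qed.

Let sgn_coef N n1 n2 (P Q : {mpoly int[N.+1]}) m :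
  (-1) ^+ n1 * P = (-1) ^+ n2 * Q -> (-1) ^+ n1 * P@_m = (-1) ^+ n2 * Q@_m :> int.
Proof.
have C n (P' : {mpoly int[N.+1]}) : ((-1) ^+ n * P')@_m = (-1) ^+ n * P'@_m.
  by rewrite -signr_odd -[in RHS]signr_odd; case: odd; rewrite ?expr0 ?expr1 ?mul1r ?mulN1r ?mcoeffN.
by move=> E; rewrite -!C E.
Qed.

(** The monomial [e_v * e_b] differs from [e_w * e_L], both its indices exceeding [w]. Its
    coefficient is a sign on one side and has to be matched on the other, which also identifies the
    global signs. *)
Let sizes N n1 n2 : (u + w + s <= N)%N -> (u' + w + s' <= N)%N ->
  let yv k : {mpoly int[N.+1]} := 'X_(inord k) in
  (-1) ^+ n1 * deg2 yv w (lmarks u S) (rmarks w u s S)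
       = (-1) ^+ n2 * deg2 yv w (lmarks u' S') (rmarks w u' s' S') ->
  perm_eq [:: u' + w; s' + w]%N [:: u + w; s + w]%N /\ (-1) ^+ n1 = (-1) ^+ n2 :> int.
Proof.
move=> LN LN' yv; rewrite !deg2_marks // => /(@sgn_coef N n1 n2 _ _ (mono N [:: u + w; s + w]%N)).
have P2 i j : (i <= N)%N -> (j <= N)%N ->
    ('X_(inord i) * 'X_(inord j) : {mpoly int[N.+1]})@_(mono N [:: u + w; s + w]%N)
    = (perm_eq [:: i; j] [:: u + w; s + w]%N)%:R.
  move=> iN jN; rewrite -(@mcoeff_prod N) /= ?iN ?jN //; last by rewrite andbT; lia.
  by rewrite !big_cons big_nil mulr1.
rewrite !mcoeffB !P2; try lia.
rewrite perm_refl !(@perm_notin _ w [:: w; _]) ?inE ?eqxx //; try by rewrite negb_or; lia.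
rewrite natr_false !subr0 mulr1; case: perm_eq => /=; first by rewrite mulr1.
by rewrite mulr0 -signr_odd; case: odd.
Qed.

Lemma formal_sizes : (u' = u /\ s' = s) \/ (u' = s /\ s' = u).
Proof.
pose N := (u + w + s + (u' + w + s'))%N; have [n1 [n2 [E _ _]]] := low N.
have LN : (u + w + s <= N)%N by rewrite /N leq_addr.
have LN' : (u' + w + s' <= N)%N by rewrite /N leq_addl.
have [+ _] := sizes LN LN' E; rewrite perm_eq2 !eqn_add2r.
by case/orP => /andP[/eqP-> /eqP->]; [left | right].
Qed.

Lemma formal_coefs : u' = u -> s' = s ->
  (forall l, coef3 w u s (fun x => ind S x - ind S' x) l = 0) /\
  (forall l, coef4 w u s (fun x z => ind S x * ind S z - ind S' x * ind S' z) l = 0).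
Proof.
move=> uE sE; suff H l : coef3 w u s (ind S) l = coef3 w u s (ind S') l /\
    coef4 w u s (fun x z => ind S x * ind S z) l = coef4 w u s (fun x z => ind S' x * ind S' z) l.
  split=> l; have [H3 H4] := H l.
  - apply/eqP; rewrite -[X in X == _]subr0; move/eqP: H3; rewrite -subr_eq0 subr0 /coef3 -sumrB.
    by under eq_bigr do rewrite -mulrBl.
  - move/eqP: H4; rewrite -subr_eq0 /coef4 -sumrB => /eqP H4; rewrite -[RHS]H4.
    apply: eq_bigr => x _; rewrite -sumrB; apply: eq_bigr => z _; by rewrite mulrBl.
pose N := (u + w + s + sumn l)%N; have [n1 [n2 [E2 E3 E4]]] := low N.
have LN : (u + w + s <= N)%N by rewrite /N leq_addr.
have lN : all (leq^~ N) l.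
  apply/allP => k kl; rewrite /N; apply: leq_trans (leq_addl _ _).
  by rewrite sumnE (big_rem k) //= leq_addr.
have [_ sg] := sizes LN ltac:(by rewrite uE sE) E2.
have S'w : forall x, closed_window w u x -> S' x = false by rewrite -uE.
have D3 := deg3_coef u0 s0 w0 LN S_window lN; have D3' := deg3_coef u0 s0 w0 LN S'w lN.
have D4 := deg4_coef u0 s0 w0 LN S_window lN; have D4' := deg4_coef u0 s0 w0 LN S'w lN.
move: {E2} E3 E4; rewrite uE sE => E3 E4.
have E3' : (-1) ^+ n1 * coef3 w u s (ind S) l = (-1) ^+ n2 * coef3 w u s (ind S') l.
  by rewrite -D3 -D3'; exact: sgn_coef E3.
have E4' : (-1) ^+ n1 * coef4 w u s (fun x z => ind S x * ind S z) l
    = (-1) ^+ n2 * coef4 w u s (fun x z => ind S' x * ind S' z) l.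
  by rewrite -D4 -D4'; exact: sgn_coef E4.
move: E3' E4'; clear -sg; rewrite sg.
have sn : (-1) ^+ n2 != 0 :> int by rewrite signr_eq0.
by move=> /(mulfI sn) -> /(mulfI sn) ->.
Qed.

End FormalIdentity.

Local Open Scope fset_scope.
Local Open Scope ring_scope.

(** * Strip counts and invariants of equivalence *)

Lemma box_eq (a b : box) : a.1 = b.1 -> a.2 = b.2 -> a = b.
Proof. by case: a b => [? ?] [? ?] /= -> ->. Qed.

Lemma boxsetP (A B : diagram) :
  (forall r c : int, ((r, c) \in A) = ((r, c) \in B)) -> A = B.
Proof. by move=> h; apply/fsetP => -[r c]. Qed.

Definition northwest (a b : box) : bool :=
  ((a.1 == b.1) && (a.2 <= b.2)) || ((a.2 == b.2) && (a.1 <= b.1)).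

Definition strip (d : bool) (X I : diagram) : bool :=
  [&& I `<=` X,
      all (fun a => all (fun b => northwest a b ==> (a \in I)) (enum_fset I)) (enum_fset X)
    & all (fun a => all (fun b => (if d then a.2 == b.2 else a.1 == b.1) ==> (a == b))
        (enum_fset I)) (enum_fset I)].

Lemma stripP d X I : reflect
  [/\ I `<=` X, forall a b : box, a \in X -> b \in I -> northwest a b -> a \in I
    & forall a b : box, a \in I -> b \in I -> (if d then a.2 == b.2 else a.1 == b.1) -> a = b]
  (strip d X I).
Proof.
apply: (iffP and3P) => [[IX H1 H2]|[IX H1 H2]]; split => //.
- by move=> a b aX bI; move/allP: H1 => /(_ a aX) /allP /(_ b bI) /implyP.
- by move=> a b aI bI h; move/allP: H2 => /(_ a aI) /allP /(_ b bI) /implyP /(_ h) /eqP.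
- by apply/allP => a aX; apply/allP => b bI; apply/implyP; exact: H1.
- by apply/allP => a aX; apply/allP => b bI; apply/implyP => h; apply/eqP; exact: H2.
Qed.

(* Horizontal strips have [d = true], vertical ones [d = false]. *)
Fixpoint strip_count (X : diagram) (l : seq (bool * nat)) : int :=
  if l is (d, k) :: l' then
    \sum_(I <- fpowerset X | strip d X I && (#|` I| == k)%N) strip_count (X `\` I) l'
  else (X == fset0)%:R.

Lemma strip0 d X : strip d X fset0.
Proof. by apply/stripP; split => [|a b|a b]; rewrite ?fsub0set ?in_fset0. Qed.

Lemma strip_count0 d X l : strip_count X ((d, 0%N) :: l) = strip_count X l.
Proof.
rewrite /= big_mkcond (bigD1_seq fset0) ?fset_uniq ?fpowersetE ?fsub0set //.
rewrite strip0 cardfs0 eqxx fsetD0 /= big1 ?addr0 // => I I0.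
by rewrite cardfs_eq0 (negbTE I0) andbF.
Qed.

Lemma sum_sign_reversing (T : eqType) (s : seq T) (P : pred T) (F : T -> int) (phi : T -> T) :
  uniq s ->
  (forall x, x \in s -> P x -> [/\ phi x \in s, P (phi x), phi (phi x) = x & F (phi x) = - F x]) ->
  \sum_(x <- s | P x) F x = 0.
Proof.
move=> us H; pose t := [seq x <- s | P x].
have Ht x : x \in t -> [/\ phi x \in t, phi (phi x) = x & F (phi x) = - F x].
  rewrite !mem_filter => /andP[Px xs]; have [h1 h2 h3 h4] := H x xs Px.
  by split => //; rewrite h2.
have tu : uniq t by rewrite filter_uniq.
have E : \sum_(x <- t) F x = - \sum_(x <- t) F x.
  have pt : perm_eq (map phi t) t.
    apply: uniq_perm => //.
      rewrite map_inj_in_uniq // => x y /Ht[_ hx _] /Ht[_ hy _] e.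
      by rewrite -hx e hy.
    move=> x; apply/mapP/idP => [[y yt ->]|xt]; first by have [] := Ht y yt.
    by have [h1 h2 _] := Ht x xt; exists (phi x).
  rewrite -{1}(perm_big _ pt) /= big_map -sumrN big_seq [RHS]big_seq.
  by apply: eq_bigr => x /Ht[].
by rewrite -big_filter -/t; move: E; move: (\sum_(x <- t) F x) => z; lia.
Qed.

Definition topright (Z : diagram) : box :=
  odflt 0 (omap val [pick z : Z | all (fun b : box => ((val z).1 < b.1) ||
     (((val z).1 == b.1) && (b.2 <= (val z).2))) (enum_fset Z)]).

Lemma fset_argmin (Z : diagram) (f : box -> int) : Z != fset0 ->
  exists2 z : box, z \in Z & forall b : box, b \in Z -> f z <= f b.
Proof.
case/fset0Pn => a aZ; pose i0 : Z := [` aZ].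
case: (Order.TotalTheory.arg_minP (fun z : Z => f (val z)) (erefl : xpredT i0)) => i _ H.
by exists (val i); [exact: valP | move=> b bZ; exact: (H [` bZ])].
Qed.

Lemma toprightP (Z : diagram) : Z != fset0 -> topright Z \in Z /\
  forall b : box, b \in Z -> (topright Z).1 < b.1 \/ (topright Z).1 = b.1 /\ b.2 <= (topright Z).2.
Proof.
move=> Z0; have [r rZ rmin] := fset_argmin (fun b => b.1) Z0.
pose Y := [fset b in Z | b.1 == r.1].
have Y0 : Y != fset0 by apply/fset0Pn; exists r; rewrite !inE rZ eqxx.
have [z] := fset_argmin (fun b => - b.2) Y0; rewrite !inE => /andP[zZ /eqP zr] zmax.
rewrite /topright; case: pickP => [x /allP H|/(_ [` zZ]) /negP []] /=.
  split; first exact: valP.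
  by move=> b /H /orP[|/andP[/eqP]]; [left | right].
apply/allP => b bZ /=; have := rmin b bZ; rewrite -zr le_eqVlt => /orP[/eqP zb|->//].
rewrite zb eqxx /= -lerN2; apply/orP; right.
by apply: zmax; rewrite !inE bZ -zb zr /=.
Qed.

Section Reciprocity.

Variables (X : diagram) (l : seq (bool * nat)) (k : nat).
Hypothesis k0 : (0 < k)%N.

Let P (p : diagram * diagram) : bool :=
  [&& strip true X p.1, strip false (X `\` p.1) p.2 & (#|` p.1| + #|` p.2| == k)%N].
Let F (p : diagram * diagram) : int :=
  (-1) ^+ #|` p.2| * strip_count (X `\` p.1 `\` p.2) l.
(** The highest, then rightmost box of the union changes sides. Entering the vertical strip it meets
    no box of its row, for such a box would lie to its left and belong to the horizontal strip by
    closure; entering the horizontal strip it meets no box of its column, for such a box would lie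
    below and force it into that strip already. *)
Let phi (p : diagram * diagram) : diagram * diagram :=
  let z := topright (p.1 `|` p.2) in
  if z \in p.1 then (p.1 `\ z, z |` p.2) else (z |` p.1, p.2 `\ z).

Let pairs : seq (diagram * diagram) :=
  [seq (A, B) | A : diagram <- enum_fset (fpowerset X), B : diagram <- enum_fset (fpowerset X)].

Let phiP p : p \in pairs -> P p ->
  [/\ phi p \in pairs, P (phi p), phi (phi p) = p & F (phi p) = - F p].
Proof.
case: p => I J _ /and3P[/= /stripP[IX Icl Icol] /stripP[JX Jcl Jrow] /eqP IJk].
have JnI b : b \in J -> b \notin I by move=> /(fsubsetP JX); rewrite inE => /andP[].
have JsX b : b \in J -> b \in X by move=> /(fsubsetP JX); rewrite inE => /andP[].
have IsX b : b \in I -> b \in X by move=> /(fsubsetP IX).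
have Z0 : I `|` J != fset0.
  apply/eqP => E; have := cardfs0 box; rewrite -E => /eqP; rewrite cardfs_eq0 => /eqP E'.
  have [I0 J0] : I = fset0 /\ J = fset0.
    by split; apply/eqP; rewrite -fsubset0 -E'; [exact: fsubsetUl | exact: fsubsetUr].
  by move: IJk k0; rewrite I0 J0 cardfs0 => <-.
have [zZ zmin] := toprightP Z0; rewrite /phi /=; set z := topright _ in zZ zmin *.
have inpairs A B : A `<=` X -> B `<=` X -> (A, B) \in pairs.
  by move=> AX BX; apply/allpairsP; exists (A, B); rewrite /= !fpowersetE.
have zrow b : b \in I `|` J -> b.1 = z.1 -> b.2 <= z.2.
  by move=> /zmin[h e|[]//]; move: h; rewrite e ltxx.
have zle b : b \in I `|` J -> z.1 <= b.1.
  by move=> /zmin[/ltW|[->]].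
have [zI|zI] := boolP (z \in I).
- have zJ : z \notin J by apply: contraTN zI => /JnI.
  have UE : (I `\ z) `|` (z |` J) = I `|` J.
    apply/fsetP => b; rewrite !inE; have [->|] := eqVneq b z; rewrite /= ?zI //.
  have DE : X `\` (I `\ z) `\` (z |` J) = X `\` I `\` J.
    apply/fsetP => b; rewrite !inE; have [->|] := eqVneq b z; rewrite /= ?zI ?andbF //.
  have c1 : (#|` I| = 1 + #|` I `\ z|)%N by rewrite (cardfsD1 z) zI.
  have c2 : (#|` z |` J| = 1 + #|` J|)%N by rewrite cardfsU1 zJ.
  split.
  + apply: inpairs; first exact: fsubset_trans (fsubsetDl _ _) IX.
    by apply/fsubsetP => b /fset1UP[->|/JsX//]; exact: IsX.
  + apply/and3P; split => /=; last by rewrite c2 addnCA addnA -c1 IJk.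
    * apply/stripP; split; first exact: fsubset_trans (fsubsetDl _ _) IX.
      - move=> a b aX /fsetD1P[bz bI] ab; apply/fsetD1P; split; last exact: Icl ab.
        apply/eqP => az; subst a; move: ab => /orP[]/andP[/eqP e1 e2]; case/eqP: bz.
          have := zrow b; rewrite inE bI e1 => /(_ isT erefl) h.
          by apply: box_eq => //; apply/eqP; rewrite eq_le h.
        by apply: Icol => //; rewrite e1.
      - by move=> a b /fsetD1P[_ aI] /fsetD1P[_ bI]; exact: Icol.
    * apply/stripP; split.
      - apply/fsubsetP => b /fset1UP[->|bJ]; first by rewrite !inE eqxx IsX.
        by rewrite !inE (negbTE (JnI _ bJ)) andbF JsX.
      - move=> a b; rewrite !inE negb_and negbK => /andP[/orP[/eqP->|aI] aX]; first by rewrite eqxx.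
        case/orP => [/eqP->|bJ] ab; first by rewrite (Icl a z) in aI.
        by rewrite (Jcl a b) ?orbT // !inE aI.
      - move=> a b /fset1UP[->|aJ] /fset1UP[->|bJ] // /eqP e.
        + have bI : b \in I.
            apply: (Icl b z) => //; first exact: JsX.
            by rewrite /northwest e eqxx zrow // inE bJ orbT.
          by rewrite (negbTE (JnI _ bJ)) in bI.
        + have aI : a \in I.
            apply: (Icl a z) => //; first exact: JsX.
            by rewrite /northwest e eqxx zrow // inE aJ orbT.
          by rewrite (negbTE (JnI _ aJ)) in aI.
        + by apply: Jrow => //; rewrite e.
  + rewrite /= UE -/z !inE eqxx /= fsetD1K // ; congr (_, _).
    by apply/fsetP => b; rewrite !inE; have [->|] := eqVneq b z; rewrite //= (negbTE zJ).
  + by rewrite /F /= DE c2 exprD expr1 mulN1r mulNr.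
- have zJ : z \in J by move: zZ; rewrite inE (negbTE zI).
  have UE : (z |` I) `|` (J `\ z) = I `|` J.
    apply/fsetP => b; rewrite !inE; have [->|] := eqVneq b z; rewrite /= ?zJ ?orbT //.
  have DE : X `\` (z |` I) `\` (J `\ z) = X `\` I `\` J.
    apply/fsetP => b; rewrite !inE; have [->|] := eqVneq b z; rewrite /= ?zJ ?andbF //.
  have c1 : (#|` J| = 1 + #|` J `\ z|)%N by rewrite (cardfsD1 z) zJ.
  have c2 : (#|` z |` I| = 1 + #|` I|)%N by rewrite cardfsU1 zI.
  have Zcl a : a \in X -> northwest a z -> a \in I `|` J.
    move=> aX az; rewrite inE; have [//|aI] := boolP (a \in I).
    by rewrite (Jcl a z) // inE aI.
  split.
  + apply: inpairs; last by apply/fsubsetP => b /fsetD1P[_ /JsX].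
    by apply/fsubsetP => b /fset1UP[->|/IsX//]; exact: JsX.
  + apply/and3P; split => /=; last by rewrite c2 -addnA addnCA -c1 IJk.
    * apply/stripP; split; first by apply/fsubsetP => b /fset1UP[->|/IsX//]; exact: JsX.
      - move=> a b aX /fset1UP[->|bI] ab; last by rewrite !inE (Icl a b) ?orbT.
        have aZ := Zcl a aX ab; rewrite !inE; move: (aZ); rewrite inE => /orP[->|aJ]; first by rewrite orbT.
        case/orP: ab => /andP[/eqP e1 e2].
          by rewrite (Jrow a z) ?eqxx // e1.
        have h := zle _ aZ; have e3 : a.1 = z.1 by apply/eqP; rewrite eq_le e2.
        by rewrite (Jrow a z) ?eqxx // e3.
      - have key b : b \in I -> b.2 = z.2 -> False.
          move=> bI e; case/negP: zI; apply: (Icl z b) => //; first exact: JsX.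
          by rewrite /northwest e eqxx /= zle ?orbT // inE bI.
        move=> a b /fset1UP[->|aI] /fset1UP[->|bI] // /eqP e.
        + by case: (key b).
        + by case: (key a).
        + by apply: Icol => //; rewrite e.
    * apply/stripP; split.
      - apply/fsubsetP => b /fsetD1P[bz bJ].
        by rewrite !inE negb_or bz JnI // JsX.
      - move=> a b; rewrite !inE negb_or => /andP[/andP[az aI] aX] /andP[bz bJ] ab.
        by rewrite az (Jcl a b) // inE aI.
      - by move=> a b /fsetD1P[_ aJ] /fsetD1P[_ bJ]; exact: Jrow.
  + rewrite /= UE -/z !inE eqxx /= fsetD1K //; congr (_, _).
    by apply/fsetP => b; rewrite !inE; have [->|] := eqVneq b z; rewrite //= (negbTE zI).
  + by rewrite /F /= DE c1 exprD expr1 mulN1r mulNr opprK.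
Qed.

(** The identity between elementary and complete symmetric functions, [sum (-1)^j h_(k-j) e_j = 0],
    in terms of strips, by the sign-reversing involution [phi]. *)
Lemma strip_reciprocity :
  \sum_(j < k.+1) (-1) ^+ j * strip_count X ((true, k - j)%N :: (false, j : nat) :: l) = 0.
Proof.
transitivity (\sum_(p <- pairs | P p) F p); last first.
  apply: sum_sign_reversing phiP; apply: allpairs_uniq; rewrite ?fset_uniq //.
  by move=> [a b] [c d] _ _ /= [-> ->].
rewrite [RHS]big_mkcond /pairs big_allpairs /=.
transitivity (\sum_(j < k.+1) \sum_(I <- fpowerset X) \sum_(J <- fpowerset X)
  if [&& strip true X I, #|` I| == (k - j)%N, strip false (X `\` I) J & #|` J| == j]
  then (-1) ^+ j * strip_count (X `\` I `\` J) l else 0).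
  apply: eq_bigr => j _; rewrite mulr_sumr big_mkcond; apply: eq_bigr => I _ /=.
  case: ifP => [/andP[h1 h2]|h]; last first.
    by rewrite big1 // => J _; rewrite andbA h.
  rewrite h1 h2 /= mulr_sumr -big_mkcond /= -big_filter -[RHS]big_filter.
  apply: perm_big; apply: uniq_perm; rewrite ?filter_uniq ?fset_uniq // => J.
  rewrite !mem_filter !fpowersetE; case: (boolP (strip false _ J)) => //= /stripP[JX _ _].
  by rewrite JX (fsubset_trans JX (fsubsetDl _ _)).
rewrite exchange_big; apply: eq_bigr => I _; rewrite exchange_big; apply: eq_bigr => J _ /=.
rewrite /P /F /=; have [Jk|kJ] := ltnP #|` J| k.+1; last first.
  have -> : (#|` I| + #|` J| == k)%N = false by lia.
  rewrite !andbF big1 // => j _; case: ifP => // /and4P[_ _ _ /eqP e].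
  by have := ltn_ord j; rewrite ltnS -e leqNgt kJ.
rewrite (bigD1 (Ordinal Jk)) //= big1 ?addr0; last first.
  move=> j jn; case: ifP => // /and4P[_ _ _ /eqP e]; case/eqP: jn; exact/val_inj.
rewrite eqxx andbT; have -> : (#|` I| == (k - #|` J|)%N) = (#|` I| + #|` J| == k)%N by lia.
by case: strip; case: strip; case: eqP.
Qed.

End Reciprocity.

Definition only_rows (l : seq (bool * nat)) := all (fun p => p.1) l.

Lemma strip_count_linear (n : nat) (c : 'I_n -> int) (t : 'I_n -> seq (bool * nat)) l1 :
  (forall X, \sum_(i < n) c i * strip_count X (t i) = 0) ->
  forall X, \sum_(i < n) c i * strip_count X (l1 ++ t i) = 0.
Proof.
move=> H; elim: l1 => [|[d k] l1 IH] X //=.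
under eq_bigr do rewrite mulr_sumr.
by rewrite exchange_big big1.
Qed.

(** A vertical strip of size [k] weighs [k + 1], so that even the removal of an empty one lowers the
    weight. *)
Definition col_weight (l : seq (bool * nat)) := sumn [seq if p.1 then 0%N else p.2.+1 | p <- l].

(** Reciprocity solves for a vertical strip in terms of horizontal strips followed by smaller
    vertical ones, with coefficients that do not depend on the diagram. *)
Lemma strip_count_rows_all X Y :
  (forall l, only_rows l -> strip_count X l = strip_count Y l) ->
  forall l, strip_count X l = strip_count Y l.
Proof.
move=> H l; have [n] := ubnP (col_weight l); elim: n l => // n IH l ln.
have [ol|] := boolP (only_rows l); first exact: H.
rewrite /only_rows => /allPn[[d k] /=]; case: d => // lmem _; case/splitPr: lmem ln => l1 l2 ln.
have wl1 d' k' l2' : col_weight (l1 ++ (d', k') :: l2') =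
    (col_weight l1 + ((if d' then 0 else k'.+1) + col_weight l2'))%N.
  by rewrite /col_weight map_cat sumn_cat.
have drop0 Z d' l2' : strip_count Z (l1 ++ (d', 0%N) :: l2') = strip_count Z (l1 ++ l2').
  elim: (l1) Z => [|[d'' k''] l1' IH'] Z /=; first exact: strip_count0.
  by apply: eq_bigr => I _; exact: IH'.
case: k ln => [|k] ln.
  rewrite !drop0; apply: IH; move: ln; rewrite wl1 /col_weight map_cat sumn_cat /=; lia.
have R := @strip_count_linear k.+2 (fun j => (-1) ^+ j)
  (fun j => (true, k.+1 - j)%N :: (false, j : nat) :: l2) l1
  (fun Z => strip_reciprocity Z l2 (ltn0Sn k)).
have := R X; rewrite big_ord_recr /= subnn; have := R Y; rewrite big_ord_recr /= subnn.
have dropH Z : strip_count Z (l1 ++ (true, 0%N) :: (false, k.+1) :: l2)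
    = strip_count Z (l1 ++ (false, k.+1) :: l2) by exact: drop0.
rewrite !dropH.
have -> : \sum_(i < k.+1) (-1) ^+ i * strip_count X (l1 ++ (true, k.+1 - i)%N :: (false, i : nat) :: l2)
   = \sum_(i < k.+1) (-1) ^+ i * strip_count Y (l1 ++ (true, k.+1 - i)%N :: (false, i : nat) :: l2).
  apply: eq_bigr => i _; congr (_ * _); apply: IH; move: ln.
  by rewrite !wl1 /col_weight /=; have := ltn_ord i; lia.
move=> hY hX; have /addrI/mulfI := etrans hX (esym hY); apply.
by rewrite signr_eq0.
Qed.

Section StripImage.

Variables (f : box -> box) (g : bool -> bool).
Hypothesis f_inj : injective f.
Hypothesis f_nw : forall a b, northwest (f a) (f b) = northwest a b.
Hypothesis f_line : forall d a b, (if d then (f a).2 == (f b).2 else (f a).1 == (f b).1) =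
  (if g d then a.2 == b.2 else a.1 == b.1).

Let img (X : diagram) : diagram := [fset f b | b in X].

Let in_img X b : (f b \in img X) = (b \in X).
Proof. exact: mem_imfset. Qed.

Let img_inj : injective img.
Proof. by move=> X Y /fsetP e; apply/fsetP => b; have := e (f b); rewrite !in_img. Qed.

Let img_eq0 X : (img X == fset0) = (X == fset0).
Proof. by apply/eqP/eqP => [e|->]; [apply: img_inj; rewrite e |]; rewrite /img imfset0. Qed.

Let img_strip d X I : strip d (img X) (img I) = strip (g d) X I.
Proof.
apply/stripP/stripP => -[h1 h2 h3]; split.
- by apply/fsubsetP => b bI; rewrite -in_img; apply: (fsubsetP h1); rewrite in_img.
- by move=> a b aX bI ab; rewrite -in_img; apply: (h2 _ (f b)); rewrite ?in_img ?f_nw.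
- by move=> a b aI bI ab; apply: f_inj; apply: h3; rewrite ?in_img ?f_line.
- by apply/fsubsetP => _ /imfsetP[b /= bI ->]; rewrite in_img; apply: (fsubsetP h1).
- move=> _ _ /imfsetP[a /= aX ->] /imfsetP[b /= bI ->]; rewrite f_nw in_img; exact: h2.
- by move=> _ _ /imfsetP[a /= aX ->] /imfsetP[b /= bI ->]; rewrite f_line => /h3 ->.
Qed.

Lemma strip_count_image X l :
  strip_count [fset f b | b in X] l = strip_count X [seq (g p.1, p.2) | p <- l].
Proof.
rewrite -/(img X); elim: l X => [|[d k] l IH] X /=; first by rewrite img_eq0.
have imgD I : img X `\` img I = img (X `\` I).
  apply/fsetP => b; apply/fsetDP/imfsetP => [[/imfsetP[a /= aX ->]]|[a /=]].
    by rewrite in_img => aI; exists a; rewrite //= inE aI.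
  by rewrite inE => /andP[aI aX] ->; rewrite !in_img.
have card_img I : #|` img I| = #|` I| by rewrite card_imfset.
have img_sub I : (img I `<=` img X) = (I `<=` X).
  apply/fsubsetP/fsubsetP => h b; first by move=> bI; rewrite -in_img; apply: h; rewrite in_img.
  by case/imfsetP => a /= aI ->; rewrite in_img; exact: h.
rewrite -big_filter -[RHS]big_filter.
have pt : perm_eq [seq I <- enum_fset (fpowerset (img X)) | strip d (img X) I && (#|` I| == k)]
   (map img [seq I <- enum_fset (fpowerset X) | strip (g d) X I && (#|` I| == k)]).
  apply: uniq_perm; rewrite ?filter_uniq ?fset_uniq ?map_inj_uniq ?filter_uniq ?fset_uniq //.
  move=> J; apply/idP/mapP => [|[I]].
    rewrite mem_filter fpowersetE => /andP[/andP[h1 h2] h3].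
    have JE : J = img [fset b in X | f b \in J].
      apply/fsetP => b; apply/idP/imfsetP => [bJ|[a /=]]; last by rewrite !inE => /andP[_ h] ->.
      by have /imfsetP[a /= aX e] := fsubsetP h3 _ bJ; exists a => //=; rewrite !inE aX -e.
    exists [fset b in X | f b \in J] => //.
    by rewrite mem_filter fpowersetE -img_sub -img_strip -card_img -!JE h1 h2 h3.
  rewrite !mem_filter !fpowersetE => /andP[/andP[h1 h2] h3] ->.
  by rewrite img_sub h3 img_strip h1 card_img h2.
by rewrite (perm_big _ pt) /= big_map; apply: eq_bigr => I _; rewrite imgD IH.
Qed.

End StripImage.

Lemma in_transpose (X : diagram) (b : box) : (b \in transpose X) = ((b.2, b.1) \in X).
Proof.
apply/imfsetP/idP => [[a aX ->]|bX] /=; first by rewrite -surjective_pairing.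
by exists (b.2, b.1) => //=; rewrite -surjective_pairing.
Qed.

Lemma transposeK : involutive transpose.
Proof. by move=> X; apply/fsetP => b; rewrite !in_transpose /= -surjective_pairing. Qed.

Lemma strip_count_transpose X l :
  strip_count (transpose X) l = strip_count X [seq (~~ p.1, p.2) | p <- l].
Proof.
apply: (@strip_count_image (fun b => (b.2, b.1)) negb).
- by move=> [a1 a2] [b1 b2] /= [-> ->].
- by move=> a b; rewrite /northwest /= orbC.
- by case.
Qed.

Lemma strip_count_translate v X l : strip_count (translate v X) l = strip_count X l.
Proof.
rewrite (@strip_count_image (fun b => b + v) id).
- by congr strip_count; elim: l => [|[d k] l /= ->].
- exact: addIr.
- by move=> a b; rewrite /northwest /= !(inj_eq (addIr _)) !lerD2r.
- by case=> a b; rewrite /= (inj_eq (addIr _)).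
Qed.

(** * Monomial coefficients of skew Schur functions *)

Section StripCoefficients.

Variables (X : diagram) (n : nat) (mu : nat -> nat).
Implicit Types (A I : diagram) (t : {ffun X -> 'I_n.+1}).

Definition ordered (t : {ffun X -> 'I_n.+1}) (a b : X) : bool :=
  (((val a).1 == (val b).1) && ((val a).2 <= (val b).2) ==> (t a <= t b)%N)
  && (((val a).2 == (val b).2) && ((val a).1 < (val b).1) ==> (t a < t b)%N).

(* Fillings of A with entries at least i and with mu j entries equal to j; off A
   the value is a dummy. *)
Definition fills A (i : nat) (t : {ffun X -> 'I_n.+1}) : bool :=
  [&& [forall a : X, (val a \in A) ==> (i <= t a)%N],
      [forall a : X, (val a \notin A) ==> (t a == ord0)],
      [forall a : X, forall b : X, (val a \in A) && (val b \in A) ==> ordered t a b]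
    & [forall j : 'I_n.+1, (i <= j)%N ==>
         (#|[set a : X | (val a \in A) && (t a == j)]| == mu j)]].

Lemma fillsP A i t : reflect
  [/\ forall a : X, val a \in A -> (i <= t a)%N,
      forall a : X, val a \notin A -> t a = ord0,
      forall a b : X, val a \in A -> val b \in A -> ordered t a b
    & forall j : 'I_n.+1, (i <= j)%N -> #|[set a : X | (val a \in A) && (t a == j)]| = mu j]
  (fills A i t).
Proof.
apply: (iffP and4P) => [[/forallP h1 /forallP h2 /forallP h3 /forallP h4]|[h1 h2 h3 h4]]; split.
- by move=> a; exact/implyP.
- by move=> a aA; apply/eqP; move: aA; exact/implyP.
- by move=> a b aA bA; move/forallP: (h3 a) => /(_ b) /implyP; apply; rewrite aA.
- by move=> j ij; apply/eqP; move: ij; exact/implyP.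
- by apply/forallP => a; apply/implyP; exact: h1.
- by apply/forallP => a; apply/implyP => aA; apply/eqP; exact: h2.
- by apply/forallP => a; apply/forallP => b; apply/implyP => /andP[aA bA]; exact: h3.
- by apply/forallP => j; apply/implyP => ij; apply/eqP; exact: h4.
Qed.

Definition level A (i : nat) t : diagram :=
  [fset b in A | [exists a : X, (val a == b) && (t a == i :> nat)]].

Lemma in_level A i t (a : X) : (val a \in level A i t) = (val a \in A) && (t a == i :> nat).
Proof.
rewrite !inE; congr (_ && _); apply/existsP/idP => [[b /andP[/eqP /val_inj ->]]//|ta].
by exists a; rewrite eqxx.
Qed.

Definition filling_count A i : int := \sum_(t | fills A i t) 1.

Lemma ordered_nw t (a b : X) : ordered t a b -> northwest (val a) (val b) -> (t a <= t b)%N.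
Proof.
case/andP => /implyP h1 /implyP h2 /orP[/h1//|/andP[/eqP e1]].
rewrite le_eqVlt => /orP[/eqP e2|e2]; last by apply/ltnW/h2; rewrite e1 eqxx.
by have -> : a = b by apply/val_inj/box_eq.
Qed.

Section Step.

Variables (A I : diagram) (i : nat).
Hypothesis AX : A `<=` X.
Hypothesis IA : I `<=` A.
Hypothesis lt_i : (i < n.+1)%N.

Let up t : {ffun X -> 'I_n.+1} := [ffun b : X => if val b \in I then inord i else t b].
Let down t : {ffun X -> 'I_n.+1} := [ffun b : X => if val b \in I then ord0 else t b].

Let card_I : #|[set a : X | val a \in I]| = #|` I|.
Proof. by rewrite -(@card_fsub _ X I) ?(fsubset_trans IA) //; apply: eq_card => a; rewrite !inE. Qed.

Let upI t (a : X) : val a \in I -> up t a = i :> nat.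
Proof. by move=> aI; rewrite ffunE aI inordK. Qed.
Let upN t (a : X) : val a \notin I -> up t a = t a.
Proof. by move=> aI; rewrite ffunE (negbTE aI). Qed.
Let IsA (b : box) : b \in I -> b \in A. Proof. exact: (fsubsetP IA). Qed.

Let count_above t (j : 'I_n.+1) : (i < j)%N ->
  [set a : X | (val a \in A) && (up t a == j)] = [set a : X | (val a \in A `\` I) && (t a == j)].
Proof.
move=> ij; apply/setP => a; rewrite !inE; have [aI|aI] := boolP (val a \in I); last by rewrite upN.
by rewrite /=; apply/negbTE/negP => /andP[_ /eqP e]; move: ij; rewrite -e upI ?ltnn.
Qed.

(** The boxes with the least entry [i] form a horizontal strip. [up] writes [i] on [I] and [down]
    restores the dummy value; the statement has the shape that reindexing along this pair
    requires. *)
Lemma fills_step t :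
  (fills A i (up t) && (level A i (up t) == I)) && (down (up t) == t) =
  (strip true A I && (#|` I| == mu i)) && fills (A `\` I) i.+1 t.
Proof.
apply/idP/idP.
- case/andP => /andP[/fillsP[lo out ord cnt] /eqP lv] /eqP dn.
  have tI (a : X) : val a \in I -> t a = ord0 by move=> aI; rewrite -dn ffunE aI.
  have notI (a : X) : val a \in A -> val a \notin I -> (i < t a)%N.
    move=> aA aI; rewrite ltn_neqAle eq_sym -(upN t aI) lo // andbT.
    by move: (aI); rewrite -{1}lv in_level aA.
  have sT : strip true A I.
    apply/stripP; split => //.
    + move=> a b aA bI ab; have aX := fsubsetP AX _ aA; have bX := fsubsetP AX _ (IsA bI).
      have := ordered_nw (ord [` aX] [` bX] aA (IsA bI)) ab; rewrite (upI _ (a := [` bX])) // => le_i.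
      by rewrite -lv (in_level _ _ _ [` aX]) aA eqn_leq le_i lo.
    + move=> a b aI bI /eqP e.
      have aX := fsubsetP AX _ (IsA aI); have bX := fsubsetP AX _ (IsA bI).
      have /andP[_ /implyP h1] := ord [` aX] [` bX] (IsA aI) (IsA bI).
      have /andP[_ /implyP h2] := ord [` bX] [` aX] (IsA bI) (IsA aI).
      move: h1 h2; rewrite /= e eqxx !(upI _ (a := [` aX])) ?(upI _ (a := [` bX])) // !ltnn /=.
      by case: (ltgtP a.1 b.1) => [_ /(_ isT)//|_ _ /(_ isT)//|e1 _ _]; apply: box_eq.
  apply/andP; split; first (apply/andP; split => //).
    have := cnt (inord i); rewrite inordK // => /(_ (leqnn i)) <-; rewrite -card_I.
    apply/eqP/eq_card => a; rewrite !inE -{1}lv in_level.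
    by congr (_ && _); rewrite -val_eqE /= inordK.
  apply/fillsP; split.
  + by move=> a; rewrite inE => /andP[aI aA]; exact: notI.
  + move=> a; rewrite inE negb_and negbK => /orP[/tI//|aA].
    have aI : val a \notin I by apply: contra aA; exact: IsA.
    by rewrite -(upN t aI) out.
  + move=> a b; rewrite !inE => /andP[aI aA] /andP[bI bA].
    by have := ord a b aA bA; rewrite /ordered !upN.
  + by move=> j ij; rewrite -count_above // cnt // ltnW.
- case/andP => /andP[/stripP[_ cl one] /eqP cI] /fillsP[lo out ord cnt].
  have outI (a : X) : val a \in I -> t a = ord0 by move=> aI; apply: out; rewrite inE aI.
  have lvE : level A i (up t) = I.
    apply/fsetP => b; have [bA|bA] := boolP (b \in A); last first.
      by rewrite !inE (negbTE bA); apply/esym/negbTE; apply: contra bA; exact: IsA.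
    have bX := fsubsetP AX _ bA; rewrite (in_level _ _ _ [` bX]) bA /=.
    have [bI|bI] := boolP (b \in I); first by rewrite upI ?eqxx.
    rewrite upN //; apply/negbTE; rewrite neq_ltn orbC lo // inE /= bI //.
  rewrite lvE eqxx andbT; apply/andP; split; last first.
    apply/eqP/ffunP => a; rewrite !ffunE; have [aI|//] := boolP (val a \in I).
    by rewrite outI.
  apply/fillsP; split.
  + move=> a aA; have [aI|aI] := boolP (val a \in I); first by rewrite upI.
    by rewrite upN // ltnW // lo // inE aI.
  + move=> a aA; have aI : val a \notin I by apply: contra aA; exact: IsA.
    by rewrite upN // out // inE (negbTE aA) andbF.
  + move=> a b aA bA; have [bI|bI] := boolP (val b \in I); have [aI|aI] := boolP (val a \in I).
    * rewrite /ordered !upI // leqnn implybT /= ltnn implybF; apply/negP => /andP[e1 e2].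
      by have e := one _ _ aI bI e1; move: e2; rewrite e ltxx.
    * have nab : ~~ northwest (val a) (val b) by apply: contra aI; exact: cl.
      move: nab; rewrite /ordered /northwest negb_or => /andP[/negbTE -> nc] /=.
      by apply/implyP => /andP[e1 /ltW e2]; move: nc; rewrite e1 e2.
    * have lt_ab : (up t a < up t b)%N by rewrite upI // upN // lo // inE bI.
      by rewrite /ordered lt_ab (ltnW lt_ab) !implybT.
    * by have := ord a b; rewrite !inE aI bI aA bA /ordered !upN // => ->.
  + move=> j; rewrite leq_eqVlt => /orP[/eqP ij|ij]; last by rewrite count_above // cnt.
    rewrite -ij -cI -card_I; apply: eq_card => a.
    have := in_level A i (up t) a; rewrite lvE !inE => ->.
    by congr (_ && _); rewrite -val_eqE /= -ij.
Qed.

Lemma filling_count_step :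
  \sum_(t | fills A i t && (level A i t == I)) 1 =
  if strip true A I && (#|` I| == mu i) then filling_count (A `\` I) i.+1 else 0.
Proof.
rewrite (reindex_onto up down) => [|t /andP[_ /eqP lv]].
  rewrite (eq_bigl _ _ fills_step); case: ifP => [_|h]; first by apply: eq_bigl.
  by rewrite big_pred0.
apply/ffunP => a; rewrite !ffunE; case: ifP => [aI|->//].
have : val a \in level A i t by rewrite lv.
by rewrite in_level => /andP[_ /eqP e]; apply/val_inj; rewrite /= inordK.
Qed.

End Step.

Lemma filling_count_rec A i : A `<=` X -> (i < n.+1)%N ->
  filling_count A i =
  \sum_(I <- fpowerset A | strip true A I && (#|` I| == mu i)) filling_count (A `\` I) i.+1.
Proof.
move=> AX lt_i; rewrite big_mkcond big_seq /=.
transitivity (\sum_(I <- fpowerset A | I \in fpowerset A)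
   \sum_(t | fills A i t && (level A i t == I)) 1 : int); last first.
  by apply: eq_bigr => I; rewrite fpowersetE => IA; rewrite filling_count_step.
rewrite -big_seq (eq_bigr (fun I => \sum_(t | fills A i t) (level A i t == I)%:R)); last first.
  move=> I _; rewrite big_mkcondr; apply: eq_bigr => t _; by case: eqP.
rewrite exchange_big; apply: eq_bigr => t _ /=.
rewrite (bigD1_seq (level A i t)) ?fset_uniq //=; last first.
  by rewrite fpowersetE; apply/fsubsetP => b; rewrite inE => /andP[].
by rewrite eqxx big1 ?addr0 // => I /negbTE h; rewrite eq_sym h.
Qed.

Lemma filling_count_end A : A `<=` X -> filling_count A n.+1 = (A == fset0)%:R.
Proof.
move=> AX; have [->|] := eqVneq A fset0; last first.
  case/fset0Pn => b bA; rewrite /filling_count big_pred0 // => t.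
  apply/negbTE/negP => /fillsP[lo _ _ _]; have := lo [` fsubsetP AX _ bA] bA.
  by rewrite leqNgt ltn_ord.
rewrite /filling_count (bigD1 [ffun=> ord0]) /=.
  rewrite big1 ?addr0 // => t /andP[/fillsP[_ out _ _] /eqP[]].
  by apply/ffunP => a; rewrite ffunE out // in_fset0.
apply/fillsP; split => [a|a _|a b|j]; rewrite ?in_fset0 ?ffunE //.
by rewrite leqNgt ltn_ord.
Qed.

Lemma filling_count_strip A i : A `<=` X -> (i <= n.+1)%N ->
  filling_count A i = strip_count A [seq (true, mu j) | j <- iota i (n.+1 - i)].
Proof.
move=> AX; move E: (n.+1 - i)%N => k; elim: k A i AX E => [|k IH] A i AX E le_i /=.
  have -> : i = n.+1 by apply/eqP; rewrite eqn_leq le_i -subn_eq0 E.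
  exact: filling_count_end.
have lt_i : (i < n.+1)%N by rewrite -subn_gt0 E.
rewrite filling_count_rec //; apply: eq_bigr => I _; apply: IH => //.
  exact: fsubset_trans (fsubsetDl _ _) AX.
by rewrite subnS E.
Qed.

End StripCoefficients.

(** A semistandard filling is the chain of its level sets, each a horizontal strip of what the
    smaller entries leave. *)
Lemma mcoeff_skew_schur X n (m : 'X_{1..n.+1}) :
  (skew_schur X n.+1)@_m = strip_count X [seq (true, m (inord j)) | j <- iota 0 n.+1].
Proof.
have E := @filling_count_strip X n (fun j => m (inord j)) X 0 (fsubset_refl X) (leq0n _).
rewrite subn0 in E; rewrite -E.
rewrite /skew_schur raddf_sum /= big_mkcond /filling_count [RHS]big_mkcond /=.
apply: eq_bigr => t _; rewrite mprodXE mcoeffX.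
have -> : fills (fun j => m (inord j)) X 0 t =
    semistandard t && (\big[mnm_add/0%MM]_(i : X) U_(t i)%MM == m).
  apply/fillsP/andP => [[_ _ h3 h4]|[/forallP h3 /eqP h4]].
    split; first by apply/forallP => a; apply/forallP => b; exact: (h3 a b (valP a) (valP b)).
    apply/eqP/mnmP => j; rewrite mnm_sumE.
    have := h4 j (leq0n _); rewrite inord_val => <-; rewrite -sum1_card [RHS]big_mkcond /=.
    by apply: eq_bigr => a _; rewrite mnm1E inE (valP a) /=; case: eqP.
  split => //.
  - by move=> a; rewrite (valP a).
  - by move=> a b _ _; move/forallP: (h3 a); apply.
  - move=> j _; rewrite inord_val -h4 mnm_sumE -sum1_card big_mkcond /=.
    by apply: eq_bigr => a _; rewrite mnm1E inE (valP a) /=; case: eqP.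
by case: semistandard; case: eqP.
Qed.

(** Horizontal strips give the coefficients, and [strip_count_rows_all] adds the vertical ones. With
    no variables the function only detects whether the diagram is empty, as does the empty list. *)
Lemma equivalent_strip X Y :
  equivalent X Y <-> forall l, strip_count X l = strip_count Y l.
Proof.
split=> [XY|H n].
  apply: strip_count_rows_all => l ol.
  wlog : l ol / l != [::].
    case: l ol => [|p l] ol h; last exact: h.
    by have := h [:: (true, 0%N)] isT isT; rewrite !strip_count0.
  case: l ol => [//|p l] ol _; pose s := map snd (p :: l).
  pose m : 'X_{1..(size l).+1} := [multinom nth 0%N s i | i < (size l).+1].
  have -> : p :: l = [seq (true, m (inord j)) | j <- iota 0 (size l).+1].
    apply: (@eq_from_nth _ (true, 0%N)) => [|i Hi]; first by rewrite size_map size_iota.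
    rewrite (nth_map 0%N) ?size_iota // nth_iota // add0n mnmE inordK //.
    rewrite /s (nth_map (true, 0%N)) //; have := all_nthP (true, 0%N) ol i Hi.
    by case: nth => d k /= ->.
  by rewrite -!mcoeff_skew_schur XY.
case: n => [|n]; last by apply/mpolyP => m; rewrite !mcoeff_skew_schur H.
have := H [::]; rewrite /=; have [X0|X0] := eqVneq X fset0; have [Y0|Y0] := eqVneq Y fset0 => // _.
  by rewrite X0 Y0.
case/fset0Pn: X0 => a aX; case/fset0Pn: Y0 => b bY.
by rewrite /skew_schur !big1 // => t _; [case: (t [` bY]) | case: (t [` aX])].
Qed.

Lemma equivalent_sym X Y : equivalent X Y -> equivalent Y X.
Proof. by move=> h n; rewrite h. Qed.

Lemma equivalent_trans X Y Z : equivalent X Y -> equivalent Y Z -> equivalent X Z.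
Proof. by move=> h1 h2 n; rewrite h1 h2. Qed.

Lemma equivalent_transpose X Y : equivalent X Y -> equivalent (transpose X) (transpose Y).
Proof.
by move=> /equivalent_strip H; apply/equivalent_strip => l; rewrite !strip_count_transpose H.
Qed.

(** * Trimming, and the row counts that equivalence preserves *)

(** Order convexity, which is shown below to characterize skew diagrams; it is far easier to
    transport through trimming, rotation and transposition than a pair of partitions. *)
Definition convex (X : diagram) : Prop := forall a b c : box, a \in X -> b \in X ->
  a.1 <= c.1 -> c.1 <= b.1 -> a.2 <= c.2 -> c.2 <= b.2 -> c \in X.

Definition trim (X : diagram) : diagram := [fset b in X | north b \in X].
Definition columns (X : diagram) : {fset int} := [fset b.2 | b in X].
Definition rows (X : diagram) : {fset int} := [fset b.1 | b in X].

Lemma in_trim X (b : box) : (b \in trim X) = (b \in X) && (north b \in X).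
Proof. by rewrite !inE. Qed.

Lemma columnsP X x : reflect (exists2 b : box, b \in X & x = b.2) (x \in columns X).
Proof. exact: imfsetP. Qed.

Lemma rowsP X x : reflect (exists2 b : box, b \in X & x = b.1) (x \in rows X).
Proof. exact: imfsetP. Qed.

Lemma northE (b : box) : north b = (b.1 - 1, b.2).
Proof. by rewrite /north; apply: box_eq; rewrite /= ?addr0. Qed.

Lemma convex_trim X : convex X -> convex (trim X).
Proof.
move=> cX a b c; rewrite !in_trim !northE => /andP[aX naX] /andP[bX nbX] h1 h2 h3 h4.
rewrite (cX a b c) //=; apply: (cX _ _ (c.1 - 1, c.2) naX nbX) => //=; by rewrite lerD2r.
Qed.

Section Tops.

Variable X : diagram.
Hypothesis cX : convex X.

Lemma below_trim (a b : box) : a \in X -> b \in X -> a.2 = b.2 -> a.1 < b.1 -> b \in trim X.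
Proof.
move=> aX bX e lt_ab; rewrite in_trim bX northE; apply: (cX aX bX) => //=; rewrite ?e //; lia.
Qed.

Lemma strip_tops : strip true X (X `\` trim X).
Proof.
have one (a b : box) : a \in X -> b \in X `\` trim X -> a.2 = b.2 -> a.1 <= b.1 -> a = b.
  move=> aX; rewrite inE => /andP[bt bX] e; rewrite le_eqVlt => /orP[/eqP e1|lt_ab].
    exact: box_eq.
  by rewrite (below_trim aX bX e lt_ab) in bt.
apply/stripP; split; first exact: fsubsetDl.
- move=> a b aX bT /orP[/andP[/eqP e1 le2]|/andP[/eqP e1 le2]]; last by rewrite (one a b).
  move: bT; rewrite !inE aX andbT /= => /andP[bt bX]; rewrite bX /= in bt.
  apply: contra bt; rewrite !northE => naX; apply: (cX naX bX) => //=; rewrite ?e1 //; lia.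
- move=> a b aT bT /eqP e; case: (leP a.1 b.1) => [h|/ltW h].
    by apply: one => //; move: aT; rewrite inE => /andP[].
  by apply/esym/one => //; move: bT; rewrite inE => /andP[].
Qed.

Lemma card_strip I : strip true X I -> (#|` I| <= #|` columns X|)%N.
Proof.
case/stripP => IX _ one; have <- : #|` [fset b.2 | b in I]| = #|` I|.
  by rewrite card_in_imfset // => a b aI bI /= e; apply: one => //; apply/eqP.
by apply: fsubset_leq_card; apply/fsubsetP => x /imfsetP[b bI ->]; apply/columnsP; exists b => //;
  apply: (fsubsetP IX).
Qed.

(** A strip of this size meets every column; being closed upwards it contains the top box of each,
    and it has room for nothing else. *)
Lemma full_strip I : strip true X I -> #|` I| = #|` columns X| -> I = X `\` trim X.
Proof.
case/stripP => IX cl one cI.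
have col : [fset b.2 | b in I] = columns X.
  apply/eqP; rewrite eqEfcard -cI; apply/andP; split.
    apply/fsubsetP => x /imfsetP[b bI ->]; apply/columnsP; exists b => //; exact: (fsubsetP IX).
  by rewrite card_in_imfset // => a b aI bI /= e; apply: one => //; apply/eqP.
apply/fsetP => b; apply/idP/idP => [bI|].
  have bX := fsubsetP IX _ bI; rewrite inE bX andbT in_trim bX /=; apply/negP => nbX.
  have nw : northwest (north b) b by rewrite /northwest northE /= eqxx /=; apply/orP; right; lia.
  have e : north b = b by apply: one => //; [exact: cl nw | rewrite northE].
  by move/(congr1 fst): e; rewrite northE /=; lia.
rewrite inE => /andP[bt bX]; have : b.2 \in columns X by apply/columnsP; exists b.
rewrite -col => /imfsetP[b' /= b'I e]; have b'X := fsubsetP IX _ b'I.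
case: (leP b.1 b'.1) => h; first by apply: (cl b b') => //; rewrite /northwest e eqxx h orbT.
by rewrite (below_trim b'X bX _ h) in bt.
Qed.

Lemma card_tops : #|` X `\` trim X| = #|` columns X|.
Proof.
apply/eqP; rewrite eqn_leq card_strip ?strip_tops //=.
have /stripP[_ _ one] := strip_tops.
have <- : #|` [fset b.2 | b in X `\` trim X]| = #|` X `\` trim X|.
  by rewrite card_in_imfset // => a b aI bI /= e; apply: one => //; apply/eqP.
apply: fsubset_leq_card; apply/fsubsetP => x /columnsP[b bX ->].
pose Y := [fset a in X | a.2 == b.2].
have Y0 : Y != fset0 by apply/fset0Pn; exists b; rewrite !inE bX eqxx.
have [z] := fset_argmin (fun a => a.1) Y0; rewrite !inE => /andP[zX /eqP zb] zmin.
apply/imfsetP; exists z => //=; rewrite !inE zX andbT /=; apply/negP => nz.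
have := zmin (north z); rewrite !inE nz northE /= zb eqxx => /(_ isT); lia.
Qed.

Lemma strip_count_tops l : strip_count X ((true, #|` columns X|) :: l) = strip_count (trim X) l.
Proof.
rewrite /= big_mkcond (bigD1_seq (X `\` trim X)) ?fset_uniq ?fpowersetE ?fsubsetDl //.
rewrite strip_tops card_tops eqxx /= big1 ?addr0.
  congr strip_count; apply/fsetP => b; rewrite !inE; by case: (b \in X); case: (north b \in X).
move=> I nI; case: ifP => // /andP[sI /eqP cI]; case/eqP: nI; exact: full_strip.
Qed.

Lemma strip_count_wide k l : (#|` columns X| < k)%N -> strip_count X ((true, k) :: l) = 0.
Proof.
move=> hk; rewrite /= big1 // => I /andP[/card_strip h /eqP e].
by move: hk; rewrite -e ltnNge h.
Qed.

End Tops.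

(** Peel off the unique full strip again and again. Consequently the number of columns is the
    largest size of a first strip with a nonzero count, hence an invariant. *)
Lemma strip_count_unit X : convex X -> exists l, strip_count X l = 1.
Proof.
have [n] := ubnP #|` X|; elim: n X => // n IH X Xn cX.
have [->|X0] := eqVneq X fset0; first by exists [::]; rewrite /= ?eqxx.
have [|l Hl] := IH (trim X) _ (convex_trim cX); last first.
  by exists ((true, #|` columns X|) :: l); rewrite strip_count_tops.
rewrite -ltnS; apply: leq_trans Xn; rewrite ltnS.
have sub : trim X `<=` X by apply/fsubsetP => b; rewrite in_trim => /andP[].
have /fset0Pn[b bX] := X0.
have : (0 < #|` X `\` trim X|)%N.
  rewrite card_tops // cardfs_gt0; apply/fset0Pn; exists b.2; apply/columnsP; by exists b.
have := fsubset_leq_card sub; rewrite cardfsDS // subn_gt0 //.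
Qed.

Lemma equivalent_trim X Y : convex X -> convex Y -> equivalent X Y ->
  #|` columns X| = #|` columns Y| /\ equivalent (trim X) (trim Y).
Proof.
move=> cX cY /equivalent_strip H.
have le X' Y' : convex X' -> convex Y' -> (forall l, strip_count X' l = strip_count Y' l) ->
    (#|` columns X'| <= #|` columns Y'|)%N.
  move=> cX' cY' H'; rewrite leqNgt; apply/negP => lt.
  have [l Hl] := strip_count_unit (convex_trim cX').
  by have := H' ((true, #|` columns X'|) :: l); rewrite strip_count_tops // Hl strip_count_wide.
have e : #|` columns X| = #|` columns Y| by apply/eqP; rewrite eqn_leq !le.
split => //; apply/equivalent_strip => l.
by rewrite -!strip_count_tops // e H.
Qed.

Definition ltrim (X : diagram) := transpose (trim (transpose X)).

Lemma convex_transpose X : convex X -> convex (transpose X).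
Proof. by move=> cX a b c; rewrite !in_transpose => ha hb *; apply: (cX _ _ _ ha hb). Qed.

Lemma columns_transpose X : columns (transpose X) = rows X.
Proof.
apply/fsetP => x; apply/columnsP/rowsP => [[b]|[b bX ->]].
  by rewrite in_transpose => bX ->; exists (b.2, b.1).
by exists (b.2, b.1); rewrite // in_transpose -surjective_pairing.
Qed.

Lemma convex_ltrim X : convex X -> convex (ltrim X).
Proof. by move=> cX; apply/convex_transpose/convex_trim/convex_transpose. Qed.

Lemma equivalent_ltrim X Y : convex X -> convex Y -> equivalent X Y ->
  #|` rows X| = #|` rows Y| /\ equivalent (ltrim X) (ltrim Y).
Proof.
move=> cX cY XY.
have := equivalent_trim (convex_transpose cX) (convex_transpose cY) (equivalent_transpose XY).
by rewrite !columns_transpose => -[-> /equivalent_transpose].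
Qed.

Lemma convex_iter_ltrim k X : convex X -> convex (iter k ltrim X).
Proof. by move=> cX; elim: k => //= k IH; exact: convex_ltrim. Qed.

Lemma in_ltrim X (b : box) : (b \in ltrim X) = (b \in X) && ((b.1, b.2 - 1) \in X).
Proof. by rewrite in_transpose in_trim northE !in_transpose /= -surjective_pairing. Qed.

Lemma in_iter_ltrim X k (b : box) : convex X ->
  (b \in iter k ltrim X) = (b \in X) && ((b.1, b.2 - k%:Z) \in X).
Proof.
move=> cX; elim: k b => [|k IH] b /=.
  by rewrite subr0 -surjective_pairing andbb.
rewrite in_ltrim !IH /=.
have -> : b.2 - 1 - k%:Z = b.2 - k.+1%:Z by lia.
apply/idP/idP => [/andP[/andP[-> _] /andP[_ ->]]//|/andP[bX b'X]].
by rewrite bX b'X !(cX _ _ _ b'X bX) //=; lia.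
Qed.

(** After [trim], a row retains the columns it shares with the row above. It survives [k] further
    left trims exactly if at least [k + 1] columns are shared, so the invariants count pairs of rows
    by overlap. *)
Lemma equivalent_rows X Y : convex X -> convex Y -> equivalent X Y ->
  #|` rows X| = #|` rows Y| /\
  forall k, #|` rows (iter k ltrim (trim X))| = #|` rows (iter k ltrim (trim Y))|.
Proof.
move=> cX cY XY; have [eX _] := equivalent_ltrim cX cY XY; split => // k.
have [_ tXY] := equivalent_trim cX cY XY.
suff /(equivalent_ltrim (convex_iter_ltrim (convex_trim cX))
        (convex_iter_ltrim (convex_trim cY)))[] :
    equivalent (iter k ltrim (trim X)) (iter k ltrim (trim Y)) by [].
elim: k => //= k IH.
have [] // := equivalent_ltrim (convex_iter_ltrim (convex_trim cX))
  (convex_iter_ltrim (convex_trim cY)) IH.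
Qed.

(** * Ribbons and boxdots from mark words *)

Lemma fstD (a b : box) : (a + b).1 = a.1 + b.1. Proof. by []. Qed.
Lemma sndD (a b : box) : (a + b).2 = a.2 + b.2. Proof. by []. Qed.
Lemma fstN (a : box) : (- a).1 = - a.1. Proof. by []. Qed.
Lemma sndN (a : box) : (- a).2 = - a.2. Proof. by []. Qed.
Definition boxE := (fstD, sndD, fstN, sndN).

Lemma in_translate (v : box) D (b : box) : (b \in translate v D) = (b - v \in D).
Proof.
apply/imfsetP/idP => [[a /= aD ->]|bD]; first by rewrite addrK.
by exists (b - v); rewrite //= subrK.
Qed.

Lemma in_rotate D (b : box) : (b \in rotate D) = (- b \in D).
Proof.
apply/imfsetP/idP => [[a /= aD ->]|bD]; first by rewrite opprK.
by exists (- b); rewrite //= opprK.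
Qed.

Lemma translateD v1 v2 D : translate v1 (translate v2 D) = translate (v2 + v1) D.
Proof. by apply/fsetP => b; rewrite !in_translate opprD addrA addrAC. Qed.

Lemma translate0 D : translate 0 D = D.
Proof. by apply/fsetP => b; rewrite in_translate subr0. Qed.

Lemma rotateK : involutive rotate.
Proof. by move=> D; apply/fsetP => b; rewrite !in_rotate opprK. Qed.

Lemma rotate_translate v D : rotate (translate v D) = translate (- v) (rotate D).
Proof. by apply/fsetP => b; rewrite !(in_rotate, in_translate) opprD opprK. Qed.

Lemma transpose_translate v D : transpose (translate v D) = translate (v.2, v.1) (transpose D).
Proof. by apply/fsetP => b; rewrite !(in_transpose, in_translate). Qed.

Lemma transpose_rotate D : transpose (rotate D) = rotate (transpose D).
Proof. by apply/fsetP => b; rewrite !(in_transpose, in_rotate). Qed.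

Lemma same_translate v D : same_diagram D (translate v D).
Proof. by apply/same_diagramP; exists v. Qed.

Lemma same_refl D : same_diagram D D.
Proof. by apply/same_diagramP; exists 0; rewrite translate0. Qed.

Lemma same_sym D E : same_diagram D E -> same_diagram E D.
Proof.
by case/same_diagramP => v ->; apply/same_diagramP; exists (- v); rewrite translateD subrr translate0.
Qed.

Lemma same_trans D E F : same_diagram D E -> same_diagram E F -> same_diagram D F.
Proof.
case/same_diagramP => v -> /same_diagramP[v' ->]; rewrite translateD; exact: same_translate.
Qed.

Lemma same_rotate D E : same_diagram D E -> same_diagram (rotate D) (rotate E).
Proof. by case/same_diagramP => v ->; rewrite rotate_translate; exact: same_translate. Qed.

Lemma same_transpose D E : same_diagram D E -> same_diagram (transpose D) (transpose E).
Proof. by case/same_diagramP => v ->; rewrite transpose_translate; exact: same_translate. Qed.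

Lemma same_equivalent D E : same_diagram D E -> equivalent D E.
Proof.
by case/same_diagramP => v ->; apply/equivalent_strip => l; rewrite strip_count_translate.
Qed.

Lemma convex_translate v D : convex D -> convex (translate v D).
Proof.
move=> cD a b c; rewrite !in_translate => ha hb *; apply: (cD _ _ _ ha hb); by rewrite !boxE lerD2r.
Qed.

Lemma convex_same D E : same_diagram D E -> convex D -> convex E.
Proof. by case/same_diagramP => v ->; exact: convex_translate. Qed.

Lemma convex_rotate D : convex D -> convex (rotate D).
Proof.
move=> cD a b c; rewrite !in_rotate => ha hb *; apply: (cD _ _ _ hb ha); by rewrite !boxE lerN2.
Qed.

Lemma in_row_of (p : box) n (b : box) : (b \in row_of p n) = (b.1 == p.1) && (p.2 <= b.2 < p.2 + n%:Z).
Proof.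
apply/imfsetP/idP => [[k /=]|/andP[/eqP e /andP[h1 h2]]].
  rewrite mem_iota => h ->; rewrite !boxE /= addr0 eqxx /=; lia.
exists (absz (b.2 - p.2)); first by rewrite /= mem_iota; lia.
apply: box_eq; rewrite !boxE /=; lia.
Qed.

(** * Skew diagrams as convex sets of boxes *)

Lemma in_skew_shape la mu (b : box) : b \in skew_shape la mu <->
  exists i : nat, [/\ (i < size la)%N, b.1 = i%:Z, (nth 0%N mu i)%:Z <= b.2
    & b.2 < (nth 0%N mu i + (nth 0%N la i - nth 0%N mu i))%N%:Z].
Proof.
split=> [/bigfcupP[i]|[i [h1 h2 h3 h4]]].
  rewrite mem_iota andbT add0n => hi; rewrite in_row_of /= => /andP[/eqP e /andP[h1 h2]].
  by exists i; split => //; rewrite PoszD.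
apply/bigfcupP; exists i; first by rewrite mem_iota h1.
by rewrite in_row_of /= h2 eqxx h3 -PoszD.
Qed.

Lemma partition_nth la i j : is_partition la -> (i <= j)%N -> (nth 0%N la j <= nth 0%N la i)%N.
Proof.
case/andP => sla _ ij; have [jl|jl] := ltnP j (size la); last by rewrite nth_default.
apply: (@sorted_leq_nth _ geq _ _ 0%N la sla i j) => //.
- by move=> a b c h1 h2; apply: leq_trans h2 h1.
- exact: leqnn.
- by rewrite inE (leq_ltn_trans ij).
Qed.

Lemma skew_convex D : skew_diagram D -> convex D.
Proof.
case=> la [mu [pla pmu lm /same_sym/convex_same]]; apply => a b c.
move=> /in_skew_shape[i [i1 i2 i3 i4]] /in_skew_shape[j [j1 j2 j3 j4]] h1 h2 h3 h4.
apply/in_skew_shape; exists (absz c.1).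
have ik : (i <= absz c.1)%N by lia.
have kj : (absz c.1 <= j)%N by lia.
have := partition_nth pla kj; have := partition_nth pmu ik; have := lm (absz c.1); have := lm i; have := lm j.
by split; lia.
Qed.

Lemma shape_partition (P : nat -> nat -> bool) H W :
  (forall i j i' j', (i' <= i)%N -> (j' <= j)%N -> P i j -> P i' j') ->
  (forall i j, P i j -> (i < H)%N && (j < W)%N) ->
  exists2 la, is_partition la & forall i j, (j < nth 0%N la i)%N = P i j.
Proof.
move=> down bnd.
have ex i : exists j, ~~ P i j by exists W; apply/negP => /bnd /andP[_]; rewrite ltnn.
pose r i := ex_minn (ex i).
have rP i j : (j < r i)%N = P i j.
  rewrite /r; case: ex_minnP => k nk kmin; apply/idP/idP => [jk|Pij].
    by apply/negPn/negP => /kmin; rewrite leqNgt jk.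
  by rewrite ltnNge; apply: contra nk => kj; apply: down Pij.
have exK : exists i, ~~ P i 0%N by exists H; apply/negP => /bnd /andP[]; rewrite ltnn.
case: (ex_minnP exK) => K nK Kmin.
have KP i : (i < K)%N = P i 0%N.
  apply/idP/idP => [iK|Pi]; first by apply/negPn/negP => /Kmin; rewrite leqNgt iK.
  by rewrite ltnNge; apply: contra nK => Ki; apply: down Pi.
have rmono i j : (i <= j)%N -> (r j <= r i)%N.
  move=> ij; rewrite leqNgt; apply/negP => h.
  by have := down _ _ i (r i) ij (leqnn _); rewrite -rP h -rP ltnn => /(_ isT).
exists [seq r i | i <- iota 0 K].
  apply/andP; split; last first.
    apply/mapP => -[i]; rewrite mem_iota add0n /= KP -rP => h e; by rewrite -e in h.
  apply: (@homo_sorted _ _ r leq geq) (iota_sorted 0 K) => i j /=; exact: rmono.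
move=> i j; have [iK|iK] := ltnP i K.
  by rewrite (nth_map 0%N) ?size_iota // nth_iota // add0n rP.
rewrite nth_default ?size_map ?size_iota // ltn0; apply/esym/negbTE/negP => Pij.
by move: iK; rewrite leqNgt KP (down _ _ _ _ (leqnn i) (leq0n j) Pij).
Qed.

Lemma has_boxP (p : box -> bool) (D : diagram) :
  reflect (exists2 b : box, b \in D & p b) (has p (enum_fset D)).
Proof. exact: hasP. Qed.

Lemma convex_skew D : convex D -> skew_diagram D.
Proof.
move=> cD; have [->|D0] := eqVneq D fset0.
  exists [::], [::]; split => //.
  have -> : skew_shape [::] [::] = fset0 by rewrite /skew_shape big_nil.
  exact: same_refl.
have [ra raD rmin] := fset_argmin (fun b => b.1) D0.
have [ca caD cmin] := fset_argmin (fun b => b.2) D0.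
pose r0 := ra.1; pose c0 := ca.2.
(* [below] asks for a box of [D] weakly southeast of the given place, [above] for one weakly
   northwest. The outer partition is the ideal [below], the inner one the part of it not yet reached
   by [above]; convexity recovers [D] as the difference. *)
pose below i j := has (fun b : box => (i%:Z + r0 <= b.1) && (j%:Z + c0 <= b.2)) (enum_fset D).
pose above i j := has (fun b : box => (b.1 <= i%:Z + r0) && (b.2 <= j%:Z + c0)) (enum_fset D).
pose H := \max_(b <- enum_fset D) (absz ((b : box).1 - r0)).+1.
pose W := \max_(b <- enum_fset D) (absz ((b : box).2 - c0)).+1.
have bnd i j : below i j -> (i < H)%N && (j < W)%N.
  case/has_boxP => b bD /andP[h1 h2].
  have hH : ((absz (b.1 - r0)).+1 <= H)%N by apply: leq_bigmax_seq.
  have hW : ((absz (b.2 - c0)).+1 <= W)%N by apply: leq_bigmax_seq.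
  apply/andP; split; lia.
have belowD i j i' j' : (i' <= i)%N -> (j' <= j)%N -> below i j -> below i' j'.
  by move=> h1 h2 /has_boxP[b bD /andP[h3 h4]]; apply/has_boxP; exists b => //; apply/andP; split; lia.
have aboveU i j i' j' : (i' <= i)%N -> (j' <= j)%N -> above i' j' -> above i j.
  by move=> h1 h2 /has_boxP[b bD /andP[h3 h4]]; apply/has_boxP; exists b => //; apply/andP; split; lia.
have [la pla laP] := shape_partition belowD bnd.
have [||mu pmu muP] := @shape_partition (fun i j => below i j && ~~ above i j) H W.
- move=> i j i' j' h1 h2 /andP[h3 h4]; rewrite (belowD _ _ _ _ h1 h2 h3) /=.
  by apply: contra h4; exact: aboveU.
- by move=> i j /andP[/bnd].
have lm i : (nth 0%N mu i <= nth 0%N la i)%N.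
  rewrite leqNgt; apply/negP => h; have := muP i (nth 0%N la i); rewrite h => /esym/andP[].
  by rewrite -laP ltnn.
exists la, mu; split => //; apply/same_diagramP; exists (- (r0, c0)); apply: boxsetP => r c.
move: ((r, c) : box) => b; rewrite in_translate opprK; apply/idP/idP => [/in_skew_shape[i [i1 i2 i3 i4]]|bD].
  have lm' := lm i.
  have : below i (absz b.2) && ~~ (below i (absz b.2) && ~~ above i (absz b.2)).
    by rewrite -muP -laP; apply/andP; split; lia.
  case/andP => h1; rewrite h1 /= negbK => h2.
  case/has_boxP: h1 => x xD /andP[x1 x2]; case/has_boxP: h2 => y yD /andP[y1 y2].
  by apply: (cD _ _ _ yD xD); rewrite !boxE /=; lia.
have h1 := rmin _ bD; have h2 := cmin _ bD; rewrite -/r0 -/c0 !boxE /= in h1 h2.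
have hb : below (absz b.1) (absz b.2).
  by apply/has_boxP; exists (b + (r0, c0)) => //; rewrite !boxE /=; apply/andP; split; lia.
have ha : above (absz b.1) (absz b.2).
  by apply/has_boxP; exists (b + (r0, c0)) => //; rewrite !boxE /=; apply/andP; split; lia.
have := laP (absz b.1) (absz b.2); have := muP (absz b.1) (absz b.2); rewrite hb ha /= => h3 h4.
apply/in_skew_shape; exists (absz b.1); split; [|lia|lia|lia].
by rewrite ltnNge; apply/negP => h; move: h4; rewrite nth_default.
Qed.

(** * Diagrams encoded by mark words *)

Definition cnt (S : nat -> bool) n := count S (iota 1 n).

Lemma cntS S n : cnt S n.+1 = (cnt S n + S n.+1)%N.
Proof. by rewrite /cnt -{1}(addn1 n) iotaD count_cat /= addn0 add1n. Qed.

Lemma cnt_bounds S i j : (i <= j)%N -> (cnt S i <= cnt S j)%N && (cnt S j <= cnt S i + (j - i))%N.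
Proof.
move/subnKC => {1 2}<-; rewrite /cnt iotaD count_cat leq_addr leq_add2l /=.
by rewrite -[X in (_ <= X)%N](size_iota (1 + i) (j - i)) count_size.
Qed.

Lemma cnt_ext S S' n : (forall x, (0 < x <= n)%N -> S x = S' x) -> cnt S n = cnt S' n.
Proof. by move=> h; apply: eq_in_count => x; rewrite mem_iota add1n ltnS; exact: h. Qed.

Lemma next_mark S i j : (cnt S i < cnt S j)%N ->
  exists x, [/\ (i <= x < j)%N, S x.+1 & cnt S x = cnt S i].
Proof.
elim: j => [|j IH] h; first by have := cnt_bounds S (leq0n i); lia.
have [/IH[x [h1 h2 h3]]|h'] := ltnP (cnt S i) (cnt S j); first by exists x; split => //; lia.
have ij : (i <= j)%N by case: leqP => // ji; have := cnt_bounds S ji; lia.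
have b1 := cnt_bounds S ij; have b2 := cntS S j.
by exists j; split; [lia | case: (S j.+1) b2 => //; lia | lia].
Qed.

(** The index [i] is the content of the box, column minus row. Diagonal shifts preserve it, which is
    what makes this encoding convenient for doubled rows. *)
Definition pos (S : nat -> bool) (i : nat) : box := (- (cnt S i)%:Z, i%:Z - (cnt S i)%:Z).

Lemma posE1 S i : (pos S i).1 = - (cnt S i)%:Z. Proof. by []. Qed.
Lemma posE2 S i : (pos S i).2 = i%:Z - (cnt S i)%:Z. Proof. by []. Qed.
Definition bE := (fstD, sndD, fstN, sndN, posE1, posE2).

Ltac box_lia := apply: box_eq; rewrite !bE /=; lia.
Ltac box_proj e := let e1 := fresh in let e2 := fresh in
  have e1 := congr1 fst e; have e2 := congr1 snd e; rewrite !bE /= in e1 e2.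

(** A ribbon runs from southwest to northeast, so a rectangle with two of its boxes as northwest and
    southeast corners is a single row or column. *)
Lemma pos_between S i j (c : box) :
  (pos S i).1 <= c.1 -> c.1 <= (pos S j).1 -> (pos S i).2 <= c.2 -> c.2 <= (pos S j).2 ->
  exists2 k, (minn i j <= k <= maxn i j)%N & c = pos S k.
Proof.
rewrite !bE => h1 h2 h3 h4; case: (leqP i j) => ij.
  have := cnt_bounds S ij => b1; pose k := absz (c.2 + (cnt S i)%:Z).
  have ik : (i <= k)%N by rewrite /k; lia.
  have kj : (k <= j)%N by rewrite /k; lia.
  have := cnt_bounds S ik; have := cnt_bounds S kj.
  by exists k; [lia | box_lia].
have := cnt_bounds S (ltnW ij) => b1; pose k := absz (c.2 - c.1).
have jk : (j <= k)%N by rewrite /k; lia.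
have ki : (k <= i)%N by rewrite /k; lia.
have := cnt_bounds S jk; have := cnt_bounds S ki.
by exists k; [lia | box_lia].
Qed.

Definition rib (l : nat) (S : nat -> bool) : diagram := [fset pos S i | i in iota 0 l].

Lemma ribP l S (b : box) : reflect (exists2 i, (i < l)%N & b = pos S i) (b \in rib l S).
Proof.
by apply: (iffP (imfsetP _ _ _ _)) => -[i /= h ->]; exists i => //=; move: h; rewrite mem_iota.
Qed.

Lemma rib_ext l S S' : (forall x, (0 < x < l)%N -> S x = S' x) -> rib l S = rib l S'.
Proof.
move=> h; apply/fsetP => b; apply/ribP/ribP => -[i il ->]; exists i => //; rewrite /pos.
  by rewrite (@cnt_ext S S') // => x hx; apply: h; lia.
by rewrite (@cnt_ext S' S) // => x hx; apply/esym/h; lia.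
Qed.

Lemma rib_convex l S : convex (rib l S).
Proof.
move=> _ _ c /ribP[i il ->] /ribP[j jl ->] h1 h2 h3 h4.
have [k hk ->] := pos_between h1 h2 h3 h4; apply/ribP; exists k => //; lia.
Qed.

(* The two pieces overlap diagonally: position [i] of the second one lies northwest of
   position [i] of the first. *)
Definition fat (w u s : nat) (S : nat -> bool) : diagram :=
  [fset pos S i | i in iota 0 (u + w)] `|` [fset pos S i - (1, 1) | i in iota u (w + s)].

Lemma fatP w u s S (b : box) : reflect
  ((exists2 i, (i < u + w)%N & b = pos S i) \/
   (exists2 i, (u <= i < u + w + s)%N & b = pos S i - (1, 1))) (b \in fat w u s S).
Proof.
apply: (iffP idP); rewrite inE; last first.
  case=> -[i h ->]; apply/orP; [left|right]; apply/imfsetP; exists i => //=; rewrite mem_iota; lia.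
by case/orP => /imfsetP[i /=]; rewrite mem_iota => h ->; [left|right]; exists i => //; lia.
Qed.

Lemma fat_ext w u s S S' : (forall x, (0 < x < u + w + s)%N -> S x = S' x) ->
  fat w u s S = fat w u s S'.
Proof.
move=> h; have e i : (i < u + w + s)%N -> pos S i = pos S' i.
  by move=> hi; rewrite /pos (@cnt_ext S S') // => x hx; apply: h; lia.
apply/fsetP => b; apply/fatP/fatP => -[] [i hi ->]; [left|right|left|right]; exists i => //;
  rewrite e //; lia.
Qed.

Lemma fat_corner w u s S (b : box) : b \in fat w u s S -> b.1 <= 0 /\ (b.1 = 0 -> 0 <= b.2).
Proof.
case/fatP => -[i hi ->]; rewrite !bE /=; last by split; lia.
by have := cnt_bounds S (leq0n i); rewrite /cnt /= => h; split; lia.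
Qed.

(** A diagonal step keeps the content, hence the index, and the two pieces share only the indices
    from [u] to [u + w - 1]. *)
Lemma fat_double w u s S (b : box) : b \in fat w u s S -> b + (1, 1) \in fat w u s S ->
  exists2 x, (u <= x < u + w)%N & b = pos S x - (1, 1).
Proof.
move=> /fatP[] [i hi ->] /fatP[] [j hj e]; box_proj e.
- have ij : i = j by lia.
  by exfalso; subst j; lia.
- have ij : i = j by lia.
  by exfalso; subst j; lia.
- have ij : i = j by lia.
  by subst j; exists i => //; lia.
- have ij : i = j by lia.
  by exfalso; subst j; lia.
Qed.

Definition window_free (w u : nat) (S : nat -> bool) := forall x, (u <= x <= u + w)%N -> S x = false.

Section FatGeometry.

Variables (w u s : nat) (S : nat -> bool).
Hypothesis w0 : (0 < w)%N.
Hypothesis u0 : (0 < u)%N.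
Hypothesis s0 : (0 < s)%N.
Hypothesis S_window : window_free w u S.

Let v := (u + w)%N.
Let L := (u + w + s)%N.
Let F := fat w u s S.
Let N := cnt S u.

Lemma window_cnt x : (u.-1 <= x <= v)%N -> cnt S x = N.
Proof using w0 u0 s0 S_window.
move=> hx; have e0 : cnt S u.-1 = N.
  by rewrite /N -{2}(prednK u0) cntS prednK // S_window ?addn0 //; lia.
have -> : x = (u.-1 + (x - u.-1))%N by lia.
have : (u.-1 + (x - u.-1) <= v)%N by rewrite /v; lia.
elim: (x - u.-1)%N => [|d IH] h; first by rewrite addn0.
rewrite addnS cntS IH; last lia.
rewrite S_window ?addn0 //; rewrite /v in h; lia.
Qed.

Lemma cnt_left x : (x <= v)%N -> (cnt S x <= N)%N.
Proof using w0 u0 s0 S_window. by move=> h; have := cnt_bounds S h; rewrite (@window_cnt v) /v; lia. Qed.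

Lemma cnt_right x : (u.-1 <= x)%N -> (N <= cnt S x)%N.
Proof using w0 u0 s0 S_window. by move=> h; have := cnt_bounds S h; rewrite (@window_cnt u.-1) /v; lia. Qed.

Lemma fat_convex : convex F.
Proof using w0 u0 s0 S_window.
move=> a b c /fatP[] [i hi ->] /fatP[] [j hj ->] h1 h2 h3 h4.
- have [k hk ->] := pos_between h1 h2 h3 h4; apply/fatP; left; exists k => //; lia.
- have := cnt_left (ltnW hi); have := @cnt_right j; rewrite !bE /= in h1 h2 h3 h4; lia.
(* The essential case: the northwest corner lies in the upper piece and the southeast corner in the
   lower one. The box is then above the doubled rows, in one of them, or below. *)
- have ci := @cnt_right i; have cj := cnt_left (ltnW hj); rewrite !bE /= in h1 h2 h3 h4.
  have ui : (u <= i)%N by lia.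
  have jv : (j <= v.-1)%N by rewrite /v; lia.
  have b1 := cnt_bounds S ui; have b2 := cnt_bounds S jv; rewrite -/N in b1.
  rewrite (@window_cnt v.-1) in b2; last by rewrite /v; lia.
  pose x := absz (c.2 + N%:Z).
  have hx : (u.-1 <= x <= v.-1)%N by rewrite /x /v in b2 *; lia.
  have cx : cnt S x = N by apply: window_cnt; rewrite /v in hx *; lia.
  have cx1 : cnt S x.+1 = N by apply: window_cnt; rewrite /v in hx *; lia.
  case: (ltgtP c.1 (- N%:Z)) => hc.
  + have [c1|c1] := eqVneq c.1 (- N%:Z - 1).
      apply/fatP; right; exists x.+1; first by rewrite /v in hx; lia.
      apply: box_eq; rewrite !bE cx1 /=; rewrite /x /v in hx *; lia.
    have vi : (v <= i)%N.
      by rewrite leqNgt; apply/negP => h; have := cnt_left (ltnW h); lia.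
    have b3 := cnt_bounds S vi; rewrite (@window_cnt v) in b3; last by rewrite /v; lia.
    have [||||k hk e] := @pos_between S i v (c + (1, 1)).
    * by rewrite !bE /=; lia.
    * by rewrite !bE /= (@window_cnt v); rewrite /v; lia.
    * by rewrite !bE /=; lia.
    * by rewrite !bE /= (@window_cnt v); rewrite /x /v in hx *; lia.
    apply/fatP; right; exists k; first by rewrite /v in vi hk; lia.
    by rewrite -e addrK.
  + have ju : (j <= u.-1)%N.
      by rewrite leqNgt; apply/negP => h; have := @cnt_right j; lia.
    have b3 := cnt_bounds S ju; rewrite (@window_cnt u.-1) in b3; last by rewrite /v; lia.
    have [||||k hk e] := @pos_between S u.-1 j c.
    * by rewrite !bE /= (@window_cnt u.-1); rewrite /v; lia.
    * by rewrite !bE /=; lia.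
    * by rewrite !bE /= (@window_cnt u.-1); rewrite /x /v in hx *; lia.
    * by rewrite !bE /=; lia.
    by apply/fatP; left; exists k; first lia.
  + apply/fatP; left; exists x; first by rewrite /v in hx; lia.
    by apply: box_eq; rewrite !bE cx /=; rewrite /x /v in hx *; lia.
- rewrite !bE /= in h1 h2 h3 h4.
  have [||||k hk e] := @pos_between S i j (c + (1, 1)); rewrite ?bE /=; try lia.
  apply/fatP; right; exists k; first lia.
  by rewrite -e addrK.
Qed.

Lemma fat_trim (b : box) : b \in trim F ->
  [\/ b.1 = - N%:Z /\ (u.-1%:Z - N%:Z <= b.2 <= v.-1%:Z - N%:Z),
      exists x, [/\ S x.+1, (x.+1 < u)%N & b = pos S x]
    | exists x, [/\ S x.+1, (v <= x)%N & b = pos S x - (1, 1)]].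
Proof using w0 u0 s0 S_window.
rewrite in_trim northE => /andP[/fatP[] [i hi ->] /fatP[] [j hj e]]; box_proj e.
- have ij : j = i.+1 by lia.
  subst j; have := cntS S i; case Si: (S i.+1) => ci; last by exfalso; lia.
  apply: Or32; exists i; split => //; rewrite ltnNge; apply/negP => h.
  by rewrite S_window // in Si; lia.
- have ij : j = i.+1 by lia.
  subst j; have ci : cnt S i = N by apply: window_cnt; rewrite /v; lia.
  by apply: Or31; rewrite !bE ci; split => //; rewrite /v; lia.
- have ij : j = i.+1 by lia.
  subst j; have ci : cnt S i = N by apply: window_cnt; rewrite /v; lia.
  have cj : cnt S i.+1 = N by apply: window_cnt; rewrite /v; lia.
  by exfalso; lia.
- have ij : j = i.+1 by lia.
  subst j; have := cntS S i; case Si: (S i.+1) => ci; last by exfalso; lia.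
  apply: Or33; exists i; split => //; rewrite leqNgt; apply/negP => h.
  by rewrite S_window // in Si; rewrite /v in h; lia.
Qed.

(** Elsewhere neighbouring rows share a single column, so [trim] leaves one box per row outside the
    lower doubled row. *)
Lemma fat_trim_row (b b' : box) : b \in trim F -> b' \in trim F -> b.1 = b'.1 -> b.2 < b'.2 ->
  [/\ b.1 = - N%:Z, u.-1%:Z - N%:Z <= b.2 & b'.2 <= v.-1%:Z - N%:Z].
Proof using w0 u0 s0 S_window.
have low x : S x.+1 -> (x.+1 < u)%N -> (cnt S x < N)%N.
  by move=> Sx h; have := cntS S x; rewrite Sx; have := @cnt_left x.+1; rewrite /v; lia.
have high x : (v <= x)%N -> (N <= cnt S x)%N by move=> h; apply: cnt_right; rewrite /v in h; lia.
have step x y : S x.+1 -> (x < y)%N -> (cnt S x < cnt S y)%N.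
  by move=> Sx h; have := cntS S x; rewrite Sx; have := cnt_bounds S h; lia.
case/fat_trim => [[e1 h1]|[x [Sx hx ->]]|[x [Sx hx ->]]];
case/fat_trim => [[e2 h2]|[y [Sy hy ->]]|[y [Sy hy ->]]]; rewrite ?bE /= ?bE /= => h3 h4.
- by split => //; lia.
- by have := low _ Sy hy; lia.
- by have := high _ hy; lia.
- by have := low _ Sx hx; lia.
- by have := step x y Sx; lia.
- by have := low _ Sx hx; have := high _ hy; lia.
- by have := high _ hx; lia.
- by have := low _ Sy hy; have := high _ hx; lia.
- by have := step x y Sx; lia.
Qed.

Lemma window_trim x : (u.-1 <= x <= v.-1)%N -> (- N%:Z, x%:Z - N%:Z) \in trim F.
Proof using w0 u0 s0 S_window.
move=> hx; have cx : cnt S x = N by apply: window_cnt; rewrite /v in hx *; lia.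
have cx1 : cnt S x.+1 = N by apply: window_cnt; rewrite /v in hx *; lia.
rewrite in_trim northE; apply/andP; split; apply/fatP; [left; exists x | right; exists x.+1].
- by rewrite /v in hx; lia.
- by apply: box_eq; rewrite !bE cx.
- by rewrite /v in hx; lia.
- by apply: box_eq; rewrite !bE cx1 /=; lia.
Qed.

Lemma fat_rows_trim : #|` rows F| = (#|` rows (trim F)|).+1.
Proof using w0 u0 s0 S_window.
pose M := cnt S L.-1; pose top : int := - M%:Z - 1.
have topP b : b \in F -> top <= b.1.
  case/fatP => -[i hi ->]; rewrite !bE /= /top /M.
    by have iL : (i <= L.-1)%N by [rewrite /L; lia]; have := cnt_bounds S iL; lia.
  by have iL : (i <= L.-1)%N by [rewrite /L; lia]; have := cnt_bounds S iL; lia.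
have -> : rows F = top |` rows (trim F).
  apply/fsetP => r; apply/rowsP/fset1UP => [[b bF ->]|[->|/rowsP[b]]]; last first.
  - by rewrite in_trim => /andP[bF _] ->; exists b.
  - exists (pos S L.-1 - (1, 1)); last by rewrite !bE.
    by apply/fatP; right; exists L.-1 => //; rewrite /L; lia.
  case/fatP: bF => -[i hi ->]; rewrite !bE.
    right; apply/rowsP; have := cnt_left (ltnW hi); rewrite leq_eqVlt => /orP[/eqP e|h].
      by exists (- N%:Z, u.-1%:Z - N%:Z); rewrite ?e // window_trim // /v; lia.
    have [x [h1 h2 h3]] := next_mark h; exists (pos S x); last by rewrite !bE h3.
    rewrite in_trim northE; apply/andP; split; apply/fatP; left; [exists x|exists x.+1] => //.
    - by rewrite /v in hi; lia.
    - by lia.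
    - by have := cntS S x; rewrite h2 => h4; box_lia.
  have iL : (i <= L.-1)%N by rewrite /L; lia.
  have := cnt_bounds S iL; rewrite -/M => hM.
  have [e|ne] := eqVneq (cnt S i) M; first by left; rewrite /top e.
  have h : (cnt S i < cnt S L.-1)%N by rewrite -/M; lia.
  have [x [h1 h2 h3]] := next_mark h; right; apply/rowsP.
  exists (pos S x - (1, 1)); last by rewrite !bE h3.
  rewrite in_trim northE; apply/andP; split; apply/fatP; right; [exists x|exists x.+1] => //.
  - by rewrite /L in h1; lia.
  - by rewrite /L in h1; lia.
  - by have := cntS S x; rewrite h2 => h4; box_lia.
rewrite cardfsU1; have -> // : top \notin rows (trim F).
apply/negP => /rowsP[b]; rewrite in_trim northE => /andP[_ /topP] /= h e; lia.
Qed.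

Lemma fat_rows_ltrim k : (0 < k <= w)%N -> #|` rows (iter k ltrim (trim F))| = 1%N.
Proof using w0 u0 s0 S_window.
move=> hk; have -> : rows (iter k ltrim (trim F)) = [fset - N%:Z].
  apply/fsetP => r; rewrite in_fset1; apply/rowsP/eqP => [[b]|->].
    rewrite (in_iter_ltrim _ _ (convex_trim fat_convex)) => /andP[h1 h2] ->.
    by have [||//] := fat_trim_row h2 h1; rewrite /=; lia.
  exists (- N%:Z, v.-1%:Z - N%:Z) => //.
  rewrite (in_iter_ltrim _ _ (convex_trim fat_convex)) /= window_trim /=; last by rewrite /v; lia.
  have -> : v.-1%:Z - N%:Z - k%:Z = (v.-1 - k)%N%:Z - N%:Z by rewrite /v; lia.
  by rewrite window_trim // /v; lia.
by rewrite cardfs1.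
Qed.

Lemma fat_rows_ltrim0 : #|` rows (iter w.+1 ltrim (trim F))| = 0%N.
Proof using w0 u0 s0 S_window.
apply/eqP; rewrite cardfs_eq0; apply/eqP/fsetP => r; rewrite in_fset0; apply/negbTE/negP.
case/rowsP => b; rewrite (in_iter_ltrim _ _ (convex_trim fat_convex)) => /andP[h1 h2] _.
by have [||] := fat_trim_row h2 h1; rewrite /= /v; lia.
Qed.

End FatGeometry.

(** The origin is the first box of the bottom row of both diagrams, so the translation is trivial.
    The contents that occur twice give [u], the largest content gives [s], and the heights at each
    content give the marks. *)
Lemma fat_inj w u s S u' s' S' : (0 < w)%N -> (0 < u)%N -> (0 < s)%N -> (0 < u')%N -> (0 < s')%N ->
  window_free w u S -> window_free w u' S' ->
  same_diagram (fat w u s S) (fat w u' s' S') ->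
  [/\ u = u', s = s' & forall x, (0 < x < u + w + s)%N -> S x = S' x].
Proof.
move=> w0 u0 s0 u'0 s'0 wS wS' /same_diagramP[p pE].
have o_fat v t R : (0 < v)%N -> (0 : box) \in fat w v t R.
  by move=> v0; apply/fatP; left; exists 0%N; [lia | box_lia].
have p0 : p = 0.
  have h1 := o_fat u s S u0; have h2 := o_fat u' s' S' u'0.
  have h3 : p \in fat w u' s' S' by rewrite pE in_translate subrr.
  have h4 : - p \in fat w u s S by move: h2; rewrite pE in_translate sub0r.
  have [a1 a2] := fat_corner h3; have [b1 b2] := fat_corner h4; rewrite !bE in b1 b2.
  by apply: box_eq; rewrite /=; lia.
move: pE; rewrite p0 translate0 => pE.
have dbl v t R v' t' R' : (0 < v)%N -> (0 < t)%N -> (0 < v')%N -> window_free w v R -> window_free w v' R' ->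
    fat w v t R = fat w v' t' R' -> (v' <= v)%N /\ (v + t <= v' + t')%N.
  move=> v0 t0 v'0 wR wR' e; split.
    have h1 : pos R v - (1, 1) \in fat w v t R by apply/fatP; right; exists v => //; lia.
    have h2 : pos R v - (1, 1) + (1, 1) \in fat w v t R.
      by rewrite subrK; apply/fatP; left; exists v => //; lia.
    rewrite e in h1 h2; have [x hx ex] := fat_double h1 h2; box_proj ex; lia.
  have : pos R (v + w + t).-1 - (1, 1) \in fat w v' t' R'.
    by rewrite -e; apply/fatP; right; exists (v + w + t).-1 => //; lia.
  by case/fatP => -[x hx ex]; box_proj ex; lia.
have [d1 d2] := dbl _ _ _ _ _ _ u0 s0 u'0 wS wS' (esym pE).
have [d3 d4] := dbl _ _ _ _ _ _ u'0 s'0 u0 wS' wS pE.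
have eu : u = u' by lia.
have es : s = s' by lia.
subst u' s'; split => // x hx.
have lo y : (y < u)%N -> cnt S y = cnt S' y.
  move=> hy; have : pos S y \in fat w u s S' by rewrite pE; apply/fatP; left; exists y => //; lia.
  by case/fatP => -[z hz ez]; box_proj ez; [have yz : y = z by lia|]; subst; lia.
have hi y : (u + w <= y < u + w + s)%N -> cnt S y = cnt S' y.
  move=> hy; have : pos S y - (1, 1) \in fat w u s S'.
    by rewrite pE; apply/fatP; right; exists y => //; lia.
  by case/fatP => -[z hz ez]; box_proj ez; [|have yz : y = z by lia]; subst; lia.
have nb (b b' : bool) : (b : nat) = b' -> b = b' by case: b; case: b'.
case: x hx => // x hx; have c1 := cntS S x; have c2 := cntS S' x.
have [h1|h1] := ltnP x.+1 u.
  by have e1 := lo _ h1; have e2 := lo x (ltnW h1); apply: nb; lia.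
have [h2|h2] := leqP x.+1 (u + w); first by rewrite wS ?wS' // h1 h2.
by have e1 := hi x.+1; have e2 := hi x; apply: nb; lia.
Qed.

Definition revm (L : nat) (S : nat -> bool) (x : nat) := S (L - x)%N.

Lemma cnt_revm L S y : (y < L)%N -> (cnt (revm L S) y + cnt S (L.-1 - y) = cnt S L.-1)%N.
Proof.
elim: y => [|y IH] h; first by rewrite subn0.
have := IH (ltnW h); have -> : (L.-1 - y)%N = (L.-1 - y.+1).+1 by lia.
rewrite !cntS /revm; have -> : (L - y.+1)%N = (L.-1 - y.+1).+1 by lia.
by lia.
Qed.

Lemma pos_revm L S y : (y < L)%N ->
  pos (revm L S) y = (- (cnt S L.-1)%:Z, L.-1%:Z - (cnt S L.-1)%:Z) - pos S (L.-1 - y).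
Proof. by move=> h; have := cnt_revm S h; move=> e; box_lia. Qed.

Lemma rotate_rib l S : same_diagram (rotate (rib l S)) (rib l (revm l S)).
Proof.
apply/same_diagramP; exists (- (cnt S l.-1)%:Z, l.-1%:Z - (cnt S l.-1)%:Z); set v := (_, _).
apply/fsetP => b; rewrite in_translate in_rotate opprB; apply/ribP/ribP => -[i hi].
  rewrite pos_revm // -/v => ->; exists (l.-1 - i)%N; first lia.
  by rewrite opprB addrCA subrr addr0.
move=> e; exists (l.-1 - i)%N; first lia.
rewrite pos_revm -/v; last lia.
by rewrite subKn; [rewrite -e opprB addrCA subrr addr0 | lia].
Qed.

Lemma rotate_fat w u s S : (0 < w)%N ->
  same_diagram (rotate (fat w u s S)) (fat w s u (revm (u + w + s) S)).
Proof.
move=> w0; set L := (u + w + s)%N.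
pose v : box := (- (cnt S L.-1)%:Z, L.-1%:Z - (cnt S L.-1)%:Z).
have prev y : (y < L)%N -> pos (revm L S) y = v - pos S (L.-1 - y) by exact: pos_revm.
have prev' y : (y < L)%N -> pos (revm L S) (L.-1 - y) = v - pos S y.
  by move=> h; rewrite prev ?subKn //; lia.
apply/same_diagramP; exists (v - (1, 1)); apply/fsetP => b.
rewrite in_translate in_rotate opprB; apply/fatP/fatP => -[] [i hi].
- move=> ->; right; exists (L.-1 - i)%N; first by rewrite /L; lia.
  rewrite prev; last by rewrite /L; lia.
  by box_lia.
- move=> ->; left; exists (L.-1 - i)%N; first by rewrite /L; lia.
  rewrite prev; last by rewrite /L; lia.
  by box_lia.
- move=> e; right; exists (L.-1 - i)%N; first by rewrite /L; lia.
  rewrite prev'; last by rewrite /L; lia.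
  by rewrite -e; apply: box_eq; rewrite !boxE /=; lia.
- move=> e; left; exists (L.-1 - i)%N; first by rewrite /L; lia.
  rewrite prev'; last by rewrite /L; lia.
  by move/(congr1 (fun z => z + (1, 1))): e; rewrite subrK => <-; apply: box_eq; rewrite !boxE /=; lia.
Qed.

(** Transposition exchanges the two kinds of steps and reverses the order of the contents. *)
Lemma transpose_rib l S :
  same_diagram (transpose (rib l S)) (rib l (fun x => ~~ S (l - x)%N)).
Proof.
set S' := fun _ => _.
have cE y : (y < l)%N -> (cnt S' y + cnt (revm l S) y = y)%N.
  elim: y => [//|y IH] h; have := IH (ltnW h); rewrite !cntS /S' /revm; case: (S _); lia.
have pE y : (y < l)%N -> pos S' y = ((pos S (l.-1 - y)).2, (pos S (l.-1 - y)).1)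
    + (- (l.-1%:Z - (cnt S l.-1)%:Z), (cnt S l.-1)%:Z).
  by move=> h; have := cE y h; have := cnt_revm S h => h1 h2; box_lia.
apply/same_diagramP; exists (- (l.-1%:Z - (cnt S l.-1)%:Z), (cnt S l.-1)%:Z).
apply: boxsetP => r c; rewrite in_translate in_transpose; apply/ribP/ribP => -[i hi e].
  exists (l.-1 - i)%N; first lia.
  by rewrite pE // in e; box_proj e; box_lia.
exists (l.-1 - i)%N; first lia.
rewrite pE; last lia.
by rewrite subKn; last lia; box_proj e; box_lia.
Qed.

(** * Adding a bottom row, and reading a boxdot as a mark word *)

(** The word after adding a bottom row of [a] boxes with overlap one: the step into position [a]
    goes up and the old word follows. [shift_marks] extends the bottom row to the left instead. *)
Definition prefix_marks a (S : nat -> bool) i := (i == a) || ((a < i)%N && S (i - a)%N).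
Definition shift_marks u (S : nat -> bool) i := (u < i)%N && S (i - u)%N.

Lemma cnt_prefix a S i : (0 < a)%N ->
  cnt (prefix_marks a S) i = if (i < a)%N then 0%N else (cnt S (i - a)).+1.
Proof.
move=> a0; elim: i => [|i IH]; first by rewrite a0.
rewrite cntS IH /prefix_marks; have [h|] := ltnP i.+1 a.
  by rewrite (ltnW h) (ltn_eqF h) ltnNge (ltnW h).
rewrite leq_eqVlt => /orP[/eqP h|h]; first by subst a; rewrite ltnSn eqxx subnn.
have h' : (a <= i)%N by [].
by rewrite [(i < a)%N]ltnNge h' (gtn_eqF h) h /= subSn // cntS addSn.
Qed.

Lemma cnt_shift u S i : cnt (shift_marks u S) i = cnt S (i - u).
Proof.
elim: i => [|i IH] //; rewrite cntS IH /shift_marks.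
have [h|h] := ltnP u i.+1; first by rewrite subSn // cntS.
by have -> : (i - u = 0)%N; [lia | have -> : (i.+1 - u = 0)%N; [lia|]].
Qed.

Lemma pos_prefix_low a S i : (0 < a)%N -> (i < a)%N -> pos (prefix_marks a S) i = (0, i%:Z).
Proof. by move=> a0 ia; rewrite /pos cnt_prefix // ia; apply: box_eq; rewrite /=; lia. Qed.

Lemma pos_prefix_high a S i : (0 < a)%N -> (a <= i)%N ->
  pos (prefix_marks a S) i = pos S (i - a) + (-1, a%:Z - 1).
Proof.
move=> a0 ia; rewrite /pos cnt_prefix // ltnNge ia /=; apply: box_eq; rewrite !boxE /=; lia.
Qed.

Lemma rib_row a (p : box) : row_of p a = translate p (rib a (fun=> false)).
Proof.
have c0 i : cnt (fun=> false) i = 0%N by rewrite /cnt count_pred0.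
apply: boxsetP => r c; rewrite in_row_of in_translate; apply/andP/ribP => [[/eqP e /andP[h1 h2]]|[i hi e]].
  rewrite /= in e h1 h2; exists (absz (c - p.2)); first lia.
  by apply: box_eq; rewrite !bE c0 /=; lia.
by box_proj e; rewrite c0 in H, H0; split; [apply/eqP|]; rewrite /=; lia.
Qed.

Lemma rib_prefix a l S (p : box) : (0 < a)%N ->
  row_of p a `|` translate (p + (-1, a%:Z - 1)) (rib l S) =
  translate p (rib (a + l) (prefix_marks a S)).
Proof.
move=> a0; apply: boxsetP => r c; rewrite inE in_row_of !in_translate; apply/idP/ribP.
- case/orP => [/andP[/eqP e1 /andP[h1 h2]]|/ribP[i il e]].
  + rewrite /= in e1 h1 h2; exists (absz (c - p.2)); first lia.
    rewrite pos_prefix_low //; last lia.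
    by box_lia.
  + exists (i + a)%N; first lia.
    by rewrite pos_prefix_high ?leq_addl // addnK; box_proj e; box_lia.
- case=> i il; case: (ltnP i a) => ia e; apply/orP.
  + rewrite pos_prefix_low // in e; box_proj e; left; apply/andP; split; [apply/eqP|]; rewrite /=; lia.
  + rewrite pos_prefix_high // in e; right; apply/ribP; exists (i - a)%N; first lia.
    by box_proj e; box_lia.
Qed.

Lemma fat_prefix a w u s S (p : box) : (0 < a)%N ->
  row_of p a `|` translate (p + (-1, a%:Z - 1)) (fat w u s S) =
  translate p (fat w (a + u) s (prefix_marks a S)).
Proof.
move=> a0; apply: boxsetP => r c; rewrite inE in_row_of !in_translate; apply/idP/fatP.
- case/orP => [/andP[/eqP e1 /andP[h1 h2]]|/fatP[] [i il e]].
  + rewrite /= in e1 h1 h2; left; exists (absz (c - p.2)); first lia.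
    rewrite pos_prefix_low //; last lia.
    by box_lia.
  + left; exists (i + a)%N; first lia.
    by rewrite pos_prefix_high ?leq_addl // addnK; box_proj e; box_lia.
  + right; exists (i + a)%N; first lia.
    by rewrite pos_prefix_high ?leq_addl // addnK; box_proj e; box_lia.
- case=> -[i il]; last first.
    rewrite pos_prefix_high //; last lia.
    move=> e; apply/orP; right; apply/fatP; right; exists (i - a)%N; first lia.
    by box_proj e; box_lia.
  case: (ltnP i a) => ia e; apply/orP.
  + rewrite pos_prefix_low // in e; box_proj e; left; apply/andP; split; [apply/eqP|]; rewrite /=; lia.
  + rewrite pos_prefix_high // in e; right; apply/fatP; left; exists (i - a)%N; first lia.
    by box_proj e; box_lia.
Qed.

Lemma fat_base w u s S (p : box) : (forall x, (0 < x <= w)%N -> S x = false) ->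
  row_of p (u + w) `|` translate (p + (-1, u%:Z - 1)) (rib (w + s) S) =
  translate p (fat w u s (shift_marks u S)).
Proof.
move=> wS; have c0 i : (i <= w)%N -> cnt S i = 0%N.
  move=> h; rewrite (@cnt_ext S (fun=> false)) ?/cnt ?count_pred0 // => x hx; apply: wS; lia.
apply: boxsetP => r c; rewrite inE in_row_of !in_translate; apply/idP/fatP.
- case/orP => [/andP[/eqP e1 /andP[h1 h2]]|/ribP[i il e]].
  + rewrite /= in e1 h1 h2; left; exists (absz (c - p.2)); first lia.
    by apply: box_eq; rewrite !bE cnt_shift c0 /=; lia.
  + right; exists (i + u)%N; first lia.
    by box_proj e; apply: box_eq; rewrite !bE cnt_shift addnK /=; lia.
- case=> -[i il e]; apply/orP.
  + left; box_proj e; rewrite cnt_shift c0 in H, H0; try lia.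
    by apply/andP; split; [apply/eqP|]; rewrite /=; lia.
  + right; apply/ribP; exists (i - u)%N; first lia.
    by box_proj e; rewrite cnt_shift in H, H0; box_lia.
Qed.

Lemma prefix_window a w u S : (0 < u)%N -> window_free w u S -> window_free w (a + u) (prefix_marks a S).
Proof.
move=> u0 h x hx; rewrite /prefix_marks; have -> : (x == a) = false by lia.
by rewrite /= (h (x - a)%N) ?andbF //; lia.
Qed.

Lemma shift_window w u S : (forall x, (0 < x <= w)%N -> S x = false) -> window_free w u (shift_marks u S).
Proof.
move=> h x hx; rewrite /shift_marks; case: ltnP => //= ux; apply: h; lia.
Qed.

Lemma stack_rib be : is_composition be -> exists l S,
  [/\ (head 0%N be <= l)%N, forall x, (0 < x < head 0%N be)%N -> S x = false
    & forall p k, (size be <= k)%N -> stack p (zip be (nseq k 1%N)) = translate p (rib l S)].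
Proof.
case/andP; elim: be => [//|a be IH] _ /= /andP[a0 cbe].
have [be0|be0] := eqVneq be [::].
  exists a, (fun=> false); split => // p [|k] // _; subst be.
  rewrite /= -rib_row; by case: k => [|k] /=; rewrite fsetU0.
have [l [S [h1 h2 h3]]] := IH be0 cbe.
exists (a + l)%N, (prefix_marks a S); split; first exact: leq_addr.
  move=> x hx; rewrite /prefix_marks; have -> : (x == a) = false by lia.
  by have -> : (a < x)%N = false by lia.
move=> p [|k] // hk /=; rewrite h3 // -rib_prefix //.
Qed.

(** The top row of [al] meets the ribbon of [be] in [w + 1] columns, which is [fat_base]; the rows
    of [al] below it are then prefixed one at a time. *)
Lemma boxdot_fat w D : (0 < w)%N -> is_boxdot w.+1 D -> exists u s S,
  [/\ (0 < u)%N, (0 < s)%N, window_free w u S & same_diagram D (fat w u s S)].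
Proof.
move=> w0 [al [be [cal cbe hal hbe /same_trans Dal]]].
suff [u [s [S [u0 s0 wS E]]]] : exists u s S, [/\ (0 < u)%N, (0 < s)%N, window_free w u S
    & forall p, stack p (zip (al ++ be) (nseq (size al).-1 1%N ++ w.+1 :: nseq (size be) 1%N))
        = translate p (fat w u s S)].
  by exists u, s, S; split => //; apply: Dal; rewrite /boxdot E translate0 same_refl.
case/andP: cal hal => {Dal}; elim: al => [//|a al IH] _ /= /andP[a0 cal].
have [al0|al0] := eqVneq al [::].
  rewrite al0 /= => ha; have [l [S [h1 h2 h3]]] := stack_rib cbe.
  exists (a - w)%N, (l - w)%N, (shift_marks (a - w) S); split; try lia.
    by apply: shift_window => x hx; apply: h2; lia.
  move=> p; rewrite -fat_base; last by move=> x hx; apply: h2; lia.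
  rewrite h3 //; congr (row_of p _ `|` translate (p + (_, _)) (rib _ _)); lia.
case: al al0 cal IH => // a' al _ cal IH h.
have [u [s [S [u0 s0 wS E]]]] := IH isT cal h.
exists (a + u)%N, s, (prefix_marks a S); split => //; first lia; first exact: prefix_window.
by move=> p; rewrite -fat_prefix // -E.
Qed.

(** * Recognizing ribbons and boxdots by removing bottom rows *)

Lemma bottom_row X : convex X -> X != fset0 -> exists (p : box) a,
  [/\ (0 < a)%N, forall b : box, b \in X -> b.1 <= p.1
    & forall b : box, b.1 = p.1 -> (b \in X) = (p.2 <= b.2 < p.2 + a%:Z)].
Proof.
move=> cX X0; have [q qX qmax] := fset_argmin (fun b => - b.1) X0.
pose Y := [fset b in X | (b : box).1 == q.1].
have Y0 : Y != fset0 by apply/fset0Pn; exists q; rewrite !inE qX eqxx.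
have [p] := fset_argmin (fun b => b.2) Y0; rewrite !inE => /andP[pX /eqP pq] pmin.
have [z] := fset_argmin (fun b => - b.2) Y0; rewrite !inE => /andP[zX /eqP zq] zmax.
exists p, (absz (z.2 - p.2)).+1; split => //.
  by move=> b /qmax; lia.
have pz : p.2 <= z.2 by apply: pmin; rewrite !inE zX zq eqxx.
move=> b eb; apply/idP/idP => [bX|hb].
  have bY : b \in Y by rewrite !inE bX eb pq eqxx.
  by have h1 := pmin _ bY; have h2 := zmax _ bY; lia.
by apply: (cX _ _ _ pX zX); lia.
Qed.

Definition linked (X : diagram) := forall a b : box, a \in X -> b \in X -> a.1 < b.1 ->
  exists c : int, ((b.1, c) \in X) && ((b.1 - 1, c) \in X).

Definition single_overlap (X : diagram) (r : int) := forall c c' : int,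
  (r, c) \in X -> (r - 1, c) \in X -> (r, c') \in X -> (r - 1, c') \in X -> c = c'.

Section RemoveBottomRow.

Variables (X : diagram) (p : box) (a : nat).
Hypothesis cX : convex X.
Hypothesis lX : linked X.
Hypothesis a0 : (0 < a)%N.
Hypothesis pmax : forall b : box, b \in X -> b.1 <= p.1.
Hypothesis prow : forall b : box, b.1 = p.1 -> (b \in X) = (p.2 <= b.2 < p.2 + a%:Z).

Definition upper_rows : diagram := [fset b in X | (b : box).1 < p.1].
Let X' := upper_rows.

Lemma in_upper (b : box) : (b \in X') = (b \in X) && (b.1 < p.1).
Proof. by rewrite !inE. Qed.

Lemma corner_in : p \in X.
Proof using a0 prow. by rewrite prow //; lia. Qed.

Lemma upper_convex : convex X'.
Proof using cX.
clear a0.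
move=> x y z; rewrite !in_upper => /andP[xX hx] /andP[yX hy] h1 h2 h3 h4.
by rewrite (cX xX yX) //=; lia.
Qed.

Lemma upper_linked : linked X'.
Proof using lX.
clear a0.
move=> x y; rewrite !in_upper => /andP[xX hx] /andP[yX hy] xy.
have [c /andP[h1 h2]] := lX xX yX xy; exists c; rewrite !in_upper h1 h2 /= hy /=; lia.
Qed.

Lemma split_bottom : X = row_of p a `|` X'.
Proof using pmax prow.
apply: boxsetP => r c; rewrite inE in_upper in_row_of /=.
have [e|e] := eqVneq r p.1; first by rewrite (@prow (r, c)) //= e ltxx andbF orbF.
apply/idP/idP => [rX|/orP[//|/andP[]//]]; rewrite rX /=.
by rewrite lt_neqAle e; apply: (pmax rX).
Qed.

Lemma card_upper : (#|` X'| < #|` X|)%N.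
Proof using a0 prow.
apply: fproper_ltn_card; rewrite fproperE; apply/andP; split.
  by apply/fsubsetP => b; rewrite in_upper => /andP[].
by apply/negP => /fsubsetP /(_ p corner_in); rewrite in_upper ltxx andbF.
Qed.

Variable p' : box.
Hypothesis p'X : p' \in X'.
Hypothesis p'corner : forall b : box, b \in X' -> b.1 <= p'.1 /\ (b.1 = p'.1 -> p'.2 <= b.2).

Lemma overlap_interval : [/\ p'.1 = p.1 - 1, p.2 <= p'.2, p'.2 < p.2 + a%:Z &
  forall c, ((p.1, c) \in X) && ((p.1 - 1, c) \in X) = (p'.2 <= c < p.2 + a%:Z)].
Proof using cX lX a0 prow p'X p'corner.
have /andP[p'X1 p'lt] : (p' \in X) && (p'.1 < p.1) by rewrite -in_upper.
have [c /andP[c1 c2]] := lX p'X1 corner_in p'lt.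
have c2' : (p.1 - 1, c) \in X' by rewrite in_upper c2 /=; lia.
have [h1 h2] := p'corner c2'; rewrite /= in h1 h2.
have e1 : p'.1 = p.1 - 1 by lia.
have hc : p'.2 <= c by apply: h2; rewrite e1.
have hc2 : p.2 <= c < p.2 + a%:Z by rewrite -(@prow (p.1, c)).
have left : p.2 <= p'.2.
  rewrite leNgt; apply/negP => lt.
  have : (p.1, p'.2) \in X by apply: (cX p'X1 corner_in) => //=; lia.
  by rewrite prow //=; lia.
split => //; first lia.
move=> d; apply/andP/idP => [[d1 d2]|hd].
  have d2' : (p.1 - 1, d) \in X' by rewrite in_upper d2 /=; lia.
  have [_ h3] := p'corner d2'; have : p'.2 <= d by apply: h3; rewrite /=; lia.
  by move: d1; rewrite prow //=; lia.
have d1 : (p.1, d) \in X by rewrite prow //=; lia.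
split => //; apply: (cX p'X1 d1) => //=; lia.
Qed.

End RemoveBottomRow.

Lemma rib_corner (p : box) l S (b : box) : b \in translate p (rib l S) ->
  b.1 <= p.1 /\ (b.1 = p.1 -> p.2 <= b.2).
Proof.
rewrite in_translate => /ribP[i hi e]; box_proj e.
by have := cnt_bounds S (leq0n i); rewrite /cnt /= => h; split; lia.
Qed.

Lemma fat_corner_translate (p : box) w u s S (b : box) : b \in translate p (fat w u s S) ->
  b.1 <= p.1 /\ (b.1 = p.1 -> p.2 <= b.2).
Proof. by rewrite in_translate => /fat_corner; rewrite !boxE => -[h1 h2]; split; lia. Qed.

Lemma convex_rib X : convex X -> X != fset0 -> linked X -> (forall r, single_overlap X r) ->
  exists p l S, (0 < l)%N /\ X = translate p (rib l S).
Proof.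
have [n] := ubnP #|` X|; elim: n X => // n IH X Xn cX X0 lX sX.
have [p [a [a0 pmax prow]]] := bottom_row cX X0.
have XE := split_bottom pmax prow; have cd := card_upper a0 prow.
have [E|X'0] := eqVneq (upper_rows X p) fset0.
  by exists p, a, (fun=> false); split => //; rewrite XE E fsetU0 rib_row.
have [||p' [l [S [l0 X'E]]]] := IH (upper_rows X p) _ (upper_convex cX) X'0 (upper_linked lX).
- by lia.
- move=> r c c'; rewrite !in_upper => /andP[h1 _] /andP[h2 _] /andP[h3 _] /andP[h4 _]; exact: sX h1 h2 h3 h4.
have p'X : p' \in upper_rows X p.
  by rewrite X'E in_translate subrr; apply/ribP; exists 0%N => //; box_lia.
have [|h1 h2 h3 h4] := overlap_interval cX lX a0 prow p'X.
  by move=> b; rewrite X'E; exact: rib_corner.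
have e : p'.2 = p.2 + a%:Z - 1.
  have /andP[i1 i2] : ((p.1, p'.2) \in X) && ((p.1 - 1, p'.2) \in X) by rewrite h4; lia.
  have /andP[j1 j2] : ((p.1, p.2 + a%:Z - 1) \in X) && ((p.1 - 1, p.2 + a%:Z - 1) \in X).
    by rewrite h4; lia.
  exact: (sX p.1 _ _ i1 i2 j1 j2).
exists p, (a + l)%N, (prefix_marks a S); split; first lia.
rewrite -rib_prefix // {1}XE X'E; congr (_ `|` translate _ _); box_lia.
Qed.

(** Bottom rows are removed until the row [r0] of the large overlap is at the bottom; what lies
    above it has only single overlaps and is a ribbon. *)
Lemma convex_fat w X (r0 c0 : int) : (0 < w)%N -> convex X -> linked X ->
  (forall r, r != r0 -> single_overlap X r) ->
  (forall c, ((r0, c) \in X) && ((r0 - 1, c) \in X) = (c0 <= c <= c0 + w%:Z)) ->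
  exists p u s S, [/\ (0 < u)%N, (0 < s)%N, window_free w u S & X = translate p (fat w u s S)].
Proof.
move=> w0; have [n] := ubnP #|` X|; elim: n X => // n IH X Xn cX lX sX fX.
have /andP[rX r'X] : ((r0, c0) \in X) && ((r0 - 1, c0) \in X) by rewrite fX; lia.
have X0 : X != fset0 by apply/fset0Pn; exists (r0, c0).
have [p [a [a0 pmax prow]]] := bottom_row cX X0.
have XE := split_bottom pmax prow; have cd := card_upper a0 prow.
have rp : r0 <= p.1 := pmax _ rX.
have r'X' : (r0 - 1, c0) \in upper_rows X p by rewrite in_upper r'X /=; lia.
have X'0 : upper_rows X p != fset0 by apply/fset0Pn; exists (r0 - 1, c0).
have sX' r : r != r0 -> single_overlap (upper_rows X p) r.
  move=> hr c c'; rewrite !in_upper => /andP[h1 _] /andP[h2 _] /andP[h3 _] /andP[h4 _].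
  exact: (sX r hr _ _ h1 h2 h3 h4).
have [e0|ne0] := eqVneq r0 p.1.
  have [|p' [l [S [l0 X'E]]]] := convex_rib (upper_convex cX) X'0 (upper_linked lX).
    move=> r; have [er|] := eqVneq r r0; last exact: sX'.
    by move=> c c'; rewrite in_upper /= er e0 ltxx andbF.
  have p'X : p' \in upper_rows X p.
    by rewrite X'E in_translate subrr; apply/ribP; exists 0%N => //; box_lia.
  have [|h1 h2 h3 h4] := overlap_interval cX lX a0 prow p'X.
    by move=> b; rewrite X'E; exact: rib_corner.
  have {}h4 c : (c0 <= c <= c0 + w%:Z) = (p'.2 <= c < p.2 + a%:Z) by rewrite -fX e0 h4.
  have q1 := h4 c0; have q2 := h4 p'.2; have q3 := h4 (c0 + w%:Z); have q4 := h4 (p.2 + a%:Z - 1).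
  have e1 : p'.2 = c0 by lia.
  have e2 : p.2 + a%:Z - 1 = c0 + w%:Z by lia.
  have rowS i : (i <= w)%N -> (i < l)%N /\ cnt S i = 0%N.
    move=> hi; have : (p.1 - 1, c0 + i%:Z) \in upper_rows X p.
      have := fX (c0 + i%:Z); rewrite in_upper e0 => /esym; have -> : (c0 <= c0 + i%:Z <= c0 + w%:Z) by lia.
      by move=> /esym/andP[_ ->] /=; lia.
    rewrite X'E in_translate => /ribP[j hj ej]; box_proj ej.
    have [ij cj] : i = j /\ cnt S j = 0%N by lia.
    by rewrite ij.
  have [wl _] := rowS w (leqnn _).
  have wS x : (0 < x <= w)%N -> S x = false.
    case: x => // x hx; have [_ q5] := rowS x.+1 (proj2 (andP hx)); have := cntS S x; rewrite q5.
    by case: (S x.+1) => //; lia.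
  exists p, (a - w)%N, (l - w)%N, (shift_marks (a - w) S); split; try lia.
    exact: shift_window.
  rewrite -fat_base // {1}XE X'E; congr (row_of p _ `|` translate _ (rib _ _)); try lia.
  by box_lia.
have [||p' [u [s [S [u0 s0 wS X'E]]]]] := IH (upper_rows X p) _ (upper_convex cX) (upper_linked lX) sX'.
- by lia.
- move=> c; rewrite -fX !in_upper /=; have -> : r0 < p.1 by lia.
  by have -> : r0 - 1 < p.1 by [lia]; rewrite !andbT.
have p'X : p' \in upper_rows X p.
  by rewrite X'E in_translate subrr; apply/fatP; left; exists 0%N; [lia | box_lia].
have [|h1 h2 h3 h4] := overlap_interval cX lX a0 prow p'X.
  by move=> b; rewrite X'E; exact: fat_corner_translate.
have e : p'.2 = p.2 + a%:Z - 1.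
  have /andP[i1 i2] : ((p.1, p'.2) \in X) && ((p.1 - 1, p'.2) \in X) by rewrite h4; lia.
  have /andP[j1 j2] : ((p.1, p.2 + a%:Z - 1) \in X) && ((p.1 - 1, p.2 + a%:Z - 1) \in X).
    by rewrite h4; lia.
  by apply: (sX p.1 _ _ _ i1 i2 j1 j2); rewrite eq_sym.
exists p, (a + u)%N, s, (prefix_marks a S); split => //; first lia; first exact: prefix_window.
rewrite -fat_prefix // {1}XE X'E; congr (_ `|` translate _ _); box_lia.
Qed.

Lemma connected_cut X (P : box -> bool) : edgewise_connected X ->
  forall a b : box, a \in X -> b \in X -> P a -> ~~ P b ->
  exists x y : box, [/\ x \in X, y \in X, adjacent x y, P x & ~~ P y].
Proof.
case=> _ con a b aX bX Pa Pb; have /connectP[s] := con [` aX] [` bX].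
elim: s a aX Pa => [|z s IH] a aX Pa /=; first by move=> _ /(congr1 val) /= e; move: Pb; rewrite e Pa.
case/andP => az ps e; have [Pz|Pz] := boolP (P (val z)).
  by case: z az ps e Pz => z zX /= az ps e Pz; exact: (IH z zX Pz ps e).
by exists a, (val z); split => //; exact: valP.
Qed.

Lemma connected_linked X : edgewise_connected X -> linked X.
Proof.
move=> con a b aX bX ab.
have [||x [y [xX yX xy Px Py]]] := connected_cut (P := fun z => b.1 <= z.1) con bX aX.
- by rewrite lexx.
- by rewrite -ltNge.
exists x.2; move: xy; rewrite /adjacent => /eqP xy; rewrite -ltNge in Py.
have -> : (b.1, x.2) = x by apply: box_eq; rewrite /=; lia.
have -> : (b.1 - 1, x.2) = y by apply: box_eq; rewrite /=; lia.
by rewrite xX yX.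
Qed.

(** Two columns shared by consecutive rows would span a block of size two, by convexity. *)
Lemma ribbon_rib T : ribbon T -> exists p l S, (0 < l)%N /\ T = translate p (rib l S).
Proof.
case=> /skew_convex cT con noblock; case: (con) => T0 _.
apply: convex_rib => //; first exact: connected_linked.
have key (r c c' : int) : (r, c) \in T -> (r - 1, c) \in T -> (r, c') \in T -> (r - 1, c') \in T -> ~ (c < c').
  move=> h1 h2 h3 h4 lt; apply: noblock; exists (r - 1, c).
  apply/fsubsetP => b /imfset2P[i hi [j hj ->]].
  have {}hi : (i < 2)%N by move: hi; change (i \in iota 0 2 -> (i < 2)%N); rewrite mem_iota.
  have {}hj : (j < 2)%N by move: hj; change (j \in iota 0 2 -> (j < 2)%N); rewrite mem_iota.
  by apply: (cT _ _ _ h2 h3); rewrite !boxE /=; lia.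
move=> r c c' h1 h2 h3 h4; have := key r c c' h1 h2 h3 h4; have := key r c' c h3 h4 h1 h2; lia.
Qed.

Lemma rib_ribbon (p : box) l S : (0 < l)%N -> ribbon (translate p (rib l S)).
Proof.
move=> l0; set T := translate p (rib l S).
have inT i : (i < l)%N -> pos S i + p \in T.
  by move=> hi; rewrite in_translate addrK; apply/ribP; exists i.
split.
- by apply: convex_skew; apply: convex_translate; exact: rib_convex.
- split; first by apply/fset0Pn; exists (pos S 0 + p); exact: inT.
  set e := fun x y : T => _.
  have esym : connect_sym e.
    apply: sym_connect_sym => x y; rewrite /e /adjacent; congr (_ + _ == _); exact: distrC.
  have from0 i (h0 : pos S 0 + p \in T) : forall h : pos S i + p \in T, (i < l)%N -> connect e [` h0] [` h].
    elim: i => [|i IH] h il; first by rewrite (bool_irrelevance h h0) connect0.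
    apply: connect_trans (IH (inT _ (ltnW il)) (ltnW il)) (connect1 _).
    rewrite /e /adjacent !bE /= cntS; case: (S i.+1); lia.
  have all0 (a : T) : connect e [` inT _ l0] a.
    case: a => a aT; have := aT; rewrite in_translate => /ribP[i hi ea].
    have {ea} ea : a = pos S i + p by rewrite -ea subrK.
    by subst a; exact: from0.
  by move=> a b; apply: connect_trans (all0 b); rewrite esym.
case=> q /fsubsetP sub.
have inb i j : (i < 2)%N -> (j < 2)%N -> q + (i%:Z, j%:Z) \in T.
  move=> hi hj; apply: sub; apply/imfset2P.
  exists i; first by change (i \in iota 0 2); rewrite mem_iota.
  by exists j => //; change (j \in iota 0 2); rewrite mem_iota.
have := inb 0%N 0%N isT isT; have := inb 1%N 1%N isT isT; rewrite !in_translate.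
move=> /ribP[i hi ei] /ribP[j hj ej]; box_proj ei; box_proj ej.
have ij : i = j by lia.
by subst j; lia.
Qed.

(** The row counts of [X] are those of the boxdot: all rows except the top one meet the row above,
    exactly one pair shares more than one column, and that pair shares [w + 1]. *)
Lemma equivalent_fat w u s S X : (0 < w)%N -> (0 < u)%N -> (0 < s)%N -> window_free w u S ->
  convex X -> equivalent X (fat w u s S) ->
  exists u' s' S', [/\ (0 < u')%N, (0 < s')%N, window_free w u' S' & same_diagram X (fat w u' s' S')].
Proof.
move=> w0 u0 s0 wS cX XF; have cF := fat_convex w0 u0 s0 wS.
have [eR eT] := equivalent_rows cX cF XF.
have r1 := fat_rows_trim w0 u0 s0 wS.
have rk k : (0 < k <= w)%N -> #|` rows (iter k ltrim (trim X))| = 1%N.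
  by move=> hk; rewrite eT fat_rows_ltrim.
have rw : #|` rows (iter w.+1 ltrim (trim X))| = 0%N by rewrite eT fat_rows_ltrim0.
have cT := convex_trim cX.
have X0 : X != fset0.
  apply/eqP => X0; move: eR; rewrite r1 X0; have -> : rows fset0 = fset0 by rewrite /rows imfset0.
  by rewrite cardfs0.
have lX : linked X.
  have [t tX tmin] := fset_argmin (fun b => b.1) X0.
  have tR : t.1 \in rows X by apply/rowsP; exists t.
  have sub : rows (trim X) `<=` rows X `\ t.1.
    apply/fsubsetP => r /rowsP[b]; rewrite in_trim northE => /andP[bX /tmin /= h] ->.
    by rewrite !inE; apply/andP; split; [lia | apply/rowsP; exists b].
  have E : rows (trim X) = rows X `\ t.1.
    apply/eqP; rewrite eqEfcard sub /=; have := cardfsD1 t.1 (rows X); rewrite tR /= eR r1.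
    by have := eT 0%N; rewrite /= => <-; lia.
  move=> a b aX bX ab; have : b.1 \in rows (trim X).
    rewrite E !inE; apply/andP; split; last by apply/rowsP; exists b.
    by have := tmin _ aX; lia.
  case/rowsP => x; rewrite in_trim northE => /andP[xX x'X] e; exists x.2; rewrite e.
  by rewrite -surjective_pairing xX.
have [r0 r0E] : exists r0, rows (iter 1 ltrim (trim X)) = [fset r0].
  by have := rk 1%N; rewrite w0 => /(_ isT) /eqP /cardfs1P.
have only (r c c' : int) : (r, c) \in trim X -> (r, c') \in trim X -> c < c' -> r = r0.
  move=> h1 h2 lt; apply/eqP; rewrite -in_fset1 -r0E; apply/rowsP; exists (r, c') => //.
  rewrite in_iter_ltrim // h2 /=; apply: (cT _ _ _ h1 h2) => //=; lia.
have inT (r c : int) : ((r, c) \in trim X) = ((r, c) \in X) && ((r - 1, c) \in X).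
  by rewrite in_trim northE.
have [c1 [h1 h2]] : exists c, (r0, c) \in trim X /\ (r0, c - w%:Z) \in trim X.
  have := rk w; rewrite w0 leqnn => /(_ isT) /eqP /cardfs1P[r Er].
  have : r \in rows (iter w ltrim (trim X)) by rewrite Er in_fset1.
  case/rowsP => b; rewrite in_iter_ltrim // => /andP[q1 q2] _.
  have eb : b = (b.1, b.2) by apply: surjective_pairing.
  have := q1; rewrite eb => q1'; have e := only _ _ _ q2 q1'; rewrite e in q1' q2 *; last lia.
  by exists b.2.
have far (r c c' : int) : (r, c) \in trim X -> (r, c') \in trim X -> c' - c <= w%:Z.
  move=> q1 q2; rewrite leNgt; apply/negP => lt.
  have : r \in rows (iter w.+1 ltrim (trim X)).
    apply/rowsP; exists (r, c') => //; rewrite in_iter_ltrim // q2 /=.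
    by apply: (cT _ _ _ q1 q2) => //=; lia.
  by move/eqP: rw; rewrite cardfs_eq0 => /eqP ->; rewrite in_fset0.
have [||p [u' [s' [S' [u'0 s'0 wS' E]]]]] := @convex_fat w X r0 (c1 - w%:Z) w0 cX lX.
- move=> r hr c c' q1 q2 q3 q4.
  have t1 : (r, c) \in trim X by rewrite inT q1.
  have t2 : (r, c') \in trim X by rewrite inT q3.
  case: (ltgtP c c') => // lt; first by rewrite (only _ _ _ t1 t2 lt) eqxx in hr.
  by rewrite (only _ _ _ t2 t1 lt) eqxx in hr.
- move=> c; rewrite -inT; apply/idP/idP => [q|q].
    by have := far _ _ _ q h1; have := far _ _ _ h2 q; lia.
  by apply: (cT _ _ _ h2 h1) => //=; lia.
by exists u', s', S'; split => //; rewrite E; apply/same_sym/same_translate.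
Qed.

(** * Compositions of ribbons *)

Lemma maxzP (s : seq int) x : x \in s -> (forall y, y \in s -> y <= x) -> maxz s = x.
Proof.
move=> xs xmax; rewrite /maxz; have : head 0 s <= x.
  by case: s xs xmax => // y s _ h; apply: h; rewrite mem_head.
move: (head 0 s) => a ax; apply/le_anti/andP; split.
  elim: s xmax {xs} => //= y s IH h; rewrite ge_max h ?mem_head //= IH // => z zs.
  by apply: h; rewrite inE zs orbT.
elim: s xs {xmax} => //= y s IH; rewrite inE le_max => /orP[/eqP ->|/IH ->]; by rewrite ?lexx ?orbT.
Qed.

Lemma minzP (s : seq int) x : x \in s -> (forall y, y \in s -> x <= y) -> minz s = x.
Proof.
move=> xs xmin; rewrite /minz; have : x <= head 0 s.
  by case: s xs xmin => // y s _ h; apply: h; rewrite mem_head.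
move: (head 0 s) => a ax; apply/le_anti/andP; split; last first.
  elim: s xmin {xs} => //= y s IH h; rewrite le_min h ?mem_head //= IH // => z zs.
  by apply: h; rewrite inE zs orbT.
elim: s xs {xmin} => //= y s IH; rewrite inE ge_min => /orP[/eqP ->|/IH ->]; by rewrite ?lexx ?orbT.
Qed.

Lemma size_row (T : diagram) i (p : box) a : p.1 = i ->
  (forall b : box, (b \in T) && (b.1 == i) = (b \in row_of p a)) -> size (row_columns T i) = a.
Proof.
move=> pi h; rewrite /row_columns size_map.
have pt : perm_eq [seq b <- enum_fset T | b.1 == i] [seq p + (0, k%:Z) | k <- iota 0 a].
  apply: uniq_perm; first by rewrite filter_uniq ?fset_uniq.
    by rewrite map_inj_uniq ?iota_uniq // => x y /(congr1 snd); rewrite !boxE /=; lia.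
  move=> b; rewrite mem_filter andbC; rewrite -[X in X && _]/(b \in T) h.
  apply/imfsetP/mapP => [[k /= hk ->]|[k hk ->]]; by exists k.
by rewrite (perm_size pt) size_map size_iota.
Qed.

Lemma first_run (S : nat -> bool) l : (0 < l)%N ->
  exists2 a, (0 < a <= l)%N & forall i, (i < l)%N -> (cnt S i == 0%N) = (i < a)%N.
Proof.
case: l => // l _; elim: l => [|l [a ha IH]]; first by exists 1%N => // -[].
have [e|ne] := eqVneq a l.+1.
  have [z|nz] := eqVneq (cnt S l.+1) 0%N.
    exists l.+2 => [|i hi]; first lia.
    rewrite hi; have : (i <= l.+1)%N by lia.
    by move/(cnt_bounds S); lia.
  exists l.+1 => [|i hi]; first lia.
  case: (ltngtP i l.+1) => h; [by rewrite IH // e | lia | by rewrite h (negbTE nz)].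
exists a => [|i hi]; first lia.
case: (ltngtP i l.+1) => h; [by rewrite IH | lia |].
have := IH a; rewrite ltnn => h1; have h2 : (a <= i)%N by lia.
have := cnt_bounds S h2; lia.
Qed.

Section RibbonEnds.

Variables (l : nat) (tau : nat -> bool) (v : box).
Hypothesis l0 : (0 < l)%N.

Let T := translate v (rib l tau).

Lemma in_ribT (b : box) : reflect (exists2 i, (i < l)%N & b = v + pos tau i) (b \in T).
Proof.
rewrite in_translate; apply: (iffP (ribP _ _ _)) => -[i hi e]; exists i => //.
  by rewrite -e addrC subrK.
by rewrite e addrC addKr.
Qed.

Lemma bottom_indexE : bottom_index T = v.1.
Proof using l0.
apply: maxzP.
  apply/mapP; exists (v + pos tau 0); last by rewrite !bE /cnt /=; lia.
  by apply/in_ribT; exists 0%N.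
by move=> y /mapP[b /in_ribT[i hi ->] ->]; rewrite !bE; lia.
Qed.

Lemma top_indexE : top_index T = v.1 - (cnt tau l.-1)%:Z.
Proof using l0.
apply: minzP.
  apply/mapP; exists (v + pos tau l.-1); last by rewrite !bE /=; lia.
  by apply/in_ribT; exists l.-1 => //; lia.
move=> y /mapP[b /in_ribT[i hi ->] ->]; rewrite !bE; have h : (i <= l.-1)%N by lia.
by have := cnt_bounds tau h; lia.
Qed.

Lemma bottom_length_le k : (0 < k)%N ->
  (k <= bottom_length T)%N = (k <= l)%N && (cnt tau k.-1 == 0%N).
Proof using l0.
move=> k0; have [a ha aP] := first_run tau l0.
have -> : bottom_length T = a.
  rewrite /bottom_length bottom_indexE; apply: (@size_row _ _ v a) => // b.
  rewrite in_row_of; apply/andP/andP => [[/in_ribT[i hi ->] /eqP e]|[/eqP e h]].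
    rewrite !bE in e; have := aP i hi; have -> : cnt tau i = 0%N by lia.
    move=> /esym ia; rewrite eqxx in ia; have c0 : cnt tau i = 0%N by lia.
    by split; [apply/eqP; rewrite !bE; lia | rewrite !bE c0; lia].
  split; last by rewrite e.
  have hi : (absz (b.2 - v.2) < a)%N by lia.
  have hl : (absz (b.2 - v.2) < l)%N by lia.
  apply/in_ribT; exists (absz (b.2 - v.2)) => //.
  have := aP _ hl; rewrite hi => /eqP c0; apply: box_eq; rewrite !bE c0; lia.
have [kl|kl] := leqP k l; last by rewrite /=; lia.
by have hk : (k.-1 < l)%N; [lia | rewrite aP //=; lia].
Qed.

Lemma top_length_le k : (0 < k)%N ->
  (k <= top_length T)%N = (k <= l)%N && (cnt tau (l - k) == cnt tau l.-1).
Proof using l0.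
move=> k0; have [a ha aP] := first_run (revm l tau) l0.
have {}aP i : (i < l)%N -> (cnt tau i == cnt tau l.-1) = (l <= i + a)%N.
  move=> hi; have hi' : (l.-1 - i < l)%N by lia.
  have := aP _ hi'; have := cnt_revm tau hi'; have -> : (l.-1 - (l.-1 - i) = i)%N by lia.
  by move=> e1 e2; lia.
have -> : top_length T = a.
  rewrite /top_length top_indexE.
  pose p : box := v + (- (cnt tau l.-1)%:Z, (l - a)%N%:Z - (cnt tau l.-1)%:Z).
  apply: (@size_row _ _ p a); first by rewrite !boxE.
  move=> b; rewrite in_row_of /p !boxE /=; apply/andP/andP => [[/in_ribT[i hi ->] /eqP e]|[/eqP e h]].
    rewrite !bE in e; have := aP i hi; have -> : cnt tau i = cnt tau l.-1 by lia.
    move=> /esym; rewrite eqxx => ia; have ci : cnt tau i = cnt tau l.-1 by lia.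
    by split; [apply/eqP; rewrite !bE; lia | rewrite !bE ci; lia].
  split; last by apply/eqP; lia.
  pose i := absz (b.2 - v.2 + (cnt tau l.-1)%:Z).
  have il : (i < l)%N by rewrite /i; lia.
  have ia : (l <= i + a)%N by rewrite /i; lia.
  apply/in_ribT; exists i => //; have := aP _ il; rewrite ia => /eqP ci.
  by apply: box_eq; rewrite !bE ci /i; lia.
have [kl|kl] := leqP k l; last by rewrite /=; lia.
by have hk : (l - k < l)%N; [lia | rewrite aP //=; lia].
Qed.

Lemma lower_cornerE : lower_corner T = v.
Proof using l0.
rewrite /lower_corner bottom_indexE [RHS]surjective_pairing; congr (_, _); apply: minzP.
  apply/mapP; exists v => //; rewrite mem_filter eqxx /=; apply/in_ribT; exists 0%N => //.
  by apply: box_eq; rewrite !bE /cnt /=; lia.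
move=> y /mapP[b]; rewrite mem_filter => /andP[/eqP e /in_ribT[i hi eb]] ->.
rewrite eb !bE in e *; lia.
Qed.

Variable w : nat.
Hypothesis w0 : (0 < w)%N.

Lemma upper_cornerE : upper_corner w.+1 T = v + (pos tau l.-1 - (0, w.-1%:Z)).
Proof using l0 w0.
rewrite /upper_corner top_indexE.
have -> : maxz (row_columns T (v.1 - (cnt tau l.-1)%:Z)) = (v + pos tau l.-1).2.
  apply: maxzP.
    apply/mapP; exists (v + pos tau l.-1) => //; rewrite mem_filter !bE; apply/andP; split; first by apply/eqP; lia.
    by apply/in_ribT; exists l.-1 => //; lia.
  move=> y /mapP[b]; rewrite mem_filter => /andP[/eqP e /in_ribT[i hi eb]] ->.
  rewrite eb !bE in e *; have h : (i <= l.-1)%N by lia.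
  by have := cnt_bounds tau h; lia.
by apply: box_eq; rewrite !bE /=; lia.
Qed.

End RibbonEnds.

(** For a ribbon of [c + w] boxes: the bottom and the top row have at least [w] boxes, so the two
    copies of the row [W] start at positions [0] and [c]. *)
Definition flat_ends (w c : nat) (tau : nat -> bool) :=
  (forall x, (0 < x < w)%N -> tau x = false) /\ (forall x, (c < x < c + w)%N -> tau x = false).

Lemma cnt_const S i j : (i <= j)%N -> (cnt S i == cnt S j) = [forall x : 'I_j, (i <= x)%N ==> ~~ S x.+1].
Proof.
move=> ij; apply/eqP/forallP => [e x|h].
  apply/implyP => ix; apply/negP => Sx; have := cntS S x; rewrite Sx.
  by have := cnt_bounds S ix; have := cnt_bounds S (ltn_ord x); lia.
elim: j ij h => [|j IH] ij h; first by have -> : i = 0%N by lia.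
move: ij; rewrite leq_eqVlt => /orP[/eqP ->//|ij]; rewrite cntS -IH.
- by have /implyP := h ord_max; rewrite /= => /(_ ij) /negbTE ->; rewrite addn0.
- by [].
- by move=> x; have := h (widen_ord (leqnSn j) x).
Qed.

Lemma cnt_constP S i j : (i <= j)%N ->
  cnt S i = cnt S j <-> (forall x, (i < x <= j)%N -> S x = false).
Proof.
move=> ij; split=> [/eqP|h]; last first.
  apply/eqP; rewrite cnt_const //; apply/forallP => x; apply/implyP => ix; rewrite h //.
  by have := ltn_ord x; lia.
rewrite cnt_const // => /forallP h [//|x] hx; have hxj : (x < j)%N by lia.
by have /implyP := h (Ordinal hxj) => /(_ _) /negbTE; apply; rewrite /=; lia.
Qed.

(** The word of period [c] followed by the translates of [T] along a row of [S], where the copies of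
    [W] are identified. *)
Definition per (c : nat) (tau : nat -> bool) (x : nat) := tau (x.-1 %% c).+1.

Section Composition.

Variables (w c k : nat) (tau sigma : nat -> bool) (v q0 : box).
Hypothesis w0 : (0 < w)%N.
Hypothesis ends : flat_ends w c tau.

Let T := translate v (rib (c + w) tau).
Let S := translate q0 (rib k sigma).
Let P := per c tau.
Let l0 : (0 < c + w)%N := ltn_addl c w0.

Lemma upper_cornerE' : upper_corner w.+1 T = v + pos tau c.
Proof using w0 ends.
rewrite upper_cornerE //; congr (_ + _).
have h : (c <= (c + w).-1)%N by lia.
have e : cnt tau c = cnt tau (c + w).-1.
  by apply/(cnt_constP tau h) => x hx; apply: (proj2 ends); lia.
by apply: box_eq; rewrite !bE /= -e; lia.
Qed.

Lemma east_stepE : east_step w.+1 T = pos tau c.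
Proof using w0 ends.
by rewrite /east_step upper_cornerE' lower_cornerE // addrC addKr.
Qed.

Lemma flat_composable : row_composable w.+1 T.
Proof using w0 ends.
have h1 : (0 <= w.-1)%N by [].
have h2 : (c <= (c + w).-1)%N by lia.
split.
- rewrite /= bottom_length_le //; apply/andP; split; first lia.
  apply/eqP/esym; rewrite -[LHS]/(cnt tau 0); apply/(cnt_constP tau h1) => x hx; apply: (proj1 ends); lia.
- rewrite /= top_length_le //; apply/andP; split; first lia.
  rewrite addnK; apply/eqP/(cnt_constP tau h2) => x hx; apply: (proj2 ends); lia.
apply: convex_skew; rewrite /lower_copy /upper_copy upper_cornerE' lower_cornerE //.
have E (b : box) : b \in T `\` row_of v w `\` row_of (v + pos tau c) w ->
    exists2 i, (w <= i < c)%N & b = v + pos tau i.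
  rewrite !inE !in_row_of => /andP[nu /andP[nl /in_ribT[i hi e]]]; exists i => //.
  apply/andP; split.
    rewrite leqNgt; apply/negP => iw; case/negP: nl; rewrite e.
    have c0 : cnt tau i = 0%N.
      apply/esym; rewrite -[LHS]/(cnt tau 0); apply/(cnt_constP tau (leq0n i)) => x hx; apply: (proj1 ends); lia.
    by rewrite !bE c0; apply/andP; split; [apply/eqP|]; lia.
  rewrite ltnNge; apply/negP => ci; case/negP: nu; rewrite e.
  have c0 : cnt tau c = cnt tau i by apply/(cnt_constP tau ci) => x hx; apply: (proj2 ends); lia.
  by rewrite !bE c0; apply/andP; split; [apply/eqP|]; lia.
move=> a b z /E[i hi ->] /E[j hj ->]; rewrite !boxE => g1 g2 g3 g4.
have [||||n hn e] := @pos_between tau i j (z - v); rewrite ?boxE; try lia.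
have {e} e : z = v + pos tau n by rewrite -e addrC subrK.
rewrite !inE !in_row_of e; apply/andP; split; [|apply/andP; split]; last by apply/in_ribT; exists n => //; lia.
- apply/negP => /andP[/eqP g5 g6]; rewrite !bE in g5 g6.
  have nc : (n <= c)%N by lia.
  by have := cnt_bounds tau nc; lia.
- apply/negP => /andP[/eqP g5 g6]; rewrite !bE in g5 g6; lia.
Qed.

Hypothesis c0 : (0 < c)%N.

Lemma lower_horizontalE : lower_horizontal w.+1 T = ~~ tau w.
Proof using w0 ends c0.
rewrite /lower_horizontal bottom_length_le //=; have -> : (w < c + w)%N by lia.
have h1 : (0 <= w.-1)%N by [].
have e : cnt tau w.-1 = 0%N.
  by apply/esym; rewrite -[LHS]/(cnt tau 0); apply/(cnt_constP tau h1) => x hx; apply: (proj1 ends); lia.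
by have := cntS tau w.-1; rewrite prednK // e add0n => ->; case: (tau w).
Qed.

Lemma upper_horizontalE : upper_horizontal w.+1 T = ~~ tau c.
Proof using w0 ends c0.
rewrite /upper_horizontal top_length_le //=; have -> : (w < c + w)%N by lia.
have h2 : (c <= (c + w).-1)%N by lia.
have <- : cnt tau c = cnt tau (c + w).-1.
  by apply/(cnt_constP tau h2) => x hx; apply: (proj2 ends); lia.
have -> : (c + w - w.+1 = c.-1)%N by lia.
by have := cntS tau c.-1; rewrite prednK // => ->; case: (tau c); lia.
Qed.

(** What a north step adds to an east step: the diagonal vector taken [tau w + tau c - 1] times. A
    mark at [w] or [c] expresses vertical attachment of the lower or upper copy; [eps] places the
    extra copy in the mixed types. *)
Definition delta : box :=
  if tau w then (if tau c then (1, 1) else 0) else (if tau c then 0 else - (1, 1)).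
Definition eps : box := if tau w then - (1, 1) else (1, 1).

Lemma north_stepE : north_step w.+1 T = pos tau c + delta.
Proof using w0 ends c0.
rewrite /north_step east_stepE lower_horizontalE upper_horizontalE /delta.
by case: (tau w); case: (tau c).
Qed.

(** Beyond [c] the ribbon is flat at its top end, and so is the next period at its bottom end. *)
Lemma per_tau x : (0 < x < c + w)%N -> P x = tau x.
Proof using w0 ends c0.
move=> hx; rewrite /P /per; have e := divn_eq x.-1 c; have := ltn_pmod x.-1 c0 => hm.
have [xc|xc] := leqP x c; first by rewrite modn_small ?prednK //; lia.
rewrite [RHS](proj2 ends); last lia.
have q1 : (1 <= x.-1 %/ c)%N by rewrite divn_gt0 //; lia.
by apply: (proj1 ends); move: q1 e hm; move: (x.-1 %/ c)%N (x.-1 %% c)%N => q r q1 e hm; nia.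
Qed.

Lemma per_period x : (0 < x)%N -> P (x + c)%N = P x.
Proof. by case: x => // x _; rewrite /P /per addSn /= modnDr. Qed.

Lemma cnt_period x : cnt P (x + c) = (cnt P x + cnt P c)%N.
Proof.
elim: x => [|x IH]; first by rewrite add0n.
by rewrite addSn !cntS IH -addSn per_period // addnAC.
Qed.

Lemma pos_period i x : pos P (i * c + x) = pos P c *+ i + pos P x.
Proof.
elim: i => [|i IH]; first by rewrite mul0n add0n mulr0n add0r.
have -> : (i.+1 * c + x = i * c + x + c)%N by rewrite mulSn; lia.
rewrite mulrS -addrA -IH; have := cnt_period (i * c + x) => e; box_lia.
Qed.

Lemma pos_tau x : (x < c + w)%N -> pos tau x = pos P x.
Proof using w0 ends c0.
move=> hx; rewrite /pos (@cnt_ext tau P) // => y hy; rewrite per_tau //; lia.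
Qed.

Lemma offset_pos i : offset w.+1 T (q0 + pos sigma i) =
  offset w.+1 T q0 + (pos P c *+ i + delta *+ cnt sigma i).
Proof using w0 ends c0.
rewrite /offset north_stepE east_stepE pos_tau; last lia.
rewrite !bE !(mulrzDr, mulrzBr, mulrNz) -!pmulrn mulrnDl.
move: (pos P c *~ q0.2) ((pos P c + delta) *~ q0.1) (pos P c *+ i) (pos P c *+ cnt sigma i)
  (delta *+ cnt sigma i) => x1 x2 x3 x4 x5.
by apply: box_eq; rewrite !boxE; lia.
Qed.

Let base := v + offset w.+1 T q0.

(** East and north steps differ by a diagonal vector only, so all translates lie along one periodic
    ribbon, displaced by [delta] once for every mark of [S] passed. *)
Lemma compose_mem (b : box) : b \in row_compose w.+1 S T <->
  (exists i x, [/\ (i < k)%N, (x < c + w)%N & b = base + (pos P (i * c + x) + delta *+ cnt sigma i)]) \/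
  (tau w != tau c /\ exists i x,
     [/\ (i.+1 < k)%N, sigma i.+1, (x < w)%N & b = base + (pos P (i.+1 * c + x) + eps)]).
Proof using w0 ends c0.
have lcE : lower_copy w.+1 T = row_of v w by rewrite /lower_copy lower_cornerE.
have wP x : (x < w)%N -> pos P x = (0, x%:Z).
  move=> hx; rewrite -pos_tau; last lia.
  have e0 : cnt tau x = 0%N.
    by apply/esym; rewrite -[LHS]/(cnt tau 0); apply/(cnt_constP tau (leq0n x)) => y hy; apply: (proj1 ends); lia.
  by apply: box_eq; rewrite !bE e0 /=; lia.
have step1 i (b' : box) : b' \in translate (offset w.+1 T (q0 + pos sigma i)) T <->
    exists2 x, (x < c + w)%N & b' = base + (pos P (i * c + x) + delta *+ cnt sigma i).
  rewrite in_translate offset_pos; split=> [/in_ribT[x hx e]|[x hx ->]].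
    exists x => //; move: e; rewrite pos_tau // pos_period /base.
    move: (offset _ _ _) (pos P c *+ i) (delta *+ _) (pos P x) => o x1 x2 x3 e; box_proj e.
    by apply: box_eq; rewrite !boxE; lia.
  apply/in_ribT; exists x => //; rewrite pos_tau // pos_period /base.
  move: (offset _ _ _) (pos P c *+ i) (delta *+ _) (pos P x) => o x1 x2 x3.
  by apply: box_eq; rewrite !boxE; lia.
have northS i : (i < k)%N -> north (q0 + pos sigma i) \in S <-> (i.+1 < k)%N && sigma i.+1.
  move=> hi; rewrite northE; split=> [/in_ribT[j hj e]|/andP[h1 h2]].
    box_proj e; have ej : j = i.+1 by lia.
    by subst j; rewrite hj; have := cntS sigma i; case: (sigma i.+1) => //; lia.
  by apply/in_ribT; exists i.+1 => //; have := cntS sigma i; rewrite h2 => e; box_lia.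
have northE' i : (i.+1 < k)%N -> sigma i.+1 -> north (q0 + pos sigma i) = q0 + pos sigma i.+1.
  by move=> h1 h2; rewrite northE; have := cntS sigma i; rewrite h2 => e; box_lia.
have rowshift (o b' : box) : b' \in translate o (row_of v w) <-> exists2 x, (x < w)%N & b' = v + o + (0, x%:Z).
  rewrite in_translate in_row_of; split=> [/andP[/eqP e h]|[x hx ->]].
    rewrite !boxE in e h; pose x := absz (b'.2 - o.2 - v.2)%R.
    by exists x; [rewrite /x; lia | apply: box_eq; rewrite !boxE /= /x; lia].
  by rewrite !boxE /=; apply/andP; split; [apply/eqP|]; lia.
have extraE i (b' : box) : (i.+1 < k)%N -> sigma i.+1 ->
   b' \in extra_copy w.+1 T (q0 + pos sigma i) <-> tau w != tau c /\ exists2 x, (x < w)%N &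
     b' = base + (pos P (i.+1 * c + x) + eps).
  move=> h1 h2; rewrite /extra_copy lower_horizontalE upper_horizontalE northE' // offset_pos lcE /eps.
  have d0 : tau w != tau c -> delta *+ cnt sigma i.+1 = 0.
    by rewrite /delta; case: (tau w); case: (tau c) => // _; rewrite mul0rn.
  case tw: (tau w) d0; case tc: (tau c) => //= d0; rewrite ?in_fset0; try by split => // -[].
  - rewrite d0 // addr0; split=> [/rowshift[x hx ->]|[_ [x hx ->]]]; [split=> //; exists x => //|apply/rowshift; exists x => //];
    rewrite pos_period (wP x) // /base /southeast1; move: (offset w.+1 T q0) (pos P c *+ i.+1) => o x1;
    by apply: box_eq; rewrite !boxE /=; lia.
  - rewrite d0 // addr0; split=> [/rowshift[x hx ->]|[_ [x hx ->]]]; [split=> //; exists x => //|apply/rowshift; exists x => //];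
    rewrite pos_period (wP x) // /base /southeast1; move: (offset w.+1 T q0) (pos P c *+ i.+1) => o x1;
    by apply: box_eq; rewrite !boxE /=; lia.
rewrite inE; split.
  case/orP => /bigfcupP[d /andP[/in_ribT[i hi ->]]].
    by move=> _ /step1[x hx e]; left; exists i, x.
  move=> /(northS i hi)/andP[h1 h2] /(extraE _ _ h1 h2)[tt [x hx e]].
  by right; split=> //; exists i, x.
case=> [[i [x [hi hx e]]]|[tt [i [x [h1 h2 hx e]]]]]; apply/orP; [left|right]; apply/bigfcupP.
  exists (q0 + pos sigma i); first by rewrite andbT; apply/in_ribT; exists i.
  by apply/step1; exists x.
exists (q0 + pos sigma i).
  by apply/andP; split; [apply/in_ribT; exists i => //; lia | apply/northS; [lia | rewrite h1]].
by apply/(extraE _ _ h1 h2); split=> //; exists x.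
Qed.

Lemma split_index p y : (0 < p)%N -> (y < p * c + w)%N ->
  exists i x, [/\ (i < p)%N, (x < c + w)%N & y = (i * c + x)%N].
Proof using w0 c0.
move=> p0 hy; have [h|h] := ltnP (y %/ c) p.
  exists (y %/ c)%N, (y %% c)%N; split => //; last exact: divn_eq.
  by have := ltn_pmod y c0; lia.
exists p.-1, (y - p.-1 * c)%N; have e := divn_eq y c.
have h2 : (p * c <= y)%N by rewrite e; apply: leq_trans (leq_addr _ _); rewrite leq_pmul2r.
have h3 : (p * c = p.-1 * c + c)%N by rewrite -{1}(prednK p0) mulSn addnC.
by split; lia.
Qed.

(** In all four attachment types a mark of [S] doubles the window shared by the two translates; this
    will bound the number of rows of [S]. *)
Lemma compose_double i x : (0 < i < k)%N -> sigma i -> (x < w)%N ->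
  exists b : box, [/\ b \in row_compose w.+1 S T, b + (1, 1) \in row_compose w.+1 S T
    & b.2 - b.1 = base.2 - base.1 + (i * c + x)%N%:Z].
Proof using w0 ends c0.
case: i => // i hi si hx; have ci := cntS sigma i; rewrite si in ci.
have prev : base + (pos P (i.+1 * c + x) + delta *+ cnt sigma i) \in row_compose w.+1 S T.
  apply/compose_mem; left; exists i, (c + x)%N; split; try lia.
  by congr (_ + (pos P _ + _)); rewrite mulSn; lia.
have next : base + (pos P (i.+1 * c + x) + delta *+ cnt sigma i.+1) \in row_compose w.+1 S T.
  by apply/compose_mem; left; exists i.+1, x; split => //; lia.
have extra : tau w != tau c -> base + (pos P (i.+1 * c + x) + eps) \in row_compose w.+1 S T.
  by move=> tt; apply/compose_mem; right; split=> //; exists i, x; split=> //; lia.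
have content (z : box) : z.1 = z.2 ->
    (base + (pos P (i.+1 * c + x) + z)).2 - (base + (pos P (i.+1 * c + x) + z)).1 =
    base.2 - base.1 + (i.+1 * c + x)%N%:Z by move=> ez; rewrite !bE; lia.
have dn n : (delta *+ n).1 = (delta *+ n).2.
  elim: n => [|n IH]; first by rewrite mulr0n.
  by rewrite mulrS !boxE IH /delta; case: (tau w); case: (tau c).
rewrite ci addn1 mulrS in next.
case tw: (tau w); case tc: (tau c).
- exists (base + (pos P (i.+1 * c + x) + delta *+ cnt sigma i)); split => //; last exact: content.
  by move: next; rewrite {1}/delta tw tc [(1, 1) + _]addrC !addrA.
- exists (base + (pos P (i.+1 * c + x) + eps)); split; last by apply: content; rewrite /eps tw.
    by apply: extra; rewrite tw tc.
  have d0 : delta = 0 by rewrite /delta tw tc.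
  by move: prev; rewrite d0 mul0rn addr0 /eps tw -!addrA addNr addr0.
- have d0 : delta = 0 by rewrite /delta tw tc.
  exists (base + (pos P (i.+1 * c + x) + delta *+ cnt sigma i)); split => //; last exact: content.
  by have := extra; rewrite tw tc => /(_ isT); rewrite d0 mul0rn addr0 /eps tw !addrA.
- exists (base + (pos P (i.+1 * c + x) + (delta + delta *+ cnt sigma i))); split => //; last first.
    by rewrite -mulrS; apply: content.
  have dE : delta = - (1, 1) by rewrite /delta tw tc.
  suff -> : base + (pos P (i.+1 * c + x) + (delta + delta *+ cnt sigma i)) + (1, 1) =
    base + (pos P (i.+1 * c + x) + delta *+ cnt sigma i) by [].
  by move: (delta *+ cnt sigma i) => D; rewrite dE; apply: box_eq; rewrite !boxE /=; lia.
Qed.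

Hypothesis k0 : (0 < k)%N.

Lemma compose_one_row : (forall i, (0 < i < k)%N -> sigma i = false) ->
  row_compose w.+1 S T = translate base (rib (k * c + w) P).
Proof using w0 k0 ends c0.
move=> s0; have cs i : (i < k)%N -> cnt sigma i = 0%N.
  by move=> hi; apply/esym; rewrite -[LHS]/(cnt sigma 0); apply/(cnt_constP sigma (leq0n i)) => x hx; apply: s0; lia.
apply: boxsetP => r z; apply/idP/in_ribT => [/compose_mem[[i [x [hi hx e]]]|[_ [i [x [h1 h2 _ _]]]]]|].
- exists (i * c + x)%N; last by rewrite e cs // mulr0n addr0.
  have : (i * c + c <= k * c)%N by rewrite addnC -mulSn leq_mul2r hi orbT.
  lia.
- by rewrite s0 in h2; lia.
- case=> y hy e; have [i [x [hi hx ey]]] := split_index k0 hy.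
  by apply/compose_mem; left; exists i, x; rewrite -ey cs // mulr0n addr0.
Qed.

End Composition.

(** * Compositions with a two-row ribbon *)

(** A composition is always flat at the ends of its window: marks of the periodic word there are
    absorbed into the diagonal displacement of the translates. *)
Definition erase (w u : nat) (S : nat -> bool) x := [&& S x, x != u & x != (u + w)%N].

Definition two_row_compose w p q c tau := fat w (p * c) (q * c) (erase w (p * c) (per c tau)).

Lemma cnt_erase w u S y : (0 < w)%N -> (0 < u)%N ->
  (cnt (erase w u S) y + ((u <= y)%N && S u) + ((u + w <= y)%N && S (u + w)%N) = cnt S y)%N.
Proof.
move=> w0 u0; elim: y => [|y IH].
  by have -> : (u <= 0)%N = false; [lia | have -> : (u + w <= 0)%N = false; [lia|]].
rewrite !cntS -IH /erase.
have [h1|h1] := eqVneq y.+1 u.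
  rewrite -h1; have -> : (y < y)%N = false by lia.
  have -> : (y.+1 + w <= y)%N = false by lia.
  have -> : (y.+1 + w <= y.+1)%N = false by lia.
  by rewrite leqnn /=; case: (S y.+1); lia.
have [h2|h2] := eqVneq y.+1 (u + w)%N.
  have -> : (u <= y)%N by lia.
  have -> : (u <= y.+1)%N by lia.
  have -> : (u + w <= y)%N = false by lia.
  by rewrite -h2 leqnn /=; case: (S y.+1); lia.
have -> : (u <= y.+1)%N = (u <= y)%N by lia.
have -> : (u + w <= y.+1)%N = (u + w <= y)%N by lia.
by rewrite !andbT; lia.
Qed.

Section TwoRows.

Variables (w p q c : nat) (tau sigma : nat -> bool) (v q0 : box).
Hypothesis w0 : (0 < w)%N.
Hypothesis p0 : (0 < p)%N.
Hypothesis q0' : (0 < q)%N.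
Hypothesis c0 : (0 < c)%N.
Hypothesis ends : flat_ends w c tau.
Hypothesis sigmaE : forall i, (0 < i < p + q)%N -> sigma i = (i == p).

Let T := translate v (rib (c + w) tau).
Let S := translate q0 (rib (p + q) sigma).
Let P := per c tau.
Let u := (p * c)%N.
Let s := (q * c)%N.
Let base := v + offset w.+1 T q0.

Lemma compose_two_rows : row_compose w.+1 S T = translate base (two_row_compose w p q c tau).
Proof using w0 p0 q0' c0 ends sigmaE.
have cs i : (i < p + q)%N -> cnt sigma i = (p <= i)%N.
  elim: i => [|i IH] hi; first by have -> : (p <= 0)%N = false by lia.
  by rewrite cntS IH ?sigmaE //; lia.
have pq0 : (0 < p + q)%N by lia.
have u0 : (0 < u)%N by rewrite /u; nia.
have s0 : (0 < s)%N by rewrite /s; nia.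
have Pw : P w = tau w by apply: (per_tau w0 ends c0); lia.
have Pu : P u = tau c.
  rewrite /P /per /u; case: (p) p0 => // p' _; rewrite mulSn.
  have -> : (c + p' * c).-1 = (p' * c + c.-1)%N by lia.
  by rewrite modnMDl modn_small ?prednK //; lia.
have Pv : P (u + w)%N = tau w.
  rewrite -Pw /P /per; congr (tau _.+1); case: (w) w0 => // w' _; rewrite addnS /=.
  by rewrite /u modnMDl.
have mem (b : box) : b \in row_compose w.+1 S T <->
   [\/ exists2 y, (y < u + w)%N & b - base = pos P y,
       exists2 y, (u <= y < u + w + s)%N & b - base = pos P y + delta w c tau
     | tau w != tau c /\ exists2 y, (u <= y < u + w)%N & b - base = pos P y + eps w tau].
  have sub (z : box) : (b - base = z) <-> (b = base + z).
    by split=> [<-|->]; [rewrite addrC subrK | rewrite addrC addKr].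
  have cm := @compose_mem w c (p + q) tau sigma v q0 w0 ends c0 b.
  split=> [/cm[[i [x [hi hx e]]]|[tt [i [x [h1 h2 hx e]]]]]|].
  - rewrite cs // in e; have [pi|pi] := leqP p i.
      apply: Or32; exists (i * c + x)%N; last by apply/sub; rewrite e pi mulr1n.
      have : (p * c <= i * c)%N by rewrite leq_mul2r pi orbT.
      have : (i * c + c <= (p + q) * c)%N by rewrite addnC -mulSn leq_mul2r hi orbT.
      by rewrite mulnDl /u /s; lia.
    apply: Or31; exists (i * c + x)%N; last by apply/sub; rewrite e leqNgt pi mulr0n addr0.
    have : (i * c + c <= p * c)%N by rewrite addnC -mulSn leq_mul2r pi orbT.
    by rewrite /u; lia.
  - rewrite sigmaE // in h2; move/eqP: h2 => h2.
    apply: Or33; split=> //; exists (i.+1 * c + x)%N; first by rewrite /u -h2; lia.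
    exact/sub.
  case=> [[y hy /sub e]|[y hy /sub e]|[tt [y hy /sub e]]]; apply/cm.
  - have [i [x [hi hx ey]]] := split_index w0 c0 p0 hy.
    left; exists i, x; rewrite -ey; split=> //; first lia.
    by rewrite cs; [have -> : (p <= i)%N = false; [lia | rewrite mulr0n addr0] | lia].
  - have hy' : (y - u < q * c + w)%N by rewrite /s in hy; lia.
    have [i [x [hi hx ey]]] := split_index w0 c0 q0' hy'.
    left; exists (p + i)%N, x; split=> //; first lia.
    have -> : ((p + i) * c + x = y)%N by rewrite mulnDl -/u; lia.
    by rewrite cs ?leq_addr //; lia.
  - right; split=> //; exists p.-1, (y - u)%N; rewrite prednK //; split; [lia| |lia|].
      by rewrite sigmaE ?eqxx //; lia.
    by have -> : (p * c + (y - u) = y)%N by [rewrite -/u; lia].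
have ce y := cnt_erase P y w0 u0; rewrite Pu Pv in ce.
(* Contents agree throughout, so only heights are compared. Erasing the two marks lowers the count
   by [tau c] from [u] on and by [tau w] from [u + w] on; with [delta] this amounts to the fixed
   shift by [(1, 1)] of the upper piece. *)
have r1 y : (y < u)%N -> cnt P y = cnt (erase w u P) y.
  move=> h; have := ce y; have -> : (u <= y)%N = false by lia.
  by have -> : (u + w <= y)%N = false; lia.
have r2 y : (u <= y < u + w)%N -> cnt P y = (cnt (erase w u P) y + tau c)%N.
  move=> h; have := ce y; have -> : (u <= y)%N by lia.
  by have -> : (u + w <= y)%N = false; lia.
have r3 y : (u + w <= y)%N -> cnt P y = (cnt (erase w u P) y + tau c + tau w)%N.
  move=> h; have := ce y; have -> : (u <= y)%N by lia.
  by rewrite h /=; lia.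
apply: boxsetP => r z; rewrite in_translate; apply/idP/idP.
- move/mem; rewrite /delta /eps => h; apply/fatP; rewrite -/u -/s -/P.
  case: h => [[y hy ->]|[y hy ->]|[tt [y hy ->]]].
  + have [h|h] := ltnP y u; first by left; exists y => //; have := r1 y h => e; box_lia.
    have hw : (u <= y < u + w)%N by lia.
    have := r2 y hw; case: (tau c) => e; [right|left]; exists y; try lia; box_lia.
  + have [h|h] := ltnP y (u + w).
      have hw : (u <= y < u + w)%N by lia.
      have := r2 y hw; case: (tau c) => e; case: (tau w); [left|right|left|right]; exists y; try lia; rewrite ?addr0; box_lia.
    have e := r3 y h; right; exists y; first lia.
    by move: e; case: (tau c); case: (tau w) => e; rewrite ?addr0; box_lia.
  + have := r2 y hy; case tc: (tau c) tt; case tw: (tau w) => // _ e; [left|right]; exists y; try lia; box_lia.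
case/fatP => -[y hy e]; apply/mem; rewrite -/u -/s -/P in hy e; rewrite /delta /eps.
- have [h|h] := ltnP y u; first by apply: Or31; exists y => //; rewrite e; have := r1 y h => e'; box_lia.
  have hw : (u <= y < u + w)%N by lia.
  have := r2 y hw; case tc: (tau c) => e'; case tw: (tau w).
  + by apply: Or32; exists y; [lia | rewrite e ?addr0; box_lia].
  + by apply: Or33; split=> //; exists y; [lia | rewrite e ?addr0; box_lia].
  + by apply: Or31; exists y; [lia | rewrite e ?addr0; box_lia].
  + by apply: Or31; exists y; [lia | rewrite e ?addr0; box_lia].
- have [h|h] := ltnP y (u + w).
    have hw : (u <= y < u + w)%N by lia.
    have := r2 y hw; case tc: (tau c) => e'; case tw: (tau w).
    + by apply: Or31; exists y; [lia | rewrite e ?addr0; box_lia].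
    + by apply: Or31; exists y; [lia | rewrite e ?addr0; box_lia].
    + by apply: Or33; split=> //; exists y; [lia | rewrite e ?addr0; box_lia].
    + by apply: Or32; exists y; [lia | rewrite e ?addr0; box_lia].
  have e' := r3 y h; apply: Or32; exists y; first lia.
  by rewrite e; move: e'; case: (tau c); case: (tau w) => e'; rewrite ?addr0; box_lia.
Qed.

End TwoRows.

(** * The skew Schur function of a boxdot *)

Section Words.

Variables (R : comNzRingType) (n : nat) (xi : nat -> R).
Implicit Types (F G : seq nat -> R) (p q : seq nat) (bs : seq bool).

Fixpoint wsum k (F : seq nat -> R) : R :=
  if k is k'.+1 then \sum_(x < n) wsum k' (fun q => F ((x : nat) :: q)) else F [::].

Lemma wsum_ext k F G : (forall q, size q = k -> F q = G q) -> wsum k F = wsum k G.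
Proof.
elim: k F G => [|k IH] F G h /=; first exact: h.
by apply: eq_bigr => x _; apply: IH => q sq; apply: h; rewrite /= sq.
Qed.

Lemma wsum_cat a b F : wsum (a + b) F = wsum a (fun p => wsum b (fun q => F (p ++ q))).
Proof. by elim: a F => //= a IH F; apply: eq_bigr => x _; exact: IH. Qed.

Lemma wsumZ k c F : wsum k (fun q => c * F q) = c * wsum k F.
Proof. by elim: k F => //= k IH F; rewrite mulr_sumr; apply: eq_bigr => x _; exact: IH. Qed.

Lemma wsumD k F G : wsum k (fun q => F q + G q) = wsum k F + wsum k G.
Proof. by elim: k F G => //= k IH F G; rewrite -big_split; apply: eq_bigr => x _; exact: IH. Qed.

Lemma wsum_sum (m : nat) k (F : 'I_m -> seq nat -> R) :
  wsum k (fun q => \sum_(i < m) F i q) = \sum_(i < m) wsum k (F i).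
Proof.
elim: k F => //= k IH F; rewrite exchange_big; apply: eq_bigr => x _; exact: IH.
Qed.

Lemma wsum_exchange a b (F : seq nat -> seq nat -> R) :
  wsum a (fun p => wsum b (F p)) = wsum b (fun q => wsum a (F^~ q)).
Proof.
elim: a F => //= a IH F; rewrite wsum_sum; apply: eq_bigr => x _.
exact: (IH (fun p => F ((x : nat) :: p))).
Qed.

Definition wt q := \prod_(x <- q) xi x.

Lemma wt_cat p q : wt (p ++ q) = wt p * wt q.
Proof. exact: big_cat. Qed.

(** Letters are entries of the transposed diagram in the order of positions: a marked step moves one
    column to the left, any other step one row down. *)
Definition step (b : bool) (x y : nat) := if b then (y <= x)%N else (x < y)%N.

Definition okl bs q :=
  all (fun k => step (nth false bs k) (nth 0%N q k) (nth 0%N q k.+1)) (iota 0 (size bs)).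

Lemma oklP bs q : reflect
  (forall k, (k < size bs)%N -> step (nth false bs k) (nth 0%N q k) (nth 0%N q k.+1)) (okl bs q).
Proof. by apply: (iffP allP) => h k hk; apply: h; move: hk; rewrite mem_iota. Qed.

Lemma okl_cat bs1 b bs2 p q : size p = (size bs1).+1 ->
  okl (bs1 ++ b :: bs2) (p ++ q) =
  [&& okl bs1 p, step b (nth 0%N p (size bs1)) (nth 0%N q 0) & okl bs2 q].
Proof.
move=> sp; apply/oklP/and3P => [h|[/oklP h1 h2 /oklP h3] k].
  split; first (apply/oklP => k hk).
  - have := h k; rewrite size_cat !nth_cat hk sp ltnS (ltnW hk) ltnS hk; apply; lia.
  - by have := h (size bs1); rewrite size_cat !nth_cat ltnn subnn sp ltnSn ltnn subnn; apply; rewrite /=; lia.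
  apply/oklP => k hk; have := h (size bs1 + k.+1)%N.
  rewrite size_cat !nth_cat sp.
  have -> : (size bs1 + k.+1 < size bs1)%N = false by lia.
  have -> : (size bs1 + k.+1 < (size bs1).+1)%N = false by lia.
  have -> : ((size bs1 + k.+1).+1 < (size bs1).+1)%N = false by lia.
  have -> : (size bs1 + k.+1 - size bs1 = k.+1)%N by lia.
  have -> : (size bs1 + k.+1 - (size bs1).+1 = k)%N by lia.
  have -> : ((size bs1 + k.+1).+1 - (size bs1).+1 = k.+1)%N by lia.
  by apply; rewrite /=; lia.
rewrite size_cat /= => hk; rewrite !nth_cat sp.
case: (ltngtP k (size bs1)) => hk1.
- have -> : (k < (size bs1).+1)%N by lia.
  have -> : (k.+1 < (size bs1).+1)%N by lia.
  exact: h1.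
- have -> : (k < (size bs1).+1)%N = false by lia.
  have -> : (k.+1 < (size bs1).+1)%N = false by lia.
  have [j ej] : exists j, k = (size bs1 + j.+1)%N by exists (k - (size bs1).+1)%N; lia.
  subst k; rewrite addKn /=.
  have -> : (size bs1 + j.+1 - (size bs1).+1 = j)%N by lia.
  have -> : ((size bs1 + j.+1).+1 - (size bs1).+1 = j.+1)%N by lia.
  apply: h3; lia.
- by subst k; rewrite subnn ltnSn ltnn subnn.
Qed.

Definition T bs := wsum (size bs).+1 (fun q => (okl bs q)%:R * wt q).

(** Across the joint exactly one of the two comparisons holds. *)
Lemma T_split bs1 bs2 : T (bs1 ++ true :: bs2) + T (bs1 ++ false :: bs2) = T bs1 * T bs2.
Proof.
have TE b : T (bs1 ++ b :: bs2) = wsum (size bs1).+1 (fun p => wsum (size bs2).+1 (fun q =>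
    (okl (bs1 ++ b :: bs2) (p ++ q))%:R * wt (p ++ q))).
  have e : (size (bs1 ++ b :: bs2)).+1 = ((size bs1).+1 + (size bs2).+1)%N by rewrite size_cat /=; lia.
  by rewrite /T e wsum_cat.
rewrite !TE -wsumD mulrC /T -wsumZ; apply: wsum_ext => p sp.
rewrite -wsumD mulrC -/(T bs2) /T -wsumZ; apply: wsum_ext => q sq.
rewrite !okl_cat // wt_cat /step ltnNge.
by case: (okl bs1 p); case: (okl bs2 q); case: (nth 0%N q 0 <= _)%N => /=; ring.
Qed.

Lemma tacc_T y a bs : (forall k, (0 < k)%N -> y k = T (nseq k.-1 false)) -> (0 < a)%N ->
  tacc y a bs = T (nseq a.-1 false ++ bs).
Proof.
move=> hy; elim: bs a => [|b bs IH] [//|a] _ /=; first by rewrite hy // cats0.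
have nE : nseq a false ++ false :: bs = nseq a.+1 false ++ bs by elim: (a) => //= a' ->.
case: b; rewrite !IH //=; last by rewrite nE.
rewrite hy //= -T_split nE; ring.
Qed.

Lemma sum_first_failure (c : nat -> bool) m :
  (all c (iota 0 m))%:R + \sum_(j < m) (all c (iota 0 j) && ~~ c j)%:R = 1 :> R.
Proof.
elim: m => [|m IH]; first by rewrite big_ord0 addr0.
rewrite big_ord_recr /= -[RHS]IH addrA [RHS]addrC addrAC [LHS]addrC; congr (_ + _).
have -> : c 0%N && all c (iota 1 m) = all c (iota 0 m) && c m.
  have e := iotaD 0 m 1; rewrite addn1 in e.
  by rewrite -[LHS]/(all c (iota 0 m.+1)) e all_cat /= andbT.
by case: (all c _); case: (c m); rewrite /= ?add0r ?addr0.
Qed.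

Section FatWords.

Variables (w u s : nat) (S : nat -> bool).
Hypothesis w0 : (0 < w)%N.
Hypothesis u0 : (0 < u)%N.
Hypothesis s0 : (0 < s)%N.
Hypothesis S_window : forall x, closed_window w u x -> S x = false.

Let v := (u + w)%N.
Let L := (u + w + s)%N.

Let okp (f : nat -> nat) o l := forall k, (k.+1 < l)%N -> step (S (o + k).+1) (f k) (f k.+1).

(** [P] and [Q] fill the two parts, and [j] is the first index at which the condition between the
    doubled rows fails. Exchanging the tails there gives a filling [X] of the whole ribbon and a
    strictly increasing word [Y] of length [w]; strictness inside the window makes the new junctions
    legal and the exchange reversible. *)
Lemma swap_tails (j : nat) (P Q X Y : nat -> nat) : (j <= w)%N ->
  (forall k, (k < u + j)%N -> P k = X k) -> (forall k, (u + j <= k)%N -> P k = Y (k - u)%N) ->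
  (forall k, (k < j)%N -> Q k = Y k) -> (forall k, (j <= k)%N -> Q k = X (u + k)%N) ->
  [/\ okp P 0 v, okp Q u (w + s) & (forall i, (i < j)%N -> (Q i <= P (u.-1 + i))%N)
      /\ (P (u.-1 + j) < Q j)%N] <->
  [/\ okp X 0 L, okp Y u w & (forall i, (i < j)%N -> (Y i <= X (u.-1 + i))%N)
      /\ ((j < w)%N -> (X (u.-1 + j) < Y j)%N)].
Proof using w0 u0 s0 S_window.
move=> jw eP1 eP2 eQ1 eQ2.
have win x : (u <= x <= u + w)%N -> S x = false by move=> h; apply: S_window.
have winP (f : nat -> nat) o l k : okp f o l -> (k.+1 < l)%N -> (u <= (o + k).+1 <= u + w)%N -> (f k < f k.+1)%N.
  by move=> h hk hw; have := h k hk; rewrite win.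
split=> [[hP hQ [hlt hj]]|[hX hY [hlt hj]]].
- split.
  + move=> k hk; rewrite add0n; case: (ltngtP k.+1 (u + j)%N) => h.
    * by rewrite -!eP1 ?(ltnW h) //; apply: (hP k); rewrite /v; lia.
    * have ek : k = (u + (k - u))%N by lia.
      have := hQ (k - u)%N; rewrite -ek eQ2; last lia.
      rewrite eQ2; last lia.
      by rewrite addnS -ek; apply; rewrite /L in hk; lia.
    * rewrite win; last lia.
      have -> : X k.+1 = Q j by rewrite eQ2 // h.
      have ek : k = (u.-1 + j)%N by lia.
      by rewrite -eP1; [rewrite ek | lia].
  + move=> k hk; rewrite win; last lia.
    rewrite /step; case: (ltngtP k.+1 j) => h.
    * rewrite -!eQ1 //; last lia.
      by apply: (winP _ _ _ _ hQ); lia.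
    * have e1 : Y k = P (u + k)%N by rewrite eP2 ?addKn //; lia.
      have e2 : Y k.+1 = P (u + k).+1 by rewrite eP2 ?subSn ?addKn //; lia.
      by rewrite e1 e2; apply: (winP _ _ _ _ hP); rewrite /v; lia.
    * have e1 : Y k = Q k by rewrite eQ1 //; lia.
      have e2 : Y k.+1 = P (u + k).+1 by rewrite eP2 ?subSn ?addKn //; lia.
      rewrite e1 e2; apply: leq_ltn_trans (hlt k _) _; first lia.
      have b1 : (P (u.-1 + k) < P (u.-1 + k).+1)%N by apply: (winP _ _ _ _ hP); rewrite /v; lia.
      have b2 : (P (u + k) < P (u + k).+1)%N by apply: (winP _ _ _ _ hP); rewrite /v; lia.
      have e3 : (u.-1 + k).+1 = (u + k)%N by lia.
      by rewrite e3 in b1; lia.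
  + split=> [i hi|hjw]; first by rewrite -eP1 -?eQ1 //; [exact: hlt | lia].
    have -> : Y j = P (u + j)%N by rewrite eP2 ?addKn.
    rewrite -eP1; last lia.
    have e3 : (u.-1 + j).+1 = (u + j)%N by lia.
    by rewrite -e3; apply: (winP _ _ _ _ hP); rewrite /v; lia.
- split.
  + move=> k hk; rewrite add0n; case: (ltngtP k.+1 (u + j)%N) => h.
    * by rewrite !eP1 ?(ltnW h) //; apply: (hX k); rewrite /v /L in hk *; lia.
    * rewrite /v in hk; rewrite win; last lia.
      rewrite eP2; last lia.
      rewrite eP2; last lia.
      by rewrite subSn; [apply: (winP _ _ _ _ hY) |]; lia.
    * rewrite /v in hk; rewrite win; last lia.
      have e1 : k = (u.-1 + j)%N by lia.
      rewrite eP1; last lia.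
      rewrite eP2; last lia.
      by rewrite h addKn e1; apply: hj; lia.
  + move=> k hk; case: (ltngtP k.+1 j) => h.
    * rewrite win; last lia.
      rewrite !eQ1 //; last lia.
      by apply: (winP _ _ _ _ hY); lia.
    * rewrite !eQ2; [|lia|lia].
      by have := hX (u + k)%N; rewrite add0n addnS; apply; rewrite /L; lia.
    * rewrite win; last lia.
      rewrite eQ1; last lia.
      rewrite eQ2; last lia.
      apply: leq_ltn_trans (hlt k _) _; first lia.
      have b1 : (X (u.-1 + k) < X (u.-1 + k).+1)%N by apply: (winP _ _ _ _ hX); rewrite /L; lia.
      have b2 : (X (u + k) < X (u + k).+1)%N by apply: (winP _ _ _ _ hX); rewrite /L; lia.
      have e3 : (u.-1 + k).+1 = (u + k)%N by lia.
      by rewrite e3 in b1; rewrite -addnS in b2; lia.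
  + split=> [i hi|]; first by rewrite eP1 ?eQ1 //; [exact: hlt | lia].
    rewrite eQ2 // eP1; last lia.
    have e3 : (u.-1 + j).+1 = (u + j)%N by lia.
    by rewrite -e3; apply: (winP _ _ _ _ hX); rewrite /L; lia.
Qed.

Let okf o l q := okl [seq S x | x <- iota o.+1 l.-1] q.

Let okfP o l q : reflect (okp (nth 0%N q) o l) (okf o l q).
Proof.
apply: (iffP (oklP _ _)) => h k hk.
  have := h k; rewrite size_map size_iota (nth_map 0%N) ?size_iota; last lia.
  by rewrite nth_iota ?addSn; [apply; lia | lia].
rewrite size_map size_iota in hk; rewrite (nth_map 0%N) ?size_iota // nth_iota // addSn.
apply: h; lia.
Qed.

Let cmp p q i := (nth 0%N q i <= nth 0%N p (u.-1 + i))%N.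

Definition fat_ok p q := [&& okf 0 v p, okf u (w + s) q & all (cmp p q) (iota 0 w.+1)].

Lemma swap_sum (j : nat) : (j <= w)%N ->
  wsum v (fun p => wsum (w + s) (fun q =>
    (okf 0 v p && okf u (w + s) q && (all (cmp p q) (iota 0 j) && ~~ cmp p q j))%:R * (wt p * wt q))) =
  wsum L (fun x => wsum w (fun z =>
    (okf 0 L x && okf u w z && (all (cmp x z) (iota 0 j) && ((j < w)%N ==> ~~ cmp x z j)))%:R
      * (wt x * wt z))).
Proof using w0 u0 s0 S_window.
move=> jw.
have ev : v = (u + j + (w - j))%N by rewrite /v; lia.
have eb : (w + s = j + (w + s - j))%N by lia.
have eL : L = (u + j + (w + s - j))%N by rewrite /L; lia.
have ew : w = (j + (w - j))%N by lia.
rewrite [in LHS]ev wsum_cat [in RHS]eL [RHS]wsum_cat; apply: wsum_ext => p1 sp1.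
under wsum_ext => p2 _ do rewrite [X in wsum X _]eb wsum_cat.
under [RHS]wsum_ext => q2 _ do rewrite [X in wsum X _]ew wsum_cat.
rewrite [RHS]wsum_exchange.
under [RHS]wsum_ext => q1 _ do rewrite wsum_exchange.
rewrite [RHS]wsum_exchange.
apply: wsum_ext => p2 sp2; apply: wsum_ext => q1 sq1; apply: wsum_ext => q2 sq2.
rewrite -ev -eL !wt_cat.
have -> : wt p1 * wt p2 * (wt q1 * wt q2) = wt p1 * wt q2 * (wt q1 * wt p2) by ring.
congr (_%:R * _).
have [||||A B] := @swap_tails j (nth 0%N (p1 ++ p2)) (nth 0%N (q1 ++ q2)) (nth 0%N (p1 ++ q2))
  (nth 0%N (q1 ++ p2)) jw.
- by move=> k hk; rewrite !nth_cat sp1 hk.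
- move=> k hk; rewrite !nth_cat sp1 sq1.
  have -> : (k < u + j)%N = false by lia.
  have -> : (k - u < j)%N = false by lia.
  by congr (nth _ _ _); lia.
- by move=> k hk; rewrite !nth_cat sq1 hk.
- move=> k hk; rewrite !nth_cat sp1 sq1.
  have -> : (k < j)%N = false by lia.
  have -> : (u + k < u + j)%N = false by lia.
  by congr (nth _ _ _); lia.
have allE (c : nat -> bool) : reflect (forall i, (i < j)%N -> c i) (all c (iota 0 j)).
  by apply: (iffP allP) => h i hi; apply: h; move: hi; rewrite mem_iota.
congr (nat_of_bool _); apply/idP/idP.
  case/andP => /andP[/okfP h1 /okfP h2] /andP[/allE h3]; rewrite /cmp -ltnNge => h4.
  have [] := A; first by split.
  move=> /okfP -> /okfP -> [g3 g4]; rewrite !andTb; apply/andP; split; first by apply/allP => i; rewrite mem_iota => hi; exact: g3.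
  by apply/implyP => /g4; rewrite ltnNge.
case/andP => /andP[/okfP h1 /okfP h2] /andP[/allE h3 /implyP h4].
have [] := B; first by split => //; split => // /h4; rewrite -ltnNge.
move=> /okfP -> /okfP -> [g3 g4]; rewrite !andTb; apply/andP; split; first by apply/allP => i; rewrite mem_iota => hi; exact: g3.
by rewrite /cmp -ltnNge.
Qed.

(** Pairs violating the doubled-row condition are sorted by their first failure [j <= w] and matched
    with pairs of a word on the whole ribbon and an increasing word of length [w]. As such a word
    has no letter at index [w], the value [j = w] collects the pairs without failure, and every pair
    is used once. *)
Lemma fat_words :
  wsum v (fun p => wsum (w + s) (fun q => (fat_ok p q)%:R * (wt p * wt q))) =
  T [seq S x | x <- iota 1 v.-1] * T [seq S x | x <- iota u.+1 (w + s).-1]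
  - T (nseq w.-1 false) * T [seq S x | x <- iota 1 L.-1].
Proof using w0 u0 s0 S_window.
have TE o l : (0 < l)%N -> T [seq S x | x <- iota o.+1 l.-1] = wsum l (fun q => (okf o l q)%:R * wt q).
  by move=> l0; rewrite /T size_map size_iota prednK.
have -> : nseq w.-1 false = [seq S x | x <- iota u.+1 w.-1].
  apply: (@eq_from_nth _ false); rewrite ?size_map ?size_nseq ?size_iota // => i hi.
  by rewrite nth_nseq hi (nth_map 0%N) ?size_iota // nth_iota // S_window // /closed_window; lia.
have prodE o l o' l' : (0 < l)%N -> (0 < l')%N ->
    T [seq S x | x <- iota o.+1 l.-1] * T [seq S x | x <- iota o'.+1 l'.-1] =
    wsum l (fun p => wsum l' (fun q => (okf o l p && okf o' l' q)%:R * (wt p * wt q))).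
  move=> l0 l'0; rewrite !TE // mulrC -wsumZ; apply: wsum_ext => p _.
  rewrite mulrC -wsumZ; apply: wsum_ext => q _.
  by case: okf; case: okf; rewrite /= ?mul0r ?mulr0 ?mul1r.
rewrite prodE; [|rewrite /v; lia|lia].
rewrite [T [seq S x | x <- iota u.+1 w.-1] * _]mulrC prodE; [|rewrite /L; lia|lia].
apply/eqP; rewrite eq_sym subr_eq; apply/eqP.
have splitV p q : (okf 0 v p && okf u (w + s) q)%:R * (wt p * wt q) =
    (fat_ok p q)%:R * (wt p * wt q) + \sum_(j < w.+1)
     (okf 0 v p && okf u (w + s) q && (all (cmp p q) (iota 0 j) && ~~ cmp p q j))%:R * (wt p * wt q).
  rewrite /fat_ok andbA; case: (okf 0 v p && okf u (w + s) q) => /=; last first.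
    by rewrite !mul0r big1 ?addr0 // => j _; rewrite mul0r.
  by rewrite -mulr_suml -mulrDl (sum_first_failure (cmp p q) w.+1).
have splitU x z : (okf 0 L x && okf u w z)%:R * (wt x * wt z) = \sum_(j < w.+1)
    (okf 0 L x && okf u w z && (all (cmp x z) (iota 0 j) && ((j < w)%N ==> ~~ cmp x z j)))%:R
      * (wt x * wt z).
  case: (okf 0 L x && okf u w z) => /=; last by rewrite mul0r big1 // => j _; rewrite mul0r.
  rewrite -mulr_suml; congr (_ * _); rewrite big_ord_recr /= ltnn /= andbT addrC.
  rewrite -[LHS](sum_first_failure (cmp x z) w); congr (_ + _).
  by apply: eq_bigr => j _; rewrite ltn_ord.
under [LHS]wsum_ext => p _ do (under wsum_ext => q _ do rewrite splitV).
under [in RHS]wsum_ext => p _ do (under wsum_ext => q _ do idtac).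
have -> : wsum L (fun p => wsum w (fun q => (okf 0 L p && okf u w q)%:R * (wt p * wt q))) =
  \sum_(j < w.+1) wsum L (fun x => wsum w (fun z =>
    (okf 0 L x && okf u w z && (all (cmp x z) (iota 0 j) && ((j < w)%N ==> ~~ cmp x z j)))%:R
      * (wt x * wt z))).
  rewrite -wsum_sum; apply: wsum_ext => x _; rewrite -wsum_sum; apply: wsum_ext => z _.
  exact: splitU.
rewrite -(eq_bigr _ (fun j _ => swap_sum (leq_ord j))).
rewrite -wsum_sum -wsumD; apply: wsum_ext => p _; rewrite -wsum_sum -wsumD.
by apply: wsum_ext.
Qed.

End FatWords.

End Words.

(** * Semistandard fillings of the transposed boxdot as words *)

Lemma wsum_tuple (R : comNzRingType) n k (F : seq nat -> R) :
  wsum n k F = \sum_(t : k.-tuple 'I_n) F [seq val i | i <- t].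
Proof.
elim: k F => [|k IH] F /=.
  rewrite (bigD1 [tuple]) //= big1 ?addr0 // => t /eqP[]; exact: tuple0.
under eq_bigr => x _ do rewrite IH.
rewrite pair_big /= (reindex (fun t : k.+1.-tuple 'I_n => (thead t, behead_tuple t))) /=.
  by apply: eq_bigr => t _; case/tupleP: t => x t; rewrite theadE.
apply: onW_bij; exists (fun p => cons_tuple p.1 p.2) => [t|[x t]].
  by case/tupleP: t => x t; apply/val_inj.
by congr (_, _); apply/val_inj.
Qed.

Section Fillings.

Variables (X : diagram) (n : nat).

Definition fval (t : {ffun X -> 'I_n}) (b : box) : nat :=
  if (insub b : option X) is Some a then val (t a) else 0%N.

Lemma fvalE t (a : X) : fval t (val a) = t a.
Proof. by rewrite /fval valK. Qed.

Lemma sum_fillings (R : comNzRingType) (bl : seq box) (H : seq nat -> R) :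
  uniq bl -> (forall b : box, (b \in X) = (b \in bl)) ->
  \sum_(t : {ffun X -> 'I_n}) H [seq fval t b | b <- bl] = wsum n (size bl) H.
Proof.
move=> ubl memX; rewrite wsum_tuple.
have inX (i : 'I_(size bl)) : nth 0 bl i \in X by rewrite memX mem_nth.
have idx (a : X) : (index (val a) bl < size bl)%N by rewrite index_mem -memX; exact: valP.
pose to_t (t : {ffun X -> 'I_n}) : (size bl).-tuple 'I_n := [tuple t [` inX i] | i < size bl].
pose of_t (s : (size bl).-tuple 'I_n) : {ffun X -> 'I_n} := [ffun a : X => tnth s (Ordinal (idx a))].
rewrite [RHS](reindex to_t).
  apply: eq_bigr => t _; congr H; apply: (@eq_from_nth _ 0%N); first by rewrite size_map [RHS]size_map size_tuple.
  move=> i; rewrite size_map => hi; rewrite (nth_map 0) //.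
  rewrite (nth_map (tnth (to_t t) (Ordinal hi))) ?size_tuple // -[i]/(val (Ordinal hi)) -tnth_nth.
  by rewrite tnth_mktuple; exact: (fvalE t [` inX (Ordinal hi)]).
exists of_t => [t _|s _].
  apply/ffunP => a; rewrite ffunE tnth_mktuple; congr (t _); apply/val_inj => /=.
  by rewrite nth_index // -memX; exact: valP.
apply: eq_from_tnth => i; rewrite tnth_mktuple ffunE; congr tnth; apply/val_inj => /=.
by rewrite index_uniq.
Qed.

Lemma prod_fillings (R : comNzRingType) (bl : seq box) (f : 'I_n -> R) (xi : nat -> R) (t : {ffun X -> 'I_n}) :
  uniq bl -> (forall b : box, (b \in X) = (b \in bl)) -> (forall i : 'I_n, xi i = f i) ->
  \prod_(b : X) f (t b) = wt xi [seq fval t b | b <- bl].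
Proof.
move=> ubl memX xif; rewrite /wt big_map.
transitivity (\prod_(b <- enum_fset X) xi (fval t b)).
  by rewrite (big_seq_fsetE _ _ predT) /=; apply: eq_bigr => a _; rewrite fvalE xif.
by apply: perm_big; apply: uniq_perm => // b; rewrite memX.
Qed.

Lemma semistandardP (t : {ffun X -> 'I_n}) : reflect
  (forall a b : box, a \in X -> b \in X ->
     (a.1 = b.1 -> a.2 <= b.2 -> (fval t a <= fval t b)%N) /\
     (a.2 = b.2 -> a.1 < b.1 -> (fval t a < fval t b)%N)) (semistandard t).
Proof.
apply: (iffP forallP) => [h a b aX bX|h a].
  have /andP[/implyP h1 /implyP h2] := forallP (h [` aX]) [` bX].
  rewrite -!(fvalE t) /= in h1 h2; split => [e1 e2|e1 e2]; [apply: h1|apply: h2]; by rewrite e1 eqxx.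
apply/forallP => b; have [h1 h2] := h _ _ (valP a) (valP b); rewrite -!(fvalE t).
by apply/andP; split; apply/implyP => /andP[/eqP e1 e2]; [apply: h1 | apply: h2].
Qed.

Lemma local_order (f : box -> nat) : convex X ->
  (forall a b : box, a \in X -> b \in X ->
     (a.1 = b.1 -> a.2 <= b.2 -> (f a <= f b)%N) /\
     (a.2 = b.2 -> a.1 < b.1 -> (f a < f b)%N)) <->
  (forall r c : int, (r, c) \in X ->
     ((r, c + 1) \in X -> (f (r, c) <= f (r, c + 1)%R)%N) /\
     ((r + 1, c) \in X -> (f (r, c) < f (r + 1, c)%R)%N)).
Proof.
move=> cX; split=> [h r c rX|h a b aX bX].
  split=> r'X; [have [h1 _] := h _ _ rX r'X | have [_ h1] := h _ _ rX r'X]; apply: h1 => //=; lia.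
split.
  move=> e1 e2; have [d hd] : exists d : nat, b.2 - a.2 = d%:Z by exists (absz (b.2 - a.2)); lia.
  elim: d a aX e1 e2 hd => [|d IH] a aX e1 e2 hd; first by have -> : a = b by apply: box_eq => //; lia.
  have a'X : (a.1, a.2 + 1) \in X by apply: (cX _ _ _ aX bX) => /=; lia.
  have eA : a = (a.1, a.2) by apply: surjective_pairing.
  have aX' := aX; rewrite eA in aX'; have [/(_ a'X) h1 _] := h _ _ aX'; rewrite -eA in h1.
  by apply: leq_trans h1 (IH _ a'X _ _ _) => //=; lia.
move=> e1 e2; have [d hd] : exists d : nat, b.1 - a.1 = d.+1%:Z by exists (absz (b.1 - a.1)).-1; lia.
elim: d a aX e1 e2 hd => [|d IH] a aX e1 e2 hd.
  have eA : a = (a.1, a.2) by apply: surjective_pairing.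
  have eB : b = (a.1 + 1, a.2) by apply: box_eq => /=; lia.
  have bX' := bX; rewrite eB in bX'; have aX' := aX; rewrite eA in aX'.
  by have [_ /(_ bX')] := h _ _ aX'; rewrite -eA -eB.
have a'X : (a.1 + 1, a.2) \in X by apply: (cX _ _ _ aX bX) => /=; lia.
have eA : a = (a.1, a.2) by apply: surjective_pairing.
have aX' := aX; rewrite eA in aX'; have [_ /(_ a'X) h1] := h _ _ aX'; rewrite -eA in h1.
by apply: ltn_trans h1 (IH _ a'X _ _ _) => //=; lia.
Qed.

End Fillings.

Section FatSchur.

Variables (w u s : nat) (S : nat -> bool) (n : nat).
Hypothesis w0 : (0 < w)%N.
Hypothesis u0 : (0 < u)%N.
Hypothesis s0 : (0 < s)%N.
Hypothesis S_window : window_free w u S.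

Let v := (u + w)%N.
Let L := (u + w + s)%N.
Let X := transpose (fat w u s S).

Let tr (b : box) : box := (b.2, b.1).
Let al i := tr (pos S i).
Let be i := tr (pos S i - (1, 1)).
Let bl : seq box := [seq al i | i <- iota 0 v] ++ [seq be i | i <- iota u (w + s)].

Let al1 i : (al i).1 = i%:Z - (cnt S i)%:Z. Proof. by []. Qed.
Let al2 i : (al i).2 = - (cnt S i)%:Z. Proof. by []. Qed.
Let be1 i : (be i).1 = i%:Z - (cnt S i)%:Z - 1. Proof. by []. Qed.
Let be2 i : (be i).2 = - (cnt S i)%:Z - 1. Proof. by []. Qed.

Let inX (b : box) : (b \in X) = (b \in bl).
Proof.
rewrite in_transpose mem_cat; apply/fatP/orP => -[].
- case=> i hi e; left; apply/mapP; exists i; first by rewrite mem_iota.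
  by box_proj e; apply: box_eq; rewrite ?al1 ?al2; lia.
- case=> i hi e; right; apply/mapP; exists i; first by rewrite mem_iota; lia.
  by box_proj e; apply: box_eq; rewrite ?be1 ?be2; lia.
- by case/mapP => i; rewrite mem_iota => hi ->; left; exists i => //; rewrite [RHS]surjective_pairing.
- case/mapP => i; rewrite mem_iota => hi ->; right; exists i; first lia.
  by rewrite [RHS]surjective_pairing.
Qed.

Let uniq_bl : uniq bl.
Proof.
rewrite cat_uniq !map_inj_in_uniq ?iota_uniq //.
- rewrite andbT /=; apply/hasPn => _ /mapP[j _ ->]; apply/negP => /mapP[i _] e.
  have e1 := congr1 fst e; have e2 := congr1 snd e; rewrite al1 be1 in e1; rewrite al2 be2 in e2.
  have ij : (i : nat) = j by lia.
  by rewrite ij in e2; lia.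
- move=> i j _ _ e; have e1 := congr1 fst e; have e2 := congr1 snd e.
  by rewrite !be1 in e1; rewrite !be2 in e2; lia.
- move=> i j _ _ e; have e1 := congr1 fst e; have e2 := congr1 snd e.
  by rewrite !al1 in e1; rewrite !al2 in e2; lia.
Qed.

Let alX i : (i < v)%N -> al i \in X.
Proof. by move=> hi; rewrite inX mem_cat map_f // mem_iota. Qed.

Let beX i : (u <= i < L)%N -> be i \in X.
Proof. by move=> hi; rewrite inX mem_cat [X in _ || X]map_f ?orbT // mem_iota; rewrite /L in hi; lia. Qed.

Let win x : (u.-1 <= x <= v)%N -> cnt S x = cnt S u.
Proof. exact: (window_cnt w0 u0 s0 S_window). Qed.

(** In the transposed diagram the box of the second piece at [u + j] lies directly to the left of
    the box of the first piece at [u - 1 + j], for [j] from [0] to [w]; these are the only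
    adjacencies beyond those within a piece. *)
Lemma fat_local (f : box -> nat) (p q : seq nat) : size p = v -> size q = (w + s)%N ->
  (forall i, (i < v)%N -> nth 0%N p i = f (al i)) ->
  (forall i, (i < w + s)%N -> nth 0%N q i = f (be (u + i)%N)) ->
  (forall r c : int, (r, c) \in X ->
     ((r, c + 1) \in X -> (f (r, c) <= f (r, c + 1)%R)%N) /\
     ((r + 1, c) \in X -> (f (r, c) < f (r + 1, c)%R)%N)) <->
  fat_ok w u s S p q.
Proof.
move=> sp sq pE qE; have lP o l r : (0 < l)%N ->
   reflect (forall k, (k.+1 < l)%N -> step (S (o + k).+1) (nth 0%N r k) (nth 0%N r k.+1))
     (okl [seq S x | x <- iota o.+1 l.-1] r).
  move=> l0; apply: (iffP (oklP _ _)) => h k hk.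
    have := h k; rewrite size_map size_iota (nth_map 0%N) ?size_iota; last lia.
    by rewrite nth_iota ?addSn; [apply; lia | lia].
  rewrite size_map size_iota in hk; rewrite (nth_map 0%N) ?size_iota // nth_iota // addSn.
  apply: h; lia.
split=> [h0|/and3P[/lP h1 /lP h2 /allP h3] r c rX].
- have h (a b : box) : a \in X -> b \in X ->
     (b = (a.1, a.2 + 1) -> (f a <= f b)%N) /\ (b = (a.1 + 1, a.2) -> (f a < f b)%N).
    by case: a => r c aX bX; have [g1 g2] := h0 r c aX; split=> e; subst b; [exact: g1 | exact: g2].
  apply/and3P; split.
  + apply/lP => [|k hk]; first lia.
    rewrite add0n !pE; [|rewrite /v in hk *; lia|rewrite /v in hk *; lia].
    have X1 := alX (ltnW hk); have X2 := alX hk.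
    have ck := cntS S k; rewrite /step; case Sk: (S k.+1) ck => ck.
      have e : al k = ((al k.+1).1, (al k.+1).2 + 1) by apply: box_eq; rewrite /= ?al1 ?al2 ?be1 ?be2; lia.
      by have [g _] := h _ _ X2 X1; exact: g.
    have e : al k.+1 = ((al k).1 + 1, (al k).2) by apply: box_eq; rewrite /= ?al1 ?al2 ?be1 ?be2; lia.
    by have [_ g] := h _ _ X1 X2; exact: g.
  + apply/lP => [|k hk]; first lia.
    rewrite !qE; [|lia|lia]; rewrite addnS.
    have X1 : be (u + k)%N \in X by apply: beX; rewrite /L; lia.
    have X2 : be (u + k).+1 \in X by apply: beX; rewrite /L; lia.
    have ck := cntS S (u + k)%N; rewrite /step; case Sk: (S (u + k).+1) ck => ck.
      have e : be (u + k)%N = ((be (u + k).+1).1, (be (u + k).+1).2 + 1).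
        by apply: box_eq; rewrite /= ?al1 ?al2 ?be1 ?be2; lia.
      by have [g _] := h _ _ X2 X1; exact: g.
    have e : be (u + k).+1 = ((be (u + k)%N).1 + 1, (be (u + k)%N).2).
      by apply: box_eq; rewrite /= ?al1 ?al2 ?be1 ?be2; lia.
    by have [_ g] := h _ _ X1 X2; exact: g.
  + apply/allP => j; rewrite mem_iota => hj; rewrite pE; last by rewrite /v; lia.
    rewrite qE; last lia.
    have X1 : be (u + j)%N \in X by apply: beX; rewrite /L; lia.
    have X2 : al (u.-1 + j)%N \in X by apply: alX; rewrite /v; lia.
    have c1 : cnt S (u + j) = cnt S u by apply: win; rewrite /v; lia.
    have c2 : cnt S (u.-1 + j) = cnt S u by apply: win; rewrite /v; lia.
    have e : al (u.-1 + j)%N = ((be (u + j)%N).1, (be (u + j)%N).2 + 1).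
      by apply: box_eq; rewrite /= ?al1 ?al2 ?be1 ?be2 c1 c2; lia.
    by have [g _] := h _ _ X1 X2; exact: g.
have {}h1 := h1 (ltn_addr _ u0); have {}h2 := h2 (ltn_addr _ w0).
have fal i : (i < v)%N -> f ((pos S i).2, (pos S i).1) = nth 0%N p i by move=> hi; rewrite pE.
have fbe i : (u <= i < L)%N -> f ((pos S i - (1, 1)).2, (pos S i - (1, 1)).1) = nth 0%N q (i - u).
  by move=> hi; rewrite qE ?subnKC //; rewrite /L in hi; lia.
have key (a b : box) : a \in fat w u s S -> b \in fat w u s S ->
    (b = (a.1 - 1, a.2) -> (f (b.2, b.1) <= f (a.2, a.1))%N) /\
    (b = (a.1, a.2 + 1) -> (f (a.2, a.1) < f (b.2, b.1))%N).
  move=> /fatP[] [i hi ->] /fatP[] [j hj ->]; split=> e; box_proj e.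
  - have ij : j = i.+1 by lia.
    subst j; have := h1 i hj; have := cntS S i; rewrite add0n; case: (S i.+1) => ci; last by exfalso; lia.
    by rewrite !fal.
  - have ij : j = i.+1 by lia.
    subst j; have := h1 i hj; have := cntS S i; rewrite add0n; case: (S i.+1) => ci; first by exfalso; lia.
    by rewrite !fal.
  - have ij : j = i.+1 by lia.
    subst j; rewrite fal // fbe //.
    have := h3 (i.+1 - u)%N; rewrite mem_iota => h4.
    have -> : i = (u.-1 + (i.+1 - u))%N by lia.
    have -> : ((u.-1 + (i.+1 - u)).+1 - u = i.+1 - u)%N by lia.
    by apply: h4; lia.
  - have ij : j = i.+1 by lia.
    by subst j; have := cntS S i; case: (S i.+1) => ci; exfalso; lia.
  - have ij : j = i.+1 by lia.
    subst j; have c1 : cnt S i = cnt S u by apply: win; rewrite /v; lia.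
    have c2 : cnt S i.+1 = cnt S u by apply: win; rewrite /v; lia.
    by exfalso; lia.
  - have ij : j = i.+1 by lia.
    subst j; have c1 : cnt S i = cnt S u by apply: win; rewrite /v; lia.
    have c2 : cnt S i.+1 = cnt S u by apply: win; rewrite /v; lia.
    by exfalso; lia.
  - have ij : j = i.+1 by lia.
    subst j; have := h2 (i - u)%N; have := cntS S i; rewrite subnKC; last lia.
    case: (S i.+1) => ci; last by exfalso; lia.
    rewrite !fbe // => h4; rewrite subSn; last lia.
    by apply: h4; lia.
  - have ij : j = i.+1 by lia.
    subst j; have := h2 (i - u)%N; have := cntS S i; rewrite subnKC; last lia.
    case: (S i.+1) => ci; first by exfalso; lia.
    rewrite !fbe // => h4; rewrite subSn; last lia.
    by apply: h4; lia.
rewrite in_transpose /= in rX; split => r'X; rewrite in_transpose /= in r'X.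
  have [+ _] := key _ _ r'X rX; rewrite /=; apply; apply: box_eq => /=; lia.
by have [_ +] := key _ _ rX r'X; rewrite /=; apply.
Qed.

Definition variable (k : nat) : {mpoly int[n]} := if (insub k : option 'I_n) is Some i then 'X_i else 0.

Lemma variableE (i : 'I_n) : variable i = 'X_i.
Proof. by rewrite /variable valK. Qed.

Lemma mesym_T k : (0 < k)%N -> mesym n int k = T n variable (nseq k.-1 false).
Proof.
case: k => // k _; rewrite -[k.+1.-1]/k mesym_tupleE /T size_nseq wsum_tuple big_mkcond.
apply: eq_bigr => t _; rewrite /tmono.
have -> : sorted ltn [seq val i | i <- t] = okl (nseq k false) [seq val i | i <- t].
  apply/(sortedP 0%N)/oklP => h i; rewrite ?size_map ?size_tuple ?size_nseq => hi.
    by rewrite nth_nseq hi; apply: h; rewrite size_map size_tuple.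
  by have := h i; rewrite size_nseq nth_nseq; rewrite ltnS in hi; rewrite hi; apply.
have -> : wt variable [seq val i | i <- t] = \prod_(i <- t) 'X_i.
  by rewrite /wt big_map; apply: eq_bigr => i _; rewrite variableE.
by case: okl; rewrite /= ?mul1r ?mul0r.
Qed.

(** The transposed diagram is used because a horizontal segment then becomes a column, whose Schur
    function is an elementary symmetric polynomial. *)
Lemma skew_schur_fat : skew_schur X n = fatpoly (mesym n int) w (lmarks u S) (rmarks w u s S).
Proof.
have Sw x : closed_window w u x -> S x = false by exact: S_window.
transitivity (wsum n (v + (w + s)) (fun r =>
    (fat_ok w u s S (take v r) (drop v r))%:R * wt variable r)).
  have sbl : size bl = (v + (w + s))%N by rewrite size_cat !size_map !size_iota.
  rewrite -sbl -(@sum_fillings X n _ bl _ uniq_bl inX) /skew_schur big_mkcond; apply: eq_bigr => t _.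
  rewrite (prod_fillings t uniq_bl inX variableE).
  set r := [seq fval t b | b <- bl].
  have rE : r = [seq fval t (al i) | i <- iota 0 v] ++ [seq fval t (be i) | i <- iota u (w + s)].
    by rewrite /r map_cat -!map_comp.
  have s1 : size [seq fval t (al i) | i <- iota 0 v] = v by rewrite size_map size_iota.
  have -> : semistandard t = fat_ok w u s S (take v r) (drop v r).
    rewrite rE -{1 3}s1 take_size_cat // drop_size_cat //.
    have cX : convex X by apply/convex_transpose/(fat_convex w0 u0 s0 S_window).
    have [||||A B] := @fat_local (fval t) [seq fval t (al i) | i <- iota 0 v]
       [seq fval t (be i) | i <- iota u (w + s)].
    - by [].
    - by rewrite size_map size_iota.
    - by move=> i hi; rewrite (nth_map 0%N) ?size_iota // nth_iota.
    - by move=> i hi; rewrite (nth_map 0%N) ?size_iota // nth_iota.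
    have [C D] := local_order (fval t) cX.
    by apply/semistandardP/idP => [/C/A|/B/D].
  by case: fat_ok; rewrite ?mul1r ?mul0r.
rewrite wsum_cat.
have -> : wsum n v (fun p => wsum n (w + s) (fun q =>
   (fat_ok w u s S (take v (p ++ q)) (drop v (p ++ q)))%:R * wt variable (p ++ q))) =
   wsum n v (fun p => wsum n (w + s) (fun q => (fat_ok w u s S p q)%:R * (wt variable p * wt variable q))).
  apply: wsum_ext => p sp; apply: wsum_ext => q sq.
  have e1 : take v (p ++ q) = p by rewrite take_size_cat.
  have e2 : drop v (p ++ q) = q by rewrite drop_size_cat.
  by rewrite e1 e2 wt_cat.
apply: etrans (@fat_words _ n variable w u s S w0 u0 s0 Sw) _.
have tT bs : tacc (mesym n int) 1 bs = T n variable bs by exact: (@tacc_T _ n variable _ 1 bs mesym_T isT).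
rewrite /fatpoly /rpoly !tT (mesym_T w0).
rewrite (left_marks u0 s0 w0 (leqnn _) Sw) (right_marks u0 s0 w0 (leqnn _) Sw).
by rewrite (all_marks u0 s0 w0 (leqnn _) Sw) [(s + w)%N]addnC.
Qed.

End FatSchur.

(** * From equivalence to a formal identity and back *)

Section FormalFatPolynomial.

Variables (w u s u' s' : nat) (S S' : nat -> bool).
Hypothesis w0 : (0 < w)%N.
Hypothesis u0 : (0 < u)%N.
Hypothesis s0 : (0 < s)%N.
Hypothesis u'0 : (0 < u')%N.
Hypothesis s'0 : (0 < s')%N.
Hypothesis wS : window_free w u S.
Hypothesis wS' : window_free w u' S'.

Lemma equivalent_fatpoly : equivalent (fat w u s S) (fat w u' s' S') ->
  forall (R : comNzRingType) (y : nat -> R),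
    fatpoly y w (lmarks u S) (rmarks w u s S) = fatpoly y w (lmarks u' S') (rmarks w u' s' S').
Proof.
move=> /equivalent_transpose E R y.
pose n := (u + w + s + u' + s' + 2)%N.
pose yv (k : nat) : {mpoly int[n]} := variable n k.-1.
have szl : size (lmarks u S) = u.-1 by rewrite size_map size_iota.
have szr : size (rmarks w u s S) = s.-1 by rewrite size_map size_iota.
have szl' : size (lmarks u' S') = u'.-1 by rewrite size_map size_iota.
have szr' : size (rmarks w u' s' S') = s'.-1 by rewrite size_map size_iota.
have yvE k (hk : (k.-1 < n)%N) : yv k = 'X_(Ordinal hk) by rewrite /yv -variableE.
have formal : fatpoly yv w (lmarks u S) (rmarks w u s S) = fatpoly yv w (lmarks u' S') (rmarks w u' s' S').
  (* Algebraic independence of the first [n] elementary symmetric polynomials; [n] was chosen larger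
     than every index that occurs. The identity in free variables is then specialized to [R]. *)
  apply: msym_fundamental_un; set St := [tuple _ | _ < n].
  have stE k : (0 < k <= n)%N -> yv k \mPo St = mesym n int k.
    move=> hk; have hk' : (k.-1 < n)%N by lia.
    rewrite (yvE k hk') comp_mpolyXU -tnth_nth tnth_mktuple /= prednK //; lia.
  have := E n.
  rewrite (@skew_schur_fat w u s S n w0 u0 s0 wS) (@skew_schur_fat w u' s' S' n w0 u'0 s'0 wS') => E'.
  have M A B : fatpoly yv w A B \mPo St = fatpoly (fun k => yv k \mPo St) w A B.
    exact: (fatpoly_morph (comp_mpoly St)).
  have mid A B : (size A + w + size B + 2 <= n)%N ->
      fatpoly (fun k => yv k \mPo St) w A B = fatpoly (mesym n int) w A B.
    by move=> hn; apply: fatpoly_ext => // k hk; apply: stE; lia.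
  apply: etrans (M _ _) _; apply: etrans (esym (M _ _)).
  by rewrite !mid ?szl ?szr ?szl' ?szr' //; rewrite /n; lia.
pose phi := mmap (intr : int -> R) (fun i : 'I_n => y i.+1).
have phiE k : (0 < k <= n)%N -> phi (yv k) = y k.
  move=> hk; have hk' : (k.-1 < n)%N by lia.
  rewrite (yvE k hk') /phi mmapX mmap1U /= prednK //; lia.
have M A B : phi (fatpoly yv w A B) = fatpoly (fun k => phi (yv k)) w A B.
  exact: (fatpoly_morph (mmap (intr : int -> R) (fun i : 'I_n => y i.+1))).
have := congr1 phi formal; rewrite !M => F.
rewrite (@fatpoly_ext _ y (fun k => phi (yv k))) //; last by move=> k hk; rewrite phiE // /n; lia.
by rewrite F; apply: fatpoly_ext => // k hk; rewrite phiE // /n; lia.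
Qed.

Lemma fatpoly_equivalent :
  (forall n, fatpoly (mesym n int) w (lmarks u S) (rmarks w u s S) =
     fatpoly (mesym n int) w (lmarks u' S') (rmarks w u' s' S')) ->
  equivalent (fat w u s S) (fat w u' s' S').
Proof.
move=> h; rewrite -[fat w u s S]transposeK -[fat w u' s' S']transposeK.
apply: equivalent_transpose => n.
by rewrite (@skew_schur_fat w u s S n w0 u0 s0 wS) (@skew_schur_fat w u' s' S' n w0 u'0 s'0 wS'); exact: h.
Qed.

End FormalFatPolynomial.

(** * Equivalence classes *)

Section SegmentPolynomials.

Variables (R : comNzRingType) (y : nat -> R).
Implicit Types (S : nat -> bool).

(** The polynomial of the [l] boxes at positions [o] to [o + l - 1]; the [l - 1] steps between them
    are the marks [o + 1] to [o + l - 1]. *)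
Definition rp S o l := rpoly y [seq S x | x <- iota o.+1 l.-1].

Definition er1 z S x := S x && (x != z).

Lemma rp_ext S S' o l : (forall x, (o < x < o + l)%N -> S x = S' x) -> rp S o l = rp S' o l.
Proof.
move=> h; congr rpoly; apply/eq_in_map => x; rewrite mem_iota => hx; apply: h; lia.
Qed.

Lemma marks_cat S o l1 l2 : (0 < l1)%N -> (0 < l2)%N ->
  [seq S x | x <- iota o.+1 (l1 + l2).-1] =
  [seq S x | x <- iota o.+1 l1.-1] ++ S (o + l1)%N :: [seq S x | x <- iota (o + l1).+1 l2.-1].
Proof.
move=> h1 h2; have -> : (l1 + l2).-1 = (l1.-1 + l2.-1.+1)%N by lia.
by rewrite iotaD map_cat /=; have -> : (o.+1 + l1.-1 = o + l1)%N by lia.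
Qed.

Lemma rp_erase S o l1 l2 : (0 < l1)%N -> (0 < l2)%N -> S (o + l1)%N ->
  rp S o (l1 + l2) = rp S o l1 * rp S (o + l1) l2 - rp (er1 (o + l1) S) o (l1 + l2).
Proof.
move=> h1 h2 Sz; rewrite /rp !marks_cat // Sz /er1 Sz eqxx /=.
have -> : [seq S x && (x != (o + l1)%N) | x <- iota o.+1 l1.-1] = [seq S x | x <- iota o.+1 l1.-1].
  by apply/eq_in_map => x; rewrite mem_iota => hx; have -> : x != (o + l1)%N; [lia | rewrite andbT].
have -> : [seq S x && (x != (o + l1)%N) | x <- iota (o + l1).+1 l2.-1] = [seq S x | x <- iota (o + l1).+1 l2.-1].
  by apply/eq_in_map => x; rewrite mem_iota => hx; have -> : x != (o + l1)%N; [lia | rewrite andbT].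
by rewrite /rpoly -[X in _ = X - _]tacc_split; ring.
Qed.

Lemma rp_false S o l : (0 < l)%N -> (forall x, (o < x < o + l)%N -> S x = false) -> rp S o l = y l.
Proof.
move=> l0 h; rewrite (@rp_ext S (fun=> false)) // /rp.
have E n m : [seq false | x <- iota m n] = nseq n false by elim: n m => //= n IH m; rewrite IH.
by rewrite E -(cats0 (nseq _ _)) /rpoly tacc_false /= add1n prednK.
Qed.

(** Induction on the number of marks: [tacc_split] trades one mark for a product and a word with
    fewer marks, and both are handled symmetrically. *)
Lemma rpoly_rev bs : rpoly y (rev bs) = rpoly y bs.
Proof.
have [n] := ubnP (count id bs); elim: n bs => // n IH bs hn.
have [tb|] := boolP (true \in bs); last first.
  move=> nt; have -> : bs = nseq (size bs) false.
    by elim: bs nt {hn} => //= -[] bs IHb; rewrite inE //= => /IHb <-.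
  congr rpoly; apply: (@eq_from_nth _ false); rewrite size_rev // => i hi.
  by rewrite nth_rev // !nth_nseq; case: ifP; case: ifP.
case/splitPr: tb hn => b1 b2; rewrite count_cat /= => hn.
have h1 := tacc_split y 1 b1 b2; have h2 := tacc_split y 1 (rev b2) (rev b1).
rewrite rev_cat rev_cons cat_rcons /rpoly.
have -> : tacc y 1 (rev b2 ++ true :: rev b1) =
    tacc y 1 (rev b2) * rpoly y (rev b1) - tacc y 1 (rev b2 ++ false :: rev b1) by rewrite -h2; ring.
have -> : tacc y 1 (b1 ++ true :: b2) = tacc y 1 b1 * rpoly y b2 - tacc y 1 (b1 ++ false :: b2).
  by rewrite -h1; ring.
have e1 := IH b1; have e2 := IH b2; have e3 := IH (b1 ++ false :: b2).
rewrite rev_cat rev_cons cat_rcons /rpoly in e3; rewrite /rpoly in e1 e2 *.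
rewrite e1; last lia.
rewrite e2; last lia.
rewrite e3; last by rewrite count_cat /=; lia.
by ring.
Qed.

Lemma rp_revm L S o l : (0 < l)%N -> (o + l <= L)%N -> rp (revm L S) o l = rp S (L - o - l) l.
Proof.
move=> l0 h; rewrite /rp -[RHS]rpoly_rev; congr rpoly.
apply: (@eq_from_nth _ false); first by rewrite size_rev !size_map !size_iota.
move=> i; rewrite size_map size_iota => hi.
rewrite nth_rev ?size_map ?size_iota // !(nth_map 0%N) ?size_iota; try lia.
by rewrite !nth_iota; try lia; congr S; lia.
Qed.

Variables (w u s : nat).
Hypothesis w0 : (0 < w)%N.
Hypothesis u0 : (0 < u)%N.
Hypothesis s0 : (0 < s)%N.

(** The polynomial [fatpoly], extended to words that may have marks at the two ends of the
    window. *)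
Definition Phi S := rp S 0 (u + w) * rp S u (w + s) - y w * rp S 0 (u + w + s).

Lemma fatpoly_Phi S : window_free w u S ->
  fatpoly y w (lmarks u S) (rmarks w u s S) = Phi S.
Proof using w0 u0 s0.
move=> wS; rewrite /fatpoly (left_marks u0 s0 w0 (leqnn _) wS) (right_marks u0 s0 w0 (leqnn _) wS).
by rewrite (all_marks u0 s0 w0 (leqnn _) wS) /Phi /rp [(s + w)%N]addnC.
Qed.

Lemma er1_out z S o l : (forall x, (o < x < o + l)%N -> x != z) -> rp (er1 z S) o l = rp S o l.
Proof. by move=> h; apply: rp_ext => x hx; rewrite /er1 h // andbT. Qed.

Lemma Phi_ext S S' : (forall x, (0 < x < u + w + s)%N -> S x = S' x) -> Phi S = Phi S'.
Proof.
move=> h; rewrite /Phi (@rp_ext S S' 0 (u + w)) ?(@rp_ext S S' u) ?(@rp_ext S S' 0 (u + w + s)) //;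
  move=> x hx; apply: h; lia.
Qed.

(** Splitting the segments at [z] produces one product in [r1 * r2] and one in [e_w * r]; they are
    equal, since the segment of length [w] contributes [y w]. What remains is minus the polynomial
    with the mark erased. *)
Lemma Phi_er1 z S : (z = u) \/ (z = u + w)%N -> (forall x, (u < x < u + w)%N -> S x = false) ->
  Phi S = (-1) ^+ (S z) * Phi (er1 z S).
Proof using w0 u0 s0.
move=> hz wS; case Sz: (S z); last first.
  rewrite expr0 mul1r; apply: Phi_ext => x _; rewrite /er1; have [->|] := eqVneq x z; by rewrite ?Sz ?andbT.
have yw : rp S u w = y w by apply: rp_false.
rewrite expr1 mulN1r /Phi.
case: hz => ez; subst z.
- have e1 := @rp_erase S 0 u w u0 w0 Sz.
  have e2 := @rp_erase S 0 u (w + s) u0 (ltn_addr _ w0) Sz.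
  rewrite add0n addnA in e1 e2; rewrite e1 e2 yw (@er1_out u S u); last by move=> x hx; lia.
  by ring.
- have e1 := @rp_erase S u w s w0 s0 Sz.
  have e2 := @rp_erase S 0 (u + w) s (ltn_addr _ u0) s0 Sz.
  rewrite add0n in e2; rewrite e1 e2 yw (@er1_out (u + w)%N S 0 (u + w)); last by move=> x hx; lia.
  by ring.
Qed.

Lemma Phi_erase S : (forall x, (u < x < u + w)%N -> S x = false) ->
  Phi (erase w u S) = (-1) ^+ (S u + S (u + w)%N) * Phi S.
Proof using w0 u0 s0.
move=> wS; have wS' x : (u < x < u + w)%N -> er1 u S x = false by move=> h; rewrite /er1 wS.
rewrite (Phi_er1 (or_introl (erefl u)) wS) (Phi_er1 (or_intror (erefl (u + w)%N)) wS').
have -> : er1 u S (u + w)%N = S (u + w)%N by rewrite /er1; have -> : (u + w)%N != u; [lia | rewrite andbT].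
have -> : Phi (er1 (u + w) (er1 u S)) = Phi (erase w u S).
  by apply: Phi_ext => x _; rewrite /er1 /erase -andbA.
by rewrite exprD; case: (S u); case: (S (u + w)%N); rewrite /= ?expr1 ?expr0; ring.
Qed.

End SegmentPolynomials.

Lemma Phi_revm (R : comNzRingType) (y : nat -> R) w u s S : (0 < w)%N -> (0 < u)%N -> (0 < s)%N ->
  Phi y w s u (revm (u + w + s) S) = Phi y w u s S.
Proof.
move=> w0 u0 s0; rewrite /Phi !rp_revm; try lia.
have -> : (u + w + s - 0 - (s + w) = u)%N by lia.
have -> : (u + w + s - s - (w + u) = 0)%N by lia.
have -> : (u + w + s - 0 - (s + w + u) = 0)%N by lia.
have -> : (s + w + u = u + w + s)%N by lia.
by rewrite [(s + w)%N]addnC [(w + u)%N]addnC mulrC.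
Qed.

Lemma revm_window w u s S : window_free w u S -> window_free w s (revm (u + w + s) S).
Proof. by move=> h x hx; apply: h; lia. Qed.

Lemma fat_rotate_equivalent w u s S : (0 < w)%N -> (0 < u)%N -> (0 < s)%N -> window_free w u S ->
  equivalent (fat w u s S) (rotate (fat w u s S)).
Proof.
move=> w0 u0 s0 wS.
apply: equivalent_trans (same_equivalent (same_sym (rotate_fat u s S w0))).
apply: fatpoly_equivalent => //; first exact: revm_window.
by move=> n; rewrite !fatpoly_Phi //; [rewrite Phi_revm | exact: revm_window].
Qed.

(** * Equivalences between compositions *)

Lemma perM c tau p x : (0 < x)%N -> per c tau (p * c + x) = per c tau x.
Proof. by case: x => // x _; rewrite /per addnS /= modnMDl. Qed.

Lemma per_id c tau x : (0 < x <= c)%N -> per c tau x = tau x.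
Proof. by move=> h; rewrite /per modn_small ?prednK //; lia. Qed.

Lemma per_flat w c tau x : (0 < w)%N -> (0 < c)%N -> flat_ends w c tau -> (0 < x < c + w)%N ->
  per c tau x = tau x.
Proof. by move=> w0 c0 ends; exact: (per_tau w0 ends c0). Qed.

(** The two arguments of [tau] are congruent modulo [c]; which of them is larger depends on whether
    [x] exceeds [n * c]. *)
Lemma per_rev w c tau n x : (0 < w)%N -> (0 < c)%N -> (0 < n)%N -> flat_ends w c tau ->
  (0 < x < n * c + w)%N -> per c (revm (c + w) tau) x = per c tau (n * c + w - x).
Proof.
move=> w0 c0 n0 ends hx; rewrite {1}/per /revm.
have e := divn_eq x.-1 c; have hm := ltn_pmod x.-1 c0.
move: (x.-1 %/ c)%N (x.-1 %% c)%N e hm => j r e hm.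
rewrite -(@per_flat w c tau) //; last lia.
have [jn|jn] := ltnP j n.
  have -> : (n * c + w - x = (n.-1 - j) * c + (c + w - r.+1))%N.
    have : (n * c = (n.-1 - j) * c + j * c + c)%N by rewrite -mulnDl -mulSnr; congr (_ * _)%N; lia.
    by move: e hm; move: (n * c)%N ((n.-1 - j) * c)%N (j * c)%N => a b d; lia.
  by rewrite perM //; lia.
have -> : (c + w - r.+1 = (j - n.-1) * c + (n * c + w - x))%N.
  have : (j * c + c = (j - n.-1) * c + n * c)%N by rewrite -mulSnr -mulnDl; congr (_ * _)%N; lia.
  by move: e hm hx; move: (n * c)%N ((j - n.-1) * c)%N (j * c)%N => a b d; lia.
by rewrite perM //; lia.
Qed.

Lemma flat_rev w c tau : flat_ends w c tau -> flat_ends w c (revm (c + w) tau).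
Proof. by case=> h1 h2; split=> x hx; rewrite /revm; [apply: h2 | apply: h1]; lia. Qed.

Section Compositions.

Variables (w c : nat) (tau : nat -> bool).
Hypothesis w0 : (0 < w)%N.
Hypothesis c0 : (0 < c)%N.
Hypothesis ends : flat_ends w c tau.

Lemma muln_pos a : (0 < a)%N -> (0 < a * c)%N.
Proof using c0. by move=> a0; rewrite muln_gt0 a0. Qed.

Lemma per_window a x : (a * c < x < a * c + w)%N -> per c tau x = false.
Proof using w0 c0 ends.
move=> hx; have -> : x = (a * c + (x - a * c))%N by lia.
rewrite perM; last lia.
by rewrite (@per_flat w) //; [apply: (proj1 ends)|]; lia.
Qed.

Lemma comp_window p : window_free w (p * c) (erase w (p * c) (per c tau)).
Proof using w0 c0 ends.
move=> x hx; rewrite /erase; have [->|h1] := eqVneq x (p * c)%N; first by rewrite andbF.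
have [->|h2] := eqVneq x (p * c + w)%N; first by rewrite !andbF.
by rewrite (@per_window p) //; lia.
Qed.

Lemma comp_convex p q : (0 < p)%N -> (0 < q)%N -> convex (two_row_compose w p q c tau).
Proof using w0 c0 ends.
by move=> p0 q0; apply: fat_convex => //; [exact: muln_pos|exact: muln_pos|exact: comp_window].
Qed.

Lemma per_c p : (0 < p)%N -> per c tau (p * c) = tau c.
Proof using c0.
move=> p0; have -> : (p * c = p.-1 * c + c)%N by rewrite -mulSnr prednK.
by rewrite perM // per_id // c0 leqnn.
Qed.

Lemma per_w p : per c tau (p * c + w) = tau w.
Proof using w0 c0 ends. by rewrite perM // (@per_flat w) //; lia. Qed.

End Compositions.

Lemma comp_ext w p q c tau tau' : (0 < w)%N -> (0 < c)%N -> flat_ends w c tau -> flat_ends w c tau' ->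
  (forall x, (0 < x < c + w)%N -> tau x = tau' x) ->
  two_row_compose w p q c tau = two_row_compose w p q c tau'.
Proof.
move=> w0 c0 e1 e2 h; apply: fat_ext => x _; rewrite /erase; congr (_ && _); rewrite /per; apply: h.
by have := ltn_pmod x.-1 c0; lia.
Qed.

(** In a periodic word the segments that start at multiples of [c] depend on their lengths only, so
    [Phi] is symmetric in [p] and [q]; the marks erased at the window ends give the same sign on
    both sides. *)
Lemma comp_swap w p q c tau : (0 < w)%N -> (0 < p)%N -> (0 < q)%N -> (0 < c)%N -> flat_ends w c tau ->
  equivalent (two_row_compose w p q c tau) (two_row_compose w q p c tau).
Proof.
move=> w0 p0 q0 c0 ends.
have pc := muln_pos c0 p0; have qc := muln_pos c0 q0.
have wp := @comp_window w c tau w0 c0 ends p; have wq := @comp_window w c tau w0 c0 ends q.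
apply: fatpoly_equivalent => // n; rewrite !fatpoly_Phi // !Phi_erase //; first last.
- by move=> x; exact: (per_window w0 c0 ends).
- by move=> x; exact: (per_window w0 c0 ends).
rewrite !(per_c tau c0) // !(per_w w0 c0 ends) //; congr (_ * _); rewrite /Phi.
have sh a l : rp (mesym n int) (per c tau) (a * c) l = rp (mesym n int) (per c tau) 0 l.
  rewrite /rp; congr rpoly; rewrite -[(a * c).+1]addn1 iotaDl -map_comp; apply/eq_in_map => x.
  by rewrite mem_iota => hx /=; rewrite perM //; lia.
rewrite !sh [(w + q * c)%N]addnC [(w + p * c)%N]addnC.
have -> : (q * c + w + p * c = p * c + w + q * c)%N by lia.
by rewrite mulrC.
Qed.

Lemma comp_rotate w p q c tau : (0 < w)%N -> (0 < p)%N -> (0 < q)%N -> (0 < c)%N -> flat_ends w c tau ->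
  same_diagram (rotate (two_row_compose w p q c tau)) (two_row_compose w q p c (revm (c + w) tau)).
Proof.
move=> w0 p0 q0 c0 ends; apply: same_trans (rotate_fat _ _ _ w0) _.
rewrite (@fat_ext w (q * c) (p * c) _ (erase w (q * c) (per c (revm (c + w) tau)))) ?same_refl //.
move=> x hx; rewrite {1}/revm /erase (@per_rev w c tau (p + q)) //; [|lia|by rewrite mulnDl; lia].
have -> : ((p + q) * c + w - x = p * c + w + q * c - x)%N by rewrite mulnDl; lia.
by congr (_ && _); move: (p * c)%N (q * c)%N hx => a b hx; lia.
Qed.

(** Rotation reverses [tau] and exchanges [p] with [q]; [comp_swap] undoes the exchange. *)
Lemma comp_rev w p q c tau : (0 < w)%N -> (0 < p)%N -> (0 < q)%N -> (0 < c)%N -> flat_ends w c tau ->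
  equivalent (two_row_compose w p q c tau) (two_row_compose w p q c (revm (c + w) tau)).
Proof.
move=> w0 p0 q0 c0 ends.
apply: equivalent_trans (fat_rotate_equivalent w0 (muln_pos c0 p0) (muln_pos c0 q0) (@comp_window w c tau w0 c0 ends p)) _.
apply: equivalent_trans (same_equivalent (comp_rotate w0 p0 q0 c0 ends)) _.
by apply: comp_swap => //; exact: flat_rev.
Qed.

Lemma revmK L S x : (0 < x < L)%N -> revm L (revm L S) x = S x.
Proof. by move=> h; rewrite /revm subKn //; lia. Qed.

(* Two periodic words agreeing away from the endpoints of the window agree there too: with at
   least three periods, some other point of the same residue class is visible. *)
Lemma per_agree w p q c c' tau tau' k : (0 < w)%N -> (0 < p)%N -> (0 < c)%N -> (0 < c')%N ->
  (3 <= p + q)%N -> (c = k * c')%N ->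
  (forall x, (0 < x < p * c + w + q * c)%N -> x != (p * c)%N -> x != (p * c + w)%N ->
     per c tau x = per c' tau' x) ->
  forall x, (0 < x < p * c + w + q * c)%N -> per c tau x = per c' tau' x.
Proof.
move=> w0 p0 c0 c'0 n3 ck h x hx.
have shift a b z : (0 < b)%N -> (z = a * c + b)%N -> per c tau z = per c tau b /\ per c' tau' z = per c' tau' b.
  by move=> b0 ->; rewrite perM //; split => //; rewrite ck mulnA perM.
have same a a' b : (0 < b)%N -> (0 < a * c + b < p * c + w + q * c)%N ->
   (a * c + b)%N != (p * c)%N -> (a * c + b)%N != (p * c + w)%N ->
   per c tau (a' * c + b) = per c' tau' (a' * c + b).
  move=> b0 r1 r2 r3; have [f1 f2] := shift a b _ b0 erefl; have [g1 g2] := shift a' b _ b0 erefl.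
  by rewrite g1 g2 -f1 -f2; apply: h.
have L3 : (3 * c <= p * c + q * c)%N by rewrite -mulnDl leq_mul2r n3 orbT.
have [xu|xu] := eqVneq x (p * c)%N.
  have -> : x = (p.-1 * c + c)%N by rewrite xu -mulSnr prednK.
  have [a ha] : exists a, [&& (a < 3)%N, a.+1 != p & (a * c + c)%N != (p * c + w)%N].
    have [e1|e1] := eqVneq (0 * c + c)%N (p * c + w)%N.
      by exists (if p == 2%N then 2 else 1)%N; case: eqVneq => e2; subst; lia.
    have [e2|e2] := eqVneq p 1%N; last by exists 0%N; rewrite e1 eq_sym e2.
    by subst p; exists (if (1 * c + c)%N == (1 * c + w)%N then 2 else 1)%N; case: eqVneq => e3; lia.
  case/and3P: ha => a3 ap av; apply: (same a) => //; have : (a * c <= 2 * c)%N by rewrite leq_mul2r; lia.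
    by lia.
  by move=> _; apply: contra ap; rewrite -mulSnr eqn_pmul2r.
have [xv|xv] := eqVneq x (p * c + w)%N; last exact: h.
rewrite xv.
have [a ha] : exists a, [&& (a < 3)%N, a != p & (a * c + w)%N != (p * c)%N].
  have [e1|e1] := eqVneq (0 * c + w)%N (p * c)%N; last by exists 0%N; rewrite e1; lia.
  have [e2|e2] := eqVneq p 1%N; first by exists 2%N; subst p; lia.
  by exists 1%N; lia.
case/and3P: ha => a3 ap av; apply: (same a) => //; have : (a * c <= 2 * c)%N by rewrite leq_mul2r; lia.
  by lia.
by move=> _; rewrite eqn_add2r eqn_pmul2r.
Qed.

Lemma rib_inj l l' S S' : (0 < l)%N -> (0 < l')%N -> same_diagram (rib l S) (rib l' S') ->
  l = l' /\ forall x, (0 < x < l)%N -> S x = S' x.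
Proof.
move=> l0 l'0 /same_diagramP[p pE].
have o_rib m Q : (0 < m)%N -> (0 : box) \in rib m Q.
  by move=> m0; apply/ribP; exists 0%N => //; box_lia.
have corner m Q (b : box) : b \in rib m Q -> b.1 <= 0 /\ (b.1 = 0 -> 0 <= b.2).
  by move=> bR; apply: (@rib_corner 0 m Q b); rewrite translate0.
have p0 : p = 0.
  have h3 : p \in rib l' S' by rewrite pE in_translate subrr; exact: o_rib.
  have h4 : - p \in rib l S by have := o_rib l' S' l'0; rewrite pE in_translate sub0r.
  have [a1 a2] := corner _ _ _ h3; have [b1 b2] := corner _ _ _ h4; rewrite !boxE in b1 b2.
  by apply: box_eq; rewrite /=; lia.
move: pE; rewrite p0 translate0 => pE.
have ll' : l = l'.
  have : pos S l.-1 \in rib l' S' by rewrite pE; apply/ribP; exists l.-1 => //; lia.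
  have : pos S' l'.-1 \in rib l S by rewrite -pE; apply/ribP; exists l'.-1 => //; lia.
  by move=> /ribP[i hi ei] /ribP[j hj ej]; box_proj ei; box_proj ej; lia.
subst l'; split => // x hx.
have ce i : (i < l)%N -> cnt S i = cnt S' i.
  move=> hi; have : pos S i \in rib l S' by rewrite pE; apply/ribP; exists i.
  by case/ribP => j hj ej; box_proj ej; have ij : i = j; [lia | subst j; lia].
have nb (b b' : bool) : (b : nat) = b' -> b = b' by case: b; case: b'.
case: x hx => // x hx; have c1 := cntS S x; have c2 := cntS S' x.
by have e1 := ce x.+1; have e2 := ce x; apply: nb; lia.
Qed.

(** * Factorizations and their parameters *)

Lemma ribbonP A : ribbon A <-> exists l S, (0 < l)%N /\ same_diagram A (rib l S).
Proof.
split=> [/ribbon_rib[p [l [S [l0 ->]]]]|[l [S [l0 /same_sym/same_diagramP[v ->]]]]].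
  by exists l, S; split=> //; apply/same_sym/same_translate.
exact: rib_ribbon.
Qed.

Lemma ribbon_rotate A : ribbon A -> ribbon (rotate A).
Proof.
case/ribbonP => l [S [l0 h]]; apply/ribbonP; exists l, (revm l S); split=> //.
exact: same_trans (same_rotate h) (rotate_rib l S).
Qed.

Lemma ribbon_transpose A : ribbon A -> ribbon (transpose A).
Proof.
case/ribbonP => l [S [l0 h]]; apply/ribbonP; exists l, (fun x => ~~ S (l - x)%N); split=> //.
exact: same_trans (same_transpose h) (transpose_rib l S).
Qed.

Definition one_mark (p i : nat) := i == p.

Lemma rotate_one_mark p q : (0 < p)%N -> (0 < q)%N ->
  same_diagram (rotate (rib (p + q) (one_mark p))) (rib (q + p) (one_mark q)).
Proof.
move=> p0 q0; apply: same_trans (rotate_rib _ _) _; rewrite addnC.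
rewrite (@rib_ext (q + p) _ (one_mark q)) ?same_refl // => x hx; rewrite /revm /one_mark; lia.
Qed.

Lemma unit_rib : unit_box = rib 1 (fun=> false).
Proof.
apply/fsetP => b; rewrite in_fset1; apply/eqP/ribP => [->|[[|i] //]]; first by exists 0%N => //; box_lia.
Qed.

Lemma rib_unit l S D : (0 < l)%N -> same_diagram D (rib l S) -> same_diagram D unit_box = (l == 1%N).
Proof.
move=> l0 h; apply/idP/eqP => [h'|e].
  by have := same_trans (same_sym h) h'; rewrite unit_rib => /rib_inj[] //.
apply: same_trans h _; rewrite unit_rib e (@rib_ext 1 S (fun=> false)) ?same_refl // => x; lia.
Qed.

(* What a factorization needs to know about D; unlike being a boxdot this is stable under
   transposition. *)
Definition fatlike (w : nat) (D : diagram) : Prop :=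
  [/\ convex D, (exists b : box, b \in D /\ b + (1, 1) \in D)
    & forall b b' : box, b \in D -> b + (1, 1) \in D -> b' \in D -> b' + (1, 1) \in D ->
        (b'.2 - b'.1) - (b.2 - b.1) < w%:Z].

Definition fatform (w : nat) (D : diagram) : Prop :=
  exists u s S, [/\ (0 < u)%N, (0 < s)%N, window_free w u S & same_diagram D (fat w u s S)].

Lemma fatlike_same w D E : same_diagram D E -> fatlike w D -> fatlike w E.
Proof.
case/same_diagramP => v -> [cD [b [b1 b2]] h]; split; first exact: convex_translate.
  by exists (b + v); rewrite !in_translate addrK addrAC addrK.
move=> x x'; rewrite !in_translate ![_ + (1, 1) - v]addrAC => h1 h2 h3 h4.
by have := h _ _ h1 h2 h3 h4; rewrite !boxE; lia.
Qed.

Lemma fatlike_transpose w D : fatlike w D -> fatlike w (transpose D).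
Proof.
case=> cD [b [b1 b2]] h; split; first exact: convex_transpose.
  by exists (b.2, b.1); rewrite !in_transpose !boxE /= -surjective_pairing.
move=> x x'; rewrite !in_transpose => h1 h2 h3 h4.
by have := h _ _ h3 h4 h1 h2; rewrite /=; lia.
Qed.

Lemma fatform_fatlike w D : (0 < w)%N -> fatform w D -> fatlike w D.
Proof.
move=> w0 [u [s [S [u0 s0 wS /same_sym/fatlike_same]]]]; apply; split; first exact: fat_convex.
  exists (pos S u - (1, 1)); split; first by apply/fatP; right; exists u => //; lia.
  by rewrite subrK; apply/fatP; left; exists u => //; lia.
move=> b b' h1 h2 h3 h4.
have [x hx ->] := fat_double h1 h2; have [x' hx' ->] := fat_double h3 h4; rewrite !bE /=; lia.
Qed.

(** Each mark [i] of [S] doubles the contents from [i * c] to [i * c + w - 1]. Two marks would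
    spread doubled contents over a distance of at least [w], and no mark would leave a ribbon; so
    [S] has exactly two rows. *)
Lemma row_factor w D S T : (0 < w)%N -> fatlike w D -> factors w.+1 D S WRow T ->
  exists p q c tau, [/\ [/\ (0 < p)%N, (0 < q)%N & (0 < c)%N], flat_ends w c tau,
    same_diagram S (rib (p + q) (one_mark p)), same_diagram T (rib (c + w) tau)
    & same_diagram D (two_row_compose w p q c tau)].
Proof.
move=> w0 fD [/ribbon_rib[q0 [k [sigma [k0 SE]]]] /ribbon_rib[v [l [tau [l0 TE]]]] [b1 b2 _] DE].
have fR := fatlike_same DE fD; subst S T.
rewrite /= bottom_length_le // in b1; rewrite /= top_length_le // in b2.
case/andP: b1 => wl /eqP b1; case/andP: b2 => _ /eqP b2.
have [c lE] : exists c, l = (c + w)%N by exists (l - w)%N; lia.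
subst l; rewrite addnK in b2.
have ends : flat_ends w c tau.
  have h1 : (0 <= w.-1)%N by [].
  have h2 : (c <= (c + w).-1)%N by lia.
  split=> x hx.
    by apply: (proj1 (cnt_constP tau h1)); [rewrite b1 | lia].
  by apply: (proj1 (cnt_constP tau h2)); [| lia].
case: fR => cR [d [d1 d2]] far.
have [c0|c0] := posnP c.
  (* Here [T] is the row [W] itself: all translates of it move along one diagonal. Two neighbouring
     rows of width [w] shifted by one column violate convexity. *)
  exfalso; subst c; set T := translate v _ in d1 d2 far cR *.
  have nh : lower_horizontal w.+1 T = false by rewrite /lower_horizontal bottom_length_le //= ltnn.
  have nu : upper_horizontal w.+1 T = false by rewrite /upper_horizontal top_length_le //= ltnn.
  have off (z : box) : offset w.+1 T z = (- z.1, - z.1).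
    rewrite /offset /north_step nh nu (east_stepE v w0 ends).
    have -> : pos tau 0 = 0 by box_lia.
    rewrite mul0rz !add0r /southeast1.
    have En (n : nat) : (1, 1) *+ n = (n%:Z, n%:Z) :> box.
      by elim: n => [|n IH] //; rewrite mulrS IH; apply: box_eq; rewrite !boxE /=; lia.
    have E (n : int) : (1, 1) *~ n = (n, n) :> box.
      by case: n => n; [rewrite -pmulrn En | rewrite NegzE mulrNz -pmulrn En].
    by rewrite E.
  have mem (b : box) : b \in row_compose w.+1 (translate q0 (rib k sigma)) T ->
      [/\ v.2 - v.1 <= b.2 - b.1, b.2 - b.1 < v.2 - v.1 + w%:Z
        & forall x, (x < w)%N -> (b.1, b.1 + (v.2 - v.1) + x%:Z) \in row_compose w.+1 (translate q0 (rib k sigma)) T].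
    rewrite inE => /orP[/bigfcupP[z /andP[zS _]]|/bigfcupP[z _]]; last by rewrite /extra_copy nh nu in_fset0.
    rewrite in_translate off => /in_ribT[i hi e].
    have ci j : (j < w)%N -> cnt tau j = 0%N.
      move=> hj; apply/esym; rewrite -[LHS]/(cnt tau 0); apply/(cnt_constP tau (leq0n j)) => x hx.
      by apply: (proj1 ends); lia.
    box_proj e; rewrite ci // in H, H0; split; try lia.
    move=> x hx; rewrite inE; apply/orP; left; apply/bigfcupP; exists z; first by rewrite zS.
    rewrite in_translate off; apply/in_ribT; exists x => //.
    by apply: box_eq; rewrite !bE ci //=; lia.
  have [m1 m2 m3] := mem _ d1; have [n1 n2 n3] := mem _ d2; rewrite !boxE /= in n1 n2 n3.
  have h1 := m3 0%N w0; have h2 := n3 w.-1; rewrite prednK // in h2; have {}h2 := h2 (leqnn _).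
  have : (d.1, d.1 + (v.2 - v.1) + w%:Z) \in row_compose w.+1 (translate q0 (rib k sigma)) T.
    by apply: (cR _ _ _ h1 h2) => /=; lia.
  by case/mem; rewrite /=; lia.
have [/hasP[p]|] := boolP (has sigma (iota 1 k.-1)); last first.
  move=> /hasPn none; exfalso; move: d1 d2; rewrite compose_one_row //.
    by move=> /in_ribT[i hi ei] /in_ribT[j hj ej]; rewrite ei in ej; box_proj ej;
       have ij : i = j; [lia | subst j; lia].
  by move=> i hi; apply/negbTE/none; rewrite mem_iota; lia.
rewrite mem_iota => hp sp; have hp' : (0 < p < k)%N by lia.
have uni i : (0 < i < k)%N -> sigma i -> i = p.
  have lt a b : (0 < a < k)%N -> (0 < b < k)%N -> sigma a -> sigma b -> ~ (a < b)%N.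
    move=> ha hb sa sb ab.
    have [x [x1 x2 xc]] := compose_double v q0 w0 ends c0 ha sa w0.
    have w1 : (w.-1 < w)%N by lia.
    have [z [z1 z2 zc]] := compose_double v q0 w0 ends c0 hb sb w1.
    have := far _ _ x1 x2 z1 z2; rewrite xc zc.
    have : (a * c + c <= b * c)%N by rewrite addnC -mulSn leq_mul2r ab orbT.
    by move: (a * c)%N (b * c)%N => a' b'; lia.
  move=> hi si; have := lt i p hi hp' si sp; have := lt p i hp' hi sp si; lia.
have sE i : (0 < i < p + (k - p))%N -> sigma i = (i == p).
  move=> hi; have hk : (0 < i < k)%N by lia.
  by apply/idP/eqP => [/(uni _ hk)|->].
exists p, (k - p)%N, c, tau; split=> //.
- by split; lia.
- have -> : (p + (k - p) = k)%N by lia.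
  rewrite (@rib_ext k (one_mark p) sigma); first by apply/same_sym/same_translate.
  by move=> x hx; rewrite sE //; lia.
- by apply/same_sym/same_translate.
apply: same_trans DE _; have kE : k = (p + (k - p))%N by lia.
rewrite {1}kE (@compose_two_rows w p (k - p) c tau sigma v q0) //; try lia.
by apply/same_sym/same_translate.
Qed.

Lemma row_factor_conv w p q c tau S T X : (0 < w)%N -> (0 < p)%N -> (0 < q)%N -> (0 < c)%N ->
  flat_ends w c tau -> same_diagram S (rib (p + q) (one_mark p)) -> same_diagram T (rib (c + w) tau) ->
  same_diagram X (two_row_compose w p q c tau) -> factors w.+1 X S WRow T.
Proof.
move=> w0 p0 q0 c0 ends /same_sym/same_diagramP[a ->] /same_sym/same_diagramP[v ->] hX.
split; [by apply: rib_ribbon; lia | by apply: rib_ribbon; lia | exact: flat_composable |].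
by apply: same_trans hX _; rewrite compose_two_rows //; exact: same_translate.
Qed.

(** * The diagrams equivalent to a given boxdot *)

Lemma class_aligned w u s S S' : (0 < w)%N -> (0 < u)%N -> (0 < s)%N ->
  window_free w u S -> window_free w u S' -> equivalent (fat w u s S') (fat w u s S) ->
  [\/ fat w u s S' = fat w u s S, same_diagram (fat w u s S') (rotate (fat w u s S)) |
   exists p q c tau, [/\ [/\ (0 < p)%N, (0 < q)%N, (0 < c)%N & p != q], flat_ends w c tau,
     [/\ u = (p * c)%N, s = (q * c)%N & c = gcdn u s], fat w u s S = two_row_compose w p q c tau &
     fat w u s S' = two_row_compose w p q c (revm (c + w) tau)]].
Proof.
move=> w0 u0 s0 wS wS' eqv.
have coefs S2 : window_free w u S2 -> equivalent (fat w u s S2) (fat w u s S) -> _ :=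
  fun wS2 h => formal_coefs w0 u0 s0 u0 s0 wS wS2
    (equivalent_fatpoly w0 u0 s0 u0 s0 wS wS2 (equivalent_sym h)) erefl erefl.
have [c3 c4] := coefs _ wS' eqv.
have [us|us] := eqVneq u s.
  have rotS : same_diagram (rotate (fat w u s S)) (fat w u s (revm (u + w + s) S)).
    by have := rotate_fat u s S w0; rewrite -us.
  have fin : (forall x, (0 < x < u + w + s)%N -> S x = S' x) \/
      (forall x y, (0 < x)%N -> (0 < y)%N -> (x + y = u + w + s)%N -> S' y = S x) ->
    fat w u s S' = fat w u s S \/ same_diagram (fat w u s S') (rotate (fat w u s S)).
    case=> h; [left; apply: fat_ext => x hx; rewrite h // | right].
    apply: same_trans (same_sym rotS).
    by rewrite (@fat_ext w u s S' (revm (u + w + s) S)) ?same_refl // => x hx; rewrite /revm; apply: h; lia.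
  suff /fin[] : (forall x, (0 < x < u + w + s)%N -> S x = S' x) \/
      (forall x y, (0 < x)%N -> (0 < y)%N -> (x + y = u + w + s)%N -> S' y = S x).
  - by move=> h; apply: Or31.
  - by move=> h; apply: Or32.
  case: (equal_sides_split w0 u0 s0 wS wS' c3 c4 us) => odd.
    exact: (equal_sides_odd w0 u0 s0 wS wS' c3 c4 us odd).
  pose S2 := revm (u + w + s) S'.
  have wS2 : window_free w u S2 by have := @revm_window w u s S' wS'; rewrite -{1}us.
  have eqv2 : equivalent (fat w u s S2) (fat w u s S).
    apply: equivalent_trans eqv; apply/equivalent_sym.
    apply: equivalent_trans (fat_rotate_equivalent w0 u0 s0 wS') _.
    apply: same_equivalent; have := rotate_fat u s S' w0; rewrite -/S2.
    by have -> : fat w s u S2 = fat w u s S2 by rewrite us.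
  have [c3' c4'] := coefs _ wS2 eqv2.
  case: (equal_sides_odd w0 u0 s0 wS wS2 c3' c4' us odd) => h; [right|left].
    move=> x y x0 y0 xy; rewrite h; last lia.
    by rewrite /S2 /revm; congr S'; lia.
  move=> x hx; rewrite -(h x (u + w + s - x)%N); try lia.
  by rewrite /S2 /revm; congr S'; lia.
case: (unequal_sides w0 u0 s0 wS wS' c3 c4 us) => [h|[T [TE T'E Tw Tper _]]].
  by apply: Or31; apply: fat_ext => x hx; rewrite h.
(* The periodic word [T] differs from [S] at the window ends only, where the composition erases its
   marks again. *)
apply: Or33; pose c := gcdn u s; pose p := (u %/ c)%N; pose q := (s %/ c)%N.
have c0 : (0 < c)%N by rewrite gcdn_gt0 u0.
have uE : u = (p * c)%N by rewrite /p divnK // dvdn_gcdl.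
have sE : s = (q * c)%N by rewrite /q divnK // dvdn_gcdr.
have p0 : (0 < p)%N by case: (posnP p) => // e; move: u0; rewrite uE e.
have q0 : (0 < q)%N by case: (posnP q) => // e; move: s0; rewrite sE e.
have cu : (c <= u)%N by rewrite uE leq_pmull.
have per' j x : (0 < x)%N -> (x + j * c < u + w + s)%N -> T (x + j * c)%N = T x.
  move=> x0; elim: j => [|j IH] h; first by rewrite mul0n addn0.
  have e : (x + j.+1 * c = x + j * c + c)%N by rewrite mulSn; lia.
  by rewrite e in h *; rewrite Tper ?IH //; lia.
have low x : (0 < x < w)%N -> T x = false.
  by move=> hx; rewrite -(@per' p) -?uE; [apply: Tw; rewrite /in_window; lia | lia | lia].
have ends : flat_ends w c T.
  split=> // x hx; have -> : x = (x - c + 1 * c)%N by lia.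
  by rewrite per' ?low //; lia.
have perT x : (0 < x < u + w + s)%N -> per c T x = T x.
  move=> hx; rewrite /per; have e := divn_eq x.-1 c.
  have {2}-> : x = ((x.-1 %% c).+1 + x.-1 %/ c * c)%N by move: e; move: (x.-1 %% c)%N (x.-1 %/ c * c)%N => a b; lia.
  by rewrite per' //; move: e; move: (x.-1 %% c)%N (x.-1 %/ c * c)%N => a b; lia.
exists p, q, c, T; split => //.
- by split=> //; apply: contra us => /eqP e; rewrite uE sE e.
- rewrite /two_row_compose -uE -sE; apply: fat_ext => x hx; rewrite /erase perT //.
  have [->|h1] := eqVneq x u; first by rewrite andbF wS //; lia.
  have [->|h2] := eqVneq x (u + w)%N; first by rewrite andbF wS //; lia.
  by rewrite !andbT TE // /end_point negb_or h1.
- rewrite /two_row_compose -uE -sE; apply: fat_ext => x hx; rewrite /erase.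
  have [->|h1] := eqVneq x u; first by rewrite andbF wS' //; lia.
  have [->|h2] := eqVneq x (u + w)%N; first by rewrite andbF wS' //; lia.
  rewrite !andbT (@per_rev w c T (p + q)) //; [|lia|by rewrite mulnDl -uE -sE; lia].
  have -> : ((p + q) * c + w - x = u + w + s - x)%N by rewrite mulnDl -uE -sE; lia.
  rewrite perT; last lia.
  by apply: T'E; rewrite ?/end_point ?negb_or ?h1 //; lia.
Qed.

(** If the two lengths come in the opposite order, the rotated diagram is aligned with the given
    one. *)
Lemma class_fat w u s S X : (0 < w)%N -> (0 < u)%N -> (0 < s)%N -> window_free w u S ->
  convex X -> equivalent X (fat w u s S) ->
  [\/ same_diagram X (fat w u s S), same_diagram X (rotate (fat w u s S)) |
   exists p q c tau, [/\ [/\ (0 < p)%N, (0 < q)%N, (0 < c)%N & p != q], flat_ends w c tau,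
     [/\ u = (p * c)%N, s = (q * c)%N & c = gcdn u s], fat w u s S = two_row_compose w p q c tau &
     same_diagram X (two_row_compose w p q c (revm (c + w) tau)) \/
     same_diagram X (rotate (two_row_compose w p q c (revm (c + w) tau)))]].
Proof.
move=> w0 u0 s0 wS cX XF.
have [u' [s' [S' [u'0 s'0 wS' hX]]]] := equivalent_fat w0 u0 s0 wS cX XF.
have eqv : equivalent (fat w u' s' S') (fat w u s S).
  exact: equivalent_trans (equivalent_sym (same_equivalent hX)) XF.
have unrot Y : same_diagram (rotate X) Y -> same_diagram X (rotate Y).
  by move=> /same_rotate; rewrite rotateK.
case: (formal_sizes w0 u0 s0 u'0 s'0 wS wS'
    (equivalent_fatpoly w0 u0 s0 u'0 s'0 wS wS' (equivalent_sym eqv))) => -[eu es]; subst u' s'.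
  case: (class_aligned w0 u0 s0 wS wS' eqv) => [h|h|[p [q [c [tau [h1 h2 h3 h4 h5]]]]]].
  - by apply: Or31; rewrite -h.
  - by apply: Or32; exact: same_trans hX h.
  - by apply: Or33; exists p, q, c, tau; split=> //; left; rewrite -h5.
have hX' : same_diagram (rotate X) (fat w u s (revm (s + w + u) S')).
  exact: same_trans (same_rotate hX) (rotate_fat s u S' w0).
have wS2 : window_free w u (revm (s + w + u) S') by exact: revm_window.
have eqv' : equivalent (fat w u s (revm (s + w + u) S')) (fat w u s S).
  apply: equivalent_trans eqv; apply/equivalent_sym.
  apply: equivalent_trans (fat_rotate_equivalent w0 s0 u0 wS') _.
  by apply: same_equivalent; exact: rotate_fat.
case: (class_aligned w0 u0 s0 wS wS2 eqv') => [h|h|[p [q [c [tau [h1 h2 h3 h4 h5]]]]]].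
- by apply: Or32; apply: unrot; rewrite -h.
- by apply: Or31; have := unrot _ (same_trans hX' h); rewrite rotateK.
- by apply: Or33; exists p, q, c, tau; split=> //; right; apply: unrot; rewrite -h5.
Qed.

(** The period found by [class_fat] is [gcd(u, s)], possibly a proper multiple of the given [c]. As
    its two multiplicities differ there are at least three periods, so [per_agree] identifies the
    two periodic words, and their reversals give the same diagram. *)
Lemma class_factored w p q c tau X : (0 < w)%N -> (0 < p)%N -> (0 < q)%N -> (0 < c)%N ->
  flat_ends w c tau -> convex X -> equivalent X (two_row_compose w p q c tau) ->
  [\/ same_diagram X (two_row_compose w p q c tau), same_diagram X (two_row_compose w q p c tau),
      same_diagram X (two_row_compose w p q c (revm (c + w) tau))
    | same_diagram X (two_row_compose w q p c (revm (c + w) tau))].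
Proof.
move=> w0 p0 q0 c0 ends cX XC.
have pc := muln_pos c0 p0; have qc := muln_pos c0 q0.
have wC := @comp_window w c tau w0 c0 ends p.
have rends := flat_rev ends.
case: (class_fat w0 pc qc wC cX XC) => [h|h|]; first exact: Or41.
  by apply: Or44; apply: same_trans h (comp_rotate w0 p0 q0 c0 ends).
case=> p2 [q2 [c2 [tau2 [[p20 q20 c20 pq2] ends2 [eu es ec] E hX]]]].
have ck : (c2 = gcdn p q * c)%N by rewrite ec muln_gcdl.
have n3 : (3 <= p2 + q2)%N by lia.
have agree : forall x, (0 < x < p2 * c2 + w + q2 * c2)%N -> per c2 tau2 x = per c tau x.
  apply: (@per_agree w p2 q2 c2 c tau2 tau (gcdn p q)) => // x hx h1 h2.
  have := E; rewrite /two_row_compose -eu -es => E'.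
  have wC2 := @comp_window w c2 tau2 w0 c20 ends2 p2; rewrite -eu in wC2.
  have [|_ _ inj] := fat_inj w0 pc qc pc qc wC wC2; first by rewrite E' same_refl.
  rewrite -eu -es in hx h1 h2; have := inj x hx; rewrite /erase h1 h2 !andbT => ->; by [].
have EE : two_row_compose w p2 q2 c2 (revm (c2 + w) tau2) = two_row_compose w p q c (revm (c + w) tau).
  rewrite /two_row_compose -eu -es; apply: fat_ext => x hx; rewrite /erase; congr (_ && _).
  rewrite (@per_rev w c2 tau2 (p2 + q2)) //; [|lia|by rewrite mulnDl -eu -es; lia].
  rewrite (@per_rev w c tau (p + q)) //; [|lia|by rewrite mulnDl; lia].
  rewrite !mulnDl -eu -es; apply: agree; rewrite -eu -es; move: hx pc qc; move: (p * c)%N (q * c)%N => a b; lia.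
rewrite EE in hX; case: hX => hX; first exact: Or43.
apply: Or42; apply: same_trans hX _; apply: same_trans (comp_rotate w0 p0 q0 c0 rends) _.
rewrite (@comp_ext w q p c _ tau) ?same_refl //; first exact: flat_rev.
by move=> x hx; exact: revmK.
Qed.

Lemma comp_rev_inj w p q c tau : (0 < w)%N -> (0 < p)%N -> (0 < q)%N -> (0 < c)%N -> flat_ends w c tau ->
  same_diagram (two_row_compose w p q c tau) (two_row_compose w p q c (revm (c + w) tau)) ->
  forall x, (0 < x < c + w)%N -> tau x = revm (c + w) tau x.
Proof.
move=> w0 p0 q0 c0 ends E x hx.
have pc := muln_pos c0 p0; have qc := muln_pos c0 q0; have rends := flat_rev ends.
have [_ _ inj] := fat_inj w0 pc qc pc qc (@comp_window w c tau w0 c0 ends p)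
  (@comp_window w c _ w0 c0 rends p) E.
have agree z : (0 < z < p * c + w + q * c)%N -> z != (p * c)%N -> z != (p * c + w)%N ->
    per c tau z = per c (revm (c + w) tau) z.
  by move=> hz h1 h2; have := inj z hz; rewrite /erase h1 h2 !andbT.
have cp : (c <= p * c)%N by rewrite leq_pmull.
rewrite -(@per_flat w c tau) // -(@per_flat w c (revm (c + w) tau)) //.
have [n3|n3] := leqP 3 (p + q).
  apply: (@per_agree w p q c c _ _ 1) => //; first by rewrite mul1n.
  by move: cp qc; move: (p * c)%N (q * c)%N => a b; lia.
(* With two periods the only hidden position of [tau] is [c]. It is read at [2 * c], visible unless
   [c = w]; in that case [c] is its own mirror image. *)
have [p1 q1] : p = 1%N /\ q = 1%N by lia.
subst p q; rewrite mul1n in agree.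
have [xc|xc] := eqVneq x c; last by apply: agree => //; lia.
have rv z : (0 < z < 2 * c + w)%N -> per c (revm (c + w) tau) z = per c tau (2 * c + w - z).
  by move=> hz; apply: per_rev.
have P1 z : (0 < z)%N -> per c tau (c + z) = per c tau z.
  by move=> z0; have := perM c tau 1 z0; rewrite mul1n.
rewrite xc rv; last lia.
have -> : (2 * c + w - c = c + w)%N by lia.
rewrite P1 //; have [cw|cw] := eqVneq c w; first by rewrite cw.
rewrite -(P1 c c0) agree; [|lia|lia|lia].
rewrite rv; last lia.
by congr per; lia.
Qed.

Lemma class_of_list D (l : seq diagram) :
  (forall X, X \in l -> convex X /\ equivalent X D) ->
  pairwise (fun X Y => ~~ same_diagram X Y) l ->
  (forall X, convex X -> equivalent X D -> exists2 Y, Y \in l & same_diagram X Y) ->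
  equivalence_class_size D (size l).
Proof.
move=> h1 /(pairwiseP fset0) h2 h3; exists (fun i : 'I_(size l) => nth fset0 l i); split.
- by move=> i; have [cX eX] := h1 _ (mem_nth fset0 (ltn_ord i)); split=> //; exact: convex_skew.
- move=> i j ij; apply/val_inj => /=; case: (ltngtP i j) => // lt.
    by have := h2 i j (ltn_ord i) (ltn_ord j) lt; rewrite ij.
  by have := h2 j i (ltn_ord j) (ltn_ord i) lt; rewrite (same_sym ij).
move=> X /skew_convex cX XD; have [Y Yl XY] := h3 X cX XD.
have iY : (index Y l < size l)%N by rewrite index_mem.
by exists (Ordinal iY); rewrite /= nth_index.
Qed.

Section RowFactorization.

Variables (w p q c : nat) (tau : nat -> bool) (D S T : diagram).
Hypothesis w0 : (0 < w)%N.
Hypothesis p0 : (0 < p)%N.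
Hypothesis q0 : (0 < q)%N.
Hypothesis c0 : (0 < c)%N.
Hypothesis ends : flat_ends w c tau.
Hypothesis sS : same_diagram S (rib (p + q) (one_mark p)).
Hypothesis sT : same_diagram T (rib (c + w) tau).
Hypothesis sD : same_diagram D (two_row_compose w p q c tau).

Let rtau := revm (c + w) tau.
Let comp a b t := two_row_compose w a b c t.

Let sS' : same_diagram (rotate S) (rib (q + p) (one_mark q)).
Proof. exact: same_trans (same_rotate sS) (rotate_one_mark p0 q0). Qed.

Let sT' : same_diagram (rotate T) (rib (c + w) rtau).
Proof. exact: same_trans (same_rotate sT) (rotate_rib _ _). Qed.

Let rends : flat_ends w c rtau := flat_rev ends.

Let cases X : convex X -> equivalent X D ->
  [\/ same_diagram X (comp p q tau), same_diagram X (comp q p tau),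
      same_diagram X (comp p q rtau) | same_diagram X (comp q p rtau)].
Proof.
move=> cX XD; apply: class_factored => //.
exact: equivalent_trans XD (same_equivalent sD).
Qed.

Let eqC : [/\ equivalent (comp p q tau) D, equivalent (comp q p tau) D,
  equivalent (comp p q rtau) D & equivalent (comp q p rtau) D].
Proof.
have e1 : equivalent (comp p q tau) D by apply/same_equivalent/same_sym.
have e2 : equivalent (comp q p tau) D.
  by apply: equivalent_trans e1; exact: comp_swap.
have e3 : equivalent (comp p q rtau) D.
  by apply: equivalent_trans e1; apply/equivalent_sym/comp_rev.
by split=> //; apply: equivalent_trans e3; exact: comp_swap.
Qed.

(** Exchanging [p] and [q] is rotation of [S], and reversing [tau] is rotation of [T]; the four
    candidates are the four combinations. *)
Lemma row_class X : convex X -> equivalent X D -> exists S' T',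
  [/\ factors w.+1 X S' WRow T', same_or_rotated S' S & same_or_rotated T' T].
Proof.
move=> cX XD; have sr := same_refl.
case: (cases cX XD) => h.
- by exists S, T; split; [exact: (row_factor_conv w0 p0 q0 c0 ends sS sT h) | left | left].
- by exists (rotate S), T; split; [exact: (row_factor_conv w0 q0 p0 c0 ends sS' sT h) | right | left].
- by exists S, (rotate T); split; [exact: (row_factor_conv w0 p0 q0 c0 rends sS sT' h) | left | right].
- by exists (rotate S), (rotate T); split; [exact: (row_factor_conv w0 q0 p0 c0 rends sS' sT' h) | right | right].
Qed.

(** The symmetry of [S] is [p = q] and that of [T] is that [tau] is a palindrome. The four
    candidates coincide accordingly, and are otherwise told apart by [fat_inj] and
    [comp_rev_inj]. *)
Lemma row_class_size : equivalence_class_size D (2 ^ kappa S T)%N.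
Proof.
have [e1 e2 e3 e4] := eqC.
have k1 : same_diagram S (rotate S) = (p == q).
  apply/idP/eqP => [h|e].
    have := same_trans (same_sym sS) (same_trans h sS').
    case/rib_inj; try lia; move=> _ /(_ p); rewrite /one_mark eqxx => h'.
    by apply/eqP; rewrite -h' //; lia.
  by apply: same_trans sS _; apply: same_sym; have := sS'; rewrite e.
have k2 : same_diagram T (rotate T) -> forall x, (0 < x < c + w)%N -> rtau x = tau x.
  move=> h; have := same_trans (same_sym sT) (same_trans h sT').
  by case/rib_inj; try lia; move=> _ h' x hx; rewrite h'.
have k2' a b : (0 < a)%N -> (0 < b)%N -> same_diagram (comp a b tau) (comp a b rtau) -> same_diagram T (rotate T).
  move=> a0 b0 h; apply: same_trans sT _; apply: same_sym; apply: same_trans sT' _.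
  rewrite (@rib_ext _ rtau tau) ?same_refl // => x hx; apply/esym; exact: (comp_rev_inj w0 a0 b0 c0 ends h).
have ne t t' : flat_ends w c t -> flat_ends w c t' -> p != q -> ~~ same_diagram (comp p q t) (comp q p t').
  move=> et et' pq; apply: contra pq => h.
  have [e _ _] := fat_inj w0 (muln_pos c0 p0) (muln_pos c0 q0) (muln_pos c0 q0) (muln_pos c0 p0)
     (@comp_window w c t w0 c0 et p) (@comp_window w c t' w0 c0 et' q) h.
  by rewrite -(eqn_pmul2r c0) e.
have cv a b t : (0 < a)%N -> (0 < b)%N -> flat_ends w c t -> convex (comp a b t).
  by move=> a0 b0 et; exact: (comp_convex w0 c0 et a0 b0).
have tE a b : same_diagram T (rotate T) -> comp a b rtau = comp a b tau.
  by move=> /k2 h; exact: comp_ext.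
rewrite /kappa k1; have [pq|pq] := eqVneq p q; have [sym|nsym] := boolP (same_diagram T (rotate T)) => /=.
- apply: (class_of_list (l := [:: comp p q tau])) => //.
    by move=> X; rewrite inE => /eqP ->; split=> //; exact: cv.
  move=> X cX XD; exists (comp p q tau); first by rewrite inE.
  by case: (cases cX XD) => //; rewrite ?tE // -pq.
- apply: (class_of_list (l := [:: comp p q tau; comp p q rtau])) => /=.
  + by move=> X; rewrite !inE => /orP[] /eqP ->; split=> //; exact: cv.
  + by rewrite !andbT; apply: contra nsym; exact: k2'.
  + move=> X cX XD; case: (cases cX XD) => h; rewrite -?pq in h.
    * by exists (comp p q tau); rewrite ?inE ?eqxx // -?pq.
    * by exists (comp p q tau); rewrite ?inE ?eqxx // -?pq.
    * by exists (comp p q rtau); rewrite ?inE ?eqxx ?orbT // -?pq.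
    * by exists (comp p q rtau); rewrite ?inE ?eqxx ?orbT // -?pq.
- apply: (class_of_list (l := [:: comp p q tau; comp q p tau])) => /=.
  + by move=> X; rewrite !inE => /orP[] /eqP ->; split=> //; exact: cv.
  + by rewrite !andbT; exact: ne.
  + move=> X cX XD; case: (cases cX XD) => h; rewrite ?tE // in h.
    * by exists (comp p q tau); rewrite ?inE ?eqxx.
    * by exists (comp q p tau); rewrite ?inE ?eqxx ?orbT.
    * by exists (comp p q tau); rewrite ?inE ?eqxx.
    * by exists (comp q p tau); rewrite ?inE ?eqxx ?orbT.
- apply: (class_of_list (l := [:: comp p q tau; comp q p tau; comp p q rtau; comp q p rtau])) => /=.
  + by move=> X; rewrite !inE => /or4P[] /eqP ->; split=> //; exact: cv.
  + have nsq a b : ~~ same_diagram a b -> ~~ same_diagram b a by apply: contra; exact: same_sym.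
    rewrite !andbT; apply/and3P; split; [apply/and3P; split|apply/andP; split|].
    * exact: ne.
    * by apply: contra nsym; exact: k2'.
    * exact: ne.
    * by apply: nsq; exact: ne.
    * by apply: contra nsym; exact: k2'.
    * exact: ne.
  + move=> X cX XD; case: (cases cX XD) => h.
    * by exists (comp p q tau); rewrite ?inE ?eqxx.
    * by exists (comp q p tau); rewrite ?inE ?eqxx ?orbT.
    * by exists (comp p q rtau); rewrite ?inE ?eqxx ?orbT.
    * by exists (comp q p rtau); rewrite ?inE ?eqxx ?orbT.
Qed.

Lemma row_equivalent X S' T' : fatlike w X -> factors w.+1 X S' WRow T' ->
  same_or_rotated S' S -> same_or_rotated T' T -> equivalent X D.
Proof.
move=> fX fac hS hT; have [e1 e2 e3 e4] := eqC.
have [p' [q' [c' [tau' [[p'0 q'0 c'0] ends' s1 s2 s3]]]]] := row_factor w0 fX fac.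
have one a b : (0 < a)%N -> (0 < b)%N -> same_diagram S' (rib (a + b) (one_mark a)) -> p' = a /\ q' = b.
  move=> a0 b0 h; have := same_trans (same_sym s1) h; case/rib_inj; try lia.
  move=> e /(_ p'); rewrite /one_mark eqxx => h'.
  have hp' : (0 < p' < p' + q')%N by lia.
  by have /esym/eqP ep := h' hp'; lia.
have pq : (p' = p /\ q' = q) \/ (p' = q /\ q' = p).
  case: hS => h; [left; apply: one => //; exact: same_trans h sS | right; apply: one => //; exact: same_trans h sS'].
have two t : same_diagram T' (rib (c + w) t) -> flat_ends w c t ->
    two_row_compose w p' q' c' tau' = comp p' q' t.
  move=> h et; have := same_trans (same_sym s2) h; case/rib_inj; try lia.
  move=> e h'; have ec : c' = c by lia.
  by rewrite ec in ends' h' *; exact: comp_ext.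
have tt : two_row_compose w p' q' c' tau' = comp p' q' tau \/ two_row_compose w p' q' c' tau' = comp p' q' rtau.
  case: hT => h; [left; apply: two => //; exact: same_trans h sT | right; apply: two => //; exact: same_trans h sT'].
apply: equivalent_trans (same_equivalent s3) _.
by case: tt => ->; case: pq => -[-> ->].
Qed.

End RowFactorization.

Lemma col_row m D S T :
  factors m D S WCol T <-> factors m (transpose D) (rotate S) WRow (transpose T).
Proof.
split=> -[h1 h2 h3 h4]; split=> //.
- exact: ribbon_rotate.
- exact: ribbon_transpose.
- by have := same_transpose h4; rewrite transposeK.
- by have := ribbon_rotate h1; rewrite rotateK.
- by have := ribbon_transpose h2; rewrite transposeK.
- by have := same_transpose h4; rewrite transposeK.
Qed.

Lemma class_size_transpose D N :
  equivalence_class_size (transpose D) N -> equivalence_class_size D N.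
Proof.
case=> f [h1 h2 h3]; exists (fun i => transpose (f i)); split.
- move=> i; have [/skew_convex c e] := h1 i; split; first exact/convex_skew/convex_transpose.
  by have := equivalent_transpose e; rewrite transposeK.
- by move=> i j h; apply: h2; have := same_transpose h; rewrite !transposeK.
move=> X /skew_convex cX XD.
have [i hi] := h3 (transpose X) (convex_skew (convex_transpose cX)) (equivalent_transpose XD).
by exists i; have := same_transpose hi; rewrite transposeK.
Qed.

(** This is what makes [kappa] independent of the factorization: the size of the class does not
    refer to one. *)
Lemma class_size_uniq D N N' :
  equivalence_class_size D N -> equivalence_class_size D N' -> N = N'.
Proof.
suff le M M' : equivalence_class_size D M -> equivalence_class_size D M' -> (M <= M')%N.
  by move=> h h'; apply/eqP; rewrite eqn_leq !le.
case=> f [f1 f2 f3] [g [g1 g2 g3]].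
have ex i : exists j, same_diagram (f i) (g j) by have [h1 h2] := f1 i; exact: g3.
pose phi i := xchoose (ex i).
have phi_inj : injective phi.
  move=> i j e; apply: f2; apply: same_trans (xchooseP (ex i)) _.
  by rewrite -/(phi i) e; apply/same_sym/(xchooseP (ex j)).
by have := leq_card phi phi_inj; rewrite !card_ord.
Qed.

Lemma rotate_unit : rotate unit_box = unit_box.
Proof. by apply/fsetP => b; rewrite in_rotate !in_fset1 oppr_eq0. Qed.

Lemma transpose_unit : transpose unit_box = unit_box.
Proof.
by apply: boxsetP => r c; rewrite in_transpose !in_fset1; apply/eqP/eqP => -[-> ->].
Qed.

Lemma rotate_same_unit S : same_diagram (rotate S) unit_box = same_diagram S unit_box.
Proof. by apply/idP/idP => /same_rotate; rewrite rotate_unit ?rotateK. Qed.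

Lemma transpose_same_unit S : same_diagram (transpose S) unit_box = same_diagram S unit_box.
Proof. by apply/idP/idP => /same_transpose; rewrite transpose_unit ?transposeK. Qed.

Lemma kappa_col S T : kappa (rotate S) (transpose T) = kappa S T.
Proof.
rewrite /kappa rotateK -transpose_rotate; congr (~~ _ + ~~ _)%N.
  by apply/idP/idP; exact: same_sym.
by apply/idP/idP => /same_transpose; rewrite ?transposeK.
Qed.

Section Factorizations.

Variables (w : nat) (D S T : diagram) (W : overlap_shape).
Hypothesis w0 : (0 < w)%N.
Hypothesis fD : fatlike w D.
Hypothesis nW : W <> WEmpty.
Hypothesis facD : factors w.+1 D S W T.

Lemma factor_class X : convex X -> equivalent X D -> exists S' T',
  [/\ factors w.+1 X S' W T', same_or_rotated S' S & same_or_rotated T' T].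
Proof.
move=> cX XD; case: W nW facD => // [_ fac|_ /col_row fac].
  have [p [q [c [tau [[p0 q0 c0] ends s1 s2 s3]]]]] := row_factor w0 fD fac.
  exact: (row_class w0 p0 q0 c0 ends s1 s2 s3).
have [p [q [c [tau [[p0 q0 c0] ends s1 s2 s3]]]]] := row_factor w0 (fatlike_transpose fD) fac.
have [S1 [T1 [f1 hS hT]]] := row_class w0 p0 q0 c0 ends s1 s2 s3 (convex_transpose cX) (equivalent_transpose XD).
exists (rotate S1), (transpose T1); split; first by apply/col_row; rewrite rotateK transposeK.
  by case: hS => /same_rotate; rewrite !rotateK => h; [left | right].
by case: hT => /same_transpose; rewrite -?transpose_rotate !transposeK => h; [left | right].
Qed.

Lemma factor_class_size : equivalence_class_size D (2 ^ kappa S T)%N.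
Proof.
case: W nW facD => // [_ fac|_ /col_row fac].
  have [p [q [c [tau [[p0 q0 c0] ends s1 s2 s3]]]]] := row_factor w0 fD fac.
  exact: (row_class_size w0 p0 q0 c0 ends s1 s2 s3).
have [p [q [c [tau [[p0 q0 c0] ends s1 s2 s3]]]]] := row_factor w0 (fatlike_transpose fD) fac.
by apply: class_size_transpose; rewrite -kappa_col; exact: (row_class_size w0 p0 q0 c0 ends s1 s2 s3).
Qed.

Lemma factor_equivalent X S' T' : fatlike w X -> factors w.+1 X S' W T' ->
  same_or_rotated S' S -> same_or_rotated T' T -> equivalent X D.
Proof.
move=> fX; case: W nW facD => // [_ fac facX hS hT|_ /col_row fac /col_row facX hS hT].
  have [p [q [c [tau [[p0 q0 c0] ends s1 s2 s3]]]]] := row_factor w0 fD fac.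
  exact: (row_equivalent w0 p0 q0 c0 ends s1 s2 s3 fX facX hS hT).
have [p [q [c [tau [[p0 q0 c0] ends s1 s2 s3]]]]] := row_factor w0 (fatlike_transpose fD) fac.
have hS' : same_or_rotated (rotate S') (rotate S) by case: hS => /same_rotate h; [left | right].
have hT' : same_or_rotated (transpose T') (transpose T).
  by case: hT => /same_transpose h; [left | right; rewrite -transpose_rotate].
have := row_equivalent w0 p0 q0 c0 ends s1 s2 s3 (fatlike_transpose fX) facX hS' hT'.
by move/equivalent_transpose; rewrite !transposeK.
Qed.

End Factorizations.

Lemma class_or_factor w D X : (0 < w)%N -> fatform w D -> convex X -> equivalent X D ->
  [\/ same_diagram X D, same_diagram X (rotate D) | exists S T,
     [/\ ~~ same_diagram S unit_box, ~~ same_diagram T unit_box & factors w.+1 D S WRow T]].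
Proof.
move=> w0 [u [s [S [u0 s0 wS DF]]]] cX XD.
have XF := equivalent_trans XD (same_equivalent DF).
case: (class_fat w0 u0 s0 wS cX XF) => [h|h|[p [q [c [tau [[p0 q0 c0 _] ends _ E _]]]]]].
- by apply: Or31; exact: same_trans h (same_sym DF).
- by apply: Or32; exact: same_trans h (same_rotate (same_sym DF)).
apply: Or33; exists (rib (p + q) (one_mark p)), (rib (c + w) tau); rewrite E in DF; split.
- rewrite (rib_unit _ (same_refl _)); lia.
- rewrite (rib_unit _ (same_refl _)); lia.
by apply: (row_factor_conv w0 p0 q0 c0 ends) => //; exact: same_refl.
Qed.

Lemma fatform_rotate w D : (0 < w)%N -> fatform w D -> equivalent D (rotate D).
Proof.
move=> w0 [u [s [S [u0 s0 wS DF]]]]; apply: equivalent_trans (same_equivalent DF) _.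
apply: equivalent_trans (fat_rotate_equivalent w0 u0 s0 wS) _.
exact/same_equivalent/same_rotate/same_sym.
Qed.

(** * Boxdots and their transposes treated together *)

Section BoxdotForms.

Variables (w : nat) (D : diagram).
Hypothesis w0 : (0 < w)%N.
Hypothesis D_form : fatform w D \/ fatform w (transpose D).

Lemma form_fatlike : fatlike w D.
Proof.
case: D_form => /(fatform_fatlike w0) // /fatlike_transpose; by rewrite transposeK.
Qed.

Lemma form_rotate : equivalent D (rotate D).
Proof.
case: D_form => /(fatform_rotate w0) // /equivalent_transpose.
by rewrite -transpose_rotate !transposeK.
Qed.

(** Any further element of the class would come with a composition, by rows for a boxdot and by
    columns for a transposed one. *)
Lemma trivial_class X : ~ has_nontrivial_factorization w.+1 D -> convex X -> equivalent X D ->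
  same_diagram X D \/ same_diagram X (rotate D).
Proof.
move=> none cX XD; case: D_form => fD.
  case: (class_or_factor w0 fD cX XD) => [h|h|[S [T [nS nT fac]]]]; [by left|by right|].
  by case: none; exists S, WRow, T.
case: (class_or_factor w0 fD (convex_transpose cX) (equivalent_transpose XD)) => [h|h|[S [T [nS nT fac]]]].
- by left; have := same_transpose h; rewrite !transposeK.
- by right; have := same_transpose h; rewrite -transpose_rotate !transposeK.
case: none; exists (rotate S), WCol, (transpose T); split=> //.
- by rewrite rotate_same_unit.
- by rewrite transpose_same_unit.
by apply/col_row; rewrite rotateK transposeK.
Qed.

Lemma chosen_class_size E1 W E2 : chosen_factorization w.+1 D E1 W E2 ->
  equivalence_class_size D (2 ^ kappa E1 E2)%N.
Proof.
have cD : convex D by case: form_fatlike.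
case=> h1 h2; case: (classic (has_nontrivial_factorization w.+1 D)) => [/h1[nW _ _ fac]|none].
  exact: (factor_class_size w0 form_fatlike nW fac).
have [s1 _ s2] := h2 none.
have k1 : same_diagram E1 (rotate E1).
  by apply: (same_trans s1); apply: same_sym; rewrite rotate_same_unit.
have k2 : same_diagram E2 (rotate E2) = same_diagram D (rotate D).
  apply/idP/idP => h; last exact: same_trans s2 (same_trans h (same_rotate (same_sym s2))).
  exact: same_trans (same_sym s2) (same_trans h (same_rotate s2)).
rewrite /kappa k1 k2; have [sym|nsym] := boolP (same_diagram D (rotate D)) => /=.
  apply: (class_of_list (l := [:: D])) => //; first by move=> X; rewrite inE => /eqP ->.
  move=> X cX XD; exists D; first by rewrite inE.
  by case: (trivial_class none cX XD) => // h; exact: same_trans h (same_sym sym).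
apply: (class_of_list (l := [:: D; rotate D])) => /=.
- move=> X; rewrite !inE => /orP[] /eqP -> //; split; first exact: convex_rotate.
  exact/equivalent_sym/form_rotate.
- by rewrite !andbT.
- move=> X cX XD; case: (trivial_class none cX XD) => h; [exists D | exists (rotate D)] => //;
    by rewrite !inE eqxx ?orbT.
Qed.

End BoxdotForms.

Theorem theorem1p3 (m : nat) (hm : (2 <= m)%N) (D E : diagram)
    (D_thick : thickened_ribbon D) (E_thick : thickened_ribbon E)
    (D_form : is_boxdot m D \/ is_boxdot m (transpose D))
    (E_form : is_boxdot m E \/ is_boxdot m (transpose E)) :
  (equivalent D E <->
     exists (E1 : diagram) (W : overlap_shape) (E2 E1' E2' : diagram),
       [/\ factors m D E1 W E2, factors m E E1' W E2',
           chosen_factorization m D E1 W E2,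
           same_or_rotated E1' E1 & same_or_rotated E2' E2])
  /\ (forall (E1 : diagram) (W : overlap_shape) (E2 : diagram),
        chosen_factorization m D E1 W E2 ->
        equivalence_class_size D (2 ^ kappa E1 E2)%N)
  /\ (forall (E1 : diagram) (W : overlap_shape) (E2 : diagram)
             (F1 : diagram) (V : overlap_shape) (F2 : diagram),
        nontrivial_factorization m D E1 W E2 ->
        nontrivial_factorization m D F1 V F2 ->
        kappa E1 E2 = kappa F1 F2).
Proof.
case: m hm D_form E_form => [//|w] hm D_form E_form; have w0 : (0 < w)%N by [].
have fD : fatform w D \/ fatform w (transpose D).
  by case: D_form => /(boxdot_fat w0); [left | right].
have fE : fatform w E \/ fatform w (transpose E).
  by case: E_form => /(boxdot_fat w0); [left | right].
have lD := form_fatlike w0 fD; have lE := form_fatlike w0 fE.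
have cE : convex E by case: lE.
have sizes := chosen_class_size w0 fD.
split; last split=> //.
- split=> [DE|[E1 [W [E2 [E1' [E2' [f1 f2 [ch1 ch2] s1 s2]]]]]]].
  + have ED := equivalent_sym DE.
    case: (classic (has_nontrivial_factorization w.+1 D)) => [has|none].
      have [S [W [T [nW nS nT fac]]]] := has.
      have [S' [T' [fac' sS sT]]] := factor_class w0 lD nW fac cE ED.
      by exists S, W, T, S', T'; split=> //; split.
    exists unit_box, WEmpty, D, unit_box, E; split.
    * by split; exact: same_refl.
    * by split; exact: same_refl.
    * by split=> // _; split=> //; exact: same_refl.
    * by left; exact: same_refl.
    * exact: (trivial_class w0 fD none cE ED).
  (* In the trivial factorization only the second factor can vary, so equivalence reduces to
     invariance under rotation. *)
  + case: (classic (W = WEmpty)) => [eW|nW].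
      rewrite eW in f1 f2; case: f1 => _ f1; case: f2 => _ f2.
      case: s2 => s2.
        by apply: same_equivalent; exact: same_trans f1 (same_trans (same_sym s2) (same_sym f2)).
      apply: equivalent_trans (form_rotate w0 fD) _; apply: same_equivalent.
      exact: same_trans (same_rotate f1) (same_trans (same_sym s2) (same_sym f2)).
    exact/equivalent_sym/(factor_equivalent w0 lD nW f1 lE f2).
move=> E1 W E2 F1 V F2 n1 n2.
have ch A U B : nontrivial_factorization w.+1 D A U B -> chosen_factorization w.+1 D A U B.
  by move=> h; split=> // none; case: none; exists A, U, B.
(* Both powers of two are the size of the same equivalence class. *)
by apply: (@expnI 2 isT); apply: class_size_uniq (sizes _ _ _ (ch _ _ _ n1)) (sizes _ _ _ (ch _ _ _ n2)).
Qed.
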